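(* Let $p:\mathcal A\to G$ be a Fell bundle over a locally compact group $G$, and let $H$ be a closed subgroup of $G$. Let $\mathcal A\times G/H\to G\times G/H$ be the transformation Fell bundle (where $G$ acts on $G/H$ by left translation), and let $\mathcal A|_H\to H$ be the restricted Fell bundle. Then $\Gamma_c(\mathcal A)$ (with the module actions and inner products described in the context) completes to a $C^*(\mathcal A\times G/H)$–$C^*(\mathcal A|_H)$ imprimitivity bimodule.
   Context: Standing assumptions. All spaces, groups and groupoids are locally compact Hausdorff and second countable; groupoids carry left Haar systems; all Banach bundles are upper semicontinuous and separable (the Banach space of continuous sections vanishing at infinity is separable). Fell bundles. A Fell bundle over a groupoid $\mathcal G$ is an upper semicontinuous Banach bundle $p:\mathcal E\to\mathcal G$ with a continuous, bilinear, associative multiplication $(a,b)\mapsto ab$ defined when $(p(a),p(b))$ is composable, with $p(ab)=p(a)p(b)$, and a continuous conjugate-linear involution $b\mapsto b^*$ with $p(b^* )=p(b)^{-1}$, $(ab)^*=b^*a^*$, $b^{**}=b$, such that each fibre $\mathcal E_u$ over a unit $u$ is a $C^*$-algebra and each fibre $\mathcal E_\gamma$ is an $\mathcal E_{r(\gamma)}$–$\mathcal E_{s(\gamma)}$ imprimitivity bimodule with module actions given by multiplication and inner products ${}_L\langle a,b\rangle=ab^*$, $\langle a,b\rangle_R=a^*b$. A group is a groupoid with one unit. $\mathcal A|_H=p^{-1}(H)$. $C^*$-algebras. For a Fell bundle $\mathcal E\to\mathcal G$ over a groupoid with Haar system $\lambda$, the compactly supported continuous sections $\Gamma_c(\mathcal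 E)$ form a $*$-algebra under $(f*g)(\gamma)=\int f(\eta)g(\eta^{-1}\gamma)\,d\lambda^{r(\gamma)}(\eta)$, $f^*(\gamma)=f(\gamma^{-1})^*$; $C^*(\mathcal E)$ is its completion in the universal norm, the supremum of $\|L(f)\|$ over $*$-representations $L$ on Hilbert space that are continuous for the inductive limit topology. This groupoid convention (no modular function in the involution) is used here also for $\mathcal A|_H$ over the group $H$, with left Haar measure; multiplying sections by a square root of the modular function of $H$ gives an isomorphism between this and the usual group convention. Transformation Fell bundle. If $G$ acts on the left of a space $X$, the transformation groupoid $G\times X$ has operations $(s,tx)(t,x)=(st,x)$, $(s,x)^{-1}=(s^{-1},sx)$, units $(e,x)$ identified with $x$ (so $r(s,x)=sx$, $s(s,x)=x$), and Haar system $\int f\,d\lambda^x=\int_G f(s,s^{-1}x)\,ds$. If $p:\mathcal A\to G$ is a Fell bundle, the transformation Fell bundle is $\mathcal A\times X\to G\times X$, $(a,x)\mapsto(p(a),x)$, with $(a,p(c)x)(c,x)=(ac,x)$ and $(a,x)^*=(a^*,p(a)x)$. Operations on $\Gamma_c(\mathcal A)$. Write $F\in\Gamma_c(\mathcal A\times G/H)$ as $F(s,tH)=(F_1(s,tH),tH)$ with $F_1(s,tH)\in\mathcal A_s$. For $\xi,\eta\in\Gamma_c(\mathcal A)$ and $g\in\Gamma_c(\mathcal A|_H)$, $$(F\cdot\xi)(t)=\int_G F_1(s,s^{-1}tH)\,\xi(s^{-1}t)\,ds,\qquad(\xi\cdot g)(t)=\int_H\xi(th)\,g(h^{-1})\,dh,$$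 $${}_*\langle\xi,\eta\rangle(s,tH)=\Bigl(\int_H\xi(sth)\,\eta(th)^*\,dh,\ tH\Bigr),\qquad\langle\xi,\eta\rangle_*(h)=\int_G\xi(s^{-1})^*\,\eta(s^{-1}h)\,ds,$$ with values of the inner products in $\Gamma_c(\mathcal A\times G/H)\subset C^*(\mathcal A\times G/H)$ and $\Gamma_c(\mathcal A|_H)\subset C^*(\mathcal A|_H)$ respectively. ''Completes'' means that $\Gamma_c(\mathcal A)$ with these operations is a pre-imprimitivity bimodule over the dense $*$-subalgebras $\Gamma_c(\mathcal A\times G/H)$ and $\Gamma_c(\mathcal A|_H)$, whose completion is the asserted imprimitivity bimodule. *)

(* Defs.v *)
From HB Require Import structures.
From mathcomp Require Import all_boot all_order all_algebra.
From mathcomp Require Import all_classical all_reals all_analysis.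
From mathcomp Require Import complex.
Set Implicit Arguments.
Unset Strict Implicit.
Unset Printing Implicit Defensive.
Import Order.TTheory GRing.Theory Num.Theory.
Import numFieldNormedType.Exports.
Local Open Scope quotient_scope.
Local Open Scope classical_set_scope.
Local Open Scope complex_scope.
Local Open Scope ring_scope.

(* the library provides both structures on products, but not their join *)
HB.instance Definition _ (S T : ptopologicalType) := Pointed.on (S * T)%type.

Lemma cont_comp (S T U : topologicalType) (f : S -> T) (g : T -> U) :
  continuous f -> continuous g -> continuous (fun x => g (f x)).
Proof. by move=> cf cg x; exact: continuous_comp (cf x) (cg (f x)). Qed.

Lemma cont_pair (S T U : topologicalType) (f : S -> T) (g : S -> U) :
  continuous f -> continuous g -> continuous (fun x => (f x, g x)).
Proof. by move=> cf cg x; exact: cvg_pair (cf x) (cg x). Qed.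

Lemma cont_fst (S T : topologicalType) : continuous (@fst S T).
Proof. by move=> x; exact: cvg_fst. Qed.

Lemma cont_snd (S T : topologicalType) : continuous (@snd S T).
Proof. by move=> x; exact: cvg_snd. Qed.

HB.mixin Record isTopGroup G of Group G & Topological G := {
  mulg_cont : continuous (fun p : (G * G)%type => (p.1 * p.2)%g);
  invg_cont : continuous (fun x : G => (x^-1)%g)
}.

(* The distinguished point inherited from [PointedTopological] carries no
   meaning; it is there because measurable types must be pointed. *)
#[short(type="topGroupType")]
HB.structure Definition TopGroup :=
  {G of PointedTopological G & Group G & isTopGroup G}.

Definition lch_second_countable (X : topologicalType) : Prop :=
  [/\ hausdorff_space X, locally_compact [set: X] & @second_countable X].

Record closed_subgroup (G : topGroupType) := ClosedSubgroup {
  subg_set :> set G;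
  subg1 : subg_set 1%g;
  subgM : forall x y, subg_set x -> subg_set y -> subg_set (x * y)%g;
  subgV : forall x, subg_set x -> subg_set (x^-1)%g;
  subg_closed : closed subg_set
}.

Definition subg_type (G : topGroupType) (H : closed_subgroup G) : Type :=
  set_type (subg_set H).

Section SubgroupType.
Variables (G : topGroupType) (H : closed_subgroup G).
Local Notation T := (subg_type H).

HB.instance Definition _ := Topological.on T.
HB.instance Definition _ := [isSub of T for @sval _ _].

Definition subg_inc (h : T) : G := sval h.

Lemma subg_incP (h : T) : subg_set H (subg_inc h).
Proof. exact: set_mem (svalP h). Qed.

Lemma subg_inc_inj : injective subg_inc.
Proof. exact: val_inj. Qed.

Definition subg_elt (x : G) (Hx : subg_set H x) : T := exist _ x (mem_set Hx).

Definition subg_one : T := subg_elt (subg1 H).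
Definition subg_mul (x y : T) : T :=
  subg_elt (subgM (subg_incP x) (subg_incP y)).
Definition subg_inv (x : T) : T := subg_elt (subgV (subg_incP x)).

Let mulA : associative subg_mul.
Proof. by move=> x y z; apply: subg_inc_inj; exact: mulgA. Qed.
Let mul1 : left_id subg_one subg_mul.
Proof. by move=> x; apply: subg_inc_inj; exact: mul1g. Qed.
Let mulr1 : right_id subg_one subg_mul.
Proof. by move=> x; apply: subg_inc_inj; exact: mulg1. Qed.
Let mulV : left_inverse subg_one subg_inv subg_mul.
Proof. by move=> x; apply: subg_inc_inj; exact: mulVg. Qed.
Let mulrV : right_inverse subg_one subg_inv subg_mul.
Proof. by move=> x; apply: subg_inc_inj; exact: mulgV. Qed.

HB.instance Definition _ := isPointed.Build T subg_one.
HB.instance Definition _ := isGroup.Build T mulA mul1 mulr1 mulV mulrV.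

Lemma subg_inc_cont : continuous (subg_inc : T -> G).
Proof. exact: initial_continuous. Qed.

Lemma subg_cont (X : topologicalType) (f : X -> T) :
  continuous (fun x => subg_inc (f x)) -> continuous f.
Proof.
move=> cf; apply/continuousP => A [B oB <-].
by have /continuousP := cf; exact.
Qed.

Let mul_cont : continuous (fun p : (T * T)%type => (p.1 * p.2)%g).
Proof.
apply: subg_cont.
apply: (cont_comp (f := fun p : T * T => (subg_inc p.1, subg_inc p.2)) _
  mulg_cont).
apply: cont_pair; apply: (cont_comp _ subg_inc_cont); last exact: cont_snd.
exact: cont_fst.
Qed.

Let inv_cont : continuous (fun x : T => (x^-1)%g).
Proof.
by apply: subg_cont; exact: (cont_comp subg_inc_cont invg_cont).
Qed.

HB.instance Definition _ := isTopGroup.Build T mul_cont inv_cont.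

End SubgroupType.

Record gspace (G : topGroupType) := GSpace {
  gsp :> ptopologicalType;
  gact : G -> gsp -> gsp;
  gact1 : forall x, gact 1%g x = x;
  gactM : forall s t x, gact (s * t)%g x = gact s (gact t x);
  gact_cont : continuous (fun p : (G * gsp)%type => gact p.1 p.2)
}.

Section CosetSpace.
Variables (G : topGroupType) (H : closed_subgroup G).

Definition left_coset_rel : rel G := fun s t => `[< subg_set H (s^-1 * t)%g >].

Lemma left_coset_refl : reflexive left_coset_rel.
Proof. by move=> s; apply/asboolP; rewrite mulVg; exact: subg1. Qed.
Lemma left_coset_sym : symmetric left_coset_rel.
Proof.
have sub s t : left_coset_rel s t -> left_coset_rel t s.
  by move=> /asboolP st; apply/asboolP; rewrite -[s]invgK -invgM; exact: subgV.
by move=> s t; apply/idP/idP; exact: sub.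
Qed.
Lemma left_coset_trans : transitive left_coset_rel.
Proof.
move=> t s r /asboolP st /asboolP tr; apply/asboolP.
by have := subgM st tr; rewrite -mulgA mulVKg.
Qed.

Canonical left_coset_equiv :=
  EquivRel left_coset_rel left_coset_refl left_coset_sym left_coset_trans.

Definition coset_space : ptopologicalType :=
  quotient_topology {eq_quot left_coset_equiv}.

Definition coset_of (t : G) : coset_space := \pi_{eq_quot left_coset_equiv} t.

Definition coset_repr (q : coset_space) : G :=
  repr (q : {eq_quot left_coset_equiv}).

Definition coset_act (s : G) (q : coset_space) : coset_space :=
  coset_of (s * coset_repr q)%g.

Lemma coset_reprK q : coset_of (coset_repr q) = q.
Proof. exact: reprK. Qed.

Lemma coset_eqP s t : coset_of s = coset_of t <-> subg_set H (s^-1 * t)%g.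
Proof.
split=> [/eqmodP/asboolP //|st].
by apply/eqmodP; exact/asboolP.
Qed.

Lemma coset_actE s t : coset_act s (coset_of t) = coset_of (s * t)%g.
Proof.
apply/coset_eqP; have /coset_eqP := coset_reprK (coset_of t).
by rewrite invgM -mulgA mulKg.
Qed.

Lemma coset_of_cont : continuous coset_of.
Proof. exact: pi_continuous. Qed.

Lemma coset_of_open (U : set G) : open U -> open (coset_of @` U).
Proof.
move=> oU; change (open (coset_of @^-1` (coset_of @` U))).
have -> : coset_of @^-1` (coset_of @` U) =
    \bigcup_(h in subg_set H) ((fun t : G => (t * h)%g) @^-1` U).
  apply/seteqP; split => t /=.
    move=> [u Uu] /coset_eqP ut; exists (u^-1 * t)^-1%g.
      exact: subgV.
    by rewrite /= invgM invgK mulgA mulgV mul1g.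
  by move=> [h Hh] /= Uth; exists (t * h)%g => //; apply/coset_eqP;
    rewrite invgM -mulgA mulVg mulg1; exact: subgV.
apply: bigcup_open => h _.
suff /continuousP : continuous (fun t : G => (t * h)%g) by exact.
apply: (cont_comp (f := fun t : G => (t, h)) _ mulg_cont).
by apply: cont_pair => t; [exact: cvg_id|exact: cvg_cst].
Qed.

Lemma coset_act_cont :
  continuous (fun p : (G * coset_space)%type => coset_act p.1 p.2).
Proof.
move=> [s q]; rewrite -(coset_reprK q); set t := coset_repr q.
move=> W /=; rewrite coset_actE => nW.
have : nbhs ((s, t) : (G * G)%type)
    ((fun p : (G * G)%type => coset_of (p.1 * p.2)%g) @^-1` W).
  apply: (@continuous_comp _ _ _ (fun p : (G * G)%type => (p.1 * p.2)%g)
    coset_of); [exact: mulg_cont|exact: coset_of_cont|exact: nW].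
move=> [[A B] /= [nA nB] AB].
move: nB; rewrite nbhsE /= => -[B' [oB' B't] B'B].
exists (A, coset_of @` B') => /=.
  split=> //; have : open_nbhs (coset_of t) (coset_of @` B').
    by split; [exact: coset_of_open|exists t].
  exact: open_nbhs_nbhs.
move=> [a _] /= [Aa [b B'b <-]]; rewrite coset_actE.
by apply: (AB (a, b)); split=> //=; exact: B'B.
Qed.

Let act1 q : coset_act 1%g q = q.
Proof. by rewrite -(coset_reprK q) coset_actE mul1g. Qed.
Let actM s t q : coset_act (s * t)%g q = coset_act s (coset_act t q).
Proof. by rewrite -(coset_reprK q) !coset_actE mulgA. Qed.

Definition coset_gspace : gspace G := GSpace act1 actM coset_act_cont.

End CosetSpace.

(* A groupoid is represented by its space of arrows; units are the arrows of
   the form [gsrc a], and [gcomp a b] is meaningful when [gsrc a = grng b]. *)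
Record groupoid := Groupoid {
  arr :> ptopologicalType;
  gcomp : arr -> arr -> arr;
  ginv : arr -> arr;
  gsrc : arr -> arr;
  grng : arr -> arr;
  gsrc_comp : forall a b, gsrc a = grng b -> gsrc (gcomp a b) = gsrc b;
  grng_comp : forall a b, gsrc a = grng b -> grng (gcomp a b) = grng a;
  gcompA : forall a b c, gsrc a = grng b -> gsrc b = grng c ->
    gcomp a (gcomp b c) = gcomp (gcomp a b) c;
  gcomp_src : forall a, gcomp a (gsrc a) = a;
  gcomp_rng : forall a, gcomp (grng a) a = a;
  gsrc_inv : forall a, gsrc (ginv a) = grng a;
  grng_inv : forall a, grng (ginv a) = gsrc a;
  gcompV : forall a, gcomp a (ginv a) = grng a;
  gcompVl : forall a, gcomp (ginv a) a = gsrc a;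
  gcomp_cont : {within [set p : (arr * arr)%type | gsrc p.1 = grng p.2],
                continuous (fun p => gcomp p.1 p.2)};
  ginv_cont : continuous ginv
}.

Definition is_unit_arrow (GG : groupoid) (u : GG) : Prop := gsrc u = u.

Section GroupGroupoid.
Variable G : topGroupType.

Definition group_groupoid : groupoid.
Proof.
refine (@Groupoid G (fun a b => (a * b)%g) (fun a => (a^-1)%g)
  (fun _ => 1%g) (fun _ => 1%g) _ _ _ _ _ _ _ _ _ _ _) => //.
- by move=> a b c _ _; exact: mulgA.
- exact: mulg1.
- exact: mul1g.
- exact: mulgV.
- exact: mulVg.
- exact/continuous_subspaceT/mulg_cont.
- exact: invg_cont.
Defined.

End GroupGroupoid.

Section TransformationGroupoid.
Variables (G : topGroupType) (X : gspace G).
Local Notation GX := (G * X)%type.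

Definition trans_comp (a b : GX) : GX := ((a.1 * b.1)%g, b.2).
Definition trans_inv (a : GX) : GX := ((a.1^-1)%g, gact a.1 a.2).
Definition trans_src (a : GX) : GX := (1%g, a.2).
Definition trans_rng (a : GX) : GX := (1%g, gact a.1 a.2).

Definition trans_groupoid : groupoid.
Proof.
refine (@Groupoid (GX : ptopologicalType) trans_comp trans_inv
  trans_src trans_rng _ _ _ _ _ _ _ _ _ _ _).
- by [].
- by move=> [s y] [t x] /= [] ->; rewrite /trans_rng /= gactM.
- by move=> [s y] [t x] [r z] /= _ _; rewrite /trans_comp /= mulgA.
- by move=> [s y]; rewrite /trans_comp /= mulg1.
- by move=> [s y]; rewrite /trans_comp /= mul1g.
- by [].
- by move=> [s y]; rewrite /trans_rng /trans_inv /= -gactM mulVg gact1.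
- by move=> [s y]; rewrite /trans_comp /trans_inv /= mulgV.
- by move=> [s y]; rewrite /trans_comp /trans_inv /= mulVg.
- apply/continuous_subspaceT/cont_pair.
    apply: (cont_comp (f := fun p : GX * GX => (p.1.1, p.2.1)) _ mulg_cont).
    apply: cont_pair; apply: cont_comp; try exact: cont_fst; exact: cont_snd.
  by apply: cont_comp; exact: cont_snd.
- apply: cont_pair; last exact: gact_cont.
  by apply: cont_comp; [exact: cont_fst|exact: invg_cont].
Defined.

End TransformationGroupoid.

Definition borel (T : ptopologicalType) := g_sigma_algebraType (@open T).

Lemma continuous_borel (S T : ptopologicalType) (f : S -> T) :
  continuous f -> measurable_fun setT (f : borel S -> borel T).
Proof.
move=> /continuousP cf; apply: (@measurability _ _ (borel S) (borel T) setT f (@open T) erefl).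
move=> _ [B oB <-]; rewrite setTI.
by apply: sub_sigma_algebra; exact: cf.
Qed.

(* Radon regularity is automatic on a second countable locally compact
   Hausdorff group for a Borel measure that is finite on compact sets. *)
Definition left_haar (R : realType) (G : topGroupType)
    (mu : {measure set (borel G) -> \bar R}) : Prop :=
  [/\ forall K : set G, compact K -> (mu K < +oo)%E,
      forall U : set G, open U -> U !=set0 -> (0 < mu U)%E &
      forall (s : G) (B : set (borel G)), measurable B ->
        mu ((fun t : G => (s * t)%g) @^-1` B) = mu B].

(* The measures are indexed by all arrows, but only the members indexed by
   units are ever used. *)
Definition measure_system (R : realType) (GG : groupoid) :=
  GG -> {measure set (borel GG) -> \bar R}.

Definition group_system (R : realType) (G : topGroupType)
    (mu : {measure set (borel G) -> \bar R}) :
  measure_system R (group_groupoid G) := fun _ => mu.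

Section TransformationSystem.
Variables (R : realType) (G : topGroupType) (X : gspace G).
Variable mu : {measure set (borel G) -> \bar R}.

Definition trans_path (x : X) (s : borel G) : borel (trans_groupoid X) :=
  (s : G, gact (s : G)^-1%g x).

Definition trans_measure (u : trans_groupoid X) :
  set (borel (trans_groupoid X)) -> \bar R := pushforward mu (trans_path u.2).

Lemma trans_path_meas x : measurable_fun setT (trans_path x).
Proof.
apply: (@continuous_borel G (trans_groupoid X)).
apply: cont_pair; first by move=> s; exact: cvg_id.
apply: (cont_comp (f := fun s : G => ((s^-1)%g, x)) _ (@gact_cont _ X)).
by apply: cont_pair; [exact: invg_cont|move=> s; exact: cvg_cst].
Qed.

Let tm0 u : trans_measure u set0 = 0%E.
Proof. by rewrite /trans_measure /pushforward preimage_set0 measure0. Qed.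
Let tm_ge0 u A : (0 <= trans_measure u A)%E.
Proof. by rewrite /trans_measure /pushforward measure_ge0. Qed.
Let tm_add u : semi_sigma_additive (trans_measure u).
Proof.
move=> F mF tF mUF; rewrite /trans_measure /pushforward preimage_bigcup.
apply: measure_semi_sigma_additive.
- by move=> n; rewrite -[X in measurable X]setTI; exact: trans_path_meas.
- apply/trivIsetP => /= i j _ _ ij; rewrite -preimage_setI.
  by move/trivIsetP : tF => /(_ _ _ _ _ ij) ->//; rewrite preimage_set0.
- by rewrite -preimage_bigcup -[X in measurable X]setTI; exact: trans_path_meas.
Qed.

HB.instance Definition _ u :=
  isMeasure.Build _ _ _ (trans_measure u) (tm0 u) (tm_ge0 u) (@tm_add u).

Definition trans_system : measure_system R (trans_groupoid X) :=
  fun u => trans_measure u.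

End TransformationSystem.

Arguments trans_system {R G} X mu.

Section CstarAlgebras.
Variable R : realType.
Local Notation C := R[i].

Definition dense_span (V : normedModType C) (S : set V) : Prop :=
  dense [set v : V | exists (n : nat) (c : 'I_n -> C) (w : 'I_n -> V),
    (forall i, S (w i)) /\ v = \sum_i c i *: w i].

Definition is_cstar_algebra (V : completeNormedModType C)
    (mul : V -> V -> V) (star : V -> V) : Prop :=
  [/\ forall k a b c, mul (k *: a + b) c = k *: mul a c + mul b c,
      forall k a b c, mul a (k *: b + c) = k *: mul a b + mul a c &
      forall a b c, mul a (mul b c) = mul (mul a b) c] /\
  [/\ forall k a b, star (k *: a + b) = conjc k *: star a + star b,
      forall a b, star (mul a b) = mul (star b) (star a) &
      forall a, star (star a) = a] /\
  [/\ forall a b, `|mul a b| <= `|a| * `|b| &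
      forall a, `|mul (star a) a| = `|a| ^+ 2].

Record cstar_algebra := CstarAlgebra {
  calg :> completeNormedModType C;
  cmul : calg -> calg -> calg;
  cstar : calg -> calg;
  cstarP : is_cstar_algebra cmul cstar
}.

Definition cpos (V : completeNormedModType C)
    (mul : V -> V -> V) (star : V -> V) (a : V) : Prop :=
  exists b, a = mul (star b) b.

(* [X] is complete for both Hilbert module norms because each of them is the
   norm it carries. *)
Definition is_imprimitivity_bimodule
    (A : completeNormedModType C) (mA : A -> A -> A) (sA : A -> A)
    (B : completeNormedModType C) (mB : B -> B -> B) (sB : B -> B)
    (X : completeNormedModType C)
    (lact : A -> X -> X) (ract : X -> B -> X)
    (lip : X -> X -> A) (rip : X -> X -> B) : Prop :=
  [/\ forall k a b x, lact (k *: a + b) x = k *: lact a x + lact b x,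
      forall k a x y, lact a (k *: x + y) = k *: lact a x + lact a y &
      forall a b x, lact (mA a b) x = lact a (lact b x)] /\
  [/\ forall k x a b, ract x (k *: a + b) = k *: ract x a + ract x b,
      forall k x y b, ract (k *: x + y) b = k *: ract x b + ract y b &
      forall x a b, ract x (mB a b) = ract (ract x a) b] /\
  [/\ forall k x y z, lip (k *: x + y) z = k *: lip x z + lip y z,
      forall a x y, lip (lact a x) y = mA a (lip x y),
      forall x y, sA (lip x y) = lip y x,
      forall x, cpos mA sA (lip x x) &
      forall x, `|lip x x| = `|x| ^+ 2] /\
  [/\ forall k x y z, rip z (k *: x + y) = k *: rip z x + rip z y,
      forall x y b, rip x (ract y b) = mB (rip x y) b,
      forall x y, sB (rip x y) = rip y x,
      forall x, cpos mB sB (rip x x) &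
      forall x, `|rip x x| = `|x| ^+ 2] /\
  (dense_span [set lip p.1 p.2 | p in [set: (X * X)%type]] /\
   dense_span [set rip p.1 p.2 | p in [set: (X * X)%type]]) /\
  [/\ forall a x b, ract (lact a x) b = lact a (ract x b),
      forall a x y, rip (lact a x) y = rip x (lact (sA a) y),
      forall x b y, lip (ract x b) y = lip x (ract y (sB b)) &
      forall x y z, lact (lip x y) z = ract x (rip y z)].

End CstarAlgebras.

Section Integrals.
Variable R : realType.
Local Notation C := R[i].

Definition cintegral (T : ptopologicalType)
    (mu : {measure set (borel T) -> \bar R}) (D : set T) (h : T -> C) : C :=
  (Rintegral mu D (fun x : borel T => complex.Re (h x))) +i*
  (Rintegral mu D (fun x : borel T => complex.Im (h x))).

(* The integral of a vector-valued function is the vector [v] such that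
   phi(v) is the integral of phi o f for every bounded linear functional
   phi; it exists and is unique for continuous compactly supported f.  It
   defaults to 0 when there is no such vector. *)
Definition vintegral (T : ptopologicalType)
    (mu : {measure set (borel T) -> \bar R}) (D : set T)
    (V : completeNormedModType C) (f : T -> V) : V :=
  xget 0 [set v | forall phi : {linear V -> C^o}, continuous phi ->
                  phi v = cintegral mu D (fun x => phi (f x))].

End Integrals.

Section BanachBundles.
Variable R : realType.
Local Notation C := R[i].

(* A bundle of Banach spaces: a space [btot] over X whose fibre over x is
   identified by [binj x] with the Banach space [fib x]. *)
Record bundle (X : ptopologicalType) := Bundle {
  btot :> topologicalType;
  bpr : btot -> X;
  fib : X -> completeNormedModType C;
  binj : forall x, fib x -> btot;
  binj_inj : forall x, injective (@binj x);
  binj_range : forall x, range (@binj x) = bpr @^-1` [set x]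
}.

Section Operations.
Variables (X : ptopologicalType) (E : bundle X).

(* the element of [fib E x] corresponding to a point of E over x, and 0 for
   the points that do not lie over x *)
Definition bco (x : X) (a : E) : fib E x := xget 0 [set v | binj v = a].

Definition bzero (x : X) : E := binj (0 : fib E x).
Definition bnorm (a : E) : R := complex.Re `|bco (bpr a) a|.
Definition badd (a b : E) : E := binj (bco (bpr a) a + bco (bpr a) b).
Definition bscale (k : C) (a : E) : E := binj (k *: bco (bpr a) a).

Definition is_usc_banach_bundle : Prop :=
  [/\ continuous (@bpr X E),
      (forall U : set E, open U -> open (@bpr X E @` U)) &
      (forall r : R, open [set a : E | bnorm a < r])] /\
  [/\ {within [set p : (E * E)%type | bpr p.1 = bpr p.2],
       continuous (fun p => badd p.1 p.2)},
      (forall k : C, continuous (bscale k)) &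
      (forall (F : set_system E) (x : X), ProperFilter F ->
         @bpr X E @ F --> x -> @bnorm @ F --> (0 : R) -> F --> bzero x)].

Definition is_section (f : X -> E) : Prop := forall x, bpr (f x) = x.

Definition Gamma0 : set (X -> E) := [set f |
  [/\ is_section f, continuous f &
      forall e : R, 0 < e ->
        exists2 K : set X, compact K & forall x, ~ K x -> bnorm (f x) < e]].

Definition bsupp (f : X -> E) : set X := closure [set x | f x <> bzero x].

Definition Gammac : set (X -> E) := [set f |
  [/\ is_section f, continuous f & compact (bsupp f)]].

Definition slin (k : C) (f g : X -> E) : X -> E :=
  fun x => binj (k *: bco x (f x) + bco x (g x)).

Definition bdist (x : X) (a b : E) : R := complex.Re `|bco x a - bco x b|.

Definition is_separable_bundle : Prop :=
  exists2 D : set (X -> E), countable D /\ D `<=` Gamma0 &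
    forall f, Gamma0 f -> forall e : R, 0 < e ->
      exists2 g, D g & forall x, bdist x (f x) (g x) < e.

End Operations.

Arguments Gamma0 {X} E.
Arguments Gammac {X} E.

(* the operations of a Fell bundle; the axioms are in [is_fell_bundle].
   [fmul a b] is meaningful when (bpr a, bpr b) is composable. *)
Record fell_ops (GG : groupoid) := FellOps {
  fbun :> bundle GG;
  fmul : fbun -> fbun -> fbun;
  fstar : fbun -> fbun;
  bpr_mul : forall a b, gsrc (bpr a) = grng (bpr b) ->
    bpr (fmul a b) = gcomp (bpr a) (bpr b);
  bpr_star : forall a, bpr (fstar a) = ginv (bpr a)
}.

Section FellBundles.
Variables (GG : groupoid) (E : fell_ops GG).

(* multiplication and involution in terms of the fibre Banach spaces, for z
   the product of x and y, resp. y the inverse of x *)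
Definition fib_mul (x y z : GG) (v : fib E x) (w : fib E y) : fib E z :=
  bco z (fmul (binj v) (binj w)).
Definition fib_star (x y : GG) (v : fib E x) : fib E y :=
  bco y (fstar (binj v)).

Definition is_fell_bundle : Prop :=
  is_usc_banach_bundle E /\ is_separable_bundle E /\
  [/\ {within [set p : (E * E)%type | gsrc (bpr p.1) = grng (bpr p.2)],
       continuous (fun p => fmul p.1 p.2)},
      (forall (x y : GG) k (v v' : fib E x) (w : fib E y), gsrc x = grng y ->
         let xy := gcomp x y in
         fib_mul xy (k *: v + v') w =
           k *: fib_mul xy v w + fib_mul xy v' w),
      (forall (x y : GG) k (v : fib E x) (w w' : fib E y), gsrc x = grng y ->
         let xy := gcomp x y in
         fib_mul xy v (k *: w + w') =
           k *: fib_mul xy v w + fib_mul xy v w') &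
      (forall a b c : E, gsrc (bpr a) = grng (bpr b) ->
         gsrc (bpr b) = grng (bpr c) ->
         fmul a (fmul b c) = fmul (fmul a b) c)] /\
  [/\ continuous (@fstar GG E),
      (forall (x : GG) k (v w : fib E x),
         fib_star (ginv x) (k *: v + w) =
           conjc k *: fib_star (ginv x) v + fib_star (ginv x) w),
      (forall a b : E, gsrc (bpr a) = grng (bpr b) ->
         fstar (fmul a b) = fmul (fstar b) (fstar a)) &
      (forall a : E, fstar (fstar a) = a)] /\
  (forall u : GG, is_unit_arrow u ->
     is_cstar_algebra (@fib_mul u u u) (@fib_star u u)) /\
  (forall x : GG,
     let r := grng x in let s := gsrc x in
     is_imprimitivity_bimodule
       (@fib_mul r r r) (@fib_star r r) (@fib_mul s s s) (@fib_star s s)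
       (@fib_mul r x x) (@fib_mul x s x)
       (fun v w : fib E x => fib_mul r v (fib_star (ginv x) w))
       (fun v w : fib E x => fib_mul s (fib_star (ginv x) v) w)).

(* the integral over D of a function whose values all lie in the fibre over
   x, as an element of [fib E x] *)
Definition fib_integral (T : ptopologicalType)
    (mu : {measure set (borel T) -> \bar R}) (D : set T) (x : GG)
    (f : T -> E) : fib E x := vintegral mu D (fun t => bco x (f t)).

Variable lam : measure_system R GG.

Definition sconv (f g : GG -> E) : GG -> E := fun x =>
  binj (fib_integral (lam (grng x)) [set y | grng y = grng x] x
    (fun y => fmul (f y) (g (gcomp (ginv y) x)))).

Definition sstar (f : GG -> E) : GG -> E := fun x => fstar (f (ginv x)).

Definition is_inner_product (V : completeNormedModType C) (ip : V -> V -> C) :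
    Prop :=
  [/\ forall k u v w, ip (k *: u + v) w = k * ip u w + ip v w,
      forall u v, ip u v = conjc (ip v u) &
      forall v, ip v v = `|v| ^+ 2].

(* By the universal property of the inductive limit topology, continuity of the
   linear map L (for the operator norm) is continuity of its restriction to the
   sections supported in K, with the supremum norm, for each compact K. *)
Definition is_representation (V : completeNormedModType C) (ip : V -> V -> C)
    (L : (GG -> E) -> V -> V) : Prop :=
  is_inner_product ip /\
  [/\ forall f, Gammac E f -> forall k v w,
        L f (k *: v + w) = k *: L f v + L f w,
      forall f, Gammac E f -> exists M : C, forall v, `|L f v| <= M * `|v|,
      forall k f g, Gammac E f -> Gammac E g -> forall v,
        L (slin k f g) v = k *: L f v + L g v,
      forall f g, Gammac E f -> Gammac E g -> forall v,
        L (sconv f g) v = L f (L g v) &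
      forall f, Gammac E f -> forall v w, ip (L f v) w = ip v (L (sstar f) w)]
  /\
  forall (K : set GG), compact K ->
    forall f, Gammac E f -> bsupp f `<=` K ->
    forall e : R, 0 < e -> exists2 d : R, 0 < d &
      forall g, Gammac E g -> bsupp g `<=` K ->
        (forall x, bdist x (g x) (f x) < d) ->
        forall v, `|L g v - L f v| <= e%:C * `|v|.

Definition opnorm (V : completeNormedModType C) (T : V -> V) : \bar R :=
  ereal_sup [set (complex.Re `|T v|)%:E | v in [set v : V | `|v| <= 1]].

Definition universal_norm (f : GG -> E) : \bar R :=
  ereal_sup [set r | exists (V : completeNormedModType C) (ip : V -> V -> C)
    (L : (GG -> E) -> V -> V), is_representation ip L /\ r = opnorm (L f)].

(* [cs] with the map [iota] is the completion of the *-algebra [Gammac E] in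
   the universal norm. *)
Definition is_universal_completion (cs : cstar_algebra R)
    (iota : (GG -> E) -> cs) : Prop :=
  [/\ forall k f g, Gammac E f -> Gammac E g ->
        iota (slin k f g) = k *: iota f + iota g,
      forall f g, Gammac E f -> Gammac E g ->
        iota (sconv f g) = cmul (iota f) (iota g),
      forall f, Gammac E f -> iota (sstar f) = cstar (iota f),
      forall f, Gammac E f ->
        universal_norm f = (complex.Re `|iota f|)%:E &
      dense (iota @` Gammac E)].

(* C*(E), which is determined up to isomorphism; [fcs_iota] is relevant on
   [Gammac E] only *)
Record fell_cstar := FellCstar {
  fcs :> cstar_algebra R;
  fcs_iota : (GG -> E) -> fcs;
  fcsP : is_universal_completion fcs_iota
}.

End FellBundles.

End BanachBundles.

Arguments Gamma0 {R X} E.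
Arguments Gammac {R X} E.

Section Restriction.
Variables (R : realType) (G : topGroupType) (H : closed_subgroup G).
Variable A : fell_ops R (group_groupoid G).
Local Notation T := (subg_type H).

Definition restr_tot : topologicalType :=
  set_type (@bpr R _ A @^-1` (subg_set H)).

Lemma restr_totP (a : restr_tot) : subg_set H (bpr (sval a)).
Proof. exact: set_mem (svalP a). Qed.

Definition restr_elt (a : A) (Ha : subg_set H (bpr a)) : restr_tot :=
  exist _ a (mem_set Ha).

Definition restr_pr (a : restr_tot) : group_groupoid T :=
  subg_elt (restr_totP a).

Definition restr_fib (h : group_groupoid T) := fib A (subg_inc h).

Lemma bpr_binj (X : ptopologicalType) (E : bundle R X) (x : X) (v : fib E x) :
  bpr (binj v) = x.
Proof.
by have : range (@binj _ _ E x) (binj v) by [exists v]; rewrite binj_range.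
Qed.

Lemma restr_injP (h : group_groupoid T) (v : restr_fib h) :
  subg_set H (bpr (binj v)).
Proof. by rewrite bpr_binj; exact: subg_incP. Qed.

Definition restr_inj (h : group_groupoid T) (v : restr_fib h) : restr_tot :=
  restr_elt (restr_injP v).

Let rinj_inj h : injective (@restr_inj h).
Proof. by move=> v w [] /binj_inj. Qed.

Let rinj_range h : range (@restr_inj h) = restr_pr @^-1` [set h].
Proof.
apply/seteqP; split => [_ [v _ <-]|a /= ah].
  by apply: subg_inc_inj; rewrite /= /subg_inc /=; exact: bpr_binj.
have : range (@binj _ _ A (subg_inc h)) (sval a).
  by rewrite binj_range /= -ah.
by move=> [v _ va]; exists v => //; exact: val_inj.
Qed.

Definition restr_bundle : bundle R (group_groupoid T) :=
  Bundle rinj_inj rinj_range.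

Lemma restr_mulP (a b : restr_tot) :
  subg_set H (bpr (fmul (sval a) (sval b))).
Proof. by rewrite bpr_mul //; apply: subgM; exact: restr_totP. Qed.

Lemma restr_starP (a : restr_tot) : subg_set H (bpr (fstar (sval a))).
Proof. by rewrite bpr_star; apply: subgV; exact: restr_totP. Qed.

Definition restr_fell : fell_ops R (group_groupoid T).
Proof.
refine (@FellOps R (group_groupoid T) restr_bundle
  (fun a b => restr_elt (restr_mulP a b))
  (fun a => restr_elt (restr_starP a)) _ _).
- move=> a b _; apply: subg_inc_inj.
  exact: (bpr_mul (f := A) (erefl : gsrc (bpr (sval a)) = grng (bpr (sval b)))).
- by move=> a; apply: subg_inc_inj; exact: (bpr_star (sval a : A)).
Defined.

End Restriction.

Section TransformationBundle.
Variables (R : realType) (G : topGroupType) (X : gspace G).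
Variable A : fell_ops R (group_groupoid G).
Local Notation GX := (trans_groupoid X).

Definition trans_tot : topologicalType := (A * X)%type.
Definition trans_pr (a : trans_tot) : GX := (bpr a.1, a.2).
Definition trans_fib (z : GX) := fib A z.1.
Definition trans_inj (z : GX) (v : trans_fib z) : trans_tot := (binj v, z.2).

Let tinj_inj z : injective (@trans_inj z).
Proof. by move=> v w [] /binj_inj. Qed.

Let tinj_range z : range (@trans_inj z) = trans_pr @^-1` [set z].
Proof.
apply/seteqP; split => [_ [v _ <-]|[a x] /= <-].
  by rewrite /= /trans_pr /= bpr_binj; case: z v.
have : range (@binj _ _ A (bpr a)) a by rewrite binj_range.
by move=> [v _ va]; exists v => //; rewrite /trans_inj /= va.
Qed.

Definition trans_bundle : bundle R GX := Bundle tinj_inj tinj_range.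

Definition trans_fell : fell_ops R GX.
Proof.
refine (@FellOps R GX trans_bundle
  (fun a b => (fmul a.1 b.1, b.2))
  (fun a => (fstar a.1, gact (bpr a.1) a.2)) _ _).
- move=> [a y] [b x] _ /=.
  rewrite /trans_pr /trans_comp /=; congr pair.
  exact: (bpr_mul (erefl : gsrc (bpr a) = grng (bpr b))).
- move=> [a y]; rewrite /= /trans_pr /trans_inv /=; congr pair.
  exact: (bpr_star a).
Defined.

End TransformationBundle.

Section ModuleOperations.
Variables (R : realType) (G : topGroupType) (H : closed_subgroup G).
Variables (mu : {measure set (borel G) -> \bar R}).
Variables (nu : {measure set (borel (subg_type H)) -> \bar R}).
Variable A : fell_ops R (group_groupoid G).
Local Notation GH := (coset_gspace H).
Local Notation AGH := (trans_fell GH A).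
Local Notation AH := (restr_fell H A).

Implicit Types (xi eta : G -> A).

Definition mod_lact (F : trans_groupoid GH -> AGH) xi : G -> A := fun t =>
  binj (fib_integral (E := A) mu setT t (fun s : G =>
    fmul (F (s, coset_of H (s^-1 * t)%g)).1 (xi (s^-1 * t)%g))).

Definition mod_ract xi (g : subg_type H -> AH) : G -> A := fun t =>
  binj (fib_integral (E := A) nu setT t (fun h : subg_type H =>
    fmul (xi (t * subg_inc h)%g) (sval (g (h^-1)%g)))).

(* The integral depends on the coset q = tH only, not on the representative t,
   by left invariance of [nu]. *)
Definition mod_lip xi eta : trans_groupoid GH -> AGH := fun z =>
  let: (s, q) := z in
  let t := coset_repr q in
  (binj (fib_integral (E := A) nu setT s (fun h : subg_type H =>
     fmul (xi (s * t * subg_inc h)%g) (fstar (eta (t * subg_inc h)%g)))), q).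

Definition mod_rip xi eta : subg_type H -> AH := fun h =>
  @binj R _ AH h (fib_integral (E := A) mu setT (subg_inc h) (fun s : G =>
    fmul (fstar (xi (s^-1)%g)) (eta (s^-1 * subg_inc h)%g))).

End ModuleOperations.

Arguments mod_lact {R G} H mu A.
Arguments mod_ract {R G H} nu A.
Arguments mod_lip {R G H} nu A.
Arguments mod_rip {R G} H mu A.

Section PreImprimitivity.
Variables (R : realType) (GA GB : groupoid) (T : ptopologicalType).
Variables (EA : fell_ops R GA) (lamA : measure_system R GA).
Variables (EB : fell_ops R GB) (lamB : measure_system R GB).
Variables (CA : fell_cstar EA lamA) (CB : fell_cstar EB lamB).
Variable EX : bundle R T.
Variables (lact : (GA -> EA) -> (T -> EX) -> (T -> EX))
          (ract : (T -> EX) -> (GB -> EB) -> (T -> EX))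
          (lip : (T -> EX) -> (T -> EX) -> (GA -> EA))
          (rip : (T -> EX) -> (T -> EX) -> (GB -> EB)).
Local Notation A0 := (Gammac EA).
Local Notation B0 := (Gammac EB).
Local Notation X0 := (Gammac EX).
Local Notation iA := (fcs_iota CA).
Local Notation iB := (fcs_iota CB).
Local Notation posA := (cpos (@cmul R CA) (@cstar R CA)).
Local Notation posB := (cpos (@cmul R CB) (@cstar R CB)).

(* Positivity, fullness and boundedness are relative to C*(EA) and C*(EB); the
   other conditions are identities between sections. *)
Definition is_pre_imprimitivity_bimodule : Prop :=
  [/\ forall F x, A0 F -> X0 x -> X0 (lact F x),
      forall x g, X0 x -> B0 g -> X0 (ract x g),
      forall x y, X0 x -> X0 y -> A0 (lip x y) &
      forall x y, X0 x -> X0 y -> B0 (rip x y)] /\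
  [/\ forall k F F' x, A0 F -> A0 F' -> X0 x ->
        lact (slin k F F') x = slin k (lact F x) (lact F' x),
      forall k F x y, A0 F -> X0 x -> X0 y ->
        lact F (slin k x y) = slin k (lact F x) (lact F y) &
      forall F F' x, A0 F -> A0 F' -> X0 x ->
        lact (sconv lamA F F') x = lact F (lact F' x)] /\
  [/\ forall k x g g', X0 x -> B0 g -> B0 g' ->
        ract x (slin k g g') = slin k (ract x g) (ract x g'),
      forall k x y g, X0 x -> X0 y -> B0 g ->
        ract (slin k x y) g = slin k (ract x g) (ract y g),
      forall x g g', X0 x -> B0 g -> B0 g' ->
        ract x (sconv lamB g g') = ract (ract x g) g' &
      forall F x g, A0 F -> X0 x -> B0 g ->
        ract (lact F x) g = lact F (ract x g)] /\
  [/\ forall k x y z, X0 x -> X0 y -> X0 z ->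
        lip (slin k x y) z = slin k (lip x z) (lip y z),
      forall F x y, A0 F -> X0 x -> X0 y ->
        lip (lact F x) y = sconv lamA F (lip x y),
      forall x y, X0 x -> X0 y -> sstar (lip x y) = lip y x &
      forall x, X0 x -> posA (iA (lip x x))] /\
  [/\ forall k x y z, X0 x -> X0 y -> X0 z ->
        rip z (slin k x y) = slin k (rip z x) (rip z y),
      forall x y g, X0 x -> X0 y -> B0 g ->
        rip x (ract y g) = sconv lamB (rip x y) g,
      forall x y, X0 x -> X0 y -> sstar (rip x y) = rip y x &
      forall x, X0 x -> posB (iB (rip x x))] /\
  (dense_span [set iA (lip p.1 p.2) | p in [set p | X0 p.1 /\ X0 p.2]] /\
   dense_span [set iB (rip p.1 p.2) | p in [set p | X0 p.1 /\ X0 p.2]]) /\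
  (forall F x, A0 F -> X0 x ->
     posB (`|iA F| ^+ 2 *: iB (rip x x) - iB (rip (lact F x) (lact F x)))) /\
  (forall x g, X0 x -> B0 g ->
     posA (`|iB g| ^+ 2 *: iA (lip x x) - iA (lip (ract x g) (ract x g)))) /\
  (forall x y z, X0 x -> X0 y -> X0 z ->
     lact (lip x y) z = ract x (rip y z)).

(* The last two equations and the density of the image make [j] the separation
   and completion of [Gammac EX] for the seminorm |<x,x>|^(1/2). *)
Definition is_imprimitivity_completion (X : completeNormedModType R[i])
    (j : (T -> EX) -> X) : Prop :=
  exists (lactX : CA -> X -> X) (ractX : X -> CB -> X)
         (lipX : X -> X -> CA) (ripX : X -> X -> CB),
  is_imprimitivity_bimodule (@cmul R CA) (@cstar R CA)
    (@cmul R CB) (@cstar R CB) lactX ractX lipX ripX /\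
  (forall k x y, X0 x -> X0 y -> j (slin k x y) = k *: j x + j y) /\
  dense (j @` X0) /\
  [/\ forall F x, A0 F -> X0 x -> j (lact F x) = lactX (iA F) (j x),
      forall x g, X0 x -> B0 g -> j (ract x g) = ractX (j x) (iB g),
      forall x y, X0 x -> X0 y -> iA (lip x y) = lipX (j x) (j y) &
      forall x y, X0 x -> X0 y -> iB (rip x y) = ripX (j x) (j y)].

Definition completes_to_imprimitivity_bimodule : Prop :=
  is_pre_imprimitivity_bimodule /\
  exists (X : completeNormedModType R[i]) (j : (T -> EX) -> X),
    is_imprimitivity_completion j.

End PreImprimitivity.

(* Main.v *)
Require Import Defs.
From HB Require Import structures.
From mathcomp Require Import all_boot all_order all_algebra.
From mathcomp Require Import all_classical all_reals all_analysis.
From mathcomp Require Import complex ring lra measurable_realfun.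

(* Every inner product <x, x> is tested against the representations L that define
the universal norm: phi(g) = (L(g) v | v) yields the positive form phi(<x, y>)
on Gamma_c(A), and A acts boundedly for it, by log-convexity of
n -> phi(<T^n x, T^n x>). Approximate units of the fibre algebras
A_e, spread over G by continuous sections and averaged with bump functions,
give finite sums of inner products that act as approximate identities on both
sides. Hence <x, x> is a limit of sums of squares and therefore positive, the
inner products have dense span, and, Riemann sums replacing the integrals, each
action is bounded by the universal norm. In the completion the identities of an
imprimitivity bimodule follow by continuity; the two norms agree since
|q^3| <= |p|^2 |q| and |p^3| <= |q|^2 |p| for p = <x, x>_A and q = <x, x>_B. *)

Set Implicit Arguments.
Unset Strict Implicit.
Unset Printing Implicit Defensive.
Import Order.TTheory GRing.Theory Num.Theory.
Import numFieldNormedType.Exports.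
Local Open Scope quotient_scope.
Local Open Scope classical_set_scope.
Local Open Scope complex_scope.
Local Open Scope ring_scope.

(** The universal norm is a supremum over representations, so its finiteness does not make it
    continuous for the inductive limit topology. That continuity is needed before uniform
    approximation of sections gives approximation in the C*-algebra; a Baire category argument
    supplies it, and no disintegration of representations is used. The second obstacle looks
    circular: a form phi(<x, y>) yields a representation of an algebra only if that algebra is
    already known to act boundedly, with bounds controlled by support and sup norm. Single
    translates break the circle. Each has an adjoint up to a modular factor, and a translate
    followed by its adjoint multiplies pointwise by a bounded element, so log-convexity applies.
    Integration gives a crude bound depending on the support; it makes the action a representation,
    and being one it satisfies the sharp bound. The approximate identities are proved over abstract
    spaces with an action of G or of H, as they are needed on Gamma_c(A), for positivity, and on the
    convolution algebras, for fullness. *)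

Local Notation borel_measure R S := {measure set (borel S) -> \bar R}.
Local Notation finite_on_compacts S m := (forall K : set S, compact K -> (m K < +oo)%E).

(** * Real-valued norms over the complex scalars *)

Section RealNorm.
Variable R : realType.
Local Notation C := R[i].

(** The norm of a complex normed module takes values in [R[i]]. Its real part is used instead so
    that estimates and suprema stay in [R]. *)
Definition rn (V : normedZmodType C) (v : V) : R := complex.Re `|v|.

Lemma rnE (V : normedZmodType C) (v : V) : (rn v)%:C = `|v|.
Proof. by rewrite /rn RRe_real // ger0_real. Qed.
Lemma rn_ge0 (V : normedZmodType C) (v : V) : 0 <= rn v.
Proof. by rewrite -ler0c rnE. Qed.
Lemma rnD (V : normedZmodType C) (v w : V) : rn (v + w) <= rn v + rn w.
Proof. by rewrite -lecR rmorphD /= !rnE ler_normD. Qed.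
Lemma rnN (V : normedZmodType C) (v : V) : rn (- v) = rn v.
Proof. by rewrite /rn normrN. Qed.
Lemma rnB (V : normedZmodType C) (v w : V) : rn (v - w) <= rn v + rn w.
Proof. by rewrite (le_trans (rnD _ _)) // rnN. Qed.
Lemma rn_distC (V : normedZmodType C) (v w : V) : rn (v - w) = rn (w - v).
Proof. by rewrite /rn distrC. Qed.
Lemma rn0 (V : normedZmodType C) : rn (0 : V) = 0.
Proof. by rewrite /rn normr0. Qed.
Lemma rn_eq0 (V : normedZmodType C) (v : V) : rn v = 0 -> v = 0.
Proof. by move=> v0; apply: normr0_eq0; rewrite -rnE v0. Qed.
Lemma rnZ (V : normedModType C) (k : C) (v : V) : rn (k *: v) = rn k * rn v.
Proof. by apply: complexI; rewrite rmorphM /= !rnE normrZ. Qed.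
Lemma rnM (k l : C) : rn (k * l) = rn k * rn l.
Proof. by apply: complexI; rewrite rmorphM /= !rnE normrM. Qed.
Lemma rn_real (k : R) : rn (k%:C) = `|k|.
Proof. by apply: complexI; rewrite rnE normc_def /= expr0n addr0 sqrtr_sqr. Qed.
Lemma rn_pos (k : R) : 0 <= k -> rn (k%:C) = k.
Proof. by move=> k0; rewrite rn_real ger0_norm. Qed.
Lemma rn_conj (k : C) : rn (conjc k) = rn k.
Proof. by rewrite /rn normcJ. Qed.
Lemma rn_Re (k : C) : `|complex.Re k| <= rn k.
Proof. by rewrite -lecR rnE normc_ge_Re. Qed.
Lemma rn_ltC (V : normedZmodType C) (v : V) (e : R) : (`|v| < e%:C) = (rn v < e).
Proof. by rewrite -ltcR !rnE. Qed.
Lemma rn_tri (V : normedZmodType C) (u v w : V) : rn (u - w) <= rn (u - v) + rn (v - w).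
Proof. by rewrite (le_trans _ (rnD _ _)) // addrA subrK. Qed.
Lemma rn_i : rn ('i%C : C) = 1.
Proof. by apply: complexI; rewrite rnE normc_def /= expr0n add0r expr1n sqrtr1. Qed.
Lemma posC_ex (e : C) : 0 < e -> exists2 d : R, 0 < d & d%:C = e.
Proof.
case: e => a b; rewrite ltcE /= => /andP[/eqP -> a0].
by exists a.
Qed.

Lemma halfR_gt0 (e : R) : 0 < e -> 0 < e / 2.
Proof. by move=> e0; rewrite divr_gt0. Qed.
Lemma halfZ_dbl (V : lmodType C) (v : V) : (2^-1 : C) *: (v + v) = v.
Proof. by rewrite -[v + v]mulr2n -(scaler_nat 2 v) scalerA mulVf ?scale1r ?pnatr_eq0. Qed.
Lemma two_real : (2 : C) = (2 : R)%:C.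
Proof. by rewrite rmorph_nat. Qed.
Lemma conj_half : conjc (2^-1 : C) = 2^-1.
Proof. by rewrite conjc_inv conjc_nat. Qed.
Lemma conj_i : conjc ('i%C : C) = - 'i%C.
Proof. by apply/eqP; rewrite eq_complex /= oppr0 !eqxx. Qed.
Lemma conj_Ni : conjc (- 'i%C : C) = 'i%C.
Proof. by apply/eqP; rewrite eq_complex /= opprK oppr0 !eqxx. Qed.
Lemma ii_N1 : ('i%C : C) * 'i%C = -1.
Proof. by rewrite -expr2 sqr_i. Qed.

(** Completeness is stated with sequences for a bare function [n], so that it also applies to the
    unitization of a C*-algebra, whose norm is never turned into a topology. *)
Definition ncauchy (V : zmodType) (n : V -> R) (u : nat -> V) :=
 forall e : R, 0 < e -> exists N, forall i j, (N <= i)%N -> (N <= j)%N ->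
  n (u i - u j) < e.

Definition nconv (V : zmodType) (n : V -> R) (u : nat -> V) (l : V) :=
 forall e : R, 0 < e -> exists N, forall i, (N <= i)%N -> n (u i - l) < e.

Definition ncomplete (V : zmodType) (n : V -> R) :=
 forall u, ncauchy n u -> exists l, nconv n u l.

Lemma nbhs_rnP (V : normedModType C) (v : V) (A : set V) :
 nbhs v A <-> exists2 e : R, 0 < e & forall w, rn (v - w) < e -> A w.
Proof.
split=> [/nbhs_ballP[e /= e0]|[e e0 eA]].
 have [d d0 <-] := posC_ex e0 => sA; exists d => // w vw; apply: sA.
 by rewrite -ball_normE /= rn_ltC.
apply/nbhs_ballP; exists e%:C => /=; first by rewrite ltcR.
by move=> w; rewrite -ball_normE /= rn_ltC => /eA.
Qed.

Lemma rn_cvgP (T : Type) (F : set_system T) (FF : Filter F)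
  (V : normedModType C) (f : T -> V) (l : V) :
 (f @ F --> l) <-> forall e : R, 0 < e -> \forall x \near F, rn (l - f x) < e.
Proof.
split=> [fl e e0|fl A /nbhs_rnP[e e0 eA]].
 have /fl : nbhs l [set w | rn (l - w) < e] by apply/nbhs_rnP; exists e.
 by [].
by apply: filterS (fl e e0) => x; exact: eA.
Qed.

Lemma nconv_cvg (V : normedModType C) (u : nat -> V) (l : V) :
 nconv (@rn V) u l <-> u @ \oo --> l.
Proof.
split=> [ul|/rn_cvgP ul e e0].
 apply/rn_cvgP => e /ul[N ulN]; exists N => // i /= /ulN.
 by rewrite rn_distC.
by have [N _ uN] := ul _ e0; exists N => i /uN; rewrite rn_distC.
Qed.

Lemma rn_complete (V : completeNormedModType C) : ncomplete (@rn V).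
Proof.
move=> u cu; suff /cvg_ex[l /nconv_cvg ul] : cvg (u @ \oo) by exists l.
apply: cauchy_cvg; apply/cauchy_ballP => e /= e0.
have [d d0 de] := posC_ex e0.
have [N uN] := cu _ d0.
exists (u @` [set i | (N <= i)%N], u @` [set i | (N <= i)%N]) => /=.
 by split; exists N => // i /= Ni; exists i.
move=> [_ _] /= [[i Ni <-] [j Nj <-]] /=.
by rewrite -ball_normE /= -de rn_ltC; exact: uN.
Qed.

Lemma rn_cont (V : normedModType C) : continuous (@rn V : V -> R).
Proof.
move=> v; apply/(@cvgrPdist_lt _ R^o _ (nbhs v)) => e e0.
apply/nbhs_rnP; exists e => // w vw.
change (is_true (`|rn v - rn w| < (e : R))); rewrite ltr_norml.
have := rn_tri v w 0; have := rn_tri w v 0; rewrite !subr0 (rn_distC w v).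
by move: (rn _) (rn _) (rn _) vw => a b c vw h1 h2; apply/andP; split; lra.
Qed.

End RealNorm.

(** * Square roots by iteration *)

Section SquareRoot.
Variable R : realType.

(** The scalar case [h = 1] of the iteration below. It increases to 1, and its increments majorize
    those in the algebra for every [h] with [n h <= 1], the boundary case included. *)
Fixpoint sqt (n : nat) : R := if n is n'.+1 then (1 + sqt n' ^+ 2) / 2 else 0.

Lemma sqt_bound n : [/\ 0 <= sqt n, sqt n <= 1 & 1 - sqt n <= 2 / n.+2%:R].
Proof.
elim: n => [|n [h0 h1 h2]] /=; first by split; lra.
have n0 : (0 : R) <= n%:R by [].
split.
- by rewrite divr_ge0 // addr_ge0 // sqr_ge0.
- by rewrite ler_pdivrMr //; nra.
(* With d = 1 - sqt n the recursion reads d -> d (1 - d/2), whose solutions decay like 2/n. *)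
- have -> : 1 - (1 + sqt n ^+ 2) / 2 = (1 - sqt n) * (1 - (1 - sqt n) / 2) by field.
 have e2 : n.+2%:R = n%:R + 2 :> R by rewrite -addn2 natrD.
 have e3 : n.+3%:R = n%:R + 3 :> R by rewrite -addn3 natrD.
 have d0 : 0 <= 1 - sqt n by lra.
 have d1 : 1 - sqt n <= 1 by lra.
 move: h2; rewrite e2 e3 !ler_pdivlMr; try lra.
 move: (1 - sqt n) d0 d1 => d d0 d1 h.
 set N : R := n%:R in n0 h *.
 have : d * (N + 3) * (1 - d / 2) <= 2.
  have [dN|dN] := leP (d * (N + 3)) 2; first by nra.
  have : (1 - d/2) * (N+3) <= N + 2 by nra.
  nra.
 nra.
Qed.

Lemma sqt_lim (e : R) : 0 < e -> exists N, forall n, (N <= n)%N -> 1 - sqt n < e.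
Proof.
move=> e0; exists (Num.Def.truncn (2 / e)) => n Nn.
have [_ _ h] := sqt_bound n; apply: le_lt_trans h _.
rewrite ltr_pdivrMr // -ltr_pdivrMl // mulrC.
have := truncnS_gt (2 / e) => /lt_le_trans; apply; rewrite ler_nat.
by rewrite ltnW // ltnS ltnS.
Qed.

Variables (V : lmodType R[i]) (mul : V -> V -> V) (n : V -> R).
Hypotheses (mulDl : forall a b c, mul (a + b) c = mul a c + mul b c)
 (mulDr : forall a b c, mul a (b + c) = mul a b + mul a c)
 (mulN : forall a b, mul a (- b) = - mul a b)
 (Nmul : forall a b, mul (- a) b = - mul a b)
 (nD : forall a b, n (a + b) <= n a + n b)
 (nZ : forall k a, n (k *: a) = rn k * n a)
 (nM : forall a b, n (mul a b) <= n a * n b)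
 (n_eq0 : forall a, n a = 0 -> a = 0)
 (ncompl : ncomplete n).

(** The limit y solves 2 y = h + y^2, that is (1 - y)^2 = 1 - h once there is a unit. So 1 - y is a
    square root of 1 - h, which replaces the functional calculus. *)
Fixpoint sqit (h : V) (i : nat) : V :=
 if i is i'.+1 then (2^-1 : R[i]) *: (h + mul (sqit h i') (sqit h i')) else 0.

Definition usq (h : V) : V := xget 0 [set l | nconv n (sqit h) l].

Let n0 : n 0 = 0.
Proof. by rewrite -(scale0r (0 : V)) nZ rn0 mul0r. Qed.
Let nN a : n (- a) = n a.
Proof. by rewrite -scaleN1r nZ rnN -(rmorph1 (real_complex R)) rn_pos // mul1r. Qed.
Let n_ge0 a : 0 <= n a.
Proof.
by have := nD a (- a); rewrite nN subrr n0; lra.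
Qed.

Lemma rn_half : rn (2^-1 : R[i]) = 2^-1.
Proof.
rewrite (_ : (2^-1 : R[i]) = (2^-1 : R)%:C) ?rn_pos //.
by rewrite fmorphV /= rmorphMn /= rmorph1.
Qed.

Lemma nconv_unique (u : nat -> V) (l l' : V) : nconv n u l -> nconv n u l' -> l = l'.
Proof.
move=> ul ul'; apply/subr0_eq/n_eq0/eqP; apply/negPn/negP => l0.
have e0 : 0 < n (l - l') by rewrite lt_neqAle eq_sym l0 n_ge0.
have [N1 h1] := ul _ (halfR_gt0 e0); have [N2 h2] := ul' _ (halfR_gt0 e0).
have := h1 (maxn N1 N2) (leq_maxl _ _); have := h2 (maxn N1 N2) (leq_maxr _ _).
have := nD (l - u (maxn N1 N2)) (u (maxn N1 N2) - l').
rewrite -(nN (l - u _)) opprB addrA subrK.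
by move: (n _) (n _) (n _) => a b c; lra.
Qed.

Section Ball.
Variables (h : V) (h1 : n h <= 1).

Let mulBB a b : mul a a - mul b b = mul a (a - b) + mul (a - b) b.
Proof. by rewrite mulDr mulDl mulN Nmul addrA subrK. Qed.
Lemma sqit_le i : n (sqit h i) <= sqt i.
Proof.
elim: i => [|i IH]; first by rewrite n0.
rewrite /= nZ rn_half mulrC ler_wpM2r //.
rewrite (le_trans (nD _ _)) // lerD // (le_trans (nM _ _)) // expr2.
by apply: ler_pM; rewrite // ?n_ge0.
Qed.

(** The identity a^2 - b^2 = a (a - b) + (a - b) b bounds each increment by the previous one times
    half the sum of two norms, and the scalar sequence satisfies the same recursion with
    equality. *)
Let sqit_step i : n (sqit h i.+1 - sqit h i) <= sqt i.+1 - sqt i.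
Proof.
elim: i => [|i IH].
 rewrite /= !subr0 nZ rn_half expr0n addr0 mulrC ler_wpM2r //.
 have z : n (mul 0 0) <= 0 by rewrite (le_trans (nM _ _)) // n0 mulr0.
 by rewrite (le_trans (nD _ _)) // (le_trans (lerD h1 z)) // addr0.
have -> : sqit h i.+2 - sqit h i.+1 = (2^-1 : R[i]) *:
  (mul (sqit h i.+1) (sqit h i.+1 - sqit h i) + mul (sqit h i.+1 - sqit h i) (sqit h i)).
 rewrite -mulBB; set a := sqit h i.+1; rewrite {2}/a -[sqit h i.+2]/(_ *: (h + mul a a)).
 by rewrite -[sqit h i.+1]/(_ *: _) -scalerBr opprD addrACA subrr add0r.
rewrite nZ rn_half.
have [a0 a1 _] := sqt_bound i; have [b0 b1 _] := sqt_bound i.+1.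
have p1 := nM (sqit h i.+1) (sqit h i.+1 - sqit h i).
have p2 := nM (sqit h i.+1 - sqit h i) (sqit h i).
have p3 := nD (mul (sqit h i.+1) (sqit h i.+1 - sqit h i)) (mul (sqit h i.+1 - sqit h i) (sqit h i)).
have q1 := sqit_le i; have q2 := sqit_le i.+1.
have q3 := n_ge0 (sqit h i); have q4 := n_ge0 (sqit h i.+1).
have q5 := n_ge0 (sqit h i.+1 - sqit h i).
have -> : sqt i.+2 - sqt i.+1 = 2^-1 * ((sqt i.+1 + sqt i) * (sqt i.+1 - sqt i)).
 have -> : sqt i.+2 - sqt i.+1 = (1 + sqt i.+1 ^+ 2) / 2 - (1 + sqt i ^+ 2) / 2 by [].
 by move: (sqt i.+1) (sqt i) => a b; field.
rewrite ler_wpM2l //.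
move: (n _) (n _) (n _) (n _) (n _) (n _) (sqt i.+1) (sqt i) IH p1 p2 p3 q1 q2 q3 q4 q5 a0 a1 b0 b1.
by move=> x y z w v u s t *; nra.
Qed.

Lemma sqit_dist i j : (i <= j)%N -> n (sqit h j - sqit h i) <= sqt j - sqt i.
Proof.
elim: j => [|j IH]; first by rewrite leqn0 => /eqP ->; rewrite !subrr n0.
rewrite leq_eqVlt => /orP[/eqP <-|]; first by rewrite !subrr n0.
rewrite ltnS => /IH ij.
have -> : sqit h j.+1 - sqit h i = (sqit h j.+1 - sqit h j) + (sqit h j - sqit h i).
 by rewrite addrA subrK.
by have := nD (sqit h j.+1 - sqit h j) (sqit h j - sqit h i); have := sqit_step j; lra.
Qed.

Lemma usq_conv : nconv n (sqit h) (usq h).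
Proof.
suff [l hl] : exists l, nconv n (sqit h) l by rewrite /usq; case: xgetP => // /(_ l).
apply: ncompl => e e0; have [N hN] := sqt_lim e0.
suff H i j : (N <= i)%N -> (i <= j)%N -> n (sqit h j - sqit h i) < e.
 exists N => i j Ni Nj; have [ij|/ltnW ij] := leqP i j; last exact: H.
 by rewrite -nN opprB; exact: H.
move=> Ni ij; apply: le_lt_trans (sqit_dist ij) _.
have [_ sj _] := sqt_bound j.
by have := hN _ Ni; lra.
Qed.

Lemma usq_dist i : n (usq h - sqit h i) <= 1 - sqt i.
Proof.
apply/ler_addgt0Pr => e e0; have [N hN] := usq_conv e0.
have := hN (maxn N i) (leq_maxl _ _); have := sqit_dist (leq_maxr N i).
have [_ sj _] := sqt_bound (maxn N i).
have := nD (usq h - sqit h (maxn N i)) (sqit h (maxn N i) - sqit h i).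
by rewrite addrA subrK -(nN (usq h - _)) opprB; lra.
Qed.

Lemma usq_le1 : n (usq h) <= 1.
Proof. by have := usq_dist 0; rewrite /= !subr0. Qed.
Lemma usq_eq : usq h = (2^-1 : R[i]) *: (h + mul (usq h) (usq h)).
Proof.
apply: nconv_unique usq_conv _ => e e0.
have [N hN] := usq_conv e0; exists N.+1 => -[//|i] Ni.
rewrite /= -scalerBr opprD addrACA subrr add0r mulBB nZ rn_half.
have := hN _ Ni; set d := sqit h i - usq h.
have := nD (mul (sqit h i) d) (mul d (usq h)); have := nM (sqit h i) d.
have := nM d (usq h); have := usq_le1; have := sqit_le i.
have [_ s1 _] := sqt_bound i.
have := n_ge0 d; have := n_ge0 (usq h); have := n_ge0 (sqit h i).
move: (n _) (n _) (n _) (n _) (n _) (n _) (sqt i) s1 => x y z w v u s s1 *.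
nra.
Qed.

(* Properties that the iteration preserves and that are closed pass to the limit. *)
Lemma usq_ind (Q : V -> Prop) : Q 0 ->
 (forall x, Q x -> Q ((2^-1 : R[i]) *: (h + mul x x))) ->
 (forall u l, (forall i, Q (u i)) -> nconv n u l -> Q l) -> Q (usq h).
Proof.
move=> Q0 QS Ql; apply: Ql usq_conv; elim=> [|i IH] //=.
exact: QS.
Qed.

End Ball.
End SquareRoot.
(* Unital C*-algebras, with the norm as a plain real-valued function. *)
Record ucstar (R : realType) := UCstar {
 uc :> algType R[i];
 ust : uc -> uc;
 unm : uc -> R;
 ustD : forall a b, ust (a + b) = ust a + ust b;
 ustZ : forall k a, ust (k *: a) = conjc k *: ust a;
 ustM : forall a b, ust (a * b) = ust b * ust a;
 ustK : forall a, ust (ust a) = a;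
 unmD : forall a b, unm (a + b) <= unm a + unm b;
 unmZ : forall k a, unm (k *: a) = rn k * unm a;
 unmM : forall a b, unm (a * b) <= unm a * unm b;
 unmC : forall a, unm (ust a * a) = unm a ^+ 2;
 unm_eq0 : forall a, unm a = 0 -> a = 0;
 unm_complete : ncomplete unm
}.

(** * Positivity in C*-algebras *)

Section PositiveCone.
Variables (R : realType) (U : ucstar R).
Local Notation C := R[i].
Local Notation n := (@unm R U).
Local Notation st := (@ust R U).
Implicit Types a b c h k u v : U.

Lemma unm0 : n 0 = 0.
Proof. by rewrite -(scale0r (0 : U)) unmZ rn0 mul0r. Qed.
Lemma unmN a : n (- a) = n a.
Proof. by rewrite -scaleN1r unmZ rnN -(rmorph1 (real_complex R)) rn_pos // mul1r. Qed.
Lemma unm_ge0 a : 0 <= n a.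
Proof. by have := unmD a (- a); rewrite unmN subrr unm0; lra. Qed.
Lemma unm1 : n 1 = 1.
Proof.
have s1 : st 1 = 1 by rewrite -[RHS]ustK -[st 1]mul1r ustM ustK mul1r.
have := unmC (1 : U); rewrite s1 mulr1 expr2 => h.
have : n 1 != 0 by apply/eqP => /unm_eq0/eqP; rewrite oner_eq0.
by move=> h0; apply: (mulfI h0); rewrite -h mulr1.
Qed.
Lemma ust1 : st 1 = 1.
Proof. by rewrite -[RHS]ustK -[st 1]mul1r ustM ustK mul1r. Qed.
Lemma ust0 : st 0 = 0.
Proof. by have := ustZ 0 (0 : U); rewrite scale0r => ->; rewrite rmorph0 scale0r. Qed.
Lemma ustN a : st (- a) = - st a.
Proof. by rewrite -scaleN1r ustZ rmorphN rmorph1 scaleN1r. Qed.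
Lemma ustB a b : st (a - b) = st a - st b.
Proof. by rewrite ustD ustN. Qed.
Lemma unm_st a : n (st a) = n a.
Proof.
suff H b : n b <= n (st b) by apply/le_anti; rewrite H -{2}(ustK a) H.
have := unmM (st b) b; rewrite unmC expr2.
have [->|b0] := eqVneq (n b) 0; first by rewrite unm_ge0.
by rewrite ler_pM2r // lt_neqAle eq_sym b0 unm_ge0.
Qed.

Lemma unm_real (r : R) a : 0 <= r -> n (r%:C *: a) = r * n a.
Proof. by move=> r0; rewrite unmZ rn_pos. Qed.
Lemma ust_real (r : R) a : st (r%:C *: a) = r%:C *: st a.
Proof. by rewrite ustZ conjc_real. Qed.
Lemma unm_le1 k : n (st k * k) <= 1 -> n k <= 1.
Proof. by rewrite unmC -[X in _ <= X](expr1n _ 2) ler_pXn2r // nnegrE ?unm_ge0. Qed.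
Lemma unm_conv_eq (w : nat -> U) (l l' : U) : nconv n w l -> nconv n w l' -> l = l'.
Proof.
exact: (nconv_unique (@unmD _ U) (@unmZ _ U) (@unm_eq0 _ U)).
Qed.

Lemma nconv_st (w : nat -> U) l : nconv n w l -> nconv n (st \o w) (st l).
Proof. by move=> wl e /wl[N wN]; exists N => i /wN; rewrite /= -ustB unm_st. Qed.
Lemma nconv_mull c (w : nat -> U) l : nconv n w l -> nconv n (fun i => c * w i) (c * l).
Proof.
move=> wl e e0; have c0 : 0 < n c + 1 by rewrite ltr_wpDl ?unm_ge0.
have [N wN] := wl (e / (n c + 1)) (divr_gt0 e0 c0).
exists N => i /wN; rewrite ltr_pdivlMr // -mulrBr => h.
by have := unmM c (w i - l); have := unm_ge0 (w i - l); nra.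
Qed.

Lemma nconv_mulr c (w : nat -> U) l : nconv n w l -> nconv n (fun i => w i * c) (l * c).
Proof.
move=> wl e e0; have c0 : 0 < n c + 1 by rewrite ltr_wpDl ?unm_ge0.
have [N wN] := wl (e / (n c + 1)) (divr_gt0 e0 c0).
exists N => i /wN; rewrite ltr_pdivlMr // -mulrBl => h.
by have := unmM (w i - l) c; have := unm_ge0 (w i - l); nra.
Qed.

(** [k] is 1 - y for the limit y of the iteration. The last clause stands in for the statement that
    [k] lies in the closed algebra generated by 1 and [h]. *)
Lemma sqrt1B h : st h = h -> n h <= 1 ->
 exists k, [/\ st k = k, k * k = 1 - h, n (1 - k) <= 1 &
  forall c, c * h = h * c -> c * k = k * c].
Proof.
move=> sh h1.
have HDl a b c : (a + b) * c = a * c + b * c by exact: mulrDl.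
have HDr a b c : a * (b + c) = a * b + a * c by exact: mulrDr.
have HNr a b : a * - b = - (a * b) by exact: mulrN.
have HNl a b : - a * b = - (a * b) by exact: mulNr.
pose y := usq (fun a b => a * b) n h.
have ind := usq_ind HDl HDr HNr HNl (@unmD _ U) (@unmZ _ U) (@unmM _ U)
 (@unm_complete _ U) h1.
have yE : y = (2^-1 : C) *: (h + y * y) := usq_eq HDl HDr HNr HNl (@unmD _ U)
 (@unmZ _ U) (@unmM _ U) (@unm_eq0 _ U) (@unm_complete _ U) h1.
have e2 : y + y = h + y * y.
 by rewrite {1 2}yE -scalerDr halfZ_dbl.
exists (1 - y); split.
- rewrite ustB ust1; congr (_ - _); apply: (ind (fun y => st y = y)); first exact: ust0.
  move=> x sx; rewrite ustZ ustD ustM sh sx; congr (_ *: _).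
  exact: conj_half.
 move=> w l sw wl; apply: unm_conv_eq (nconv_st wl) _.
 by rewrite (_ : st \o w = w) //; apply/funext => i /=.
- rewrite mulrBl mul1r mulrBr mulr1 opprB addrA.
 have -> : y * y = y + y - h by rewrite e2 addrC addKr.
 by rewrite !addrA subrK addrAC addrK.
- by rewrite subKr; apply: (usq_le1 HDl HDr HNr HNl (@unmD _ U) (@unmZ _ U) (@unmM _ U)
  (@unm_complete _ U) h1).
- move=> c ch; suff cy : c * y = y * c by rewrite mulrBr mulrBl mul1r mulr1 cy.
 apply: (ind (fun y => c * y = y * c)); first by rewrite mulr0 mul0r.
  by move=> x cx; rewrite -scalerAr -scalerAl mulrDr mulrDl ch mulrA cx -!mulrA cx.
 move=> w l cw wl; apply: unm_conv_eq (nconv_mull c wl) _.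
 by under eq_fun do rewrite cw; exact: nconv_mulr.
Qed.

(** Positivity without spectra: for selfadjoint [h] the estimate says that the spectrum lies in
    [0, 2M]. In this form sums are immediate and, after division by [M], the element has the shape 1
    - g with g of norm at most 1, whose square root exists. *)
Definition upos h := st h = h /\ exists2 M : R, 0 < M & n (M%:C%:A - h) <= M.

Lemma ust_algR (r : R) : st (r%:C%:A) = r%:C%:A.
Proof. by rewrite ust_real ust1. Qed.
Lemma upos_sqrt h : upos h ->
 exists k, [/\ st k = k, k * k = h, upos k & forall c, c * h = h * c -> c * k = k * c].
Proof.
move=> [sh [M M0 hM]].
pose g := (M^-1)%:C *: (M%:C%:A - h).
have M1 : (M^-1)%:C * M%:C = 1 :> C by rewrite -rmorphM mulVf ?rmorph1 ?gt_eqF.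
have gE : 1 - g = (M^-1)%:C *: h.
 by rewrite /g scalerBr scalerA M1 scale1r subKr.
have [|| k [sk kk kn kc]] := @sqrt1B g.
- by rewrite ust_real ustB ust_algR sh.
- by rewrite /g unm_real ?invr_ge0 ?(ltW M0) // ler_pdivrMl // mulr1.
have s2 : (Num.sqrt M)%:C * (Num.sqrt M)%:C = M%:C :> C.
 by rewrite -rmorphM -expr2 sqr_sqrtr // ltW.
exists ((Num.sqrt M)%:C *: k); split.
- by rewrite ust_real sk.
- rewrite -scalerAl -scalerAr scalerA s2 kk gE scalerA -rmorphM mulfV ?gt_eqF //.
 by rewrite scale1r.
- split; first by rewrite ust_real sk.
 exists (Num.sqrt M); first by rewrite sqrtr_gt0.
 rewrite -scalerBr unm_real ?sqrtr_ge0 //.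
 by rewrite -[X in _ <= X]mulr1 ler_wpM2l ?sqrtr_ge0.
- move=> c ch; rewrite -scalerAl -scalerAr kc // /g -scalerAl -scalerAr.
 by rewrite mulrBl mulrBr -scalerAl -scalerAr mul1r mulr1 ch.
Qed.

(** Let w be the square root of 1 - h^2 and u = h + i w. As [h] and w commute, [st u * u = 1], so w,
    the imaginary part of u, has norm at most 1; and 1 - h^2 = w^2. *)
Lemma upos_sq1 h : st h = h -> n h <= 1 -> n (1 - h * h) <= 1.
Proof.
move=> sh h1.
have hh1 : n (h * h) <= 1.
 by rewrite -{1}sh unmC -[X in _ <= X](expr1n _ 2) ler_pXn2r // nnegrE ?unm_ge0.
have [|w [sw ww _ wc]] := sqrt1B _ hh1; first by rewrite ustM sh.
rewrite -ww -{1}sw unmC -[X in _ <= X](expr1n _ 2) ler_pXn2r ?nnegrE ?unm_ge0 //.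
have hw : h * w = w * h by apply: wc; rewrite mulrA.
have ii := ii_N1 R.
pose u := h + 'i%C *: w.
have su : st u = h - 'i%C *: w.
 by rewrite ustD ustZ sh sw conj_i scaleNr.
have u1 : st u * u = 1.
 rewrite su mulrBl !mulrDr -!scalerAl -!scalerAr hw scalerA ii scaleN1r ww.
 by rewrite opprD opprK addrA addrK addrC subrK.
have nu : n u <= 1 by apply: unm_le1; rewrite u1 unm1.
have nsu : n (st u) <= 1 by rewrite unm_st.
have -> : w = (- 'i%C / 2 : C) *: (u - st u).
 rewrite su /u opprB addrC addrA subrK -scalerA halfZ_dbl scalerA mulNr ii.
 by rewrite opprK scale1r.
have := unmD u (- st u); rewrite unmZ unmN rnM rnN rn_i rn_half mul1r.
by lra.
Qed.

Lemma upos_sq h (M : R) : st h = h -> 0 < M -> n h ^+ 2 <= M -> n (M%:C%:A - h * h) <= M.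
Proof.
move=> sh M0 hM; pose r := Num.sqrt M.
have r0 : 0 < r by rewrite sqrtr_gt0.
have rr : r * r = M by rewrite -expr2 sqr_sqrtr // ltW.
have := @upos_sq1 ((r^-1)%:C *: h); rewrite ust_real sh unm_real ?invr_ge0 ?(ltW r0) //.
have hr : r^-1 * n h <= 1.
 rewrite ler_pdivrMl // mulr1.
 rewrite leNgt; apply/negP => hr; have : n h ^+ 2 <= r * r by rewrite rr.
 by nra.
move=> /(_ erefl hr); rewrite -scalerAl -scalerAr scalerA -rmorphM -invfM rr => H.
have -> : M%:C%:A - h * h = M%:C *: (1 - (M^-1)%:C *: (h * h)).
 by rewrite scalerBr scalerA -rmorphM mulfV ?gt_eqF // scale1r.
by rewrite unm_real ?(ltW M0) // -[X in _ <= X]mulr1 ler_pM2l.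
Qed.

Lemma upos_self_sq h : st h = h -> upos (h * h).
Proof.
move=> sh; split; first by rewrite ustM sh.
exists (n h ^+ 2 + 1); first by rewrite ltr_wpDl ?sqr_ge0.
by apply: upos_sq => //; rewrite ?ltr_wpDl ?sqr_ge0 // lerDl.
Qed.

(** Writing [h] as a square reduces to [upos_sq]. Thus any positive bound of the norm may serve as
    the constant of [upos]; this makes the constants uniform along a convergent sequence, whence the
    cone is closed. *)
Lemma upos_ball h (M : R) : upos h -> 0 < M -> n h <= M -> n (M%:C%:A - h) <= M.
Proof.
move=> /upos_sqrt[k [sk <- _ _]] M0 kM; apply: upos_sq => //.
by rewrite -unmC sk.
Qed.

Lemma upos0 : upos 0.
Proof. by split; [exact: ust0|exists 1; rewrite // subr0 unm_real // unm1 mulr1]. Qed.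
Lemma uposD h k : upos h -> upos k -> upos (h + k).
Proof.
move=> [sh [M M0 hM]] [sk [N N0 kN]]; split; first by rewrite ustD sh sk.
exists (M + N); first exact: addr_gt0.
rewrite rmorphD scalerDl opprD addrACA (le_trans (unmD _ _)) //.
exact: lerD.
Qed.

Lemma uposZ (r : R) h : 0 <= r -> upos h -> upos (r%:C *: h).
Proof.
move=> r0 [sh [M M0 hM]]; split; first by rewrite ust_real sh.
have [->|rn0] := eqVneq r 0.
 by exists 1; rewrite // scale0r subr0 unm_real // unm1 mulr1.
have rp : 0 < r by rewrite lt_neqAle eq_sym rn0.
exists (r * M); first exact: mulr_gt0.
by rewrite rmorphM -scalerA -scalerBr unm_real // ler_pM2l.
Qed.

Lemma upos_closed (w : nat -> U) l : (forall i, upos (w i)) -> nconv n w l -> upos l.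
Proof.
move=> wp wl; split.
 apply: unm_conv_eq (nconv_st wl) _.
 by rewrite (_ : st \o w = w) //; apply/funext => i /=; case: (wp i).
have M0 : 0 < n l + 1 by rewrite ltr_wpDl ?unm_ge0.
exists (n l + 1) => //; apply/ler_addgt0Pr => e e0.
have d0 : 0 < Num.min e 1 by rewrite lt_min e0 ltr01.
have [N wN] := wl _ d0; have := wN N (leqnn _); rewrite lt_min => /andP[h1 h2].
have h3 : n (w N) <= n l + 1.
 by have := unmD (w N - l) l; rewrite subrK; lra.
have := upos_ball (wp N) M0 h3.
have := unmD ((n l + 1)%:C%:A - w N) (w N - l); rewrite addrA subrK; lra.
Qed.

Lemma unm_sq h : st h = h -> n (h * h) = n h ^+ 2.
Proof. by move=> sh; rewrite -unmC sh. Qed.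
(** For commuting selfadjoint [k] and [l] both k + i l and k - i l have the square sum k^2 + l^2 as
    inner square. A bound on that sum therefore bounds their mean [k], by the C*-identity alone. *)
Lemma sq_sum_unit k l : st k = k -> st l = l -> k * l = l * k ->
 [/\ st (k + 'i%C *: l) * (k + 'i%C *: l) = k * k + l * l,
   st (k - 'i%C *: l) * (k - 'i%C *: l) = k * k + l * l,
   k = (2^-1 : C) *: ((k + 'i%C *: l) + (k - 'i%C *: l)) &
   n (k - 'i%C *: l) = n (k + 'i%C *: l)].
Proof.
move=> sk sl kl.
have ii := ii_N1 R.
have ci := conj_i R.
have s1 : st (k + 'i%C *: l) = k - 'i%C *: l by rewrite ustD ustZ sk sl ci scaleNr.
have s2 : st (k - 'i%C *: l) = k + 'i%C *: l by rewrite -s1 ustK.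
split.
- rewrite s1 mulrBl !mulrDr -!scalerAl -!scalerAr kl scalerA ii scaleN1r.
 by rewrite opprD opprK addrA addrK.
- rewrite s2 mulrDl !mulrBr -!scalerAl -!scalerAr kl scalerA ii scaleN1r opprK.
 by rewrite addrA subrK.
- by rewrite addrACA subrr addr0 halfZ_dbl.
- by rewrite -s1 unm_st.
Qed.

Lemma upos_le1 u : upos u -> upos (1 - u) -> n u <= 1.
Proof.
move=> /upos_sqrt[k [sk kk _ kc]] /upos_sqrt[l [sl ll _ lc]].
have kl : k * l = l * k.
 by apply: lc; rewrite mulrBr mulrBl mul1r mulr1 -kk mulrA.
have [e1 _ ke nn] := sq_sum_unit sk sl kl.
rewrite -kk unm_sq // -[X in _ <= X](expr1n _ 2) ler_pXn2r ?nnegrE ?unm_ge0 // ke.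
have : n (k + 'i%C *: l) <= 1 by apply: unm_le1; rewrite e1 kk ll addrC subrK unm1.
have := unmD (k + 'i%C *: l) (k - 'i%C *: l); rewrite nn unmZ rn_half; lra.
Qed.

Lemma upos_anti u : upos u -> upos (- u) -> u = 0.
Proof.
move=> /upos_sqrt[k [sk kk _ kc]] /upos_sqrt[l [sl ll _ lc]].
have kl : k * l = l * k by apply: lc; rewrite mulrN mulNr -kk mulrA.
have [e1 e2 ke nn] := sq_sum_unit sk sl kl.
have z : k + 'i%C *: l = 0.
 apply/unm_eq0/eqP; rewrite -(sqrf_eq0 (n _)) -unmC e1 kk ll subrr unm0 eqxx //.
have z' : k - 'i%C *: l = 0 by apply: unm_eq0; rewrite nn z unm0.
by rewrite -kk ke z z' addr0 scaler0 mul0r.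
Qed.

Lemma upos_bound h (M : R) : 0 <= M -> st h = h -> n h <= M -> upos (M%:C%:A - h).
Proof.
move=> M0 sh hM; split; first by rewrite ustB ust_algR sh.
have [M1|] := ltP 0 M.
 by exists M; rewrite // subKr.
move=> M2; have M00 : M = 0 by apply/le_anti; rewrite M2 M0.
have -> : h = 0 by apply: unm_eq0; apply/le_anti; rewrite unm_ge0 -M00 hM.
by exists 1; rewrite // M00 scale0r subrr subr0 unm_real // unm1 mulr1.
Qed.

(** For every M above the norm of [v] the chain u <= v <= M puts u/M between 0 and 1, where
    [upos_le1] applies. *)
Lemma upos_mono u v : upos u -> upos (v - u) -> n u <= n v.
Proof.
move=> pu pv.
have sv : st v = v.
 by have [su _] := pu; have [] := pv; rewrite ustB su => /addIr.
apply/ler_addgt0Pr => e e0; set M := n v + e.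
have M0 : 0 < M by rewrite ltr_wpDl ?unm_ge0.
have pM : upos (M%:C%:A - u).
 rewrite -(subrK v (M%:C%:A)) -addrA; apply: uposD => //.
 by apply: upos_bound; rewrite // ?ltW // /M ltrDl.
have := @upos_le1 ((M^-1)%:C *: u).
rewrite unm_real ?invr_ge0 ?(ltW M0) // ler_pdivrMl // mulr1; apply.
 by apply: uposZ; rewrite // invr_ge0 ltW.
have -> : 1 - (M^-1)%:C *: u = (M^-1)%:C *: (M%:C%:A - u).
 by rewrite scalerBr scalerA -rmorphM mulVf ?gt_eqF // scale1r.
by apply: uposZ; rewrite // invr_ge0 ltW.
Qed.

Lemma sq_sum_eq0 x y : st x = x -> st y = y -> x * x + y * y = 0 -> x = 0 /\ y = 0.
Proof.
move=> sx sy e.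
have z : x * x = 0.
 apply: upos_anti; first exact: upos_self_sq.
 by rewrite (_ : - (x * x) = y * y); [exact: upos_self_sq|apply/eqP; rewrite eq_sym -addr_eq0 addrC e].
have H w : st w = w -> w * w = 0 -> w = 0.
 move=> sw ww; apply: unm_eq0; apply/eqP.
 by rewrite -(sqrf_eq0 (n w)) -unm_sq // ww unm0.
by split; apply: H => //; move: e; rewrite z add0r.
Qed.

(* [d* d + d d* = 2 (x^2 + y^2)] for [d = x + i y] *)
Lemma mul_star_sum d : exists x y, [/\ st x = x, st y = y,
 st d * d + d * st d = 2 *: (x * x + y * y) & d = x + 'i%C *: y].
Proof.
have ii := ii_N1 R.
have ci := conj_i R.
have c2 := conj_half R.
pose x : U := (2^-1 : C) *: (d + st d); pose y : U := (- 'i%C : C) *: ((2^-1 : C) *: (d - st d)).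
have sx : st x = x by rewrite ustZ ustD ustK addrC c2.
have sy : st y = y.
 rewrite /y !ustZ ustB ustK c2 -opprB !scalerN -scaleNr.
 by rewrite conj_Ni.
have dE : d = x + 'i%C *: y.
 rewrite /x /y scalerA mulrN ii opprK scale1r -scalerDr addrACA subrr addr0.
 by rewrite halfZ_dbl.
clearbody x y; exists x, y; split=> //.
have sd : st d = x - 'i%C *: y by rewrite {1}dE ustD ustZ sx sy [conjc _]ci scaleNr.
rewrite sd dE; set z := 'i%C *: y.
have zz : z * z = - (y * y) by rewrite -scalerAl -scalerAr scalerA ii scaleN1r.
have e1 : (x - z) * (x + z) = (x * x - z * z) + (x * z - z * x).
 by rewrite mulrBl !mulrDr opprD (addrC (- (z * x))) addrACA.
have e2 : (x + z) * (x - z) = (x * x - z * z) - (x * z - z * x).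
 by rewrite mulrDl !mulrBr opprB (addrC (z * x) (- (z * z))) addrACA (addrC (- (x * z))).
by rewrite e1 e2 addrACA subrr addr0 zz opprK scaler_nat mulr2n.
Qed.

(** Let a be a square root of [- (st d * d)] and d' = d a. Then [st d' * d'] and [d' * st d'] are
    minus the squares of a^2 and of [d * st d], so their sum is negative; by [mul_star_sum] it is
    also positive. Hence it vanishes, and with it d', then the square of [d * st d], then [d]. No
    comparison of the spectra of the two products is needed. *)
Lemma upos_star_self (d : U) : upos (- (st d * d)) -> d = 0.
Proof.
move=> pd; have [a [sa aa _ ac]] := upos_sqrt pd.
have pb : upos (d * st d).
 have [x [y [sx sy e _]]] := mul_star_sum d.
 have -> : d * st d = 2 *: (x * x + y * y) + - (st d * d).
  by rewrite -e addrAC subrr add0r.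
 rewrite two_real.
 by apply: uposD => //; apply: uposZ => //; apply: uposD; exact: upos_self_sq.
pose d' := d * a.
have sd' : st d' = a * st d by rewrite ustM sa.
have e1 : d' * st d' = - ((d * st d) * (d * st d)).
 by rewrite sd' /d' -!mulrA (mulrA a) aa mulNr mulrN !mulrA.
have e2 : st d' * d' = - ((a * a) * (a * a)).
 rewrite sd' /d' -!mulrA (mulrA (st d)) -[st d * d]opprK -aa mulNr mulrN.
 by rewrite !mulrA.
have z : st d' * d' + d' * st d' = 0.
 apply: upos_anti.
  have [x [y [sx sy -> _]]] := mul_star_sum d'.
  rewrite two_real.
  by apply: uposZ => //; apply: uposD; exact: upos_self_sq.
 rewrite e1 e2 opprD !opprK; apply: uposD; apply: upos_self_sq.
  by rewrite ustM sa.
 by rewrite ustM ustK.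
have d'0 : d' = 0.
 have [x [y [sx sy e ->]]] := mul_star_sum d'.
 move: e; rewrite z => /esym/eqP; rewrite scaler_eq0 pnatr_eq0 /= => /eqP.
 by case/(sq_sum_eq0 sx sy) => -> ->; rewrite scaler0 addr0.
have b0 : (d * st d) * (d * st d) = 0 by apply/eqP; rewrite -oppr_eq0 -e1 d'0 mul0r.
have b1 : d * st d = 0.
 have sb : st (d * st d) = d * st d by rewrite ustM ustK.
 by have [] := sq_sum_eq0 sb sb _; rewrite ?b0 ?addr0.
have : st d = 0.
 by apply/unm_eq0/eqP; rewrite -(sqrf_eq0 (n _)) -unmC ustK b1 unm0.
by move=> sd0; rewrite -(ustK d) sd0 ust0.
Qed.

(* Kelley and Vaught: with [h = c* c] and [n = |h| - h], the element [d = c n]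
  satisfies [d* d = - |h| n^2 <= 0], hence vanishes, so that [h = |h|]. *)
Lemma upos_star_mul c : upos (st c * c).
Proof.
set h := st c * c.
have sh : st h = h by rewrite ustM ustK.
have [k [sk kk pk kc]] := upos_sqrt (upos_self_sq sh).
have hk : h * k = k * h by apply: kc; rewrite mulrA.
pose m := k - h.
have sm : st m = m by rewrite ustB sk sh.
have hm : h * m = - (k * m) by rewrite !mulrBr opprB hk kk.
have [q [sq qq _ qc]] := upos_sqrt pk.
have qm : m * q = q * m.
 apply: qc; rewrite mulrBl mulrBr; congr (_ - _); exact: hk.
have d0 : c * m = 0.
 apply: upos_star_self; rewrite ustM sm -mulrA (mulrA (st c)) -/h hm mulrN opprK.
 rewrite -qq -mulrA (mulrA m) -qm.
 by apply: upos_self_sq; rewrite ustM sm sq qm.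
have hm0 : h * m = 0 by rewrite /h -mulrA d0 mulr0.
have km0 : k * m = 0 by apply/eqP; rewrite -oppr_eq0 -hm hm0.
have : m * m = 0 by rewrite {1}/m mulrBl hm0 km0 subr0.
move=> mm; have : m = 0.
 by have [] := sq_sum_eq0 sm sm _; rewrite ?mm ?addr0.
by move/subr0_eq => <-.
Qed.

Lemma upos_conj h c : upos h -> upos (st c * h * c).
Proof.
move=> /upos_sqrt[k [sk <- _ _]].
have -> : st c * (k * k) * c = st (k * c) * (k * c) by rewrite ustM sk !mulrA.
exact: upos_star_mul.
Qed.

End PositiveCone.

(** * Unitization of a C*-algebra *)

Section ComplexComplete.
Variable R : realType.

Lemma real_ncomplete : ncomplete (fun x : R => `|x|).
Proof.
move=> u cu; suff /cvg_ex[l /cvgrPdist_lt ul] : cvg (u @ \oo).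
 exists l => e e0; have [N _ uN] := ul _ e0.
 by exists N => i /uN; rewrite distrC.
apply: cauchy_cvg; apply/cauchy_ballP => e /= e0.
have [N uN] := cu _ e0.
exists (u @` [set i | (N <= i)%N], u @` [set i | (N <= i)%N]) => /=.
 by split; exists N => // i /= Ni; exists i.
by move=> [_ _] /= [[i Ni <-] [j Nj <-]] /=; exact: uN.
Qed.

Lemma rn_ReIm (z : R[i]) : rn z <= `|complex.Re z| + `|complex.Im z|.
Proof.
rewrite [z in rn z]complexE (le_trans (rnD _ _)) // rnM rn_i mul1r.
by rewrite !rn_real.
Qed.

Lemma rn_Im (z : R[i]) : `|complex.Im z| <= rn z.
Proof.
have := rn_Re (- 'i%C * z); rewrite rnM rnN rn_i mul1r; congr (`|_| <= _).
by case: z => a b /=; ring.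
Qed.

Lemma complex_ncomplete : ncomplete (@rn R R[i]).
Proof.
move=> u cu.
have cRe : ncauchy (fun x : R => `|x|) (fun i => complex.Re (u i)).
 move=> e /cu[N uN]; exists N => i j Ni Nj; apply: le_lt_trans (uN i j Ni Nj).
 by rewrite -raddfB; exact: rn_Re.
have cIm : ncauchy (fun x : R => `|x|) (fun i => complex.Im (u i)).
 move=> e /cu[N uN]; exists N => i j Ni Nj; apply: le_lt_trans (uN i j Ni Nj).
 by rewrite -raddfB; exact: rn_Im.
have [a ua] := real_ncomplete cRe; have [b ub] := real_ncomplete cIm.
exists (Complex a b) => e e0.
have [N1 h1] := ua _ (halfR_gt0 e0); have [N2 h2] := ub _ (halfR_gt0 e0).
exists (maxn N1 N2) => i; rewrite geq_max => /andP[/h1 l1 /h2 l2].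
apply: le_lt_trans (rn_ReIm _) _.
have -> : complex.Re (u i - Complex a b) = complex.Re (u i) - a by case: (u i).
have -> : complex.Im (u i - Complex a b) = complex.Im (u i) - b by case: (u i).
by lra.
Qed.

End ComplexComplete.

Lemma conj0C (R : realType) : conjc (0 : R[i]) = 0.
Proof. exact: rmorph0. Qed.

Section CstarLemmas.
Variables (R : realType) (B : cstar_algebra R).
Implicit Types a b c : B.

Lemma cmulDl a b c : cmul (a + b) c = cmul a c + cmul b c.
Proof. by have [[h _ _] _] := cstarP B; have := h 1 a b c; rewrite !scale1r. Qed.
Lemma cmul0l c : cmul 0 c = 0.
Proof. by have := cmulDl 0 0 c; rewrite addr0 => /eqP; rewrite -subr_eq subrr eq_sym => /eqP. Qed.
Lemma cmulZl k a c : cmul (k *: a) c = k *: cmul a c.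
Proof. by have [[h _ _] _] := cstarP B; have := h k a 0 c; rewrite cmul0l !addr0. Qed.
Lemma cmulDr a b c : cmul a (b + c) = cmul a b + cmul a c.
Proof. by have [[_ h _] _] := cstarP B; have := h 1 a b c; rewrite !scale1r. Qed.
Lemma cmul0r c : cmul c 0 = 0.
Proof. by have := cmulDr c 0 0; rewrite addr0 => /eqP; rewrite -subr_eq subrr eq_sym => /eqP. Qed.
Lemma cmulZr k a c : cmul a (k *: c) = k *: cmul a c.
Proof. by have [[_ h _] _] := cstarP B; have := h k a c 0; rewrite cmul0r !addr0. Qed.
Lemma cmulA a b c : cmul a (cmul b c) = cmul (cmul a b) c.
Proof. by have [[_ _ h] _] := cstarP B. Qed.
Lemma cmulNl a c : cmul (- a) c = - cmul a c.
Proof. by rewrite -scaleN1r cmulZl scaleN1r. Qed.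
Lemma cmulNr a c : cmul a (- c) = - cmul a c.
Proof. by rewrite -scaleN1r cmulZr scaleN1r. Qed.
Lemma cmulBl a b c : cmul (a - b) c = cmul a c - cmul b c.
Proof. by rewrite cmulDl cmulNl. Qed.
Lemma cmulBr a b c : cmul a (b - c) = cmul a b - cmul a c.
Proof. by rewrite cmulDr cmulNr. Qed.
Lemma cstarM a b : cstar (cmul a b) = cmul (cstar b) (cstar a).
Proof. by have [_ [[_ h _] _]] := cstarP B. Qed.
Lemma cstarK a : cstar (cstar a) = a.
Proof. by have [_ [[_ _ h] _]] := cstarP B. Qed.
Lemma cstarD a b : cstar (a + b) = cstar a + cstar b.
Proof. by have [_ [[h _ _] _]] := cstarP B; have := h 1 a b; rewrite rmorph1 !scale1r. Qed.
Lemma cstar0 : cstar (0 : B) = 0.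
Proof. by have := cstarD 0 0; rewrite addr0 => /eqP; rewrite -subr_eq subrr eq_sym => /eqP. Qed.
Lemma cstarZ k a : cstar (k *: a) = conjc k *: cstar a.
Proof. by have [_ [[h _ _] _]] := cstarP B; have := h k a 0; rewrite cstar0 !addr0. Qed.
Lemma cstarN a : cstar (- a) = - cstar a.
Proof. by rewrite -scaleN1r cstarZ rmorphN rmorph1 scaleN1r. Qed.
Lemma cstarB a b : cstar (a - b) = cstar a - cstar b.
Proof. by rewrite cstarD cstarN. Qed.
Lemma rn_cmul a b : rn (cmul a b) <= rn a * rn b.
Proof.
have [_ [_ [h _]]] := cstarP B; have := h a b.
by rewrite -!rnE -rmorphM lecR.
Qed.
Lemma rn_cstar_mul a : rn (cmul (cstar a) a) = rn a ^+ 2.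
Proof.
have [_ [_ [_ h]]] := cstarP B; have := h a.
by rewrite -!rnE -rmorphXn => /complexI.
Qed.
Lemma rn_cstar a : rn (cstar a) = rn a.
Proof.
suff H b : rn b <= rn (cstar b) by apply/le_anti; rewrite H -{2}(cstarK a) H.
have := rn_cmul (cstar b) b; rewrite rn_cstar_mul expr2.
have [->|b0] := eqVneq (rn b) 0; first by rewrite rn_ge0.
by rewrite ler_pM2r // lt_neqAle eq_sym b0 rn_ge0.
Qed.

Definition unitz : Type := (R[i] * calg B)%type.
HB.instance Definition _ := GRing.Lmodule.copy unitz (R[i]^o * calg B)%type.

Definition umul (x y : unitz) : unitz :=
 (x.1 * y.1, x.1 *: y.2 + y.1 *: x.2 + cmul x.2 y.2).

Let umulA : associative umul.
Proof.
move=> [k a] [l b] [m c]; rewrite /umul /=; congr pair; first by rewrite mulrA.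
rewrite !scalerDr !cmulDl !cmulDr !cmulZl !cmulZr !scalerA cmulA.
rewrite (mulrC m k) (mulrC m l) -!addrA; do 2 congr (_ + _).
rewrite addrCA; congr (_ + _); rewrite [RHS]addrCA; congr (_ + _); exact: addrCA.
Qed.
Let umul1 : left_id ((1, 0) : unitz) umul.
Proof.
by move=> [k a]; rewrite /umul /= mul1r scale1r scaler0 cmul0l !addr0.
Qed.
Let umulr1 : right_id ((1, 0) : unitz) umul.
Proof.
by move=> [k a]; rewrite /umul /= mulr1 scale1r scaler0 cmul0r add0r addr0.
Qed.
Let umulDl : left_distributive umul +%R.
Proof.
move=> [k a] [l b] [m c]; rewrite /umul /=; congr pair; first exact: mulrDl.
transitivity ((k *: c + m *: a + cmul a c) + (l *: c + m *: b + cmul b c)) => //.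
rewrite scalerDl scalerDr cmulDl; move: (k *: c) (l *: c) (m *: a) (m *: b) (cmul a c) (cmul b c) => p q r s t u.
by rewrite (addrACA p q) [LHS]addrACA.
Qed.
Let umulDr : right_distributive umul +%R.
Proof.
move=> [k a] [l b] [m c]; rewrite /umul /=; congr pair; first exact: mulrDr.
transitivity ((k *: b + l *: a + cmul a b) + (k *: c + m *: a + cmul a c)) => //.
rewrite scalerDl scalerDr cmulDr; move: (k *: b) (k *: c) (l *: a) (m *: a) (cmul a b) (cmul a c) => p q r s t u.
by rewrite (addrACA p q) [LHS]addrACA.
Qed.
Let uone0 : ((1, 0) : unitz) != 0.
Proof. by apply/eqP => -[] /eqP; rewrite oner_eq0. Qed.

HB.instance Definition _ := GRing.Zmodule_isNzRing.Build unitz umulA umul1 umulr1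
 umulDl umulDr uone0.

Let uscaleAl (k : R[i]) (x y : unitz) : k *: (x * y) = k *: x * y.
Proof.
case: x => l a; case: y => m b.
change ((k * (l * m), k *: (l *: b + m *: a + cmul a b)) =
 ((k * l) * m, (k * l) *: b + m *: (k *: a) + cmul (k *: a) b) :> unitz).
rewrite mulrA; congr pair.
by rewrite !scalerDr !scalerA cmulZl (mulrC k m).
Qed.
HB.instance Definition _ := GRing.Lmodule_isLalgebra.Build _ unitz uscaleAl.
Let uscaleAr (k : R[i]) (x y : unitz) : k *: (x * y) = x * (k *: y).
Proof.
case: x => l a; case: y => m b.
change ((k * (l * m), k *: (l *: b + m *: a + cmul a b)) =
 (l * (k * m), l *: (k *: b) + (k * m) *: a + cmul a (k *: b)) :> unitz).
rewrite mulrCA; congr pair.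
by rewrite !scalerDr !scalerA cmulZr (mulrC k l).
Qed.
HB.instance Definition _ := GRing.Lalgebra_isAlgebra.Build _ unitz uscaleAr.

Definition uact (x : unitz) (c : B) : B := x.1 *: c + cmul x.2 c.
Definition uop (x : unitz) : R := sup [set rn (uact x c) | c in [set c : B | rn c <= 1]].
(** The operator norm on [B] alone degenerates when [B] has a unit, since it kills the difference of
    the two units. The maximum with the modulus of the scalar part, which is the norm of the
    quotient by [B], repairs this and keeps the C*-identity. *)
Definition unorm (x : unitz) : R := Num.max (rn x.1) (uop x).
Definition ustar (x : unitz) : unitz := (conjc x.1, cstar x.2).
Definition uinj (b : B) : unitz := (0, b).

Lemma uactM (x y : unitz) c : uact (x * y) c = uact x (uact y c).
Proof.
case: x => l a; case: y => m b; rewrite /uact /=.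
rewrite scalerDr cmulDr cmulZr !cmulDl !cmulZl scalerA cmulA -!addrA.
by congr (_ + _); rewrite addrCA.
Qed.

Let uact_bnd x c : rn (uact x c) <= (rn x.1 + rn x.2) * rn c.
Proof.
by rewrite (le_trans (rnD _ _)) // mulrDl lerD // ?rn_cmul // rnZ.
Qed.

Let uop_has x : has_sup [set rn (uact x c) | c in [set c : B | rn c <= 1]].
Proof.
split; first by exists (rn (uact x 0)), 0; rewrite //= rn0.
exists (rn x.1 + rn x.2) => _ [c /= c1 <-]; rewrite (le_trans (uact_bnd x c)) //.
by rewrite ler_piMr // addr_ge0 // rn_ge0.
Qed.

Lemma uop_ge0 x : 0 <= uop x.
Proof.
apply: le_trans (_ : rn (uact x 0) <= _); first exact: rn_ge0.
by apply: ub_le_sup; [case: (uop_has x)|exists 0; rewrite //= rn0].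
Qed.

Lemma uactZ x k c : uact x (k *: c) = k *: uact x c.
Proof. by rewrite /uact cmulZr scalerDr !scalerA mulrC. Qed.
Lemma uopP x c : rn (uact x c) <= uop x * rn c.
Proof.
have [c0|c0] := eqVneq (rn c) 0.
 by have := uact_bnd x c; rewrite c0 !mulr0.
have cp : 0 < rn c by rewrite lt_neqAle eq_sym c0 rn_ge0.
rewrite mulrC -ler_pdivrMl //.
have e : rn ((rn c)^-1%:C *: c) = 1.
 by rewrite rnZ rn_pos ?invr_ge0 ?(ltW cp) // mulVf.
have -> : (rn c)^-1 * rn (uact x c) = rn (uact x ((rn c)^-1%:C *: c)).
 by rewrite uactZ rnZ rn_pos ?invr_ge0 ?(ltW cp).
by apply: ub_le_sup; [case: (uop_has x)|exists ((rn c)^-1%:C *: c); rewrite //= e].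
Qed.

Lemma uop_le x (M : R) : 0 <= M -> (forall c, rn (uact x c) <= M * rn c) -> uop x <= M.
Proof.
move=> M0 h; apply: ge_sup; first by case: (uop_has x).
by move=> _ [c /= c1 <-]; rewrite (le_trans (h c)) // ler_piMr.
Qed.

Lemma uop_inj b : uop (uinj b) = rn b.
Proof.
apply/le_anti/andP; split.
 by apply: uop_le (rn_ge0 _) _ => c; rewrite /uact /= scale0r add0r rn_cmul.
have := uopP (uinj b) (cstar b); rewrite /uact /= scale0r add0r -{1}(cstarK b).
rewrite rn_cstar_mul !rn_cstar expr2.
have [->|b0] := eqVneq (rn b) 0; first by rewrite uop_ge0.
by rewrite ler_pM2r // lt_neqAle eq_sym b0 rn_ge0.
Qed.

Lemma unorm_inj b : unorm (uinj b) = rn b.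
Proof. by rewrite /unorm uop_inj /= rn0; apply/max_idPr; exact: rn_ge0. Qed.
Let ustarD x y : ustar (x + y) = ustar x + ustar y.
Proof. by case: x => l a; case: y => m b; rewrite /ustar /= rmorphD cstarD. Qed.
Let ustarZ k x : ustar (k *: x) = conjc k *: ustar x.
Proof. by case: x => l a; rewrite /ustar /= rmorphM cstarZ. Qed.
Let ustarM x y : ustar (x * y) = ustar y * ustar x.
Proof.
case: x => l a; case: y => m b; congr pair; first by rewrite /= rmorphM mulrC.
by rewrite /= !cstarD !cstarZ cstarM (addrC (_ *: cstar b)).
Qed.
Let ustarK x : ustar (ustar x) = x.
Proof. by case: x => l a; rewrite /ustar /= conjcK cstarK. Qed.
Let uopD x y : uop (x + y) <= uop x + uop y.
Proof.
apply: uop_le; first by rewrite addr_ge0 ?uop_ge0.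
move=> c; have -> : uact (x + y) c = uact x c + uact y c.
 by rewrite /uact /= scalerDl cmulDl addrACA.
by rewrite (le_trans (rnD _ _)) // mulrDl lerD // uopP.
Qed.
Let uopM x y : uop (x * y) <= uop x * uop y.
Proof.
apply: uop_le; first by rewrite mulr_ge0 ?uop_ge0.
move=> c; rewrite uactM (le_trans (uopP _ _)) // -mulrA ler_wpM2l ?uop_ge0 //.
exact: uopP.
Qed.
Let uopZ_le k x : uop (k *: x) <= rn k * uop x.
Proof.
apply: uop_le; first by rewrite mulr_ge0 ?uop_ge0 ?rn_ge0.
move=> c; have -> : uact (k *: x) c = k *: uact x c.
 by rewrite /uact /= cmulZl scalerDr scalerA.
by rewrite rnZ -mulrA ler_wpM2l ?rn_ge0 // uopP.
Qed.
Let uopZ k x : uop (k *: x) = rn k * uop x.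
Proof.
apply/le_anti; rewrite uopZ_le /=.
have [->|k0] := eqVneq k 0; first by rewrite rn0 mul0r uop_ge0.
have kp : 0 < rn k.
 by rewrite lt_neqAle rn_ge0 andbT eq_sym; apply/eqP => /rn_eq0/eqP; rewrite (negPf k0).
rewrite mulrC -ler_pdivlMr //.
have -> : uop (k *: x) / rn k = rn k^-1 * uop (k *: x).
 rewrite mulrC; congr (_ * _); apply: (mulfI (lt0r_neq0 kp)).
 rewrite divff ?gt_eqF // -rnM divff //.
 by rewrite -(rmorph1 (real_complex R)) rn_pos.
by rewrite -{1}(scale1r x) -(mulVf k0) -scalerA uopZ_le.
Qed.
(** The C*-identity of [B], applied to [uact x c], brings in the operator [ustar x * x] between
    [cstar c] and [c]. *)
Let uop_sq_le x : uop x ^+ 2 <= uop (ustar x * x).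
Proof.
have s0 := uop_ge0 (ustar x * x).
rewrite -(sqr_sqrtr s0) ler_pXn2r ?nnegrE ?sqrtr_ge0 ?uop_ge0 //.
apply: uop_le (sqrtr_ge0 _) _ => c.
rewrite -(@ler_pXn2r _ 2) ?nnegrE ?rn_ge0 ?mulr_ge0 ?sqrtr_ge0 ?rn_ge0 //.
rewrite exprMn sqr_sqrtr // -rn_cstar_mul.
have -> : cmul (cstar (uact x c)) (uact x c) = cmul (cstar c) (uact (ustar x * x) c).
 rewrite uactM /uact cstarD cstarZ cstarM /= cmulDl cmulZl [in RHS]cmulDr cmulZr.
 by rewrite -cmulA.
rewrite (le_trans (rn_cmul _ _)) // rn_cstar expr2 mulrCA ler_wpM2l ?rn_ge0 //.
exact: uopP.
Qed.
Let uop_star x : uop (ustar x) = uop x.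
Proof.
suff H y : uop y <= uop (ustar y) by apply/le_anti; rewrite H -{2}(ustarK x) H.
have := le_trans (uop_sq_le y) (uopM _ _); rewrite expr2.
have [->|b0] := eqVneq (uop y) 0; first by rewrite uop_ge0.
by rewrite ler_pM2r // lt_neqAle eq_sym b0 uop_ge0.
Qed.

Let unormD x y : unorm (x + y) <= unorm x + unorm y.
Proof.
rewrite /unorm ge_max; apply/andP; split.
 by rewrite (le_trans (rnD _ _)) // lerD // le_max lexx.
by rewrite (le_trans (uopD _ _)) // lerD // le_max lexx orbT.
Qed.
Let unormZ k x : unorm (k *: x) = rn k * unorm x.
Proof. by rewrite /unorm uopZ maxr_pMr ?rn_ge0 // rnM. Qed.
Let unormM x y : unorm (x * y) <= unorm x * unorm y.
Proof.
rewrite /unorm ge_max; apply/andP; split.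
 by rewrite rnM ler_pM ?rn_ge0 // le_max lexx.
by rewrite (le_trans (uopM _ _)) // ler_pM ?uop_ge0 // le_max lexx orbT.
Qed.
Let unormC x : unorm (ustar x * x) = unorm x ^+ 2.
Proof.
have e : uop (ustar x * x) = uop x ^+ 2.
 apply/le_anti; rewrite uop_sq_le andbT (le_trans (uopM _ _)) //.
 by rewrite uop_star expr2.
rewrite /unorm e rnM rn_conj -expr2.
have p0 := rn_ge0 x.1; have q0 := uop_ge0 x.
have [h|/ltW h] := leP (rn x.1) (uop x); [apply/max_idPr|apply/max_idPl];
 by rewrite ler_pXn2r.
Qed.
Let unorm_eq0 x : unorm x = 0 -> x = 0.
Proof.
case: x => l a h.
have l0 : l = 0.
 by apply: rn_eq0; apply/le_anti; rewrite rn_ge0 andbT -h le_max lexx.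
have : rn a = 0.
 rewrite -unorm_inj; move: h; rewrite l0; apply.
by move/rn_eq0 => ->; rewrite l0.
Qed.
Let unorm_complete : ncomplete unorm.
Proof.
move=> u cu.
(* [n1], [n2] and [n3] compare [unorm] with the sum of the norms of the two components, which
   reduces completeness to that of the scalars and of [B]. *)
have n1 (x : unitz) : rn x.1 <= unorm x by rewrite le_max lexx.
have n2 (x : unitz) : rn x.2 <= unorm x + unorm x.
 rewrite -(uop_inj x.2) (_ : uinj x.2 = x + - x.1 *: 1); last first.
  by case: x => l a; rewrite /uinj; congr pair; rewrite /= ?scaler0 ?addr0 //
   /GRing.scale /= mulr1 subrr.
 rewrite (le_trans (uopD _ _)) // lerD //; first by rewrite le_max lexx orbT.
 rewrite (le_trans (uopZ_le _ _)) // rnN (le_trans _ (n1 x)) // ler_piMr ?rn_ge0 //.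
 by apply: uop_le => // c; rewrite /uact /= scale1r cmul0l addr0 mul1r.
have n3 (x : unitz) : unorm x <= rn x.1 + rn x.2.
 rewrite ge_max lerDl rn_ge0 /=; apply: uop_le; first by rewrite addr_ge0 ?rn_ge0.
 by move=> c; exact: uact_bnd.
have [|l ul] := @complex_ncomplete R (fun i => (u i).1).
 move=> e /cu[N uN]; exists N => i j Ni Nj; apply: le_lt_trans (uN i j Ni Nj).
 exact: (n1 (u i - u j)).
have [|a ua] := @rn_complete R B (fun i => (u i).2).
 move=> e e0; have [N uN] := cu _ (halfR_gt0 e0); exists N => i j Ni Nj.
 apply: le_lt_trans (n2 (u i - u j)) _.
 by rewrite [X in _ < X](splitr e) ltrD // uN.
exists (l, a) => e e0.
have [N1 h1] := ul _ (halfR_gt0 e0); have [N2 h2] := ua _ (halfR_gt0 e0).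
exists (maxn N1 N2) => i; rewrite geq_max => /andP[/h1 l1 /h2 l2].
by apply: le_lt_trans (n3 _) _; rewrite [X in _ < X](splitr e) ltrD.
Qed.

Definition unitization : ucstar R :=
 UCstar ustarD ustarZ ustarM ustarK unormD unormZ unormM unormC unorm_eq0 unorm_complete.

Local Notation bpos b := (upos (U := unitization) (uinj b)).
Local Notation cp := (cpos (@cmul R B) (@cstar R B)).

Lemma uinjM a b : (uinj (cmul a b) : unitization) = (uinj a : unitz) * uinj b.
Proof. by congr pair; rewrite /= ?mul0r // !scale0r !add0r. Qed.
Lemma ust_inj b : ust (u := unitization) (uinj b) = uinj (cstar b).
Proof. by change ((conjc 0, cstar b) = (0, cstar b) :> unitz); rewrite conj0C. Qed.
Lemma uinjB a b : (uinj a : unitization) - uinj b = uinj (a - b).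
Proof. by change ((0 - 0, a - b) = (0, a - b) :> unitz); rewrite subrr. Qed.
(** A square root, taken in the unitization, of an element of [B] has a scalar part with square 0
    and so lies in [B]. Facts about positive elements can thus be imported from the unital case. *)
Lemma cpos_upos b : cp b <-> bpos b.
Proof.
split=> [[c ->]|ub].
 rewrite uinjM; rewrite -ust_inj; exact: upos_star_mul.
have [k [sk kk _ _]] := @upos_sqrt R unitization _ ub.
case: k sk kk => l c [/= _ sc] [].
move=> /eqP; rewrite mulf_eq0 orbb => /eqP -> {l}; rewrite !scale0r !add0r => e.
by exists c; rewrite sc e.
Qed.

Lemma cpos_star b : cp b -> cstar b = b.
Proof. by move=> [c ->]; rewrite cstarM cstarK. Qed.
Lemma cpos_mul c : cp (cmul (cstar c) c).
Proof. by exists c. Qed.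
Lemma cposD a b : cp a -> cp b -> cp (a + b).
Proof.
move=> /cpos_upos pa /cpos_upos pb; apply/cpos_upos.
have -> : uinj (a + b) = (uinj a : unitz) + uinj b by congr pair; rewrite /= addr0.
exact: (uposD (U := unitization)).
Qed.

Lemma cpos0 : cp 0.
Proof. by exists 0; rewrite cmul0r. Qed.
Lemma cpos_sum (I : Type) (s : seq I) (f : I -> B) :
 (forall i, cp (f i)) -> cp (\sum_(i <- s) f i).
Proof.
by move=> pf; elim/big_ind : _ => //; [exact: cpos0|move=> x y; exact: cposD].
Qed.

Lemma cposZ (r : R) a : 0 <= r -> cp a -> cp (r%:C *: a).
Proof.
move=> r0 /cpos_upos pa; apply/cpos_upos.
have -> : uinj (r%:C *: a) = r%:C *: (uinj a : unitz).
 by congr pair; rewrite /GRing.scale /= mulr0.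
exact: (uposZ (U := unitization)).
Qed.

Lemma cpos_closed (w : nat -> B) l :
 (forall i, cp (w i)) -> nconv (@rn R B) w l -> cp l.
Proof.
move=> pw wl; apply/cpos_upos; apply: (@upos_closed R unitization (fun i => uinj (w i))).
 by move=> i; apply/cpos_upos.
move=> e /wl[N wN]; exists N => i /wN.
have -> : (uinj (w i) : unitization) - uinj l = uinj (w i - l).
 by congr pair; rewrite /= subrr.
by rewrite [unm _]unorm_inj.
Qed.

Lemma cpos_mono a b : cp a -> cp (b - a) -> rn a <= rn b.
Proof.
move=> /cpos_upos pa /cpos_upos pb.
rewrite -(unorm_inj a) -(unorm_inj b); apply: (@upos_mono R unitization _ _ pa).
by rewrite uinjB.
Qed.

(* [|a| - a >= 0] in the unitization, conjugated back into the algebra *)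
Lemma cpos_conj_bound a c (M : R) : cstar a = a -> rn a <= M ->
 cp (M%:C *: cmul (cstar c) c - cmul (cstar c) (cmul a c)).
Proof.
move=> sa aM; have M0 := le_trans (rn_ge0 _) aM; apply/cpos_upos.
have : upos (U := unitization) (M%:C%:A - uinj a).
 apply: (upos_bound (U := unitization)) => //.
  by rewrite ust_inj sa.
 by rewrite [unm _]unorm_inj.
move=> /(upos_conj (U := unitization) (uinj c)).
rewrite ust_inj mulrBr mulrBl -!uinjM -cmulA.
have -> : (uinj (cstar c) : unitization) * (M%:C%:A) * uinj c = uinj (M%:C *: cmul (cstar c) c).
 rewrite -scalerAr mulr1 -scalerAl -uinjM.
 by change ((M%:C * 0, M%:C *: cmul (cstar c) c) = (0, M%:C *: cmul (cstar c) c) :> unitz);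
  rewrite mulr0.
by rewrite uinjB.
Qed.

(** The norm of M - b in the unitization is the maximum of M and of an operator norm on [B], so
    positivity can be tested by multiplication on [B] alone. For the universal completion this is an
    estimate between universal norms. *)
Lemma cpos_unit_bound b (M : R) : 0 < M -> cstar b = b -> rn b <= M ->
 (forall c, rn (M%:C *: c - cmul b c) <= M * rn c) -> cp b.
Proof.
move=> M0 sb bM h; apply/cpos_upos; split.
 by rewrite ust_inj sb.
exists M => //; rewrite /= /unorm ge_max; apply/andP; split.
 by rewrite /= subr0 /GRing.scale /= mulr1 rn_pos // ltW.
have -> : (M%:C%:A : unitz) - uinj b = (M%:C, - b).
 change ((M%:C * 1 - 0, M%:C *: 0 - b) = (M%:C, - b) :> unitz).
 by rewrite mulr1 subr0 scaler0 sub0r.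
by apply: uop_le (ltW M0) _ => c; rewrite /uact cmulNl h.
Qed.

End CstarLemmas.

(** * Vector-valued integrals *)

Section HahnBanach.
Variables (R : realType) (V : normedModType R[i]) (v : V).
Local Notation C := R[i].

(** A partial functional is kept as a subset of [V * R]. Single-valuedness is not imposed, as it
    follows from linearity and domination: (0, r - s) in the graph forces r <= s. The line [G0] is
    adjoined throughout, so that the empty chain is no exception in Zorn's lemma. *)
Let lin_graph (G : set (V * R)) :=
 (forall (t : R) a b, G a -> G b -> G (a.1 + t%:C *: b.1, a.2 + t * b.2)) /\
 (forall a, G a -> a.2 <= rn a.1).

Let G0 : set (V * R) := [set a | exists t : R, a = (t%:C *: v, t * rn v)].

Let lin_graph_chain (F : set (set (V * R))) :
 F `<=` [set G | lin_graph (G0 `|` G)] -> total_on F subset ->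
 lin_graph (G0 `|` \bigcup_(X in F) X).
Proof.
move=> FP tF.
have lG0 : lin_graph G0.
 split=> [t _ _ [r ->] [s ->]|_ [t ->]] /=.
  by exists (r + t * s); rewrite rmorphD rmorphM scalerDl scalerA mulrDl mulrA.
 by rewrite rnZ rn_real ler_wpM2r ?rn_ge0 // ler_norm.
have H a b : (G0 `|` \bigcup_(X in F) X) a -> (G0 `|` \bigcup_(X in F) X) b ->
  exists X, [/\ X `<=` G0 `|` \bigcup_(X in F) X, lin_graph X, X a & X b].
 have big X : F X -> G0 `|` X `<=` G0 `|` \bigcup_(X in F) X.
  by move=> FX c [|Xc]; [left|right; exists X].
 move=> [a0|[X FX Xa]] [b0|[Y FY Yb]].
 - by exists G0; split=> // c; left.
 - by exists (G0 `|` Y); split; [exact: big|exact: FP|left|right].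
 - by exists (G0 `|` X); split; [exact: big|exact: FP|right|left].
 - have [XY|YX] := tF _ _ FX FY.
   by exists (G0 `|` Y); split; [exact: big|exact: FP|right; exact: XY|right].
  by exists (G0 `|` X); split; [exact: big|exact: FP|right|right; exact: YX].
split=> [t a b Ga Gb|a Ga].
 by have [X [sX [lX _] Xa Xb]] := H _ _ Ga Gb; apply: sX; exact: lX.
by have [X [_ [_ lX] Xa _]] := H _ _ Ga Ga; exact: lX.
Qed.

Let real_functional : exists f : V -> R,
 [/\ forall (t : R) a b, f (a + t%:C *: b) = f a + t * f b,
   forall a, f a <= rn a & f v = rn v].
Proof.
have [A [lA maxA]] := Zorn_bigcup lin_graph_chain.
set G := G0 `|` A in lA *; have [l1 l2] := lA.
have G0v (t : R) : G (t%:C *: v, t * rn v) by left; exists t.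
have G00 : G (0, 0) by have := G0v 0; rewrite scale0r mul0r.
have Gs (t : R) a : G a -> G (t%:C *: a.1, t * a.2).
 by move=> Ga; have := l1 t _ _ G00 Ga; rewrite /= !add0r.
have tot x : exists r, G (x, r).
 apply: contrapT => nx.
 (* Domination on the extension demands that the value at [x] lie above every element of [S] and
    below every [rn (b.1 + x) - b.2]; the supremum of [S] qualifies. *)
 pose S := [set a.2 - rn (a.1 - x) | a in G].
 have ub b : G b -> ubound S (rn (b.1 + x) - b.2).
  move=> Gb _ [a Ga <-].
  have := l2 _ (l1 1 _ _ Ga Gb); rewrite /= scale1r mul1r.
  have := rnD (a.1 - x) (b.1 + x); rewrite addrACA (addrC (- x)) subrr addr0.
  by lra.
 have hS : has_sup S.
  by split; [exists (0 - rn (0 - x)), (0, 0)|exists (rn (0 + x) - 0); exact: (ub (0, 0))].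
 pose c := sup S.
 have c1 a : G a -> a.2 - rn (a.1 - x) <= c.
  by move=> Ga; apply: ub_le_sup; [case: hS|exists a].
 have c2 a : G a -> c <= rn (a.1 + x) - a.2.
  by move=> Ga; apply: ge_sup; [case: hS|exact: ub].
 pose E := [set p : V * R | exists a (t : R), G a /\ p = (a.1 + t%:C *: x, a.2 + t * c)].
 have GE : G `<=` E by move=> [a r] Ga; exists (a, r), 0; rewrite scale0r mul0r !addr0.
 have Ex : E (x, c).
  by exists (0, 0), 1; split=> //=; rewrite scale1r mul1r !add0r.
 apply: (maxA E).
  split=> [a Aa|EA]; first by apply: GE; right.
  by apply: nx; exists c; right; exact: EA.
 have -> : [set G | lin_graph (G0 `|` G)] E = lin_graph E.
  by rewrite /=; congr lin_graph; apply/setUidPr => a a0; apply: GE; left.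
 split=> [s _ _ [a [t [Ga ->]]] [b [u [Gb ->]]]|_ [a [t [Ga ->]]]] /=.
  exists (a.1 + s%:C *: b.1, a.2 + s * b.2), (t + s * u); split; first exact: l1.
  by congr pair => /=; rewrite ?rmorphD ?rmorphM ?scalerDl ?scalerDr -?scalerA; 
   [rewrite addrACA|ring].
 have [t0|t0|->] := ltgtP t 0; last by rewrite scale0r mul0r !addr0; exact: l2.
  have := c1 _ (Gs (- t^-1) _ Ga) => /=.
  have -> : (- t^-1)%:C *: a.1 - x = (- t^-1)%:C *: (a.1 + t%:C *: x).
   rewrite scalerDr scalerA -rmorphM mulNr mulVf ?lt_eqF //.
   by congr (_ + _); rewrite -scaleN1r; congr (_ *: _); rewrite rmorphN rmorph1.
  rewrite rnZ rn_pos; last by rewrite oppr_ge0 invr_le0 ltW.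
  move=> h; have t1 : 0 < - t by rewrite oppr_gt0.
  have := ler_wpM2l (ltW t1) h.
  have -> : - t * (- t^-1 * a.2 - - t^-1 * rn (a.1 + t%:C *: x)) =
   a.2 - rn (a.1 + t%:C *: x) by field; rewrite lt_eqF.
  by lra.
 have := c2 _ (Gs (t^-1) _ Ga) => /=.
 have -> : (t^-1)%:C *: a.1 + x = (t^-1)%:C *: (a.1 + t%:C *: x).
  by rewrite scalerDr scalerA -rmorphM mulVf ?gt_eqF // rmorph1 scale1r.
 rewrite rnZ rn_pos; last by rewrite invr_ge0 ltW.
 move=> h; have := ler_wpM2l (ltW t0) h.
 have -> : t * (t^-1 * rn (a.1 + t%:C *: x) - t^-1 * a.2) =
  rn (a.1 + t%:C *: x) - a.2 by field; rewrite gt_eqF.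
 by lra.
have uniq x r s : G (x, r) -> G (x, s) -> r = s.
 move=> Gr Gs'; have := l2 _ (l1 (-1) _ _ Gr Gs'); have := l2 _ (l1 (-1) _ _ Gs' Gr).
 by rewrite /= rmorphN rmorph1 scaleN1r subrr rn0; lra.
have [f fP] := choice tot; exists f; split.
- move=> t a b; apply: uniq (fP _) _.
 by apply: (l1 t (a, f a) (b, f b)); exact: fP.
- by move=> a; exact: (l2 (a, f a) (fP a)).
- by apply: uniq (fP _) _; have := G0v 1; rewrite scale1r mul1r.
Qed.

Lemma hahn_banach : exists phi : {linear V -> C^o},
 [/\ continuous phi, forall w, rn (phi w : C) <= rn w & phi v = (rn v)%:C].
Proof.
have [f [fl fn fv]] := real_functional.
have fD a b : f (a + b) = f a + f b by have := fl 1 a b; rewrite scale1r mul1r.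
have f0 : f 0 = 0 by have := fD 0 0; rewrite addr0; lra.
have fZ (t : R) a : f (t%:C *: a) = t * f a by have := fl t 0 a; rewrite !add0r f0 add0r.
have fN a : f (- a) = - f a.
 by have := fZ (-1) a; rewrite rmorphN rmorph1 scaleN1r mulN1r.
(* The complex-linear functional with real part [f]. *)
pose g (w : V) : C^o := f w +i* - f ('i%C *: w).
have gi (k : C) a : g (k *: a) = k * g a.
 case: k => x y; have xy : x +i* y = x%:C + 'i%C * y%:C :> C by rewrite [LHS]complexE.
 have e1 : (x +i* y) *: a = x%:C *: a + y%:C *: ('i%C *: a).
  by rewrite xy scalerDl scalerA mulrC.
 have e2 : 'i%C *: ((x +i* y) *: a) = x%:C *: ('i%C *: a) + (- y)%:C *: a.
  have e3 : 'i%C * y%:C * 'i%C = (- y)%:C :> C by rewrite mulrAC ii_N1 mulN1r rmorphN.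
  by rewrite e1 scalerDr !scalerA e3 (mulrC 'i%C).
 rewrite /g e2 e1 !fD !fZ.
 by apply/eqP; rewrite eq_complex /=; apply/andP; split; apply/eqP; ring.
have gl : linear g.
 move=> k a b; have gD u w : g (u + w) = g u + g w.
  by rewrite /g scalerDr !fD opprD.
 by rewrite gD gi.
pose phi : {linear V -> C^o} := HB.pack g (GRing.isLinear.Build _ _ _ _ _ gl).
have gn w : rn (g w : C) <= rn w.
 have [->|gw] := eqVneq (g w) 0; first by rewrite rn0 rn_ge0.
 (* A phase that turns [g w] into its modulus, where the bound on the real part applies. *)
 pose u : C := (rn (g w : C))%:C / g w.
 have ru : rn u = 1.
  have r0 : rn (g w : C) != 0 by apply/eqP => /rn_eq0/eqP; rewrite (negPf gw).
  apply: (mulIf r0); rewrite -rnM /u divfK // mul1r rn_pos ?rn_ge0 //.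
 have := fn (u *: w); rewrite rnZ ru mul1r; apply: le_trans.
 have : g (u *: w) = (rn (g w : C))%:C by rewrite gi /u divfK.
 by move=> [<- _].
exists phi; split=> //.
 move=> w; apply/rn_cvgP => e e0; apply/nbhs_rnP; exists e => // w' ww.
 by rewrite -linearB; exact: le_lt_trans (gn _) ww.
(* The real part of [g v] is already the norm of [v], which also bounds the modulus, so the
   imaginary part is 0. *)
have : complex.Re (g v) = rn v by [].
have := gn v; change (phi v) with (g v); case: (g v) => a b /= h e.
rewrite e in h *; congr Complex; apply/eqP; rewrite -sqrf_eq0.
have := add_Re2_Im2 (rn v +i* b : C); rewrite -rnE -rmorphXn => /complexI /= h2.
have : rn (rn v +i* b : C) ^+ 2 <= rn v ^+ 2 by rewrite ler_pXn2r ?nnegrE ?rn_ge0.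
rewrite -h2 gerDl => b0; apply/eqP/le_anti; rewrite b0 sqr_ge0 //.
Qed.

End HahnBanach.

(** * Scalar integrals and quadrature rules *)

Section ScalarIntegral.
Variables (R : realType) (T : ptopologicalType).
Hypothesis hT : hausdorff_space T.
Variable mu : borel_measure R T.
Hypothesis muK : finite_on_compacts T mu.

Lemma borel_open (U : set T) : open U -> measurable (U : set (borel T)).
Proof. by move=> oU; apply: sub_sigma_algebra. Qed.
Lemma borel_closed (U : set T) : closed U -> measurable (U : set (borel T)).
Proof.
move=> cU; rewrite -[U]setCK; apply: measurableC; apply: borel_open.
exact: closed_openC.
Qed.

Lemma borel_compact (K : set T) : compact K -> measurable (K : set (borel T)).
Proof. by move=> /(compact_closed hT); exact: borel_closed. Qed.
Lemma cont_meas (f : T -> R) : continuous f -> measurable_fun setT (f : borel T -> R).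
Proof.
move=> /continuousP cf; apply: (measurability _ (measurable_realfun.RGenOpens.measurableE R)).
move=> _ [_ [a [b ->] <-]]; rewrite setTI; apply: borel_open.
exact/cf/interval_open.
Qed.

Lemma Rint_supp (K : set T) (f : T -> R) : (forall t, ~ K t -> f t = 0) ->
 Rintegral mu setT f = Rintegral mu K f.
Proof.
move=> f0; rewrite [RHS]Rintegral_mkcond; congr (Rintegral _ _ _); apply/funext => t.
by rewrite patchE; case: ifPn => // /negP tK; apply: f0 => /mem_set.
Qed.

Lemma cc_integrable (K : set T) (f : T -> R) : compact K -> continuous f ->
 mu.-integrable (K : set (borel T)) (EFin \o f).
Proof.
move=> cK cf; apply: measurable_bounded_integrable; [exact: borel_compact|exact: muK| |].
 exact: measurable_funS (cont_meas cf).
have /compact_bounded[M [_ mrt]] : compact (f @` K).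
 by apply: continuous_compact => //; exact: continuous_subspaceT.
by exists M; split; rewrite ?num_real // => ? ? ? ?; exact: mrt.
Qed.

(** A finite quadrature rule: the weights will be the measures of the pieces of a partition of [K],
    each piece inside some [U s]. One rule serves every function that varies little along [U], in
    particular all compositions of one vector-valued function with functionals of norm at most 1. *)
Definition weights (K : set T) (U : T -> set T) (w : seq (R * T)) :=
 [/\ forall p, p \in w -> 0 <= p.1 /\ K p.2, \sum_(p <- w) p.1 = fine (mu K) &
  forall (f : T -> R) (e : R), continuous f -> (forall t, ~ K t -> f t = 0) ->
  (forall s t, K s -> K t -> U s t -> `|f t - f s| <= e) ->
  `|Rintegral mu setT f - \sum_(p <- w) p.1 * f p.2| <= e * fine (mu K)].

Lemma weights_exist (K : set T) (U : T -> set T) : compact K ->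
 (forall s, K s -> nbhs s (U s)) -> exists w, weights K U w.
Proof.
move=> cK nU; have mK := borel_compact cK.
(* The induction over the centres needs a measurable [D] in place of [K]: each step splits off the
   part of [D] inside one open set, gives its measure to the centre as weight, and leaves the
   remainder to the other centres. *)
suff H (l : seq T) (D : set T) : measurable (D : set (borel T)) -> D `<=` K ->
  (forall s, s \in l -> K s) -> (forall t, D t -> exists2 s, s \in l & (U s)^° t) ->
  exists w : seq (R * T), [/\ forall p, p \in w -> 0 <= p.1 /\ K p.2,
   \sum_(p <- w) p.1 = fine (mu D) &
   forall (f : T -> R) (e : R), continuous f ->
   (forall s t, K s -> K t -> U s t -> `|f t - f s| <= e) ->
   `|Rintegral mu D f - \sum_(p <- w) p.1 * f p.2| <= e * fine (mu D)].
 move: (cK); rewrite compact_cover => cc.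
 have [||l lK Kl] := cc T K (fun s => (U s)^°).
 - by move=> s _; exact: open_interior.
 - by move=> t Kt; exists t => //; exact: nU.
 have [|s sl|t Kt|w [w1 w2 w3]] := H (finmap.enum_fset l) K mK.
 - by [].
 - by have := lK s sl; rewrite inE.
 - by have [s /= sl Us] := Kl t Kt; exists s.
 exists w; split=> // f e cf f0 fe; rewrite (Rint_supp f0); exact: w3.
elim: l D => [|s l IH] D mD DK lK Dl.
 have -> : D = set0 by apply/seteqP; split=> // t /Dl[].
 exists [::]; split=> //; first by rewrite big_nil measure0.
 by move=> f e _ _; rewrite big_nil Rintegral_set0 measure0 subrr normr0 mulr0.
pose D1 := D `&` (U s)^°; pose D2 := D `\` (U s)^°.
have mU : measurable ((U s)^° : set (borel T)) by apply: borel_open; exact: open_interior.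
have mD1 : measurable (D1 : set (borel T)) by exact: measurableI.
have mD2 : measurable (D2 : set (borel T)) by exact: measurableD.
have fin (E : set T) : measurable (E : set (borel T)) -> E `<=` K -> (mu E < +oo)%E.
 by move=> mE EK; apply: le_lt_trans (muK cK); apply: le_measure; rewrite ?inE.
have fD1 : (mu D1 < +oo)%E by apply: fin => // t [/DK].
have fD2 : (mu D2 < +oo)%E by apply: fin => // t [/DK].
have [t [Dt _]|t tl|t [Dt nt]|w [w1 w2 w3]] := IH D2 mD2.
- exact: DK.
- by apply: lK; rewrite inE tl orbT.
- by have [u] := Dl t Dt; rewrite inE => /orP[/eqP ->//|ul Uu]; exists u.
have eD : fine (mu D) = fine (mu D1) + fine (mu D2).
 by rewrite (measureDI mu mD mU) addeC fineD ?ge0_fin_numE.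
exists ((fine (mu D1), s) :: w); split.
- move=> p; rewrite inE => /orP[/eqP ->|/w1//]; split; last by apply: lK; rewrite inE eqxx.
 exact: fine_ge0.
- by rewrite big_cons w2 eD.
move=> f e cf fe; rewrite big_cons /= eD mulrDr.
have iD (E : set T) : measurable (E : set (borel T)) -> E `<=` K ->
  mu.-integrable (E : set (borel T)) (EFin \o f).
 by move=> mE EK; apply: integrableS (cc_integrable cK cf).
have -> : Rintegral mu D f = Rintegral mu D1 f + Rintegral mu D2 f.
 have DE : D = D1 `|` D2.
  apply/seteqP; split=> [t Dt|t [[]|[]]//].
  by have [h|h] := pselect ((U s)^° t); [left|right].
 rewrite {1}DE; apply: Rintegral_setU => //.
  by apply: iD; [exact: measurableU|move=> t [] [/DK]].
 by apply/disj_setPS => t [[_ Ut] [_ /(_ Ut)]].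
have icst (r : R) : mu.-integrable (D1 : set (borel T)) (EFin \o (fun=> r)).
 apply: measurable_bounded_integrable => //.
 by exists `|r|; split; rewrite ?num_real // => x rx y _ /=; exact: ltW.
have i1 : mu.-integrable (D1 : set (borel T)) (EFin \o f) by apply: iD => // t [/DK].
have up : Rintegral mu D1 f <= (f s + e) * fine (mu D1).
 rewrite -Rintegral_cst //; apply: le_Rintegral => // t [Dt Ut].
 have := fe s t (lK s (mem_head _ _)) (DK _ Dt) (interior_subset Ut).
 by rewrite ler_norml => /andP[_]; lra.
have lo : (f s - e) * fine (mu D1) <= Rintegral mu D1 f.
 rewrite -Rintegral_cst //; apply: le_Rintegral => // t [Dt Ut].
 have := fe s t (lK s (mem_head _ _)) (DK _ Dt) (interior_subset Ut).
 by rewrite ler_norml => /andP[h _]; lra.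
have := w3 f e cf fe; rewrite !ler_norml => /andP[a b].
by apply/andP; split; lra.
Qed.

End ScalarIntegral.

Section LinearFunctionals.
Variables (R : realType) (V : normedModType R[i]).

Lemma functional_bounded (phi : {linear V -> R[i]^o}) : continuous phi ->
 exists2 M : R, 0 <= M & forall w, rn (phi w : R[i]) <= M * rn w.
Proof.
move=> cphi.
have /rn_cvgP /(_ 1 ltr01) /nbhs_rnP[d d0 hd] := cphi 0.
exists (2 / d); first by rewrite divr_ge0 // ltW.
move=> w; have [w0|w0] := eqVneq (rn w) 0.
 by rewrite w0 mulr0 (rn_eq0 w0) linear0 rn0.
have wp : 0 < rn w by rewrite lt_neqAle eq_sym w0 rn_ge0.
pose c := d / (2 * rn w).
have c0 : 0 < c by rewrite divr_gt0 // mulr_gt0.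
have := hd (c%:C *: w); rewrite /= -linearB !sub0r linearN !rnN linearZ /= rnZ [rn (_ *: _)]rnZ rn_pos; last exact: ltW.
rewrite (_ : c * rn w = d / 2); last by rewrite /c; field; rewrite gt_eqF.
have -> : 2 / d * rn w = c^-1 by rewrite /c; field; rewrite !gt_eqF.
move=> h; apply/ltW; rewrite -[X in _ < X]mulr1 ltr_pdivlMl //; apply: h.
by lra.
Qed.

End LinearFunctionals.

Section VectorIntegral.
Variables (R : realType) (T : ptopologicalType).
Hypothesis hT : hausdorff_space T.
Variable mu : borel_measure R T.
Hypothesis muK : finite_on_compacts T mu.
Local Notation C := R[i].

Definition csupp (V : zmodType) (K : set T) (f : T -> V) :=
 compact K /\ forall t, ~ K t -> f t = 0.

Lemma Re_cont : continuous (fun z : C^o => complex.Re z : R).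
Proof.
move=> z; apply/(@cvgrPdist_lt _ R^o _ (nbhs z)) => e e0.
apply/nbhs_rnP; exists e => // w; apply: le_lt_trans.
by have := rn_Re (z - w); rewrite raddfB.
Qed.

Lemma Im_cont : continuous (fun z : C^o => complex.Im z : R).
Proof.
move=> z; apply/(@cvgrPdist_lt _ R^o _ (nbhs z)) => e e0.
apply/nbhs_rnP; exists e => // w; apply: le_lt_trans.
by have := rn_Im (z - w); rewrite raddfB.
Qed.

Definition wsum (V : lmodType C) (w : seq (R * T)) (f : T -> V) : V :=
 \sum_(p <- w) p.1%:C *: f p.2.

Lemma Re_wsum (w : seq (R * T)) (h : T -> C^o) :
 complex.Re (wsum w h) = \sum_(p <- w) p.1 * complex.Re (h p.2).
Proof.
rewrite /wsum; elim: w => [|p w IH]; first by rewrite !big_nil.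
have ReD (a b : C^o) : complex.Re (a + b) = complex.Re a + complex.Re b by case: a; case: b.
by rewrite !big_cons ReD IH; congr (_ + _); case: (h p.2) => a b /=; rewrite mul0r subr0.
Qed.

Lemma Im_wsum (w : seq (R * T)) (h : T -> C^o) :
 complex.Im (wsum w h) = \sum_(p <- w) p.1 * complex.Im (h p.2).
Proof.
rewrite /wsum; elim: w => [|p w IH]; first by rewrite !big_nil.
have ImD (a b : C^o) : complex.Im (a + b) = complex.Im a + complex.Im b by case: a; case: b.
by rewrite !big_cons ImD IH; congr (_ + _); case: (h p.2) => a b /=; rewrite mul0r addr0.
Qed.

Lemma cintegral_weights (K : set T) U w (h : T -> C^o) (e : R) : weights mu K U w ->
 continuous h -> csupp K h ->
 (forall s t, K s -> K t -> U s t -> rn (h t - h s : C) <= e) ->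
 `|complex.Re (cintegral mu setT h) - complex.Re (wsum w h)| <= e * fine (mu K) /\
 `|complex.Im (cintegral mu setT h) - complex.Im (wsum w h)| <= e * fine (mu K).
Proof.
move=> [_ _ wP] ch [cK h0] he; split.
 rewrite Re_wsum; apply: (wP (fun t => complex.Re (h t))).
 - exact: (cont_comp ch Re_cont).
 - by move=> t /h0 ->.
 - move=> s t Ks Kt Us; apply: le_trans (he s t Ks Kt Us).
  by rewrite -raddfB; exact: rn_Re.
rewrite Im_wsum; apply: (wP (fun t => complex.Im (h t))).
- exact: (cont_comp ch Im_cont).
- by move=> t /h0 ->.
- move=> s t Ks Kt Us; apply: le_trans (he s t Ks Kt Us).
 by rewrite -raddfB; exact: rn_Im.
Qed.

Variable V : completeNormedModType C.
Implicit Types f g : T -> V.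

Lemma functional_wsum (phi : {linear V -> C^o}) w f :
 phi (wsum w f) = wsum w (fun t => phi (f t)).
Proof. by rewrite /wsum linear_sum; apply: eq_bigr => p _; rewrite linearZ. Qed.
(** The weighted sums [u n] form a Cauchy sequence: Hahn-Banach gives a norming functional of
    [u i - u j], and for functionals of norm at most 1 both sums approximate the same scalar
    integral with an error that does not depend on the functional. *)
Lemma vint_exists (K : set T) f : continuous f -> csupp K f ->
 exists v : V, forall phi : {linear V -> C^o}, continuous phi ->
  phi v = cintegral mu setT (fun x => phi (f x)).
Proof.
move=> cf sf; have [cK f0] := sf.
set m := fine (mu K); have m0 : 0 <= m by exact: fine_ge0.
pose ep (n : nat) : R := n.+1%:R^-1.
have ep0 n : 0 < ep n by rewrite invr_gt0.
pose U n s := [set t | rn (f t - f s) <= ep n].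
have wex n : exists w, weights mu K (U n) w.
 apply: weights_exist => // s Ks.
 have /rn_cvgP /(_ _ (ep0 n)) := cf s; apply: filterS => t /= h.
 by rewrite /U /= rn_distC ltW.
have [w wP] := choice wex.
pose u n := wsum (w n) f.
have key (phi : {linear V -> C^o}) (M : R) n : continuous phi -> 0 <= M ->
  (forall v, rn (phi v : C) <= M * rn v) ->
  rn (cintegral mu setT (fun x => phi (f x)) - phi (u n) : C) <= 2 * M * ep n * m.
 move=> cphi M0 hM.
 have [|||a b] := cintegral_weights (wP n) (h := fun t => phi (f t)) (e := M * ep n).
 - exact: (cont_comp cf cphi).
 - by split=> // t /f0 ->; rewrite linear0.
 - move=> s t Ks Kt Us; rewrite -linearB; apply: le_trans (hM _) _.
  by rewrite ler_wpM2l.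
 apply: le_trans (rn_ReIm _) _; rewrite functional_wsum !raddfB /=.
 by move: a b; rewrite -/m; lra.
have [|v uv] := @rn_complete R V u.
 have lim0 (e : R) : 0 < e -> exists N, forall n, (N <= n)%N -> 2 * ep n * m < e.
  move=> e0; exists (Num.Def.truncn (2 * m / e)) => n Nn.
  rewrite /ep -mulrAC ltr_pdivrMr // -ltr_pdivrMl // mulrC.
  have := truncnS_gt (2 * m / e) => /lt_le_trans; apply; rewrite ler_nat.
  by rewrite ltnS.
 move=> e e0; have [N hN] := lim0 _ (halfR_gt0 e0); exists N => i j Ni Nj.
 have [phi [cphi phi1 phiE]] := hahn_banach (u i - u j).
 have hM v : rn (phi v : C) <= 1 * rn v by rewrite mul1r.
 have ki := key phi 1 i cphi ler01 hM; have kj := key phi 1 j cphi ler01 hM.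
 rewrite -(rn_pos (rn_ge0 (u i - u j))) -phiE linearB.
 have := rn_tri (phi (u i) : C) (cintegral mu setT (fun x => phi (f x))) (phi (u j)).
 rewrite (rn_distC (phi (u i)) (cintegral _ _ _)); move: ki kj (hN i Ni) (hN j Nj); rewrite mulr1; lra.
exists v => phi cphi; have [M M0 hM] := functional_bounded cphi.
apply/eqP; rewrite -subr_eq0; apply/eqP/rn_eq0/le_anti; rewrite rn_ge0 andbT.
apply/ler_addgt0Pr => e e0; rewrite add0r.
have M1 : 0 < M + 1 by lra.
have [N1 h1] := uv _ (divr_gt0 (halfR_gt0 e0) M1).
pose n := maxn N1 (Num.Def.truncn (2 * M * m / (e / 2))).
have k := key phi M n cphi M0 hM.
have k2 : 2 * M * ep n * m <= e / 2.
 rewrite -mulrA (mulrC (ep n)) mulrA /ep ler_pdivrMr // -ler_pdivrMl ?halfR_gt0 // mulrC.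
 apply/ltW; have := truncnS_gt (2 * M * m / (e / 2)) => /lt_le_trans; apply.
 by rewrite ler_nat ltnS leq_maxr.
have k1 := h1 n (leq_maxl _ _).
have k3 := hM (u n - v); rewrite linearB in k3.
have := rn_tri (phi v : C) (phi (u n)) (cintegral mu setT (fun x => phi (f x))).
rewrite (rn_distC (phi v) (phi (u n))) (rn_distC (phi (u n)) (cintegral _ _ _)).
move: k1; rewrite ltr_pdivlMr // => k1.
have := rn_ge0 (u n - v).
move: (rn _) (rn _) (rn _) (rn _) k k1 k3 => a b c d k k1 k3 *; nra.
Qed.

Definition vint f : V := vintegral mu setT f.

Lemma vintP (K : set T) f : continuous f -> csupp K f ->
 forall phi : {linear V -> C^o}, continuous phi ->
  phi (vint f) = cintegral mu setT (fun x => phi (f x)).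
Proof.
move=> cf sf; have [v vP] := vint_exists cf sf.
by rewrite /vint /vintegral; case: xgetP => [y _ //|/(_ v)].
Qed.

(** A norming functional of the difference reduces this to scalar integrals. Norm bounds, linearity
    and the exchange of integrals are all read off from finite sums through this estimate. *)
Lemma vint_weights (K : set T) U w f (e : R) : weights mu K U w ->
 continuous f -> csupp K f ->
 (forall s t, K s -> K t -> U s t -> rn (f t - f s) <= e) ->
 rn (vint f - wsum w f) <= e * fine (mu K).
Proof.
move=> wP cf sf fe; have [phi [cphi phi1 phiE]] := hahn_banach (vint f - wsum w f).
have -> : rn (vint f - wsum w f) = complex.Re (phi (vint f - wsum w f)) by rewrite phiE.
rewrite linearB (vintP cf sf cphi) functional_wsum raddfB.
have [|||a _] := cintegral_weights wP (h := fun t => phi (f t)) (e := e).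
- exact: (cont_comp cf cphi).
- by case: sf => cK f0; split=> // t /f0 ->; rewrite linear0.
- by move=> s t Ks Kt Us; rewrite -linearB; apply: le_trans (phi1 _) (fe s t Ks Kt Us).
exact: le_trans (ler_norm _) a.
Qed.

Lemma near_dist f (s : T) (e : R) : continuous f -> 0 < e ->
 nbhs s [set t | rn (f t - f s) <= e].
Proof.
move=> cf e0; have /rn_cvgP /(_ _ e0) := cf s; apply: filterS => t h.
by rewrite /= rn_distC ltW.
Qed.

Lemma rn_wsum (W : normedModType C) (K : set T) U w (g : T -> W) (M : R) :
 weights mu K U w ->
 (forall t, K t -> rn (g t) <= M) -> rn (wsum w g) <= M * fine (mu K).
Proof.
move=> [w1 <- _] gM; rewrite /wsum mulr_sumr.
elim: w w1 => [|p w IH] w1; first by rewrite !big_nil rn0.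
rewrite !big_cons; apply: le_trans (rnD _ _) _; apply: lerD; last first.
 by apply: IH => q qw; apply: w1; rewrite inE qw orbT.
have [p0 Kp] := w1 p (mem_head _ _).
by rewrite rnZ rn_pos // mulrC ler_wpM2r // gM.
Qed.

Lemma le_small (a b m : R) : 0 <= m -> (forall e : R, 0 < e -> a <= b + e * m) -> a <= b.
Proof.
move=> m0 h; apply/ler_addgt0Pr => e e0.
have m1 : 0 < m + 1 by lra.
apply: le_trans (h _ (divr_gt0 e0 m1)) _; rewrite lerD2l mulrAC ler_pdivrMr //.
by rewrite ler_wpM2l ?ltW //; lra.
Qed.

Lemma vint_bound (K : set T) f (M : R) : continuous f -> csupp K f ->
 (forall t, K t -> rn (f t) <= M) -> rn (vint f) <= M * fine (mu K).
Proof.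
move=> cf sf fM; have [cK _] := sf.
have m0 : 0 <= fine (mu K) by exact: fine_ge0.
apply: (le_small m0) => e e0.
have [w wP] := weights_exist hT muK cK (fun s _ => near_dist s cf e0).
have h1 := vint_weights wP cf sf (fun s t _ _ h => h).
have h2 := rn_wsum wP fM.
have := rnD (vint f - wsum w f) (wsum w f); rewrite subrK; lra.
Qed.

Lemma vint_lin (K : set T) (k : C) f g : continuous f -> csupp K f ->
 continuous g -> csupp K g ->
 vint (fun t => k *: f t + g t) = k *: vint f + vint g.
Proof.
move=> cf sf cg sg; have [cK f0] := sf; have [_ g0] := sg.
have ch : continuous (fun t => k *: f t + g t).
 move=> t; apply: cvgD; last exact: cg.
 by apply: cvgZr; exact: cf.
have sh : csupp K (fun t => k *: f t + g t).
 by split=> // t nt; rewrite f0 // g0 // scaler0 addr0.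
have m0 : 0 <= fine (mu K) by exact: fine_ge0.
apply/subr0_eq/rn_eq0/le_anti; rewrite rn_ge0 andbT.
have m2 : 0 <= 2 * (rn k + 1) * fine (mu K) by rewrite !mulr_ge0 // addr_ge0 // rn_ge0.
apply: (le_small m2) => e e0; rewrite add0r.
pose U s := [set t | rn (f t - f s) <= e] `&` [set t | rn (g t - g s) <= e].
have [w wP] : exists w, weights mu K U w.
 by apply: weights_exist => // s _; apply: filterI; exact: near_dist.
have h1 : rn (vint f - wsum w f) <= e * fine (mu K).
 by apply: vint_weights wP cf sf _ => s t _ _ [].
have h2 : rn (vint g - wsum w g) <= e * fine (mu K).
 by apply: vint_weights wP cg sg _ => s t _ _ [].
have kE a b c d : (k *: a + b) - (k *: c + d) = k *: (a - c) + (b - d) :> V.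
 by rewrite scalerBr opprD addrACA.
have h3 : rn (vint (fun t => k *: f t + g t) - wsum w (fun t => k *: f t + g t)) <=
  (rn k * e + e) * fine (mu K).
 apply: vint_weights wP ch sh _ => s t _ _ [hf hg]; rewrite kE.
 by apply: le_trans (rnD _ _) _; rewrite rnZ lerD // ler_wpM2l ?rn_ge0.
have E : wsum w (fun t => k *: f t + g t) = k *: wsum w f + wsum w g.
 rewrite /wsum scaler_sumr -big_split /=; apply: eq_bigr => p _.
 by rewrite scalerDr !scalerA mulrC.
rewrite E in h3.
have h4 : rn ((k *: vint f + vint g) - (k *: wsum w f + wsum w g)) <= (rn k * e + e) * fine (mu K).
 rewrite kE; apply: le_trans (rnD _ _) _; rewrite rnZ mulrDl lerD // -mulrA.
 by rewrite ler_wpM2l ?rn_ge0.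
have := rn_tri (vint (fun t => k *: f t + g t)) (k *: wsum w f + wsum w g) (k *: vint f + vint g).
rewrite (rn_distC (k *: wsum w f + _)); move: h3 h4.
move: (rn _) (rn _) (rn _) (rn k) (fine _) => a b c d m *; lra.
Qed.

End VectorIntegral.
(** The source of the uniform estimates over compact parameter sets: joint continuity at each point
    of [L] gives one neighbourhood of [s] for all of [L]. *)
Lemma tube (S T : topologicalType) (L : set T) (P : S -> T -> Prop) (s : S) :
 compact L -> (forall t, L t -> nbhs (s, t) [set p : S * T | P p.1 p.2]) ->
 nbhs s [set s' | forall t, L t -> P s' t].
Proof.
move=> /compact_near_coveringP cL h.
have := cL S (nbhs s) P _; apply => t Lt.
have [[A B] /= [nA nB] AB] := h t Lt.
by exists (B, A) => //= -[t' s'] /= [Bt As]; exact: (AB (s', t')).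
Qed.

Lemma cont_slice (S T U : topologicalType) (F : S * T -> U) (s : S) :
 continuous F -> continuous (fun t => F (s, t)).
Proof.
move=> cF; apply: (cont_comp (f := fun t => (s, t)) _ cF).
by apply: cont_pair => t; [exact: cvg_cst|exact: cvg_id].
Qed.

Arguments cont_slice {S T U F} s _.

Lemma cont_slice2 (S T U : topologicalType) (F : S * T -> U) (t : T) :
 continuous F -> continuous (fun s => F (s, t)).
Proof.
move=> cF; apply: (cont_comp (f := fun s => (s, t)) _ cF).
by apply: cont_pair => s; [exact: cvg_id|exact: cvg_cst].
Qed.

Arguments cont_slice2 {S T U F} t _.

Section VectorIntegral2.
Variables (R : realType) (T : ptopologicalType).
Hypothesis hT : hausdorff_space T.
Variable mu : borel_measure R T.
Hypothesis muK : finite_on_compacts T mu.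
Variable V : completeNormedModType R[i].
Implicit Types f g : T -> V.

Lemma csupp_sub (W : zmodType) (K L : set T) (f : T -> W) :
 compact L -> K `<=` L -> csupp K f -> csupp L f.
Proof. by move=> cL KL [_ f0]; split=> // t Lt; apply: f0 => /KL. Qed.
(** [A] is only required to be additive and real-homogeneous, so that the conjugate-linear
    involution is covered as well. *)
Lemma vint_map (W : completeNormedModType R[i]) (A : V -> W) (M : R) (K : set T) f :
 (forall a b, A (a + b) = A a + A b) -> (forall (r : R) a, A (r%:C *: a) = r%:C *: A a) ->
 0 <= M -> (forall a, rn (A a) <= M * rn a) -> continuous f -> csupp K f ->
 A (vint mu f) = vint mu (fun t => A (f t)).
Proof.
move=> AD AZ M0 AM cf sf; have [cK f0] := sf.
have A0 : A 0 = 0 by have := AZ 0 0; rewrite !scale0r.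
have AN a : A (- a) = - A a.
 by have := AZ (-1) a; rewrite rmorphN rmorph1 !scaleN1r.
have AB a b : A a - A b = A (a - b) by rewrite AD AN.
have cA : continuous (fun t => A (f t)).
 move=> t; apply/rn_cvgP => e e0; have M1 : 0 < M + 1 by lra.
 have /rn_cvgP /(_ _ (divr_gt0 e0 M1)) := cf t; apply: filterS => s.
 rewrite ltr_pdivlMr // AB => h; apply: le_lt_trans (AM _) _.
 by have := rn_ge0 (f t - f s); nra.
have sA : csupp K (fun t => A (f t)) by split=> // t /f0 ->.
have m0 : 0 <= (M + M) * fine (mu K) by rewrite mulr_ge0 ?addr_ge0 // fine_ge0.
apply/subr0_eq/rn_eq0/le_anti; rewrite rn_ge0 andbT.
apply: (le_small m0) => e e0; rewrite add0r.
have [w wP] := weights_exist hT muK cK (fun s _ => near_dist s cf e0).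
have h1 := vint_weights hT muK wP cf sf (fun s t _ _ h => h).
have h2 : rn (vint mu (fun t => A (f t)) - wsum w (fun t => A (f t))) <= M * e * fine (mu K).
 apply: (vint_weights hT muK wP cA sA) => s t _ _ h; rewrite AB.
 by apply: le_trans (AM _) _; rewrite ler_wpM2l.
have E : wsum w (fun t => A (f t)) = A (wsum w f).
 rewrite /wsum (big_morph A AD A0); apply: eq_bigr => p _; exact: esym (AZ _ _).
have h3 := AM (vint mu f - wsum w f); rewrite -AB -E in h3.
have := rn_tri (A (vint mu f)) (wsum w (fun t => A (f t))) (vint mu (fun t => A (f t))).
rewrite (rn_distC (wsum _ _)); have := ler_wpM2l M0 h1; lra.
Qed.

Lemma vint0 : vint mu (fun=> 0 : V) = 0.
Proof.
apply/rn_eq0/le_anti; rewrite rn_ge0 andbT.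
have := @vint_bound R T hT mu muK V set0 (fun=> 0) 0.
by rewrite measure0 mulr0; apply => //; [exact: cst_continuous|split=> //; exact: compact0].
Qed.

Lemma vintZ (K : set T) (k : R[i]) f : continuous f -> csupp K f ->
 vint mu (fun t => k *: f t) = k *: vint mu f.
Proof.
move=> cf sf; have [cK _] := sf.
have := @vint_lin R T hT mu muK V K k f (fun=> 0) cf sf.
rewrite vint0 addr0 => <- //; first by congr vint; apply/funext => t; rewrite addr0.
exact: cst_continuous.
Qed.

Lemma vintB (K : set T) f g : continuous f -> csupp K f -> continuous g -> csupp K g ->
 vint mu (fun t => f t - g t) = vint mu f - vint mu g.
Proof.
move=> cf sf cg sg; have := vint_lin hT muK (-1) cg sg cf sf.
rewrite scaleN1r addrC => <-; congr vint; apply/funext => t.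
by rewrite scaleN1r addrC.
Qed.

Lemma vint_cont (S : topologicalType) (F : S * T -> V) (K : set T) :
 continuous F -> compact K -> (forall s t, ~ K t -> F (s, t) = 0) ->
 continuous (fun s => vint mu (fun t => F (s, t))).
Proof.
move=> cF cK F0 s; apply/rn_cvgP => e e0.
have m0 : 0 <= fine (mu K) by exact: fine_ge0.
have m1 : 0 < fine (mu K) + 1 by lra.
have d0 := divr_gt0 (halfR_gt0 e0) m1.
have : nbhs s [set s' | forall t, K t -> rn (F (s, t) - F (s', t)) <= e / 2 / (fine (mu K) + 1)].
 apply: tube => // t Kt.
 have /rn_cvgP /(_ _ (halfR_gt0 d0)) h1 := cF (s, t).
 have [[A B] /= [nA nB] AB] := h1.
 exists (A, B) => //= -[s' t'] /= [As Bt].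
 have h2 := AB (s', t') (conj As Bt); have h3 := AB (s, t') (conj (nbhs_singleton nA) Bt).
 have := rn_tri (F (s, t')) (F (s, t)) (F (s', t')).
 by rewrite (rn_distC (F (s, t')) (F (s, t))); move: h2 h3 => /=; lra.
apply: filterS => s' hs.
have sp u : csupp K (fun t => F (u, t)) by split=> // t; exact: F0.
rewrite -(vintB (cont_slice s cF) (sp s) (cont_slice s' cF) (sp s')).
have cB : continuous (fun t => F (s, t) - F (s', t)).
 by move=> t; apply: cvgB; apply: (cont_slice _ cF).
have sB : csupp K (fun t => F (s, t) - F (s', t)).
 by split=> // t nt; rewrite !F0 // subrr.
apply: le_lt_trans (vint_bound hT muK cB sB hs) _.
rewrite mulrAC ltr_pdivrMr //; nra.
Qed.

Lemma vint_wsum (S : ptopologicalType) (w : seq (R * S)) (F : S -> T -> V) (K : set T) :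
 (forall p, p \in w -> continuous (F p.2) /\ csupp K (F p.2)) -> compact K ->
 vint mu (fun t => wsum w (fun s => F s t)) = wsum w (fun s => vint mu (F s)) /\
 (continuous (fun t => wsum w (fun s => F s t)) /\
  csupp K (fun t => wsum w (fun s => F s t))).
Proof.
move=> + cK; elim: w => [|p w IH] h.
 have -> : (fun t => wsum [::] (fun s => F s t)) = (fun=> 0).
  by apply/funext => t; rewrite /wsum big_nil.
 rewrite vint0 /wsum big_nil; split=> //.
 by split=> //; exact: cst_continuous.
have [e [c s]] := IH (fun q qw => h q (mem_behead (s := _ :: _) qw)).
have [cp sp] := h p (mem_head _ _).
have -> : (fun t => wsum (p :: w) (fun s => F s t)) =
  (fun t => p.1%:C *: F p.2 t + wsum w (fun s => F s t)).
 by apply/funext => t; rewrite /wsum big_cons.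
split; first by rewrite (vint_lin hT muK _ cp sp c s) e /wsum big_cons.
split; first by move=> t; apply: cvgD; [apply: cvgZr; exact: cp|exact: c].
by split=> // t nt; case: sp => _ ->//; case: s => _ ->//; rewrite scaler0 addr0.
Qed.

End VectorIntegral2.

Section Fubini.
Variables (R : realType) (S T : ptopologicalType).
Hypotheses (hS : hausdorff_space S) (hT : hausdorff_space T).
Variables (mu : borel_measure R S) (nu : borel_measure R T).
Hypotheses (muK : finite_on_compacts S mu)
 (nuK : finite_on_compacts T nu).
Variable V : completeNormedModType R[i].

(** A quadrature rule in [s] that is good for all [t] in [L] at once brings both iterated integrals
    close to the same finite sum; no product measure is formed. *)
Lemma vint_swap (F : S * T -> V) (K : set S) (L : set T) : continuous F ->
 compact K -> compact L -> (forall s t, ~ (K s /\ L t) -> F (s, t) = 0) ->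
 vint mu (fun s => vint nu (fun t => F (s, t))) =
 vint nu (fun t => vint mu (fun s => F (s, t))).
Proof.
move=> cF cK cL F0.
have FK s t : ~ K s -> F (s, t) = 0 by move=> h; apply: F0 => -[].
have FL s t : ~ L t -> F (s, t) = 0 by move=> h; apply: F0 => -[].
have mK : 0 <= fine (mu K) by exact: fine_ge0.
have mL : 0 <= fine (nu L) by exact: fine_ge0.
have c1 := vint_cont hT nuK cF cL FL.
have cF' : continuous (fun q : T * S => F (q.2, q.1)).
 by apply: (cont_comp _ cF); apply: cont_pair; [exact: cont_snd|exact: cont_fst].
have c2 : continuous (fun t => vint mu (fun s => F (s, t))).
 exact: (vint_cont hS muK cF' cK (fun t s => FK s t)).
have s1 : csupp K (fun s => vint nu (fun t => F (s, t))).
 split=> // s nK; rewrite (_ : (fun t => _) = fun=> 0) ?vint0 //.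
 by apply/funext => t; rewrite FK.
have s2 : csupp L (fun t => vint mu (fun s => F (s, t))).
 split=> // t nL; rewrite (_ : (fun s => _) = fun=> 0) ?vint0 //.
 by apply/funext => s; rewrite FL.
have sT s : csupp L (fun t => F (s, t)) by split=> // t; exact: FL.
have sS t : csupp K (fun s => F (s, t)) by split=> // s; exact: FK.
apply/subr0_eq/rn_eq0/le_anti; rewrite rn_ge0 andbT.
have m0 : 0 <= 2 * (fine (mu K) * fine (nu L)) by rewrite !mulr_ge0.
apply: (le_small m0) => e e0; rewrite add0r.
pose U s := [set s' | forall t, L t -> rn (F (s', t) - F (s, t)) <= e].
have [w wP] : exists w, weights mu K U w.
 apply: weights_exist => // s _; apply: tube => // t Lt.
 have /rn_cvgP /(_ _ (halfR_gt0 e0)) h1 := cF (s, t).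
 have [[A B] /= [nA nB] AB] := h1.
 exists (A, B) => //= -[s' t'] /= [As Bt].
 have h2 := AB (s', t') (conj As Bt); have h3 := AB (s, t') (conj (nbhs_singleton nA) Bt).
 have := rn_tri (F (s', t')) (F (s, t)) (F (s, t')).
 by rewrite (rn_distC (F (s', t')) (F (s, t))); move: h2 h3 => /=; lra.
have [E [cw sw]] := vint_wsum hT nuK (w := w) (F := fun s t => F (s, t))
 (fun p _ => conj (cont_slice p.2 cF) (sT p.2)) cL.
have h1 : rn (vint mu (fun s => vint nu (fun t => F (s, t))) -
  wsum w (fun s => vint nu (fun t => F (s, t)))) <= (e * fine (nu L)) * fine (mu K).
 apply: (vint_weights hS muK wP c1 s1) => s s' _ _ us.
 rewrite -(vintB hT nuK (cont_slice s' cF) (sT s') (cont_slice s cF) (sT s)).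
 apply: vint_bound us => //.
  by move=> t; apply: cvgB; apply: (cont_slice _ cF).
 by split=> // t nt; rewrite !FL // subrr.
have h2 : rn (vint nu (fun t => vint mu (fun s => F (s, t))) -
  vint nu (fun t => wsum w (fun s => F (s, t)))) <= (e * fine (mu K)) * fine (nu L).
 rewrite -(vintB hT nuK c2 s2 cw sw); apply: vint_bound => //.
 - by move=> t; apply: cvgB; [exact: c2|exact: cw].
 - by split=> // t nt; case: s2 => _ ->//; case: sw => _ ->//; rewrite subrr.
 - move=> t Lt; apply: (vint_weights hS muK wP (cont_slice2 t cF) (sS t)) => s s' _ _ us.
  exact: us.
rewrite E in h2.
have := rn_tri (vint mu (fun s => vint nu (fun t => F (s, t))))
 (wsum w (fun s => vint nu (fun t => F (s, t))))
 (vint nu (fun t => vint mu (fun s => F (s, t)))).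
rewrite (rn_distC (wsum _ _)); move: h1 h2.
move: (rn _) (rn _) (rn _) (fine _) (fine _) => a b c m n *; nra.
Qed.

End Fubini.

Section Transfer.
Variables (R : realType) (S T : ptopologicalType).
Variables (mu : borel_measure R S) (nu : borel_measure R T).
Variable theta : S -> T.
Hypothesis ctheta : continuous theta.
Hypothesis nuE : forall A : set (borel T), measurable A -> nu A = mu (theta @^-1` A).
Variable D : set T.
Hypotheses (mD : measurable (D : set (borel T))) (thetaD : forall s, D (theta s)).

Import HBNNSimple.

(** With a translation as [theta] this is left invariance of the integral; with the path of arrows
    of given range it computes integrals for the Haar system of the transformation groupoid. *)
Lemma Rint_transfer (h : T -> R) : continuous h ->
 Rintegral nu D h = Rintegral mu setT (fun s => h (theta s)).
Proof.
move=> ch; have mt := @continuous_borel S T theta ctheta.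
have mh0 : measurable_fun (D : set (borel T)) (h : borel T -> R).
 exact: measurable_funS (cont_meas ch).
have mh := (measurable_EFinP _ _).2 mh0.
have DT : theta @^-1` D = setT by apply/seteqP; split=> // s _; exact: thetaD.
have key (f : borel T -> \bar R) : measurable_fun (D : set (borel T)) f -> (forall t, (0 <= f t)%E) ->
  (\int[nu]_(t in D) f t = \int[mu]_(s in setT) f (theta s))%E.
 move=> mf f0; rewrite -DT -(ge0_integral_pushforward mt mu mD mf (fun t _ => f0 t)).
 rewrite !ge0_integralE //.
 (* [nu] is known to be the image of [mu] only on Borel sets, so the two integrals are compared on
    simple functions, level set by level set. *)
 congr ereal_sup; apply: eq_imagel => /= g _.
 rewrite !sintegralE; apply: eq_fsbigr => r _; congr (_ * _)%E; apply: nuE.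
 by apply: (measurable_funPTI g); exact: measurable_set1.
rewrite /Rintegral integralE [in RHS]integralE; congr (fine (_ - _)).
 have := key _ (measurable_funepos mh) (fun t => funepos_ge0 _ t).
 move=> E; apply: etrans E _; apply: eq_integral => s _.
 by have /(congr1 (fun g => g s)) /esym := funepos_comp (EFin \o h) theta.
have := key _ (measurable_funeneg mh) (fun t => funeneg_ge0 _ t).
move=> E; apply: etrans E _; apply: eq_integral => s _.
by have /(congr1 (fun g => g s)) /esym := funeneg_comp (EFin \o h) theta.
Qed.

Lemma vintegral_transfer (V : completeNormedModType R[i]) (f : T -> V) : continuous f ->
 vintegral nu D f = vintegral mu setT (fun s => f (theta s)).
Proof.
move=> cf; rewrite /vintegral; congr xget; apply/seteqP.
have E (phi : {linear V -> R[i]^o}) : continuous phi ->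
  cintegral nu D (fun x => phi (f x)) = cintegral mu setT (fun s => phi (f (theta s))).
 move=> cphi; rewrite /cintegral; congr Complex; apply: Rint_transfer.
  exact: (cont_comp (cont_comp cf cphi) (@Re_cont R)).
 exact: (cont_comp (cont_comp cf cphi) (@Im_cont R)).
by split=> v /= h phi cphi; rewrite h // E.
Qed.

End Transfer.

(** * Upper semicontinuous Banach bundles *)

Section Bundles.
Variables (R : realType) (X : ptopologicalType) (E : bundle R X).
Implicit Types (a b c d : E) (x : X).

Lemma bcoE x (v : fib E x) : bco x (binj v) = v.
Proof. by rewrite /bco; case: xgetP => [w _ /binj_inj//|/(_ v)/=]. Qed.
Lemma bcoK x a : bpr a = x -> binj (bco x a) = a.
Proof.
move=> ax; have : range (@binj _ _ E x) a by rewrite binj_range /= ax.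
by move=> [v _ <-]; rewrite bcoE.
Qed.

Lemma bpr_bzero x : bpr (bzero E x) = x.
Proof. exact: bpr_binj. Qed.
Lemma bco_zero x : bco x (bzero E x) = 0.
Proof. exact: bcoE. Qed.
Lemma bco_eq x a b : bpr a = x -> bpr b = x -> bco x a = bco x b -> a = b.
Proof. by move=> ax bx e; rewrite -(bcoK ax) -(bcoK bx) e. Qed.
Lemma bnormE x a : bpr a = x -> bnorm a = rn (bco x a).
Proof. by move=> <-. Qed.
Lemma bnorm_binj x (v : fib E x) : bnorm (binj v) = rn v.
Proof. by rewrite (bnormE (bpr_binj v)) bcoE. Qed.
Lemma baddE x a b : bpr a = x -> badd a b = binj (bco x a + bco x b).
Proof. by move=> <-. Qed.
Lemma bscaleE x k a : bpr a = x -> bscale k a = binj (k *: bco x a).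
Proof. by move=> <-. Qed.
Lemma bpr_badd a b : bpr (badd a b) = bpr a.
Proof. exact: bpr_binj. Qed.
Lemma bpr_bscale k a : bpr (bscale k a) = bpr a.
Proof. exact: bpr_binj. Qed.

Definition bsub a b : E := badd a (bscale (-1) b).

Lemma bpr_bsub a b : bpr (bsub a b) = bpr a.
Proof. exact: bpr_badd. Qed.
Lemma bco_badd x a b : bpr a = x -> bco x (badd a b) = bco x a + bco x b.
Proof. by move=> ax; rewrite (baddE _ ax) bcoE. Qed.
Lemma bco_bscale x k a : bpr a = x -> bco x (bscale k a) = k *: bco x a.
Proof. by move=> ax; rewrite (bscaleE _ ax) bcoE. Qed.
Lemma bco_bsub x a b : bpr a = x -> bpr b = x -> bco x (bsub a b) = bco x a - bco x b.
Proof. by move=> ax bx; rewrite bco_badd // bco_bscale // scaleN1r. Qed.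
Lemma bdistE x a b : bdist x a b = rn (bco x a - bco x b).
Proof. by []. Qed.
Lemma bdist_bsub x a b : bpr a = x -> bpr b = x -> bdist x a b = bnorm (bsub a b).
Proof.
by move=> ax bx; rewrite (@bnormE x) ?bco_bsub // bpr_bsub.
Qed.

Lemma bdist_tri x a b c : bdist x a c <= bdist x a b + bdist x b c.
Proof. exact: rn_tri. Qed.
Lemma bdistC x a b : bdist x a b = bdist x b a.
Proof. exact: rn_distC. Qed.
Lemma bdistxx x a : bdist x a a = 0.
Proof. by rewrite bdistE subrr rn0. Qed.
Lemma bnorm_ge0 a : 0 <= bnorm a.
Proof. exact: rn_ge0. Qed.
Lemma bnorm_zero x : bnorm (bzero E x) = 0.
Proof. by rewrite bnorm_binj rn0. Qed.
Lemma bnorm_eq0 x a : bpr a = x -> bnorm a = 0 -> a = bzero E x.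
Proof.
move=> ax; rewrite (bnormE ax) => /rn_eq0 a0.
by apply: bco_eq ax (bpr_bzero x) _; rewrite bco_zero.
Qed.

Lemma cvg_within_comp (T S U : topologicalType) (D : set S) (g : S -> U)
  (F : set_system T) (FF : Filter F) (f : T -> S) (s : S) :
 {within D, continuous g} -> D s -> (\forall t \near F, D (f t)) -> f @ F --> s ->
 (fun t => g (f t)) @ F --> g s.
Proof.
move=> /subspace_continuousP cg Ds Df fs A /(cg s Ds) h.
have h2 : F [set t | D (f t) -> A (g (f t))] := fs _ h.
by apply: (@filterS2 T F FF _ _ _ _ h2 Df) => t; apply.
Qed.

Lemma cont_within_comp (T S U : topologicalType) (D : set S) (g : S -> U) (f : T -> S) :
 {within D, continuous g} -> (forall t, D (f t)) -> continuous f ->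
 continuous (fun t => g (f t)).
Proof. move=> cg Df cf t.
apply: (cvg_within_comp (nbhs_filter t) cg (Df t) _ (cf t)).
by apply: filterE. Qed.

Hypothesis hE : is_usc_banach_bundle E.

Lemma bpr_cont : continuous (@bpr _ _ E).
Proof. by case: hE => -[]. Qed.
Lemma bpr_open (U : set E) : open U -> open (@bpr _ _ E @` U).
Proof. by case: hE => -[] _ h _ _; exact: h. Qed.
Lemma bnorm_open (r : R) : open [set a : E | bnorm a < r].
Proof. by case: hE => -[]. Qed.
Lemma badd_cont (T : topologicalType) (f g : T -> E) :
 continuous f -> continuous g -> (forall t, bpr (f t) = bpr (g t)) ->
 continuous (fun t => badd (f t) (g t)).
Proof.
move=> cf cg fg; case: hE => _ [h _ _].
by apply: (cont_within_comp (f := fun t => (f t, g t)) h fg); exact: cont_pair.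
Qed.

Lemma bscale_contl k : continuous (@bscale _ _ E k).
Proof. by case: hE => _ []. Qed.
Lemma bsub_cont (T : topologicalType) (f g : T -> E) :
 continuous f -> continuous g -> (forall t, bpr (f t) = bpr (g t)) ->
 continuous (fun t => bsub (f t) (g t)).
Proof.
move=> cf cg fg; apply: badd_cont => //; first exact: (cont_comp cg (@bscale_contl (-1))).
by move=> t; rewrite bpr_bscale.
Qed.

(* the sets [p^-1(V)] intersected with open balls form a basis at a zero *)
Lemma nbhs_bzero x (W : set E) : nbhs (bzero E x) W ->
 exists V (e : R), [/\ nbhs x V, 0 < e & forall a, V (bpr a) -> bnorm a < e -> W a].
Proof.
case: hE => _ [_ _ hz] nW.
pose F := [set S : set E | exists V (e : R), [/\ nbhs x V, 0 < e &
 forall a, V (bpr a) -> bnorm a < e -> S a]].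
have FF : ProperFilter F.
 split.
  move=> [V [e [nV e0 h]]]; apply: (h (bzero E x)).
   by rewrite bpr_bzero; exact: nbhs_singleton.
  by rewrite bnorm_zero.
 split.
 - by exists setT, 1; split=> //; exact: filterT.
 - move=> P Q [V [e [nV e0 h]]] [V' [e' [nV' e0' h']]].
  exists (V `&` V'), (Num.min e e'); split; first exact: filterI.
   by rewrite lt_min e0.
  by move=> a [Va V'a]; rewrite lt_min => /andP[ae ae']; split; [exact: h|exact: h'].
 - by move=> P Q PQ [V [e [nV e0 h]]]; exists V, e; split=> // a Va ae; exact/PQ/h.
apply: (hz F x FF) => //.
 by move=> V nV; exists V, 1; split.
apply/(@cvgrPdist_lt _ R^o) => e e0; exists setT, e; split=> //; first exact: filterT.
by move=> a _ ae; rewrite /= sub0r normrN ger0_norm ?bnorm_ge0.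
Qed.

(** Continuity of addition at the pair of [a] and the zero over it, combined with the basis of
    neighbourhoods of that zero: whatever is close in norm to a point near [a] is itself near
    [a]. *)
Lemma bundle_tube (a : E) (W : set E) : nbhs a W ->
 exists W' (e : R), [/\ open_nbhs a W', 0 < e &
  forall c d, W' c -> bpr d = bpr c -> bdist (bpr c) d c < e -> W d].
Proof.
case: hE => _ [hadd _ _] nW; set x := bpr a.
have hz : bpr a = bpr (bzero E x) by rewrite bpr_bzero.
have az : badd a (bzero E x) = a.
 by apply: (@bco_eq x); rewrite ?bpr_badd // bco_badd // bco_zero addr0.
move/subspace_continuousP : hadd => /(_ (a, bzero E x) hz) /=.
rewrite /from_subspace /= az => /(_ _ nW) [[A B] /= [nA nB] AB].
have [V [e [nV e0 VB]]] := nbhs_bzero nB.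
have nAV : nbhs a (A `&` @bpr _ _ E @^-1` V) by apply: filterI => //; exact: bpr_cont.
exists ((A `&` @bpr _ _ E @^-1` V)^°), e; split=> //.
 by split; [exact: open_interior|exact: nAV].
move=> c d /interior_subset[Ac Vc] dc dce.
have -> : d = badd c (bsub d c).
 apply: (@bco_eq (bpr c)); rewrite ?bpr_badd // bco_badd // bco_bsub //.
 by rewrite addrC subrK.
apply: (AB (c, bsub d c)) => /=; last by rewrite bpr_bsub.
by split=> //; apply: VB; rewrite ?bpr_bsub ?dc // -(@bdist_bsub (bpr c)).
Qed.

(* Uniform limits: it suffices that [f] is approximated near [t0] by functions
  that are themselves continuous up to small errors. *)
Lemma bundle_cvg (T : topologicalType) (f : T -> E) (t0 : T) :
 (forall e : R, 0 < e -> exists b, [/\ bpr b = bpr (f t0), bdist (bpr b) b (f t0) < e &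
   forall W, nbhs b W -> \forall t \near t0, exists c, [/\ W c, bpr c = bpr (f t) &
    bdist (bpr (f t)) (f t) c < e]]) ->
 f @ t0 --> f t0.
Proof.
move=> h W nW; have [W' [e [[oW' W'f] e0 hW']]] := bundle_tube nW.
have [W2 [d [[_ W2f] d0 hW2]]] := bundle_tube (open_nbhs_nbhs (conj oW' W'f)).
have m0 : 0 < Num.min e d by rewrite lt_min e0.
have [b [pb]] := h _ m0; rewrite lt_min => /andP[bf1 bf2] hb.
have W'b : W' b.
 by apply: (hW2 (f t0)) => //; rewrite -pb.
have := hb W' (open_nbhs_nbhs (conj oW' W'b)); apply: filterS => t [c [W'c pc]].
rewrite lt_min => /andP[fc _]; apply: (hW' c) => //; by rewrite pc.
Qed.

Lemma bundle_cvg_unif (T : topologicalType) (f : T -> E) (t0 : T) :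
 (forall e : R, 0 < e -> exists g : T -> E, [/\ g @ t0 --> g t0,
   forall t, bpr (g t) = bpr (f t) &
   \forall t \near t0, bdist (bpr (f t)) (f t) (g t) < e]) ->
 f @ t0 --> f t0.
Proof.
move=> h; apply: bundle_cvg => e e0; have [g [cg pg hg]] := h e e0.
exists (g t0); split; first exact: pg.
 by rewrite pg bdistC; exact: nbhs_singleton hg.
move=> W /cg nW; near=> t; exists (g t); split; first by near: t.
- exact: pg.
- by near: t.
Unshelve. all: by end_near. Qed.

Lemma bnorm_near (T : topologicalType) (f : T -> E) (t0 : T) (r : R) :
 f @ t0 --> f t0 -> bnorm (f t0) < r -> \forall t \near t0, bnorm (f t) < r.
Proof. move=> cf fr; suff /cf : nbhs (f t0) [set a | bnorm a < r] by [].
by apply: open_nbhs_nbhs; split=> //; exact: bnorm_open. Qed.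

Lemma bdist_near (T : topologicalType) (f g : T -> E) (t0 : T) (r : R) :
 continuous f -> continuous g -> (forall t, bpr (f t) = bpr (g t)) ->
 bdist (bpr (f t0)) (f t0) (g t0) < r ->
 \forall t \near t0, bdist (bpr (f t)) (f t) (g t) < r.
Proof.
move=> cf cg fg; rewrite bdist_bsub ?fg // => h.
have := bnorm_near (bsub_cont cf cg fg (x := t0)) h; apply: filterS => t.
by rewrite bdist_bsub ?fg.
Qed.

(** An upper semicontinuous norm is still locally bounded, and compactness makes the bound
    global. *)
Lemma bnorm_compact (T : topologicalType) (f : T -> E) (K : set T) :
 continuous f -> compact K -> exists2 M : R, 0 <= M & forall t, K t -> bnorm (f t) <= M.
Proof.
move=> cf cK.
suff [n hn] : exists n : nat, forall t, K t -> bnorm (f t) < n%:R.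
 by exists n%:R => // t /hn/ltW.
have cov t : K t -> \forall t' \near t & n \near \oo, bnorm (f t') < n%:R.
 move=> Kt; pose N := (Num.Def.truncn (bnorm (f t))).+1.
 exists ([set t' | bnorm (f t') < N%:R], [set n | (N <= n)%N]) => /=.
  split; last by exists N.
  by apply: bnorm_near; [exact: cf|exact: truncnS_gt].
 by move=> [t' n] /= [h Nn]; apply: lt_le_trans h _; rewrite ler_nat.
have /compact_near_coveringP/(_ nat \oo (fun n t => bnorm (f t) < n%:R) _ cov) := cK.
by move=> /filter_ex[n hn]; exists n.
Qed.

Lemma bnorm_bscale k a : bnorm (bscale k a) = rn k * bnorm a.
Proof. by rewrite (@bnormE (bpr a)) ?bpr_bscale // bco_bscale // rnZ. Qed.
(** The axioms give continuity in the vector for each fixed scalar only. The joint statement uses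
    that the norm is bounded near [t0], which makes a change of scalar a uniformly small
    perturbation. *)
Lemma bscale_cvg (T : topologicalType) (k : T -> R[i]) (f : T -> E) (t0 : T) :
 (k : T -> R[i]^o) @ t0 --> (k t0 : R[i]^o) -> f @ t0 --> f t0 ->
 (fun t => bscale (k t) (f t)) @ t0 --> bscale (k t0) (f t0).
Proof.
move=> ck cf; apply: bundle_cvg_unif => e e0.
exists (fun t => bscale (k t0) (f t)); split.
- exact: (cvg_comp f _ cf (@bscale_contl (k t0) (f t0))).
- by move=> t; rewrite !bpr_bscale.
have m0 : 0 < bnorm (f t0) + 1 by rewrite ltr_wpDl ?bnorm_ge0.
near=> t; rewrite bpr_bscale bdistE !bco_bscale // -scalerBl rnZ -bnormE //.
have h1 : bnorm (f t) < bnorm (f t0) + 1.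
 by near: t; apply: bnorm_near; [exact: cf|rewrite ltrDl].
have h2 : rn (k t0 - k t) < e / (bnorm (f t0) + 1).
 near: t; have /rn_cvgP := ck; apply; exact: divr_gt0.
rewrite rn_distC; move: h2; rewrite ltr_pdivlMr // => h2.
by have := rn_ge0 (k t0 - k t); have := bnorm_ge0 (f t); nra.
Unshelve. all: by end_near. Qed.

Lemma bscale_cont (T : topologicalType) (k : T -> R[i]) (f : T -> E) :
 continuous (k : T -> R[i]^o) -> continuous f -> continuous (fun t => bscale (k t) (f t)).
Proof. by move=> ck cf t; apply: bscale_cvg; [exact: ck|exact: cf]. Qed.
Lemma bzero_cont : continuous (bzero E).
Proof.
move=> x W /nbhs_bzero[V [e [nV e0 h]]]; apply: filterS nV => y Vy.
by apply: h; rewrite ?bpr_bzero ?bnorm_zero.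
Qed.

Lemma bco_cont (T : topologicalType) x (f : T -> E) :
 continuous f -> (forall t, bpr (f t) = x) -> continuous (fun t => bco x (f t)).
Proof.
move=> cf fx t0; apply/rn_cvgP => e e0.
have c0 : continuous (fun _ : T => f t0) by exact: cst_continuous.
have := bdist_near (f := fun _ => f t0) (g := f) (t0 := t0) (r := e) c0 cf.
rewrite bdistxx => /(_ _ e0); rewrite fx; apply; move=> t; by rewrite !fx.
Qed.

Lemma binj_sum_cont (I : eqType) (T : topologicalType) (pi : T -> X) (w : seq (R * I))
  (f : I -> T -> E) :
 continuous pi -> (forall p, p \in w -> continuous (f p.2) /\ forall t, bpr (f p.2 t) = pi t) ->
 continuous (fun t => binj (\sum_(p <- w) p.1%:C *: bco (pi t) (f p.2 t))).
Proof.
move=> cpi; elim: w => [|p w IH] h.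
 by rewrite (_ : (fun t => _) = bzero E \o pi);
  [exact: (cont_comp cpi bzero_cont)|apply/funext => t /=; rewrite big_nil].
have [cp pp] := h p (mem_head _ _).
have {}IH := IH (fun q qw => h q (mem_behead (s := _ :: _) qw)).
rewrite (_ : (fun t => _) = fun t => badd (bscale p.1%:C (f p.2 t))
  (binj (\sum_(p <- w) p.1%:C *: bco (pi t) (f p.2 t)))).
 apply: badd_cont => //; first exact: (cont_comp cp (@bscale_contl _)).
 by move=> t; rewrite bpr_bscale pp bpr_binj.
apply/funext => t; rewrite (@baddE (pi t)) ?bpr_bscale // bco_bscale // bcoE.
by rewrite big_cons.
Qed.

End Bundles.
Definition lcpt (X : topologicalType) := forall x : X, exists2 M, nbhs x M & compact M.

Section Bump.
Variables (R : realType) (X : topologicalType).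
Hypotheses (hX : hausdorff_space X) (lX : locally_compact [set: X]).

Lemma lc_lcpt : lcpt X.
Proof.
move=> x; have := @lX x Logic.I; rewrite withinET => -[U nU [cU _]].
by exists U.
Qed.

Lemma bump (x : X) (U : set X) : nbhs x U -> exists phi : X -> R,
 [/\ continuous phi, forall y, 0 <= phi y, 0 < phi x &
   forall y, ~ U y -> \forall z \near y, phi z = 0].
Proof.
move=> nU; have cr := @locally_compact_completely_regular X R lX hX.
have cB : closed (~` U^°) by apply: open_closedC; exact: open_interior.
have nBx : ~ (~` U^°) x by move=> h; apply: h; exact: nU.
have /(@uniform_separatorP _ R)[f [cf f01 f0 f1]] := cr x _ cB nBx.
have fx : f x = 0 by apply: f0; exists x.
have fU y : ~ U y -> f y = 1.
 by move=> nUy; apply: f1; exists y => // /interior_subset.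
have f1' y : f y <= 1.
 have : range f (f y) by exists y.
 by move/f01; rewrite /= in_itv /= => /andP[].
(* Twice the positive part of 1/2 - f. Since f = 1 off [U], it vanishes on a whole neighbourhood of
   each point outside [U], as extension by zero requires. *)
exists (fun y => (2^-1 - f y) + `|2^-1 - f y|); split.
- have cd : continuous (fun y => 2^-1 - f y : R^o).
  by move=> y; apply: cvgB; [exact: cvg_cst|exact: cf].
 by move=> y; apply: (@cvgD _ R^o); [exact: cd|apply: (@cvg_norm _ R^o); exact: cd].
- by move=> y; have := ler_norm (- (2^-1 - f y)); rewrite normrN; lra.
- by rewrite fx subr0 ger0_norm //; lra.
- move=> y /fU fy.
 have : \forall z \near y, 2^-1 < f z.
  apply: (cvgr_gt (f y)); first exact: cf.
  by rewrite fy invf_lt1 // ltr1n.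
 by apply: filterS => z h; rewrite ler0_norm ?subrr // subr_le0 ltW.
Qed.

End Bump.

Section GammaC.
Variables (R : realType) (X : ptopologicalType) (E : bundle R X).
Hypothesis hX : hausdorff_space X.

Lemma GammacP (f : X -> E) : Gammac E f <->
 [/\ is_section f, continuous f & exists2 K, compact K & forall x, ~ K x -> f x = bzero E x].
Proof.
split=> [[sf cf cs]|[sf cf [K cK f0]]]; split=> //.
 exists (bsupp f) => // x nx; apply: contrapT => fx; apply: nx.
 exact: subset_closure.
apply: (subclosed_compact _ cK); first exact: closed_closure.
have cl := compact_closed hX cK.
rewrite /bsupp closureE; apply: smallest_sub => // x /= fx.
by apply: contrapT => /f0.
Qed.

Lemma bsuppP (f : X -> E) x : ~ bsupp f x -> f x = bzero E x.
Proof. by move=> nx; apply: contrapT => fx; apply: nx; exact: subset_closure. Qed.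
Lemma bsupp_sub (f : X -> E) (K : set X) : compact K ->
 (forall x, ~ K x -> f x = bzero E x) -> bsupp f `<=` K.
Proof.
move=> cK f0; have cl := compact_closed hX cK.
rewrite /bsupp closureE; apply: smallest_sub => // x /= fx.
by apply: contrapT => /f0.
Qed.

End GammaC.

Section BundleIntegral.
Variables (R : realType) (X : ptopologicalType) (E : bundle R X).
Hypothesis hE : is_usc_banach_bundle E.
Variables (S : ptopologicalType) (mu : borel_measure R S).
Hypotheses (hS : hausdorff_space S)
 (muK : finite_on_compacts S mu).

Definition bint (x : X) (f : S -> E) : E := binj (vint mu (fun s => bco x (f s))).

Lemma bpr_bint x f : bpr (bint x f) = x.
Proof. exact: bpr_binj. Qed.
Lemma bco_bint x f : bco x (bint x f) = vint mu (fun s => bco x (f s)).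
Proof. exact: bcoE. Qed.

Definition csec (x : X) (K : set S) (f : S -> E) :=
 [/\ continuous f, forall s, bpr (f s) = x, compact K & forall s, ~ K s -> f s = bzero E x].

Lemma csec_bco x K f : csec x K f -> continuous (fun s => bco x (f s)) /\
 csupp K (fun s => bco x (f s)).
Proof.
move=> [cf pf cK f0]; split; first exact: bco_cont.
by split=> // s /f0 ->; rewrite bco_zero.
Qed.

Lemma bint_bound x K f (M : R) : csec x K f -> (forall s, K s -> bnorm (f s) <= M) ->
 bnorm (bint x f) <= M * fine (mu K).
Proof.
move=> sf fM; have [c s] := csec_bco sf; have [_ pf _ _] := sf.
rewrite bnorm_binj; apply: vint_bound => // t Kt.
by rewrite -bnormE //; exact: fM.
Qed.

Lemma bint_map x y K f (A : fib E x -> fib E y) (Phi : E -> E) (M : R) :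
 (forall v, Phi (binj v) = binj (A v)) ->
 (forall a b, A (a + b) = A a + A b) -> (forall (r : R) a, A (r%:C *: a) = r%:C *: A a) ->
 0 <= M -> (forall a, rn (A a) <= M * rn a) -> csec x K f ->
 Phi (bint x f) = bint y (fun s => Phi (f s)).
Proof.
move=> PA AD AZ M0 AM sf; have [cf s1] := csec_bco sf; have [_ pf _ _] := sf.
rewrite PA (vint_map hS muK AD AZ M0 AM cf s1) /bint.
congr (binj (vint _ _)); apply/funext => s; rewrite -{2}(bcoK (pf s)) PA bcoE //.
Qed.

Section Family.
Variables (T : topologicalType) (pi : T -> X) (F : S * T -> E).
Hypotheses (cpi : continuous pi) (cF : continuous F)
 (pF : forall s t, bpr (F (s, t)) = pi t).

Definition bsum (w : seq (R * S)) (t : T) : E :=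
 binj (\sum_(p <- w) p.1%:C *: bco (pi t) (F (p.2, t))).

Definition closeto (M : set T) (e : R) (s : S) : set S :=
 [set s' | forall t, M t -> bdist (pi t) (F (s', t)) (F (s, t)) <= e].

Lemma nbhs_closeto (M : set T) (e : R) (s : S) : compact M -> 0 < e ->
 nbhs s (closeto M e s).
Proof.
move=> cM e0; apply: tube => // t Mt.
have c2 : continuous (fun q : S * T => F (s, q.2)).
 apply: (cont_comp _ cF); apply: cont_pair; last exact: cont_snd.
 by move=> q; exact: cvg_cst.
have := bdist_near (f := F) (g := fun q : S * T => F (s, q.2)) (t0 := (s, t)) (r := e) hE cF c2.
rewrite /= bdistxx => h; have {h} : \forall q \near (s, t), bdist (bpr (F q)) (F q) (F (s, q.2)) < e.
 by apply: h => // -[s' t'] /=; rewrite !pF.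
by apply: filterS => -[s' t'] /=; rewrite pF => h; exact: ltW.
Qed.

Lemma bint_closeto (K : set S) U w (M : set T) (e : R) (t : T) : weights mu K U w ->
 compact K -> (forall s t, M t -> ~ K s -> F (s, t) = bzero E (pi t)) -> M t ->
 (forall s, U s `<=` closeto M e s) ->
 bdist (pi t) (bint (pi t) (fun s => F (s, t))) (bsum w t) <= e * fine (mu K).
Proof.
move=> wP cK F0 Mt UM; rewrite bdistE bco_bint bcoE.
have st : csec (pi t) K (fun s => F (s, t)).
 by split=> //; [exact: cont_slice2|move=> s; exact: F0].
have [c s1] := csec_bco st.
apply: (vint_weights hS muK wP c s1) => s s' Ks Ks' /UM; exact.
Qed.

Lemma bsum_cont w : continuous (bsum w).
Proof.
apply: (binj_sum_cont hE (f := fun s t => F (s, t))) => // p _.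
by split; [exact: cont_slice|move=> t; exact: pF].
Qed.

(** The values lie in varying fibres. Over a compact neighbourhood of [t0] the integral is a uniform
    limit of the continuous finite sums [bsum w], and uniform limits preserve continuity in a Banach
    bundle. *)
Lemma bint_cont (hsupp : forall t0 : T, exists (M : set T) (K : set S), [/\ nbhs t0 M, compact M, compact K &
  forall s t, M t -> ~ K s -> F (s, t) = bzero E (pi t)]) :
 continuous (fun t => bint (pi t) (fun s => F (s, t))).
Proof.
move=> t0; have [M [K [nM cM cK F0]]] := hsupp t0.
apply: (bundle_cvg_unif hE) => e e0.
have m1 : 0 < fine (mu K) + 1 by rewrite ltr_wpDl ?fine_ge0.
have d0 := divr_gt0 e0 m1.
have [w wP] := weights_exist hS muK cK (fun s _ => nbhs_closeto s cM d0).
exists (bsum w); split; first exact: bsum_cont.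
 by move=> t; rewrite bpr_binj bpr_bint.
apply: filterS nM => t Mt; rewrite bpr_bint.
apply: le_lt_trans (bint_closeto wP cK F0 Mt (fun s => @subset_refl _ _)) _.
have := fine_ge0 (measure_ge0 mu K); rewrite mulrAC ltr_pdivrMr //; nra.
Qed.

End Family.
End BundleIntegral.

(** * Continuous sections through every point *)

Section EnoughSections.
Variables (R : realType) (X : ptopologicalType) (E : bundle R X).
Hypotheses (hE : is_usc_banach_bundle E) (hX : hausdorff_space X)
 (lX : locally_compact [set: X]).

(** Subtraction is continuous at (b, b), where its value has norm 0, and small norm is an open
    condition. The sets [W] are thin: they meet each fibre in a set of small diameter. *)
Lemma bsub_near (b : E) (e : R) : 0 < e -> exists W, [/\ open W, W b &
 forall c c', W c -> W c' -> bpr c = bpr c' -> bdist (bpr c') c c' < e].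
Proof.
move=> e0; set x := bpr b.
pose D := [set p : E * E | bpr p.1 = bpr p.2].
have hadd : {within D, continuous (fun p : E * E => badd p.1 p.2)} by case: hE => _ [].
have csub : (fun p : E * E => badd p.1 (bscale (-1) p.2)) @ within D (nbhs (b, b)) --> bsub b b.
 apply: (@cvg_within_comp _ _ _ D (fun p : E * E => badd p.1 p.2) (within D (nbhs (b, b))) _
  (fun p : E * E => (p.1, bscale (-1) p.2)) (b, bscale (-1) b) hadd).
 - by rewrite /D /= bpr_bscale.
 - by apply: (@filterE _ (nbhs (b, b))) => p h; rewrite /D /= bpr_bscale.
 - apply: cvg_within_filter; apply: cvg_pair => /=; first exact: cvg_fst.
  exact: (cont_comp (@cont_snd E E) (bscale_contl hE (k := -1)) (x := (b, b))).
have /csub : nbhs (bsub b b) [set a | bnorm a < e].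
 apply: open_nbhs_nbhs; split; first exact: bnorm_open.
 by rewrite /= -(@bdist_bsub _ _ _ x) // bdistxx.
move=> [[A B] /= [nA nB] AB].
have nAB : nbhs b (A `&` B) by exact: filterI.
exists (A `&` B)^°; split; [exact: open_interior|exact: nAB|].
move=> c c' /interior_subset[Ac _] /interior_subset[_ Bc'] cc'.
by rewrite bdist_bsub //; exact: (AB (c, c')).
Qed.

(* [f] is continuous at [x] up to the error [e], with approximate value [b] *)
Let good (e : X -> R) (f : X -> E) (x : X) (b : E) :=
 [/\ bpr b = x, bdist x (f x) b <= e x & forall W, nbhs b W -> \forall y \near x,
  exists c, [/\ W c, bpr c = y & bdist y (f y) c <= e y]].

Let good_add e f e' f' x b b' : is_section f -> is_section f' ->
 good e f x b -> good e' f' x b' ->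
 good (fun y => e y + e' y) (fun y => badd (f y) (f' y)) x (badd b b').
Proof.
move=> sf sf' [pb bf h] [pb' bf' h'].
have dist_add y c c' : bpr c = y -> bpr c' = y ->
  bdist y (badd (f y) (f' y)) (badd c c') <= bdist y (f y) c + bdist y (f' y) c'.
 move=> pc pc'; rewrite !bdistE !(@bco_badd _ _ _ y) // opprD addrACA.
 exact: rnD.
split; first by rewrite bpr_badd.
 by apply: le_trans (dist_add _ _ _ pb pb') _; exact: lerD.
move=> W nW.
have hadd : {within [set p : E * E | bpr p.1 = bpr p.2], continuous (fun p => badd p.1 p.2)}.
 by case: hE => _ [].
have hb : [set p : E * E | bpr p.1 = bpr p.2] (b, b') by rewrite /= pb pb'.
move/subspace_continuousP : hadd => /(_ _ hb).
rewrite /from_subspace /= => /(_ _ nW) [[A B] /= [nA nB] AB].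
near=> y.
have [c [Ac pc dc]] : exists c, [/\ A c, bpr c = y & bdist y (f y) c <= e y].
 by near: y; exact: h.
have [c' [Bc' pc' dc']] : exists c, [/\ B c, bpr c = y & bdist y (f' y) c <= e' y].
 by near: y; exact: h'.
exists (badd c c'); split; first by apply: (AB (c, c')) => //=; rewrite pc.
 by rewrite bpr_badd.
by apply: le_trans (dist_add _ _ _ pc pc') _; exact: lerD.
Unshelve. all: by end_near. Qed.

Let good_scale e f x b (phi : X -> R) : is_section f -> (forall y, 0 <= phi y) ->
 phi @ x --> phi x -> good e f x b ->
 good (fun y => phi y * e y) (fun y => bscale (phi y)%:C (f y)) x (bscale (phi x)%:C b).
Proof.
move=> sf p0 cphi [pb bf h].
have dist_scale y c : bpr c = y ->
  bdist y (bscale (phi y)%:C (f y)) (bscale (phi y)%:C c) = phi y * bdist y (f y) c.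
 by move=> pc; rewrite !bdistE !(@bco_bscale _ _ _ y) // -scalerBr rnZ rn_pos.
split; first by rewrite bpr_bscale.
 by rewrite dist_scale // ler_wpM2l.
move=> W nW.
have cs : continuous (fun p : R[i]^o * E => bscale p.1 p.2).
 by apply: bscale_cont => //; [exact: cont_fst|exact: cont_snd].
have [[A B] /= [nA nB] AB] := cs ((phi x)%:C, b) _ nW.
have nA' : \forall y \near x, A (phi y)%:C.
 move/nbhs_rnP : nA => [d d0 hA].
 have /cvgrPdist_lt/(_ _ d0) := cphi; apply: filterS => y hy; apply: hA.
 by rewrite -rmorphB rn_real.
near=> y.
have [c [Bc pc dc]] : exists c, [/\ B c, bpr c = y & bdist y (f y) c <= e y].
 by near: y; exact: h.
exists (bscale (phi y)%:C c); split.
- by apply: (AB ((phi y)%:C, c)) => /=; split=> //; near: y.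
- by rewrite bpr_bscale.
- by rewrite dist_scale // ler_wpM2l.
Unshelve. all: by end_near. Qed.

Let good_zero e f x (phi : X -> R) : is_section f -> (\forall y \near x, phi y = 0) ->
 good (fun y => phi y * e y) (fun y => bscale (phi y)%:C (f y)) x (bzero E x).
Proof.
move=> sf p0.
have z y : phi y = 0 -> bdist y (bscale (phi y)%:C (f y)) (bzero E y) <= phi y * e y.
 move=> py; rewrite py mul0r bdistE bco_zero (@bco_bscale _ _ _ y) //.
 by rewrite scale0r subrr rn0.
split; first exact: bpr_bzero.
 by apply: z; exact: nbhs_singleton p0.
move=> W nW; have := bzero_cont hE nW; move: p0; apply: filterS2 => y py Wy.
by exists (bzero E y); split=> //; [exact: bpr_bzero|exact: z].
Qed.

Let eps_section (K : set X) (e : R) (f : X -> E) :=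
 is_section f /\ forall x, K x -> exists b, good (fun=> e) f x b.

(** The bundle projection is open, so for y near [x] each neighbourhood of [g x] inside the thin set
    [W] has a point over y; that point is close to [g y], which lies in [W] too. *)
Let good_thin (W : set E) (e : R) (g : X -> E) x : open W ->
 (forall c c', W c -> W c' -> bpr c = bpr c' -> bdist (bpr c') c c' < e) ->
 is_section g -> (\forall y \near x, W (g y)) -> good (fun=> e) g x (g x).
Proof.
move=> oW hW sg Wg; have e0 : 0 <= e.
 have Wgx := nbhs_singleton Wg.
 by have := hW _ _ Wgx Wgx erefl; rewrite bdistxx => /ltW.
split=> //; first by rewrite bdistxx.
move=> W' nW'; have nW : nbhs (g x) (W `&` W').
 by apply: filterI => //; apply: open_nbhs_nbhs; split=> //; exact: nbhs_singleton Wg.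
have op : open (@bpr _ _ E @` (W `&` W')^°) by apply: bpr_open => //; exact: open_interior.
have : nbhs x (@bpr _ _ E @` (W `&` W')^°).
 by apply: open_nbhs_nbhs; split=> //; exists (g x) => //; exact: nW.
move: Wg; apply: filterS2 => y Wgy [c /interior_subset[Wc W'c] pc].
exists c; split=> //; apply/ltW; rewrite -{1}pc; apply: hW => //.
by rewrite sg pc.
Qed.

Let good_mono e e' f x b : (forall y, e y <= e' y) -> good e f x b -> good e' f x b.
Proof.
move=> ee' [pb bf h]; split=> //; first exact: le_trans bf (ee' x).
move=> W /h; apply: filterS => y [c [Wc pc cd]]; exists c; split=> //.
exact: le_trans cd (ee' y).
Qed.

Let thin_section (x : X) (b : E) (e : R) (P : X -> E -> Prop) : 0 < e ->
 (forall W, nbhs b W -> \forall y \near x, exists c, [/\ W c, bpr c = y & P y c]) ->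
 exists (g : X -> E) (U : set X), [/\ is_section g, nbhs x U, forall y, U y -> P y (g y) &
  forall y, U^° y -> good (fun=> e) g y (g y)].
Proof.
move=> e0 hb; have [W [oW Wb hW]] := bsub_near b e0.
pose Q y := [set c | [/\ W c, bpr c = y & P y c]].
have nU : nbhs x [set y | exists c, Q y c] by apply: hb; exact: open_nbhs_nbhs.
pose g y := xget (bzero E y) (Q y).
have sg : is_section g.
 by move=> y; rewrite /g; case: xgetP => [c _ [_ ->]|_] //; rewrite bpr_bzero.
have Qg y : (exists c, Q y c) -> Q y (g y).
 by move=> [c Pc]; rewrite /g; case: xgetP => // /(_ c).
exists g, [set y | exists c, Q y c]; split=> // [y /Qg[]//|y Uy].
apply: (good_thin oW hW sg); apply: filterS (Uy) => z /Qg[]//.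
Qed.

(** One step of a Michael-type selection. Locally there are choices within [e] of [f] that are
    continuous up to e/2; their normalized average by bump functions has both properties again, as
    both are convex conditions in each fibre. *)
Let sel_step (K : set X) (e : R) (f : X -> E) : compact K -> 0 < e ->
 eps_section K e f -> exists f', eps_section K (e / 2) f' /\
  forall y, K y -> bdist y (f' y) (f y) <= e.
Proof.
move=> cK e0 [sf gf].
have loc x : exists gp : (X -> E) * (X -> R), K x -> [/\ is_section gp.1,
  forall y, 0 <= gp.2 y, continuous gp.2, 0 < gp.2 x &
  forall y, (0 < gp.2 y -> bdist y (gp.1 y) (f y) <= e) /\
   exists b, good (fun z => gp.2 z * (e / 2)) (fun z => bscale (gp.2 z)%:C (gp.1 z)) y b].
 have [Kx|] := pselect (K x); last by exists (f, fun=> 0).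
 have [b [pb _ hb]] := gf x Kx.
 have [g [U [sg nU Pg gg]]] := @thin_section x b (e / 2) (fun y c => bdist y (f y) c <= e) (halfR_gt0 e0) hb.
 have nU' : nbhs x U^° by apply: open_nbhs_nbhs; split; [exact: open_interior|exact: nU].
 have [phi [cphi p0 px pz]] := bump R hX lX nU'.
 exists (g, phi) => _; split=> // y; split.
  move=> /= py; have /interior_subset Uy : U^° y.
   apply: contrapT => ny; have /nbhs_singleton p00 := pz y ny.
   by move: py; rewrite p00 ltxx.
  by rewrite bdistC; exact: Pg.
 have [Uy|nUy] := pselect (U^° y).
  by exists (bscale (phi y)%:C (g y)); apply: good_scale => //; [exact: cphi|exact: gg].
 by exists (bzero E y); apply: good_zero => //; exact: pz.
have [gp gpP] := choice loc.
move: (cK); rewrite compact_cover => cc.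
have [||l lK Kl] := cc X K (fun x => (gp x).2 @^-1` [set r | 0 < r]).
- move=> x Kx; have [_ _ c _ _] := gpP x Kx.
 by apply: open_comp; [move=> y _; exact: c|exact: open_gt].
- by move=> x Kx; exists x => //; have [] := gpP x Kx.
have {}lK x : x \in finmap.enum_fset l -> K x by move=> xl; have := lK x xl; rewrite inE.
pose Phi L y := \sum_(x <- L) (gp x).2 y.
pose Sum L y := foldr (fun x a => badd (bscale ((gp x).2 y)%:C ((gp x).1 y)) a) (bzero E y) L.
have Phi0 L y : (forall x, x \in L -> K x) -> 0 <= Phi L y.
 move=> LK; rewrite /Phi big_seq; apply: sumr_ge0 => x xL.
 by have [_ p0 _ _ _] := gpP x (LK x xL).
have LH x (L : seq X) : (forall z, z \in x :: L -> K z) -> K x /\ forall z, z \in L -> K z.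
 by move=> h; split=> [|z zL]; apply: h; rewrite inE ?eqxx // zL orbT.
have sSum L : (forall x, x \in L -> K x) -> is_section (Sum L).
 case: L => [|x L] LK y; first exact: bpr_bzero.
 have [Kx _] := LH _ _ LK; have [sx _ _ _ _] := gpP x Kx.
 by rewrite /Sum /= bpr_badd bpr_bscale sx.
have dSum L y : (forall x, x \in L -> K x) ->
  bdist y (Sum L y) (bscale (Phi L y)%:C (f y)) <= Phi L y * e.
 elim: L => [|x L IH] LK.
  by rewrite /Phi big_nil /Sum /= mul0r bdistE bco_zero (@bco_bscale _ _ _ y) // scale0r subrr rn0.
 have [Kx {}LK] := LH _ _ LK; have [sx p0 _ _ hx] := gpP x Kx.
 have := IH LK; rewrite /Phi big_cons -/(Phi L y) /Sum /= -/(Sum L y) !bdistE.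
 rewrite !(@bco_bscale _ _ _ y) // (@bco_badd _ _ _ y); last by rewrite bpr_bscale sx.
 rewrite (@bco_bscale _ _ _ y) // rmorphD /= scalerDl opprD addrACA -scalerBr.
 move=> h; apply: le_trans (rnD _ _) _; rewrite mulrDl; apply: lerD => //.
 rewrite rnZ rn_pos //; have [hx' _] := hx y.
 have [->|px] := eqVneq ((gp x).2 y) 0; first by rewrite !mul0r.
 by rewrite ler_wpM2l // hx' // lt_neqAle eq_sym px p0.
have gSum L y : (forall x, x \in L -> K x) ->
  exists b, good (fun z => Phi L z * (e / 2)) (Sum L) y b.
 elim: L => [|x L IH] LK.
  exists (bzero E y); split; first exact: bpr_bzero.
   by rewrite /Phi big_nil mul0r bdistxx.
  move=> W nW; have : nbhs y (bzero E @^-1` W) := bzero_cont hE nW.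
  apply: filterS => z Wz; exists (bzero E z); split=> //.
   exact: bpr_bzero.
  by rewrite /Phi big_nil mul0r bdistxx.
 have [Kx {}LK] := LH _ _ LK; have [sx p0 _ _ hx] := gpP x Kx.
 have [b hb] := IH LK; have [_ [b' hb']] := hx y.
 have sx' : is_section (fun z => bscale ((gp x).2 z)%:C ((gp x).1 z)).
  by move=> z; rewrite bpr_bscale sx.
 exists (badd b' b); have := good_add sx' (sSum _ LK) hb' hb.
 by apply: good_mono => z; rewrite -mulrDl /Phi big_cons.
pose L := finmap.enum_fset l.
have hp y : K y -> 0 < Phi L y.
 move=> Ky; have [x /= xl px] := Kl y Ky.
 rewrite /Phi (perm_big _ (perm_to_rem xl)) /= big_cons ltr_wpDr // big_seq.
 apply: sumr_ge0 => z /mem_rem zL; by have [_ p0 _ _ _] := gpP z (lK z zL).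
have cPhi M : (forall x, x \in M -> K x) -> continuous (Phi M : X -> R^o).
 elim: M => [|x M IH] LK.
  by rewrite (_ : Phi [::] = fun=> 0); [exact: cst_continuous|apply/funext => y; rewrite /Phi big_nil].
 have [Kx {}LK] := LH _ _ LK; have [_ _ cx _ _] := gpP x Kx.
 rewrite (_ : Phi _ = fun y => (gp x).2 y + Phi M y); last by apply/funext => y; rewrite /Phi big_cons.
 by move=> y; apply: (@cvgD _ R^o); [exact: cx|exact: IH].
exists (fun y => bscale (Phi L y)^-1%:C (Sum L y)); split; first split.
- by move=> y; rewrite bpr_bscale sSum.
- move=> y Ky; have [b hb] := gSum L y lK.
 exists (bscale (Phi L y)^-1%:C b).
 have /good_mono : forall z, (Phi L z)^-1 * (Phi L z * (e / 2)) <= e / 2.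
  move=> z; have [->|pz] := eqVneq (Phi L z) 0.
   by rewrite invr0 mul0r ltW // halfR_gt0.
  by rewrite mulKf.
 apply; apply: (@good_scale _ _ _ _ (fun z => (Phi L z)^-1)) => //.
 + exact: sSum.
 + by move=> z; rewrite invr_ge0 Phi0.
 + by apply: cvgV; [rewrite gt_eqF // hp|exact: cPhi].
- move=> y Ky; have := dSum L y lK; have py := hp y Ky.
 rewrite !bdistE (@bco_bscale _ _ _ y) // (@bco_bscale _ _ _ y); last exact: sSum.
 have {2}-> : bco y (f y) = (Phi L y)^-1%:C *: ((Phi L y)%:C *: bco y (f y)).
  by rewrite scalerA -rmorphM mulVf ?gt_eqF // scale1r.
 rewrite -scalerBr rnZ rn_pos ?invr_ge0 ?(ltW py) // => h.
 by rewrite ler_pdivrMl.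
Qed.

(** The displacements e, e/2, e/4, ... add up to at most 2 e, and the limit is continuous because
    the n-th section is continuous up to e/2^n. Only interior points of [K] are claimed, since the
    estimates hold on [K] alone. *)
Let sel_limit (K : set X) (e : R) (f : X -> E) : compact K -> 0 < e ->
 eps_section K e f -> exists g, [/\ is_section g,
  forall y, K y -> bdist y (g y) (f y) <= 2 * e & forall y, K^° y -> g @ y --> g y].
Proof.
move=> cK e0 ef.
have st (p : nat * (X -> E)) : exists f', eps_section K (e / 2 ^+ p.1) p.2 ->
  eps_section K (e / 2 ^+ p.1.+1) f' /\ forall y, K y -> bdist y (f' y) (p.2 y) <= e / 2 ^+ p.1.
 have [h|] := pselect (eps_section K (e / 2 ^+ p.1) p.2); last by exists f.
 have ep : 0 < e / 2 ^+ p.1 by rewrite divr_gt0 // exprn_gt0.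
 have [f' [h1 h2]] := sel_step cK ep h.
 by exists f' => _; split=> //; rewrite exprSr invfM mulrA.
have [nx nxP] := choice st.
pose F := fix F n := if n is m.+1 then nx (m, F m) else f.
have eF n : eps_section K (e / 2 ^+ n) (F n).
 by elim: n => [|n IH]; [rewrite expr0 divr1|have [] := nxP (n, F n) IH].
have dF n y : K y -> bdist y (F n.+1 y) (F n y) <= e / 2 ^+ n.
 by move=> Ky; have [_] := nxP (n, F n) (eF n); exact.
have h2 n : 0 < 2 ^+ n :> R by rewrite exprn_gt0.
have dF2 n m y : K y -> bdist y (F (n + m)%N y) (F n y) <= 2 * e / 2 ^+ n - 2 * e / 2 ^+ (n + m).
 move=> Ky; elim: m => [|m IH]; first by rewrite addn0 bdistxx subrr.
 rewrite addnS; apply: le_trans (bdist_tri _ _ (F (n + m)%N y) _) _.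
 have := dF (n + m)%N y Ky; rewrite exprSr invfM !mulrA.
 by rewrite (_ : 2 * e / 2 ^+ (n + m) / 2 = e / 2 ^+ (n + m)); [lra|field; rewrite gt_eqF].
have dF3 n m y : K y -> bdist y (F (n + m)%N y) (F n y) <= 2 * e / 2 ^+ n.
 move=> Ky; apply: le_trans (dF2 n m y Ky) _; rewrite gerBl divr_ge0 ?mulr_ge0 ?ltW //.
have small (d : R) : 0 < d -> exists n, 3 * e / 2 ^+ n < d.
 move=> d0; exists (Num.Def.truncn (3 * e / d)).+1; rewrite ltr_pdivrMr // -ltr_pdivrMl // mulrC.
 apply: lt_trans (truncnS_gt _) _; rewrite -natrX ltr_nat; exact: ltn_expl.
have lim y : exists v : fib E y, K y -> forall n, rn (bco y (F n y) - v) <= 2 * e / 2 ^+ n.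
 have [Ky|] := pselect (K y); last by exists 0.
 have [|v uv] := @rn_complete R _ (fun n => bco y (F n y)).
  move=> d d0; have [N hN] := small _ (halfR_gt0 d0); exists N => i j Ni Nj.
  have := dF3 N (i - N)%N y Ky; have := dF3 N (j - N)%N y Ky; rewrite !subnKC // => hj hi.
  have := bdist_tri y (F i y) (F N y) (F j y); rewrite (bdistC _ (F N y)) !bdistE in hi hj *.
  have : 2 * e / 2 ^+ N <= 3 * e / 2 ^+ N by rewrite ler_wpM2r ?invr_ge0 ?ltW //; lra.
  lra.
 exists v => _ n; apply/ler_addgt0Pr => d d0; have [N hN] := uv _ d0.
 have := rn_tri (bco y (F n y)) (bco y (F (n + N)%N y)) v.
 have := hN (n + N)%N (leq_addl _ _); have := dF3 n N y Ky; rewrite bdistE (rn_distC (bco _ (F (n + N)%N y)) (bco _ (F n y))); lra.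
pose g y : E := binj (xget 0 [set v : fib E y | K y -> forall n, rn (bco y (F n y) - v) <= 2 * e / 2 ^+ n]).
have gP y n : K y -> bdist y (F n y) (g y) <= 2 * e / 2 ^+ n.
 move=> Ky; rewrite bdistE /g bcoE; have [v hv] := lim y.
 by case: xgetP => [w _ hw|/(_ v)//]; exact: hw.
have pg y : bpr (g y) = y by exact: bpr_binj.
exists g; split=> // [y Ky|y0 Ky0].
 by have := gP y 0 Ky; rewrite bdistC /= expr0 divr1.
apply: (bundle_cvg hE) => d d0; have [n hn] := small _ d0.
have Ky0' := interior_subset Ky0.
have [_ /(_ y0 Ky0') [b [pb bf hb]]] := eF n.
have E3 : 3 * e / 2 ^+ n = 2 * e / 2 ^+ n + e / 2 ^+ n by rewrite -mulrDl; congr (_ / _); ring.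
exists b; split; first by rewrite pb pg.
 rewrite pb; have := bdist_tri y0 b (F n y0) (g y0); have := gP y0 n Ky0'.
 by rewrite (bdistC _ b (F n y0)); lra.
move=> W /hb; move: (Ky0); rewrite /interior /=; apply: filterS2 => y Ky [c [Wc pc dc]].
exists c; split=> //; first by rewrite pg.
rewrite pg; have := bdist_tri y (g y) (F n y) c; have := gP y n Ky.
by rewrite (bdistC _ (g y) (F n y)); lra.
Qed.

Theorem enough_sections (x : X) (a : E) (e : R) : bpr a = x -> 0 < e ->
 exists2 f, Gammac E f & bdist x (f x) a < e.
Proof.
(* The error budget: e/4 from the thin neighbourhood of [a] and 2 (e/4) from the selection. *)
move=> ax e0; have e4 : 0 < e / 4 by rewrite divr_gt0.
have [W [oW Wa hW]] := bsub_near a e4.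
have [|g [U [sg nU Pg gg]]] := @thin_section x a (e / 4) (fun y c => W c) e4.
 move=> V nV; have nWV : nbhs a (W `&` V) by apply: filterI => //; exact: open_nbhs_nbhs.
 have op : open (@bpr _ _ E @` (W `&` V)^°) by apply: (bpr_open hE); exact: open_interior.
 have : nbhs x (@bpr _ _ E @` (W `&` V)^°).
  by apply: open_nbhs_nbhs; split=> //; exists a => //; exact: nWV.
 by apply: filterS => y [c /interior_subset[Wc Vc] pc]; exists c.
have nU' : nbhs x U^° by apply: open_nbhs_nbhs; split; [exact: open_interior|exact: nU].
have [phi [cphi p0 px pz]] := bump R hX lX nU'.
have [M nM cM] := lc_lcpt lX x.
pose K := M `&` [set y | phi x / 2 <= phi y].
have cK : compact K.
 apply: compact_closedI => //; have := closed_comp (f := phi) (D := [set r | phi x / 2 <= r]).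
 by apply; [move=> y _; exact: cphi|exact: closed_ge].
have KU y : K y -> U^° y.
 move=> [_ /= py]; apply: contrapT => ny; have /nbhs_singleton p00 := pz y ny.
 by move: py; rewrite p00; have := px; lra.
have nK : nbhs x K.
 apply: filterI => //; have : \forall y \near x, phi x / 2 < phi y.
  by apply: (cvgr_gt (phi x)); [exact: cphi|lra].
 by apply: filterS => y /ltW.
have eK : eps_section K (e / 4) g by split=> // y /KU/gg h; exists (g y).
have [f [sf df cf]] := sel_limit cK e4 eK.
have nK' : nbhs x K^° by apply: open_nbhs_nbhs; split; [exact: open_interior|exact: nK].
have [psi [cpsi q0 qx qz]] := bump R hX lX nK'.
exists (fun y => bscale (psi y / psi x)%:C (f y)).
 apply/(GammacP hX); split.
 - by move=> y; rewrite bpr_bscale sf.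
 - move=> y; have [Ky|nKy] := pselect (K^° y).
   apply: (bscale_cvg hE); last exact: cf.
   apply/rn_cvgP => d d0; have cq : (fun y => psi y / psi x : R^o) @ y --> (psi y / psi x : R^o).
    by apply: cvgM; [exact: cpsi|exact: cvg_cst].
   by have /cvgrPdist_lt/(_ _ d0) := cq; apply: filterS => z; rewrite -rmorphB rn_real.
  have := qz y nKy => hz V.
  have -> : bscale (psi y / psi x)%:C (f y) = bzero E y.
   rewrite (nbhs_singleton hz) mul0r; apply: (@bco_eq _ _ _ y).
   + by rewrite bpr_bscale sf.
   + exact: bpr_bzero.
   + by rewrite bco_bscale ?sf // scale0r bco_zero.
  move=> /(bzero_cont hE); move: hz; apply: filterS2 => z hz Vz /=.
  suff -> : bscale (psi z / psi x)%:C (f z) = bzero E z by [].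
  rewrite hz mul0r; apply: (@bco_eq _ _ _ z).
  + by rewrite bpr_bscale sf.
  + exact: bpr_bzero.
  + by rewrite bco_bscale ?sf // scale0r bco_zero.
 - exists K => // y nKy; have /qz/nbhs_singleton -> : ~ K^° y by move=> /interior_subset.
  apply: (@bco_eq _ _ _ y); first by rewrite bpr_bscale sf.
   exact: bpr_bzero.
  by rewrite bco_bscale ?sf // mul0r scale0r bco_zero.
have Kx := nbhs_singleton nK.
have := bdist_tri x (f x) (g x) a; have := df x Kx.
have := hW (g x) a (Pg x (nbhs_singleton nU)) Wa; rewrite sg ax => /(_ erefl).
rewrite divff ?gt_eqF // !bdistE (@bco_bscale _ _ _ x) // scale1r; lra.
Qed.

End EnoughSections.

(** * Cauchy-Schwarz inequality and a decay estimate *)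

Lemma sqr_le (R : realType) (a b : R) : 0 <= b -> a ^+ 2 <= b ^+ 2 -> a <= b.
Proof. by move=> b0 h; rewrite leNgt; apply/negP => ba; move: h; nra. Qed.

Section CauchySchwarz.
Variables (R : realType) (B : cstar_algebra R).
Local Notation cp := (cpos (@cmul R B) (@cstar R B)).

(* the hypothesis is the positivity of [<x t b - y, x t b - y>] for [b = <x, y>],
  [p = <x, x>], [q = <y, y>] *)
Lemma cauchy_schwarz (p q b : B) : cp p ->
 (forall t : R, cp ((t ^+ 2)%:C *: cmul (cstar b) (cmul p b) - (t *+ 2)%:C *: cmul (cstar b) b + q)) ->
 rn b ^+ 2 <= rn p * rn q.
Proof.
move=> pp h; apply: (le_small (rn_ge0 q)) => e e0; rewrite -mulrDl.
(* The quadratic is used at t = 1/M. As p <= M, its first term is at most b^* b / M, which leaves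
   b^* b / M <= q. The summand [e] keeps [M] positive when p = 0. *)
set M := rn p + e; have M0 : 0 < M by rewrite ltr_wpDl ?rn_ge0.
have pM : rn p <= M by rewrite lerDl ltW.
have h1 := cpos_conj_bound b (cpos_star pp) pM.
have M2 : 0 <= M^-1 ^+ 2 by rewrite sqr_ge0.
have := cposD (h M^-1) (cposZ M2 h1).
rewrite scalerBr scalerA -rmorphM.
have -> : M^-1 ^+ 2 * M = M^-1 by rewrite expr2 mulfVK // gt_eqF.
set u := _ *: cmul _ (cmul _ _); rewrite mulr2n rmorphD /= scalerDl.
set v := M^-1%:C *: _ => H.
have {}H : cp (q - v).
 by move: H; congr cp; rewrite addrC addrA addrA subrK opprD addrA subrr add0r addrC.
have cv : cp v by apply: cposZ; [rewrite invr_ge0 ltW|exact: cpos_mul].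
have := cpos_mono cv H; rewrite rnZ rn_pos ?invr_ge0 ?(ltW M0) // rn_cstar_mul.
by rewrite ler_pdivrMl.
Qed.

Local Notation U := (unitization B).
Local Notation n := (@unm R U).

Lemma upos_powers (q : U) (k : nat) : upos q -> ust (q ^+ k) = q ^+ k /\ upos (q ^+ k).
Proof.
move=> uq; have sq := uq.1; have sk m : ust (q ^+ m) = q ^+ m.
 elim: m => [|m IH]; first by rewrite expr0 ust1.
 by rewrite {1}exprSr ustM IH sq exprS.
split=> //; have [r [sr rr ur cr]] := upos_sqrt uq.
have srk m : ust (r ^+ m) = r ^+ m.
 elim: m => [|m IH]; first by rewrite expr0 ust1.
 by rewrite {1}exprSr ustM IH sr exprS.
by rewrite -rr -expr2 -exprM mulnC exprM expr2; apply: upos_self_sq.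
Qed.

(* [(m+1) q^m z <= \sum_(k <= m) q^k z = 1 - q^(m+1) <= 1] *)
Lemma power_decay (z : U) (m : nat) : upos z -> n z <= 1 ->
 m.+1%:R * n ((1 - z) ^+ m * z) <= 1.
Proof.
move=> uz z1; set q := 1 - z.
have uq : upos q.
 by have := upos_bound ler01 uz.1 z1; rewrite rmorph1 scale1r.
have zq : z * q = q * z by rewrite /q mulrBr mulrBl mul1r mulr1.
have zqk k : z * q ^+ k = q ^+ k * z by rewrite (commrX k (zq : GRing.comm z q)).
have pqz k : upos (q ^+ k * z).
 have [s [ss sz us cs]] := upos_sqrt uz.
 have -> : q ^+ k * z = ust s * q ^+ k * s.
  by rewrite ss -sz mulrA; congr (_ * _); apply: cs; rewrite zqk.
 exact: upos_conj (upos_powers k uq).2.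
have dec k : upos (q ^+ k * z - q ^+ k.+1 * z).
 have -> : q ^+ k * z - q ^+ k.+1 * z = ust z * q ^+ k * z.
  have qz : z - q * z = z * z.
   by rewrite -{1}[z]mul1r -mulrBl; congr (_ * _); rewrite /q opprB addrC subrK.
  by rewrite uz.1 zqk exprSr -!mulrA -mulrBr qz.
 exact: upos_conj (upos_powers k uq).2.
have dec2 k j : upos (q ^+ k * z - q ^+ (k + j) * z).
 elim: j => [|j IH]; first by rewrite addn0 subrr; exact: upos0.
 by have := uposD IH (dec (k + j)%N); rewrite addrA subrK addnS.
have tel j : \sum_(k < j) q ^+ k * z = 1 - q ^+ j.
 elim: j => [|j IH]; first by rewrite big_ord0 expr0 subrr.
 rewrite big_ord_recr /= IH exprSr -addrA; congr (_ + _).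
 by rewrite /q mulrBr mulr1 opprB addrC.
have le j : (j <= m.+1)%N -> upos (\sum_(k < j) q ^+ k * z - (q ^+ m * z) *+ j).
 elim: j => [|j IH] jm; first by rewrite big_ord0 mulr0n subrr; exact: upos0.
 rewrite big_ord_recr /= mulrSr opprD addrACA; apply: uposD; first exact: IH (ltnW jm).
 by have := dec2 j (m - j)%N; rewrite subnKC.
have h1 : upos (1 - (q ^+ m * z) *+ m.+1).
 have := uposD (le m.+1 (leqnn _)) (upos_powers m.+1 uq).2.
 by rewrite tel -addrA addrACA addNr addr0 addrC.
have h0 : upos ((q ^+ m * z) *+ m.+1).
 by elim: (m.+1) => [|j IH]; [exact: upos0|rewrite mulrSr; exact: uposD].
have := upos_le1 h0 h1.
by rewrite -scaler_nat unmZ -(rmorph_nat (@real_complex R)) rn_pos.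
Qed.

End CauchySchwarz.

(** * Haar measure *)

Section GroupTopology.
Variables (G : topGroupType) (H : closed_subgroup G).
Local Notation T := (subg_type H).

Lemma mul_cont (T' : topologicalType) (f g : T' -> G) : continuous f -> continuous g ->
 continuous (fun t => (f t * g t)%g).
Proof. by move=> cf cg; apply: cont_comp (cont_pair cf cg) (@mulg_cont G). Qed.
Lemma inv_cont (T' : topologicalType) (f : T' -> G) : continuous f ->
 continuous (fun t => (f t)^-1%g).
Proof. by move=> cf; apply: cont_comp cf (@invg_cont G). Qed.

Definition mulset (K L : set G) : set G := [set (p.1 * p.2)%g | p in K `*` L].
Definition invset (K : set G) : set G := [set x^-1%g | x in K].

Lemma mulsetI (K L : set G) x y : K x -> L y -> mulset K L (x * y)%g.
Proof. by move=> Kx Ly; exists (x, y). Qed.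
Lemma mulset_eq (K L : set G) x y z : K x -> L y -> z = (x * y)%g -> mulset K L z.
Proof. by move=> ? ? ->; exact: mulsetI. Qed.
Lemma invsetI (K : set G) x : K x -> invset K x^-1%g.
Proof. by move=> Kx; exists x. Qed.
Lemma mulset_compact (K L : set G) : compact K -> compact L -> compact (mulset K L).
Proof.
move=> cK cL; apply: continuous_compact; last exact: compact_setX.
exact/continuous_subspaceT/mulg_cont.
Qed.

Lemma invset_compact (K : set G) : compact K -> compact (invset K).
Proof.
move=> cK; apply: continuous_compact => //; exact/continuous_subspaceT/invg_cont.
Qed.

Lemma nbhs_subg (h : T) (B : set T) : nbhs h B ->
 exists2 V, nbhs (subg_inc h) V & forall k, V (subg_inc k) -> B k.
Proof.
rewrite nbhsE /= => -[U [[V oV VO] Oh] OB]; exists V.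
 by apply: open_nbhs_nbhs; split=> //; move: Oh; rewrite -VO.
by move=> k Vk; apply: OB; rewrite -VO.
Qed.

Lemma subg_compact (K : set G) : compact K -> compact [set h : T | K (subg_inc h)].
Proof.
move=> cK F FF FK.
have [x [Kx clx]] := cK (@subg_inc G H @ F) _ FK.
have Hx : subg_set H x.
 apply: (@subg_closed G H) => B nB.
 have [|y [Hy By]] := clx (subg_set H) B _ nB; last by exists y.
 by apply: (@filterE _ F) => h /=; exact: subg_incP.
exists (subg_elt Hx); split=> // A B FA /nbhs_subg[V nV VB].
have [|y [[h Ah <-] Vy]] := clx (@subg_inc G H @` A) V _ nV.
 by apply: (@filterS _ F _ A) FA => h Ah; exists h.
by exists h; split=> //; exact: VB.
Qed.

Lemma subg_hausdorff : hausdorff_space G -> hausdorff_space T.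
Proof.
move=> hG h k hk; apply: subg_inc_inj; apply: hG => A B nA nB.
have [||l []] := hk (@subg_inc G H @^-1` A) (@subg_inc G H @^-1` B); last by exists (subg_inc l).
all: exact: (@subg_inc_cont G H).
Qed.

Lemma subg_lcpt : lcpt G -> lcpt T.
Proof.
move=> lG h; have [M nM cM] := lG (subg_inc h); exists [set k : T | M (subg_inc k)].
 exact: (@subg_inc_cont G H).
exact: subg_compact.
Qed.

Lemma prod_lcpt (S U : topologicalType) : lcpt S -> lcpt U -> lcpt (S * U)%type.
Proof.
move=> lS lU [s u]; have [M nM cM] := lS s; have [N nN cN] := lU u.
by exists (M `*` N); [exists (M, N)|exact: compact_setX].
Qed.

Lemma prod_hausdorff (S U : topologicalType) : hausdorff_space S -> hausdorff_space U ->
 hausdorff_space (S * U)%type.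
Proof.
move=> hS hU [s u] [s' u'] cl; congr pair.
 apply: hS => A B nA nB; have [||[a b] [/= Aa Ba]] := cl (A `*` setT) (B `*` setT).
 - by exists (A, setT) => //; split=> //; exact: filterT.
 - by exists (B, setT) => //; split=> //; exact: filterT.
 - by exists a; split; [case: Aa|case: Ba].
apply: hU => A B nA nB; have [||[a b] [/= Aa Ba]] := cl (setT `*` A) (setT `*` B).
- by exists (setT, A) => //; split=> //; exact: filterT.
- by exists (setT, B) => //; split=> //; exact: filterT.
- by exists b; split; [case: Aa|case: Ba].
Qed.

Local Notation coset := (@coset_of G H).

Lemma coset_nbhs (t : G) (A : set G) : nbhs t A -> nbhs (coset t) (coset @` A).
Proof.
rewrite nbhsE /= => -[U [oU Ut] UA].
have : open_nbhs (coset t) (coset @` U) by split; [exact: coset_of_open|exists t].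
by move=> /open_nbhs_nbhs; apply: filterS => _ [x /UA Ax <-]; exists x.
Qed.

(** For a closed subgroup, lying in different cosets is an open condition on pairs, and the open
    quotient map carries a box of such pairs to separated neighbourhoods. *)
Lemma coset_hausdorff : hausdorff_space (coset_space H).
Proof.
move=> p q; rewrite -(coset_reprK p) -(coset_reprK q).
set s := coset_repr p; set t := coset_repr q => cl; apply/coset_eqP; apply: contrapT => st.
have co : open [set z : G * G | ~ subg_set H (z.1^-1 * z.2)%g].
 apply: (@open_comp _ _ (fun z : G * G => (z.1^-1 * z.2)%g) (~` subg_set H)).
  by move=> z _; apply: mul_cont; [apply: inv_cont; exact: cont_fst|exact: cont_snd].
 exact/closed_openC/(@subg_closed G H).
have [[A B] /= [nA nB] AB] : nbhs (s, t) [set z : G * G | ~ subg_set H (z.1^-1 * z.2)%g].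
 exact: open_nbhs_nbhs.
have [_ [[a Aa <-] [b Bb /coset_eqP ba]]] := cl _ _ (coset_nbhs nA) (coset_nbhs nB).
by apply: (AB (a, b)) => //=; have := subgV ba; rewrite invgM invgK.
Qed.

Lemma coset_lcpt : lcpt G -> lcpt (coset_space H).
Proof.
move=> lG q; rewrite -(coset_reprK q); have [M nM cM] := lG (coset_repr q).
exists (coset @` M); first exact: coset_nbhs.
apply: continuous_compact => //; exact/continuous_subspaceT/coset_of_cont.
Qed.

Lemma coset_compact (K : set G) : compact K -> compact (coset @` K).
Proof.
move=> cK; apply: continuous_compact => //; exact/continuous_subspaceT/coset_of_cont.
Qed.

(** The quotient map is open, so images of compact neighbourhoods are neighbourhoods and finitely
    many of them cover. This supplies compact sets of coset representatives. *)
Lemma coset_lift (L : set (coset_space H)) : lcpt G -> compact L ->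
 exists2 K, compact K & L `<=` coset @` K.
Proof.
move=> lG cL; move: (cL); rewrite compact_cover => cc.
have [M hM] := choice (fun t => let: ex_intro2 M nM cM := lG t in ex_intro _ M (conj nM cM)).
have [||l lL Ll] := cc (coset_space H) L (fun q => (coset @` M (coset_repr q))^°).
- by move=> q _; exact: open_interior.
- move=> q Lq; exists q => //; rewrite /interior /= -{1}(coset_reprK q).
 by apply: coset_nbhs; case: (hM (coset_repr q)).
suff [K cK hK] : exists2 K, compact K & forall p, p \in finmap.enum_fset l ->
  M (coset_repr p) `<=` K.
 exists K => // q /Ll[p /= pl /interior_subset[t Mt <-]]; exists t => //.
 exact: hK pl _ Mt.
elim: (finmap.enum_fset l) => [|p s [K cK hK]]; first by exists set0 => //; exact: compact0.
exists (M (coset_repr p) `|` K) => [|r].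
 by apply: compactU => //; case: (hM (coset_repr p)).
by rewrite inE => /orP[/eqP -> t|/hK h t /h]; [left|right].
Qed.

Lemma coset_inv (t : G) (h : T) : coset (t * subg_inc h)%g = coset t.
Proof.
apply/coset_eqP; rewrite invgM -mulgA mulVg mulg1; apply: subgV; exact: subg_incP.
Qed.

End GroupTopology.

Lemma mulg_contr (G : topGroupType) (r : G) : continuous (fun s : G => (r * s)%g).
Proof. by apply: (mul_cont (f := fun=> r)) => [|s]; [exact: cst_continuous|exact: cvg_id]. Qed.

(** A hook inside [cts], redefined once products and adjoints in the Fell bundle are known to be
    continuous. *)
Ltac fell_cts := fail.
Ltac cts := cbv beta; repeat first
 [ fell_cts | exact: cont_fst | exact: cont_snd | exact: cst_continuous | assumption
 | exact: mulg_contr | exact: subg_inc_cont | exact: invg_cont | exact: coset_of_cont | (move=> ?; exact: cvg_id)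
 | lazymatch goal with
  | |- continuous (fun _ => (_ * _)%g) => apply: mul_cont
  | |- continuous (fun _ => (_^-1)%g) => apply: inv_cont
  | |- continuous (fun _ => subg_inc _) => apply: (cont_comp _ (@subg_inc_cont _ _))
  | |- continuous (fun _ => coset_of _ _) => apply: (cont_comp _ (@coset_of_cont _ _))
  | |- continuous (fun _ => (_, _)) => apply: cont_pair
  | |- continuous (fun _ => fst _) => apply: (cont_comp _ (@cont_fst _ _))
  | |- continuous (fun _ => snd _) => apply: (cont_comp _ (@cont_snd _ _))
  end
 | match goal with
  | h : continuous ?g |- continuous (fun _ => ?g _) => apply: (cont_comp _ h)
  end ].

Ltac gsimp := do ?[rewrite invgM | rewrite invgK | rewrite invg1];
 rewrite -?mulgA; do ?[rewrite mulKg | rewrite mulVKg | rewrite mulgV | rewrite mulVg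
  | rewrite mulg1 | rewrite mul1g].

Lemma bint_shift (R : realType) (L : topGroupType) (nu : borel_measure R L)
  (X : ptopologicalType) (E : bundle R X) (x : X) (f : L -> E) (r : L) :
 is_usc_banach_bundle E -> left_haar nu -> continuous f -> (forall s, bpr (f s) = x) ->
 bint nu x (fun s => f (r * s)%g) = bint nu x f.
Proof.
move=> hE [_ _ inv] cf pf; rewrite /bint /vint; congr binj.
have cm : continuous (fun s : L => (r * s)%g).
 by apply: (mul_cont (f := fun=> r)) => [|s]; [exact: cst_continuous|exact: cvg_id].
apply/esym/(@vintegral_transfer _ _ _ nu nu _ cm _ setT) => //.
 by move=> B mB; rewrite inv.
exact: bco_cont.
Qed.
Fixpoint Alls (T : Type) (P : T -> Prop) (s : seq T) : Prop :=
 if s is x :: s' then P x /\ Alls P s' else True.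

Lemma Alls_cat (T : Type) (P : T -> Prop) s s' : Alls P s -> Alls P s' -> Alls P (s ++ s').
Proof. by elim: s => //= x s IH [Px /IH h /h]. Qed.
Lemma Alls_map (S T : Type) (P : T -> Prop) (f : S -> T) (Q : S -> Prop) s :
 (forall x, Q x -> P (f x)) -> Alls Q s -> Alls P (map f s).
Proof. by move=> fP; elim: s => //= x s IH [/fP Px /IH]. Qed.

Section ScalarIntegrals.
Variables (R : realType) (S : ptopologicalType) (m : borel_measure R S).
Hypothesis hS : hausdorff_space S.
Hypothesis (mK : finite_on_compacts S m).
Local Notation I rho := (Rintegral m setT rho).
Implicit Types (rho : S -> R) (K : set S).

Definition rsupp K rho := [/\ continuous rho, compact K & forall s, ~ K s -> rho s = 0].

Lemma rsupp_sub K L rho : compact L -> K `<=` L -> rsupp K rho -> rsupp L rho.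
Proof. by move=> cL KL [cr _ r0]; split=> // s nL; apply: r0 => /KL. Qed.
Let int K rho : rsupp K rho -> m.-integrable (K : set (borel S)) (EFin \o rho).
Proof. by case=> cr cK _; exact: (cc_integrable hS mK cK cr). Qed.
Let IK K rho : rsupp K rho -> I rho = Rintegral m K rho.
Proof. by case=> _ _ r0; exact: Rint_supp. Qed.
Lemma rsuppD K rho rho' : rsupp K rho -> rsupp K rho' -> rsupp K (fun s => rho s + rho' s).
Proof.
move=> [cr cK r0] [cr' _ r0']; split=> // [s|s nK]; last by rewrite r0 // r0' // addr0.
by apply: (@cvgD _ R^o); [exact: cr|exact: cr'].
Qed.

Lemma rsuppZ K (c : R) rho : rsupp K rho -> rsupp K (fun s => c * rho s).
Proof.
move=> [cr cK r0]; split=> // [s|s nK]; last by rewrite r0 // mulr0.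
by apply: (@cvgM R^o); [exact: cvg_cst|exact: cr].
Qed.

Lemma RintD K rho rho' : rsupp K rho -> rsupp K rho' ->
 I (fun s => rho s + rho' s) = I rho + I rho'.
Proof.
move=> h h'; rewrite (IK (rsuppD h h')) (IK h) (IK h') RintegralD //.
- by apply: borel_compact => //; case: h.
- exact: int.
- exact: int.
Qed.

Lemma RintZ K (c : R) rho : rsupp K rho -> I (fun s => c * rho s) = c * I rho.
Proof.
move=> h; rewrite (IK (rsuppZ c h)) (IK h) RintegralZl //.
- by apply: borel_compact => //; case: h.
- exact: int.
Qed.

Lemma Rint_ge0 rho : (forall s, 0 <= rho s) -> 0 <= I rho.
Proof. by move=> h; apply: Rintegral_ge0. Qed.
Lemma Rint_close K rho rho' (e : R) : rsupp K rho -> rsupp K rho' ->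
 (forall s, K s -> `|rho s - rho' s| <= e) -> `|I rho - I rho'| <= e * fine (m K).
Proof.
move=> h h' d; have [cr cK _] := h; have [cr' _ _] := h'.
have mKK := borel_compact hS cK.
have cd : continuous (fun s => rho s - rho' s : R).
 by move=> s; apply: (@cvgB _ R^o); [exact: cr|exact: cr'].
have cn : continuous (fun s => `|rho s - rho' s| : R).
 by move=> s; apply: (@cvg_norm _ R^o); exact: cd.
rewrite (IK h) (IK h') -RintegralB //; [|exact: int|exact: int].
apply: le_trans (le_normr_Rintegral mKK (cc_integrable hS mK cK cd)) _.
rewrite -Rintegral_cst //; apply: le_Rintegral => //.
 exact: (cc_integrable hS mK cK cn).
by apply: (cc_integrable hS mK cK); exact: cst_continuous.
Qed.

Lemma Rint_gt0 K rho s0 : rsupp K rho -> (forall s, 0 <= rho s) -> 0 < rho s0 ->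
 (forall U : set S, open U -> U !=set0 -> (0 < m U)%E) -> 0 < I rho.
Proof.
move=> h r0 rs0 pos; have [cr cK rz] := h; have mKK := borel_compact hS cK.
pose U := [set s | rho s0 / 2 < rho s].
have oU : open U.
 by apply: (open_comp (f := rho) (D := [set r | rho s0 / 2 < r])); [move=> s _; exact: cr|exact: open_gt].
have UK : U `<=` K.
 by move=> s Us; apply: contrapT => /rz e; move: Us; rewrite /U /= e; lra.
have mU : measurable (U : set (borel S)) by exact: borel_open.
have pU : (0 < m U)%E by apply: pos => //; exists s0; rewrite /U /=; lra.
have fU : (m U < +oo)%E by apply: le_lt_trans (mK cK); apply: le_measure; rewrite ?inE.
have iU (f : S -> R) : continuous f -> m.-integrable (U : set (borel S)) (EFin \o f).
 by move=> cf; apply: integrableS (cc_integrable hS mK cK cf).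
have -> : I rho = Rintegral m U rho + Rintegral m (K `\` U) rho.
 have KE : K = U `|` (K `\` U) by rewrite setDUK.
 rewrite (IK h) {1}KE; apply: Rintegral_setU => //; first exact: measurableD.
  by rewrite -KE; exact: int.
 by apply/disj_setPS => t [Ut []].
apply: ltr_wpDr; first exact: Rintegral_ge0.
apply: lt_le_trans (_ : rho s0 / 2 * fine (m U) <= _).
 by rewrite mulr_gt0 ?fine_gt0 ?pU //; lra.
rewrite -Rintegral_cst //; apply: le_Rintegral => //.
- by apply: iU; exact: cst_continuous.
- exact: iU.
- by move=> s /ltW.
Qed.

Lemma Rint_cont (T : topologicalType) (F : S * T -> R) : continuous F ->
 (forall t0 : T, exists (M : set T) (K : set S), [/\ nbhs t0 M, compact K & forall s t, M t -> ~ K s -> F (s, t) = 0]) ->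
 continuous (fun t => I (fun s => F (s, t))).
Proof.
move=> cF hF t0; have [M [K [nM cK F0]]] := hF t0.
apply/(@cvgrPdist_lt _ R^o _ (nbhs t0)) => e e0.
have m0 : 0 <= fine (m K) by exact: fine_ge0.
have m1 : 0 < fine (m K) + 1 by lra.
have d0 := divr_gt0 e0 m1.
have nT : nbhs t0 [set t | forall s, K s -> `|F (s, t0) - F (s, t)| <= e / (fine (m K) + 1)].
 apply: (tube (P := fun t s => `|F (s, t0) - F (s, t)| <= e / (fine (m K) + 1)) cK) => s Ks.
 have cG : continuous (fun p : T * S => `|F (p.2, t0) - F (p.2, p.1)| : R).
  move=> p; apply: (@cvg_norm _ R^o); apply: (@cvgB _ R^o); apply: (cont_comp _ cF).
   by apply: cont_pair; [exact: cont_snd|exact: cst_continuous].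
  by apply: cont_pair; [exact: cont_snd|exact: cont_fst].
 have : \forall p \near (t0, s), `|F (p.2, t0) - F (p.2, p.1)| < e / (fine (m K) + 1).
  by apply: (cvgr_lt _ (cG (t0, s))); rewrite /= subrr normr0.
 by apply: filterS => p /ltW.
move: (nM) nT; apply: filterS2 => t Mt ht.
have sp u : M u -> rsupp K (fun s => F (s, u)).
 by move=> Mu; split=> // [|s nK]; [exact: cont_slice2|exact: F0].
apply: le_lt_trans (Rint_close (sp _ _) (sp _ Mt) ht) _; first exact: nbhs_singleton.
by rewrite mulrAC ltr_pdivrMr //; nra.
Qed.

(** The averaging estimate behind the approximate identities. The error is measured against the
    integral of [rho], not against the measure of its support, so it becomes [e] as soon as [rho] is
    normalized. *)
Lemma vint_weighted (V : completeNormedModType R[i]) K (f : S -> V) rho (a : V) (e : R) :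
 continuous f -> csupp K f -> rsupp K rho -> (forall s, 0 <= rho s) -> 0 <= e ->
 (forall s, rn (f s - (rho s)%:C *: a) <= e * rho s) ->
 rn (vint m f - (I rho)%:C *: a) <= e * I rho.
Proof.
move=> cf sf sr r0 e0 h; have [cr cK rz] := sr.
have m0 : 0 <= fine (m K) * (1 + e + rn a).
 by rewrite mulr_ge0 ?fine_ge0 // addr_ge0 ?rn_ge0 // addr_ge0.
apply: (le_small m0) => d d0.
pose U s := [set t | rn (f t - f s) <= d /\ `|rho t - rho s| <= d].
have [w wP] : exists w, weights m K U w.
 apply: weights_exist => // s _; apply: filterI; first exact: near_dist.
 have /cvgrPdist_lt/(_ _ d0) := cr s; apply: filterS => t /ltW.
 by rewrite distrC.
have A1 := vint_weights hS mK wP cf sf (e := d) (fun s t _ _ ust => ust.1).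
have [w1 w2 w3] := wP; have A2 := w3 rho d cr rz (fun s t _ _ ust => ust.2).
pose W := \sum_(p <- w) p.1 * rho p.2.
have A3 : rn (wsum w f - W%:C *: a) <= e * W.
 rewrite /W /wsum; elim: w {wP A1 w2 w3 A2 W} w1 => [|p w IH] w1.
  by rewrite !big_nil scale0r subrr rn0 mulr0.
 rewrite !big_cons rmorphD /= scalerDl opprD addrACA; apply: le_trans (rnD _ _) _.
 rewrite mulrDr; apply: lerD; last by apply: IH => q qw; apply: w1; rewrite inE qw orbT.
 have [p0 _] := w1 p (mem_head _ _).
 by rewrite rmorphM -scalerA -scalerBr rnZ rn_pos // mulrCA ler_wpM2l.
have A4 := rn_tri (vint m f) (wsum w f) ((I rho)%:C *: a).
have A5 := rn_tri (wsum w f) (W%:C *: a) ((I rho)%:C *: a).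
have A6 : rn (W%:C *: a - (I rho)%:C *: a) <= d * fine (m K) * rn a.
 rewrite -scalerBl -rmorphB rnZ rn_real distrC ler_wpM2r ?rn_ge0 //.
have A7 : e * W <= e * (I rho + d * fine (m K)).
 by rewrite ler_wpM2l // -lerBlDl; move: A2; rewrite ler_norml => /andP[]; rewrite -/W; lra.
by move: A1 A3 A4 A5 A6 A7; move: (rn _) (rn _) (rn _) (rn _) (rn _) (rn _) (fine _) => *; nra.
Qed.

Lemma bint_weighted (X : ptopologicalType) (E : bundle R X) (x : X) K (f : S -> E) rho (a : E) (e : R) :
 is_usc_banach_bundle E -> csec x K f -> rsupp K rho -> (forall s, 0 <= rho s) -> 0 <= e ->
 (forall s, rn (bco x (f s) - (rho s)%:C *: bco x a) <= e * rho s) ->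
 rn (bco x (bint m x f) - (I rho)%:C *: bco x a) <= e * I rho.
Proof.
move=> hE sf sr r0 e0 h; rewrite bco_bint; have [cf s1] := csec_bco hE sf.
exact: vint_weighted cf s1 sr r0 e0 h.
Qed.

End ScalarIntegrals.

Lemma Rint_shift (R : realType) (L : topGroupType) (nu : borel_measure R L)
  (rho : L -> R) (r : L) : left_haar nu -> continuous rho ->
 Rintegral nu setT (fun s => rho (r * s)%g) = Rintegral nu setT rho.
Proof.
move=> [_ _ inv] cr; apply/esym/(@Rint_transfer _ _ _ nu nu _ (@mulg_contr L r) _ setT) => //.
by move=> B mB; rewrite inv.
Qed.
Lemma Alls_flatmap (I : eqType) (T : Type) (P : T -> Prop) (g : I -> seq T) (s : seq I) :
 (forall i, i \in s -> Alls P (g i)) -> Alls P (flatten [seq g i | i <- s]).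
Proof.
elim: s => //= i s IH h; apply: Alls_cat; first by apply: h; exact: mem_head.
by apply: IH => j js; apply: h; rewrite inE js orbT.
Qed.

Lemma eq_Alls (I : Type) (V : nmodType) (P : I -> Prop) (s : seq I) (f g : I -> V) :
 (forall i, P i -> f i = g i) -> Alls P s -> \sum_(i <- s) f i = \sum_(i <- s) g i.
Proof.
move=> fg; elim: s => [|i s IH] /=; first by rewrite !big_nil.
by move=> [/fg e /IH h]; rewrite !big_cons e h.
Qed.

Lemma Alls_impl (T : Type) (P Q : T -> Prop) s : (forall x, P x -> Q x) -> Alls P s -> Alls Q s.
Proof. by move=> PQ; elim: s => //= x s IH [/PQ Px /IH]. Qed.
Lemma lcpt_lc (X : topologicalType) : hausdorff_space X -> lcpt X -> locally_compact [set: X].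
Proof.
move=> hX lX x _; have [M nM cM] := lX x; exists M; first by apply: filterS nM => y My _.
by split=> //; exact: compact_closed.
Qed.

Section ModularFunction.
Variables (R : realType) (L : topGroupType) (nu : borel_measure R L).
Hypotheses (hL : hausdorff_space L) (lL : lcpt L) (hnu : left_haar nu).
Let nuK : finite_on_compacts L nu. Proof. by case: hnu. Qed.

Lemma vint_shift (V : completeNormedModType R[i]) (f : L -> V) (r : L) : continuous f ->
 vint nu (fun s => f (r * s)%g) = vint nu f.
Proof.
move=> cf; have [_ _ inv] := hnu.
apply/esym/(@vintegral_transfer _ _ _ nu nu _ (@mulg_contr L r) _ setT) => //.
by move=> B mB; rewrite inv.
Qed.

Lemma vint_scal (S : ptopologicalType) (m : borel_measure R S)
  (hS : hausdorff_space S) (mK : finite_on_compacts S m)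
  (V : completeNormedModType R[i]) (K : set S) (rho : S -> R) (a : V) :
 rsupp K rho -> (forall s, 0 <= rho s) ->
 vint m (fun s => (rho s)%:C *: a) = (Rintegral m setT rho)%:C *: a.
Proof.
move=> sr r0; have [cr cK rz] := sr; apply/eqP; rewrite -subr_eq0; apply/eqP/rn_eq0/eqP.
rewrite eq_le rn_ge0 andbT -[leRHS](mul0r (Rintegral m setT rho)).
apply: (vint_weighted hS mK (K := K)) => //; last by move=> s; rewrite subrr rn0 mul0r.
- move=> s; apply: cvgZr_tmp; apply/rn_cvgP => d d0.
 have /cvgrPdist_lt/(_ _ d0) := cr s; apply: filterS => z.
 by rewrite -rmorphB rn_real.
- by split=> // s /rz ->; rewrite scale0r.
Qed.

(* Uniqueness of Haar measure: the double integral of phi (l k h) v (k h) is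
  evaluated in both orders. *)
Lemma modular_function : exists Delta : L -> R, [/\ continuous Delta, forall h, 0 < Delta h &
 forall (V : completeNormedModType R[i]) (K : set L) (f : L -> V) (h : L), continuous f -> csupp K f ->
  vint nu (fun k => f (k * h)%g) = (Delta h)%:C *: vint nu f].
Proof.
have [M nM cM] := lL 1%g.
have [phi [cphi phi0 phi1 phiz]] := bump R hL (lcpt_lc hL lL) nM.
have phiM a : ~ M a -> phi a = 0 by move=> /phiz/nbhs_singleton.
pose E k := Rintegral nu setT (fun l => phi (l * k)%g).
have sE k : rsupp (mulset M (invset [set k])) (fun l => phi (l * k)%g).
 split; first by apply: (cont_comp _ cphi); cts.
  by apply: mulset_compact => //; apply: invset_compact; exact: compact_set1.
 move=> l nl; apply: phiM => Ml; apply: nl.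
 by rewrite (_ : l = l * k * k^-1)%g; [apply: mulsetI => //; exact: invsetI|gsimp].
have cE : continuous E.
 apply: (Rint_cont hL nuK (F := fun q : L * L => phi (q.1 * q.2)%g)).
  by apply: (cont_comp _ cphi); cts.
 move=> k0; have [N nN cN] := lL k0; exists N, (mulset M (invset N)); split=> //.
  by apply: mulset_compact => //; exact: invset_compact.
 move=> l k Nk nl; apply: phiM => /= Ml; apply: nl.
 by rewrite (_ : l = l * k * k^-1)%g; [apply: mulsetI => //; exact: invsetI|gsimp].
have posL : forall U : set L, open U -> U !=set0 -> (0 < nu U)%E by case: hnu.
have E0 k : 0 < E k.
 by apply: (Rint_gt0 (s0 := k^-1%g) hL nuK (sE k)) => //; rewrite mulVg.
exists (fun h => E h / E 1%g); split=> [h|h|].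
- by apply: (@cvgM R^o); [exact: cE|exact: cvg_cst].
- by rewrite divr_gt0.
move=> V K f h0 cf [cK fK].
(* [E] is the modular function up to normalization. Division by it makes [f k] equal to E k v k, the
   integral over l of phi (l k) v k, so that [f] itself becomes an inner integral. *)
pose v k := (E k)^-1%:C *: f k.
have cRC (T : topologicalType) (rho : T -> R) (g : T -> V) : continuous rho -> continuous g ->
  continuous (fun t => (rho t)%:C *: g t).
 move=> cr cg t; apply: (@cvgZ _ _ _ (nbhs t) _ (fun t => (rho t)%:C : R[i]^o)); last exact: cg.
 apply/rn_cvgP => d d0; have /cvgrPdist_lt/(_ _ d0) := cr t; apply: filterS => z.
 by rewrite -rmorphB rn_real.
have cv : continuous v.
 by apply: cRC => // k; apply: cvgV; [rewrite gt_eqF|exact: cE].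
have vK k : ~ K k -> v k = 0 by move=> /fK h; rewrite /v h scaler0.
have Ev k : (E k)%:C *: v k = f k.
 by rewrite /v scalerA -rmorphM mulfV ?scale1r // gt_eqF.
pose w := vint nu (fun l => v l^-1%g).
suff key h : vint nu (fun k => f (k * h)%g) = (E h)%:C *: w.
 have := key 1%g; rewrite (_ : (fun k => _) = f); last by apply/funext => k; rewrite mulg1.
 by move=> ->; rewrite key scalerA -rmorphM mulfVK // gt_eqF.
have cKh : compact (mulset K (invset [set h])).
 by apply: mulset_compact => //; apply: invset_compact; exact: compact_set1.
have cMh : compact (mulset M (invset [set h])).
 by apply: mulset_compact => //; apply: invset_compact; exact: compact_set1.
have cMK : compact (mulset M (invset K)) by apply: mulset_compact => //; exact: invset_compact.
have inh (P : set L) k : P (k * h)%g -> mulset P (invset [set h]) k.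
 by move=> Pk; rewrite (_ : k = k * h * h^-1)%g; [apply: mulsetI => //; exact: invsetI|gsimp].
transitivity (vint nu (fun k => vint nu (fun l => (phi (l * k * h)%g)%:C *: v (k * h)%g))).
 congr vint; apply/funext => k; rewrite -Ev (_ : (fun l => _) = fun l => (phi (l * (k * h))%g)%:C *: v (k * h)%g).
  by rewrite (vint_scal hL nuK _ (sE (k * h)%g)).
 by apply/funext => l; rewrite mulgA.
have c1 : continuous (fun q : L * L => (phi (q.2 * q.1 * h)%g)%:C *: v (q.1 * h)%g).
 by apply: cRC; [apply: (cont_comp _ cphi); cts|apply: (cont_comp _ cv); cts].
rewrite (vint_swap hL hL nuK nuK c1 cKh cMK); last first.
 move=> k l nkl /=; have [Kk|/vK ->] := pselect (K (k * h)%g); last by rewrite scaler0.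
 rewrite phiM ?scale0r // => Ml; apply: nkl; split; first exact: inh.
 by rewrite (_ : l = (l * k * h) * (k * h)^-1)%g; [apply: mulsetI => //; exact: invsetI|gsimp].
(* Left invariance in k frees [phi] from l; after the second exchange the inner integral over l no
   longer depends on k. *)
transitivity (vint nu (fun l => vint nu (fun k => (phi (k * h)%g)%:C *: v (l^-1 * k * h)%g))).
 congr vint; apply/funext => l /=; rewrite -(vint_shift l^-1%g (cont_slice2 l c1)) /=.
 by congr vint; apply/funext => k; gsimp.
have c2 : continuous (fun q : L * L => (phi (q.2 * h)%g)%:C *: v (q.1^-1 * q.2 * h)%g).
 by apply: cRC; [apply: (cont_comp _ cphi); cts|apply: (cont_comp _ cv); cts].
rewrite (vint_swap hL hL nuK nuK c2 cMK cMh); last first.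
 move=> l k nkl /=; have [Kk|/vK ->] := pselect (K (l^-1 * k * h)%g); last by rewrite scaler0.
 rewrite phiM ?scale0r // => Ml; apply: nkl; split; last exact: inh.
 by rewrite (_ : l = (k * h) * (l^-1 * k * h)^-1)%g; [apply: mulsetI => //; exact: invsetI|gsimp].
rewrite -(vint_scal hL nuK w (sE h)) //; congr vint; apply/funext => k /=.
have civ : continuous (fun l : L => v (l^-1 * (k * h))%g) by apply: (cont_comp _ cv); cts.
have -> : w = vint nu (fun l => v (l^-1 * (k * h))%g).
 by rewrite -(vint_shift (k * h)%g civ) /w; congr vint; apply/funext => l; congr v; gsimp.
rewrite -(vintZ hL nuK (K := mulset [set (k * h)%g] (invset K)) _ civ).
 by congr vint; apply/funext => l; rewrite mulgA.
split; first by apply: mulset_compact; [exact: compact_set1|exact: invset_compact].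
move=> l nl; apply: vK => Kl; apply: nl.
by rewrite (_ : l = (k * h) * (l^-1 * (k * h))^-1)%g; [apply: mulsetI => //; exact: invsetI|gsimp].
Qed.

End ModularFunction.

(** * Growth of log-convex sequences and quadratic bounds *)

Lemma conj_mulC (R : realType) (z : R[i]) : conjc z * z = (rn z ^+ 2)%:C.
Proof.
case: z => a b; apply/eqP; rewrite eq_complex /= /rn normc_def /= sqr_sqrtr ?addr_ge0 ?sqr_ge0 //.
by apply/andP; split; apply/eqP; ring.
Qed.

Lemma ReD (R : realType) (a b : R[i]) : complex.Re (a + b) = complex.Re a + complex.Re b.
Proof. by case: a b => [? ?] [? ?]. Qed.
Lemma Re_scale (R : realType) (r : R) (a : R[i]) : complex.Re (r%:C * a) = r * complex.Re a.
Proof. by case: a => a b /=; rewrite mul0r subr0. Qed.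
Lemma Re_conj (R : realType) (a : R[i]) : complex.Re (conjc a) = complex.Re a.
Proof. by case: a. Qed.
Lemma conj_scale (R : realType) (r : R) (a : R[i]) : conjc (r%:C * a) = r%:C * conjc a.
Proof. by case: a => a b; apply/eqP; rewrite eq_complex /= !mul0r !addr0 !subr0 mulrN !eqxx. Qed.
Lemma bernoulli_le (R : realType) (x : R) (n : nat) : 0 <= x -> 1 + n%:R * x <= (1 + x) ^+ n.
Proof.
move=> x0; elim: n => [|n IH]; first by rewrite mul0r addr0 expr0.
rewrite exprS; apply: le_trans (_ : (1 + x) * (1 + n%:R * x) <= _).
 by rewrite -natr1; have := ler0n R n; nra.
by rewrite ler_wpM2l // addr_ge0.
Qed.

(* a log-convex sequence that grows at most like e^n has initial ratio at most e *)
Lemma log_convex_growth (R : realType) (a : nat -> R) (D e : R) : (forall n, 0 <= a n) ->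
 (forall n, a n.+1 ^+ 2 <= a n * a n.+2) -> 0 <= e -> (forall n, a n <= D * e ^+ n) ->
 a 1%N <= e * a 0%N.
Proof.
move=> a0 ac e0 aD; rewrite leNgt; apply/negP => lt1.
have [z|p0] := eqVneq (a 0%N) 0.
 by have := ac 0%N; rewrite z mul0r; move: lt1; rewrite z mulr0; nra.
have {p0} p0 : 0 < a 0%N by rewrite lt_neqAle eq_sym p0 a0.
pose q := a 1%N / a 0%N; have qe : e < q by rewrite ltr_pdivlMr.
have q0 : 0 < q by exact: le_lt_trans qe.
have step n : 0 < a n /\ q * a n <= a n.+1.
 elim: n => [|n [an IH]]; first by rewrite divfK ?gt_eqF.
 have an1 : 0 < a n.+1 by apply: lt_le_trans IH; rewrite mulr_gt0.
 split=> //; have := ac n; rewrite expr2 => h.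
 rewrite -(ler_pM2l an); apply: le_trans h.
 by rewrite mulrCA mulrA ler_wpM2r ?(ltW an1).
have pow n : q ^+ n * a 0%N <= a n.
 elim: n => [|n IH]; first by rewrite mul1r.
 by apply: le_trans (step n).2; rewrite exprS -mulrA ler_wpM2l // ltW.
have [ez|e1] := eqVneq e 0.
 by have := aD 1%N; rewrite ez expr1 mulr0; have [] := step 1%N; lra.
have {e1} e1 : 0 < e by rewrite lt_neqAle eq_sym e1.
pose x := q / e - 1; have x0 : 0 < x by rewrite subr_gt0 ltr_pdivlMr ?mul1r.
have qx : q = e * (1 + x) by rewrite /x addrC subrK mulrC divfK ?gt_eqF.
have bd n : (1 + n%:R * x) * a 0%N <= D.
 have h1 := le_trans (pow n) (aD n); rewrite qx exprMn mulrC mulrA in h1.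
 have en : 0 < e ^+ n by rewrite exprn_gt0.
 rewrite -(ler_pM2l en); apply: le_trans (_ : e ^+ n * ((1 + x) ^+ n * a 0%N) <= _).
  by rewrite ler_wpM2l ?(ltW en) // ler_wpM2r ?(ltW p0) // bernoulli_le // ltW.
 rewrite (mulrC _ D); apply: le_trans h1; rewrite le_eqVlt; apply/orP; left; apply/eqP; ring.
have xa : 0 < x * a 0%N by rewrite mulr_gt0.
have D0 : 0 <= D by have := bd 0%N; rewrite mul0r addr0 mul1r; lra.
have := bd (Num.Def.truncn (D / (x * a 0%N))).+1.
have := truncnS_gt (D / (x * a 0%N)); rewrite ltr_pdivrMr //.
set k : R := _.+1%:R => h1; have -> : (1 + k * x) * a 0%N = a 0%N + k * (x * a 0%N) by ring.
lra.
Qed.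

(** The minimum of the quadratic is at t = 1/a; for a = 0 a nonconstant affine function cannot stay
    nonnegative. *)
Lemma quadratic_bound (R : realType) (N a b : R) : 0 <= N -> 0 <= a ->
 (forall t, 0 <= t ^+ 2 * N * a - (t * N) *+ 2 + b) -> N <= a * b.
Proof.
move=> N0 a0 key; have [az|az] := eqVneq a 0.
 rewrite az mul0r; have [->//|Nz] := eqVneq N 0.
 have N1 : 0 < N by rewrite lt_neqAle eq_sym Nz.
 by have := key ((b + 1) / N); rewrite az mulr0 divfK //; have := key 0; rewrite az; lra.
have a1 : 0 < a by rewrite lt_neqAle eq_sym az.
have := key a^-1; have -> : a^-1 ^+ 2 * N * a = N / a by field; rewrite gt_eqF.
rewrite (mulrC _^-1) => h; have {h} : N / a <= b by lra.
by rewrite ler_pdivrMr // mulrC.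
Qed.

(** * Completions and representations *)

Section NormedComplete.
Variables (R : realType) (V : normedModType R[i]).

(** Centres of balls of radius 1/(n+1) that belong to the filter form a Cauchy sequence, and its
    limit is the limit of the filter. *)
Lemma ncomplete_cauchy (F : set_system V) : ncomplete (@rn R V) -> ProperFilter F -> cauchy F -> cvg F.
Proof.
move=> hV PF cF.
have sm (n : nat) : exists v : V, F [set w | rn (v - w) < n.+1%:R^-1].
 have e0 : 0 < (n.+1%:R^-1 : R)%:C by rewrite ltcR invr_gt0 ltr0n.
 have [v hv] := (cauchyP F).1 cF _ e0.
 by exists v; apply: filterS hv => w; rewrite -ball_normE /= rn_ltC.
have [u hu] := choice sm.
have cu : ncauchy (@rn R V) u.
 move=> e e0; exists (Num.Def.truncn (2 / e)) => i j ni nj.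
 have [w [wi wj]] := filter_ex (filterI (hu i) (hu j)).
 have small k : (Num.Def.truncn (2 / e) <= k)%N -> k.+1%:R^-1 < e / 2.
  move=> nk; rewrite invf_plt ?posrE ?divr_gt0 // ?ltr0n // invf_div.
  by apply: lt_le_trans (truncnS_gt _) _; rewrite ler_nat ltnS.
 have h := rn_tri (u i) w (u j); rewrite (rn_distC w) in h.
 apply: le_lt_trans h _; rewrite (splitr e).
 by apply: ltrD; [exact: lt_trans wi (small i ni)|exact: lt_trans wj (small j nj)].
have [l hl] := hV u cu.
apply: (cvgP l) => A /nbhs_rnP[e e0 hA].
have [N hN] := hl _ (halfR_gt0 e0).
pose M := maxn N (Num.Def.truncn (2 / e)).
have hM : M.+1%:R^-1 < e / 2.
 rewrite invf_plt ?posrE ?divr_gt0 // ?ltr0n // invf_div.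
 by apply: lt_le_trans (truncnS_gt _) _; rewrite ler_nat ltnS leq_maxr.
apply: filterS (hu M) => w /= hw; apply: hA; have h2 := lt_trans hw hM; have h1 := hN M (leq_maxl _ _).
by apply: le_lt_trans (rn_tri l (u M) w) _; rewrite (splitr e) (rn_distC l (u M)); exact: ltrD.
Qed.

End NormedComplete.

(* Completions are realized as spaces of functions, as uniform closures of a
  submodule of bounded functions. *)
Record bounded_submodule (R : realType) (I : Type) (W : normedModType R[i]) := BoundedSubmodule {
 bset :> set (I -> W);
 bset_complete : ncomplete (@rn R W);
 bset0 : bset 0;
 bset_lin : forall k f g, bset f -> bset g -> bset (k *: f + g);
 bset_bound : forall f, bset f -> exists M : R, forall i, rn (f i) <= M
}.

Section UniformClosure.
Variables (R : realType) (I : Type) (W : normedModType R[i]).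
Variable Q : bounded_submodule I W.

Definition uclosure : {pred (I -> W)} := fun f =>
 `[< forall e : R, 0 < e -> exists2 g, bset Q g & forall i, rn (f i - g i) <= e >].

Lemma uclosureP (f : I -> W) : reflect
 (forall e : R, 0 < e -> exists2 g, bset Q g & forall i, rn (f i - g i) <= e) (f \in uclosure).
Proof. exact: asboolP. Qed.
Lemma uclosure_submod : submod_closed uclosure.
Proof.
split=> [|k f g /uclosureP hf /uclosureP hg]; apply/uclosureP => e e0.
 by exists 0; [exact: bset0|move=> i; rewrite subrr rn0 ltW].
have k1 : 0 < rn k + 1 by have := rn_ge0 k; lra.
have d0 : 0 < e / (rn k + 1) / 2 by rewrite !divr_gt0.
have [f' Qf' hf'] := hf _ d0; have [g' Qg' hg'] := hg _ (halfR_gt0 e0).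
exists (k *: f' + g'); first exact: bset_lin.
move=> i; have -> : (k *: f + g) i - (k *: f' + g') i = k *: (f i - f' i) + (g i - g' i).
 by rewrite /= !fctE scalerBr opprD addrACA.
apply: le_trans (rnD _ _) _; rewrite rnZ.
have h1 := hf' i; have h2 := hg' i; have h3 := rn_ge0 k; have h4 := rn_ge0 (f i - f' i).
have : rn k * rn (f i - f' i) <= e / 2.
 apply: le_trans (_ : (rn k + 1) * (e / (rn k + 1) / 2) <= _); first by apply: ler_pM => //; lra.
 by rewrite mulrA mulrCA divff ?gt_eqF // mulr1.
lra.
Qed.

HB.instance Definition _ := GRing.isSubmodClosed.Build R[i] (I -> W) uclosure uclosure_submod.

Record cpl := Cpl { cval : I -> W; cvalP : cval \in uclosure }.
HB.instance Definition _ := [isSub for cval].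
HB.instance Definition _ := [Choice of cpl by <:].
HB.instance Definition _ := [SubChoice_isSubLmodule of cpl by <:].

(** The extra element 0 keeps the supremum meaningful for an empty index type. *)
Definition cnorm (f : cpl) : R := sup [set r | r = 0 \/ exists i, r = rn (cval f i)].

Let cnorm_has f : has_sup [set r | r = 0 \/ exists i, r = rn (cval f i)].
Proof.
split; first by exists 0; left.
have /uclosureP/(_ _ ltr01)[g Qg hg] := cvalP f; have [M hM] := bset_bound Qg.
exists (Num.max 0 (1 + M)) => _ [->|[i ->]]; first by rewrite le_max lexx.
rewrite le_max; apply/orP; right.
by have := rnD (cval f i - g i) (g i); rewrite subrK; have := hg i; have := hM i; lra.
Qed.

Lemma cnorm_ge0 f : 0 <= cnorm f.
Proof. by apply: ub_le_sup; [case: (cnorm_has f)|left]. Qed.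
Lemma cnormP f i : rn (cval f i) <= cnorm f.
Proof. by apply: ub_le_sup; [case: (cnorm_has f)|right; exists i]. Qed.
Lemma cnorm_le f (M : R) : 0 <= M -> (forall i, rn (cval f i) <= M) -> cnorm f <= M.
Proof. by move=> M0 h; apply: ge_sup; [case: (cnorm_has f)|move=> _ [->|[i ->]]]. Qed.
Let cnormD (f g : cpl) : (cnorm (f + g))%:C <= (cnorm f)%:C + (cnorm g)%:C :> R[i].
Proof.
rewrite -rmorphD lecR; apply: cnorm_le; first by rewrite addr_ge0 ?cnorm_ge0.
by move=> i; apply: le_trans (rnD _ _) _; apply: lerD; exact: cnormP.
Qed.

Let cnormZ_le (k : R[i]) (f : cpl) : cnorm (k *: f) <= rn k * cnorm f.
Proof.
apply: cnorm_le; first by rewrite mulr_ge0 ?rn_ge0 ?cnorm_ge0.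
by move=> i; rewrite /= fctE rnZ ler_wpM2l ?rn_ge0 ?cnormP.
Qed.

Let cnormZ (k : R[i]) (f : cpl) : (cnorm (k *: f))%:C = `|k| * (cnorm f)%:C :> R[i].
Proof.
rewrite -[`|k|]rnE -rmorphM; congr (_%:C); apply/eqP; rewrite eq_le cnormZ_le /=.
have [->|k0] := eqVneq k 0; first by rewrite rn0 mul0r cnorm_ge0.
have rk : 0 < rn k.
 by rewrite lt_neqAle rn_ge0 andbT eq_sym; apply/eqP => /rn_eq0/eqP; exact/negP.
have := cnormZ_le k^-1 (k *: f); rewrite scalerA mulVf // scale1r => h.
have e1 : rn k * rn k^-1 = 1 by rewrite -rnM mulfV // -(rn_pos (k := 1)).
by rewrite -[leRHS]mul1r -e1 -mulrA ler_wpM2l ?rn_ge0.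
Qed.

Let cnorm_eq0 (f : cpl) : (cnorm f)%:C = 0 :> R[i] -> f = 0.
Proof.
move=> /(congr1 (@complex.Re _)) /= h; apply/val_inj/funext => i; apply: rn_eq0; apply/eqP.
by rewrite eq_le rn_ge0 andbT -h cnormP.
Qed.

HB.instance Definition _ := Lmodule_isNormed.Build R[i] cpl cnormD cnormZ cnorm_eq0.

Lemma rn_cpl (f : cpl) : rn f = cnorm f.
Proof. by []. Qed.
Let cpl_ncomplete : ncomplete (@rn R cpl).
Proof.
move=> u cu.
have pt i : exists l, nconv (@rn R W) (fun n => cval (u n) i) l.
 apply: (bset_complete Q) => e e0; have [N hN] := cu e e0; exists N => m n hm hn.
 by apply: le_lt_trans (hN m n hm hn); exact: (cnormP (u m - u n) i).
have [l hl] := choice pt.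
have unif (e : R) : 0 < e -> exists N, forall n, (N <= n)%N -> forall i, rn (cval (u n) i - l i) <= e.
 move=> e0; have [N hN] := cu _ (halfR_gt0 e0); exists N => n hn i.
 apply/ler_addgt0Pr => d d0; have [N' hN'] := hl i _ d0.
 have h1 := hN n (maxn N N') hn (leq_maxl _ _); have h2 := hN' _ (leq_maxr N N').
 have h3 := cnormP (u n - u (maxn N N')) i.
 have := rn_tri (cval (u n) i) (cval (u (maxn N N')) i) (l i).
 by move: h3 h1; rewrite rn_cpl; lra.
have lP : l \in uclosure.
 apply/uclosureP => e e0; have [N hN] := unif _ (halfR_gt0 e0).
 have /uclosureP/(_ _ (halfR_gt0 e0))[g Qg hg] := cvalP (u N).
 exists g => // i; have := rn_tri (l i) (cval (u N) i) (g i); rewrite (rn_distC (l i) (cval (u N) i)).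
 by have := hN N (leqnn _) i; have := hg i; lra.
exists (Cpl lP) => e e0; have [N hN] := unif _ (halfR_gt0 e0); exists N => n hn.
apply: le_lt_trans (_ : e / 2 < e); last by lra.
by apply: cnorm_le; [lra|move=> i; exact: hN].
Qed.

HB.instance Definition _ := Uniform_isComplete.Build cpl (fun F => @ncomplete_cauchy _ _ F cpl_ncomplete).

End UniformClosure.

(** Each x is represented by the function i -> p x i / n i. By Cauchy-Schwarz its sup norm is at
    most [n x], and the index i = x attains that value, so the completion for the seminorm [n] is a
    space of bounded functions. [S] carries no vector space structure: a linear combination is any
    element with the right pairings. Indices with n i = 0 contribute 0 because the inverse of 0 is
    0. *)
Theorem pairing_completion (R : realType) (S : Type) (X0 : set S) (W : normedModType R[i])
  (p : S -> S -> W) (n : S -> R) : ncomplete (@rn R W) -> X0 !=set0 -> (forall x, 0 <= n x) ->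
 (forall x y, X0 x -> X0 y -> rn (p x y) <= n x * n y) ->
 (forall x, X0 x -> rn (p x x) = n x ^+ 2) ->
 (forall k x y, X0 x -> X0 y -> exists2 z, X0 z & forall i, X0 i -> p z i = k *: p x i + p y i) ->
 exists (V : completeNormedModType R[i]) (j : S -> V),
 [/\ forall k x y z, X0 x -> X0 y -> X0 z -> (forall i, X0 i -> p z i = k *: p x i + p y i) ->
    j z = k *: j x + j y,
   forall x, X0 x -> rn (j x) = n x &
   forall v e, 0 < e -> exists2 x, X0 x & rn (j x - v) < e].
Proof.
move=> hW [x0 hx0] n0 pn pxx plin.
pose f (x : S) : S -> W := fun i => if `[< X0 i >] then (n i)^-1%:C *: p x i else 0.
have f_lin k x y z : (forall i, X0 i -> p z i = k *: p x i + p y i) -> f z = k *: f x + f y.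
 move=> h; apply/funext => i; rewrite [RHS](_ : _ = k *: f x i + f y i) // /f; case: asboolP => [hi|_]; last by rewrite scaler0 addr0.
 by rewrite h // scalerDr !scalerA [_ * k]mulrC.
have f_bd x i : X0 x -> rn (f x i) <= n x.
 move=> hx; rewrite /f; case: asboolP => [hi|_]; last by rewrite rn0.
 have ni : 0 <= (n i)^-1 by rewrite invr_ge0.
 rewrite rnZ rn_pos //; apply: le_trans (_ : (n i)^-1 * (n x * n i) <= _); first by rewrite ler_wpM2l // pn.
 have [->|i0] := eqVneq (n i) 0; first by rewrite !mulr0.
 by rewrite mulrCA mulVf ?mulr1.
have f0 : exists2 z, X0 z & f z = 0.
 have [z hz pz] := plin (-1) x0 x0 hx0 hx0; exists z => //.
 by rewrite (f_lin _ _ _ _ pz) scaleN1r addNr.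
have Q0 : [set g | exists2 x, X0 x & g = f x] 0 by have [z hz fz] := f0; exists z.
have Ql k g g' : [set g | exists2 x, X0 x & g = f x] g -> [set g | exists2 x, X0 x & g = f x] g' ->
  [set g | exists2 x, X0 x & g = f x] (k *: g + g').
 move=> [x hx ->] [y hy ->]; have [z hz pz] := plin k x y hx hy.
 by exists z => //; rewrite (f_lin _ _ _ _ pz).
have Qb g : [set g | exists2 x, X0 x & g = f x] g -> exists M : R, forall i, rn (g i) <= M.
 by move=> [x hx ->]; exists (n x) => i; exact: f_bd.
pose Q := BoundedSubmodule hW Q0 Ql Qb.
have fQ x : X0 x -> f x \in uclosure Q.
 by move=> hx; apply/uclosureP => e e0; exists (f x); [exists x|move=> i; rewrite subrr rn0 ltW].
pose j x : cpl Q := insubd 0 (f x).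
have jE x : X0 x -> cval (j x) = f x by move=> hx; exact: (insubdK (0 : cpl Q) (fQ x hx)).
exists (cpl Q), j; split.
- move=> k x y z hx hy hz h; apply: val_inj; rewrite /= jE // (f_lin k x y z h).
 by rewrite -(jE x hx) -(jE y hy).
- move=> x hx; rewrite rn_cpl; apply/eqP; rewrite eq_le; apply/andP; split.
  by apply: cnorm_le => // i; rewrite jE // f_bd.
 have [->|nx] := eqVneq (n x) 0; first exact: cnorm_ge0.
 apply: le_trans (cnormP (j x) x); rewrite jE // /f; case: asboolP => // _.
 by rewrite rnZ rn_pos ?invr_ge0 // pxx // expr2 mulKf.
- move=> v e e0; have /uclosureP/(_ _ (halfR_gt0 e0))[_ [x hx ->] h] := cvalP v; exists x => //.
 apply: le_lt_trans (_ : e / 2 < e); last by lra.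
 rewrite rn_distC rn_cpl; apply: cnorm_le; first by lra.
 by move=> i; rewrite /= fctE /= jE //; exact: h.
Qed.

Section Extension.
Variables (R : realType).

Definition rndense (S : Type) (X0 : set S) (V : normedModType R[i]) (j : S -> V) :=
 forall v (e : R), 0 < e -> exists2 x, X0 x & rn (j x - v) < e.

Definition rnlip (V W : normedModType R[i]) (f : V -> W) (B : R) := forall v w, rn (f v - f w) <= B * rn (v - w).

Lemma rnlip_cont (V W : normedModType R[i]) (f : V -> W) (B : R) : rnlip f B -> continuous f.
Proof.
move=> hf v; apply/rn_cvgP => e e0; apply/nbhs_rnP.
have B1 : 0 < `|B| + 1 by rewrite ltr_wpDl.
exists (e / (`|B| + 1)); first by rewrite divr_gt0.
move=> w; rewrite ltr_pdivlMr // => h; apply: le_lt_trans (hf v w) _; apply: le_lt_trans h.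
rewrite mulrC ler_wpM2l ?rn_ge0 //; have := ler_norm B; lra.
Qed.

Lemma extend1 (S : Type) (X0 : set S) (V W : normedModType R[i])
  (j : S -> V) (T : S -> W) (B : R) : ncomplete (@rn R W) -> rndense X0 j -> 0 <= B ->
 (forall x y, X0 x -> X0 y -> rn (T x - T y) <= B * rn (j x - j y)) ->
 exists2 f : V -> W, rnlip f B & forall x, X0 x -> f (j x) = T x.
Proof.
move=> hW dj B0 hT; have B1 : 0 < B + 1 by lra.
(* The value at [v] is characterized by its distances to all [T x], which makes it independent of
   the approximating sequence and yields the Lipschitz bound directly. *)
have ex v : exists l : W, forall x, X0 x -> rn (T x - l) <= B * rn (j x - v).
 have sm (n : nat) : exists x, X0 x /\ rn (j x - v) < n.+1%:R^-1.
  by have [|x hx h] := dj v n.+1%:R^-1; [rewrite invr_gt0 ltr0n|exists x].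
 have [u hu] := choice sm.
 have small (e : R) : 0 < e -> exists N, forall k, (N <= k)%N -> rn (j (u k) - v) < e.
  move=> e0; exists (Num.Def.truncn e^-1) => k nk; apply: lt_trans (hu k).2 _.
  rewrite invf_plt ?posrE ?ltr0n //.
  by apply: lt_le_trans (truncnS_gt _) _; rewrite ler_nat ltnS.
 have [l hl] : exists l, nconv (@rn R W) (fun n => T (u n)) l.
  apply: hW => e e0; have [|N hN] := small (e / (B + 1) / 2); first by rewrite !divr_gt0.
  exists N => m n hm hn; apply: le_lt_trans (hT _ _ (hu m).1 (hu n).1) _.
  have h1 := hN m hm; have h2 := hN n hn.
  have h3 := rn_tri (j (u m)) v (j (u n)); rewrite (rn_distC v) in h3.
  have h4 : rn (j (u m) - j (u n)) < e / (B + 1).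
   by apply: le_lt_trans h3 _; rewrite (splitr (e / _)); exact: ltrD.
  move: h4; rewrite ltr_pdivlMr // => h4; apply: le_lt_trans h4.
  by rewrite mulrC ler_wpM2l ?rn_ge0 //; lra.
 exists l => x hx; apply: (@le_small _ _ _ (B + 1)) => [|e e0]; first by lra.
 have [N1 hN1] := small e e0; have [N2 hN2] := hl e e0.
 have h1 := hN1 _ (leq_maxl N1 N2); have h2 := hN2 _ (leq_maxr N1 N2); set k := maxn N1 N2 in h1 h2.
 apply: le_trans (rn_tri _ (T (u k)) _) _.
 have h3 := hT x (u k) hx (hu k).1; have h4 := rn_tri (j x) v (j (u k)); rewrite (rn_distC v) in h4.
 have h5 : B * rn (j x - j (u k)) <= B * (rn (j x - v) + e).
  by rewrite ler_wpM2l //; apply: le_trans h4 _; rewrite lerD2l ltW.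
 apply: le_trans (lerD h3 (ltW h2)) _; apply: le_trans (lerD h5 (lexx _)) _.
 by rewrite !mulrDr mulr1 [e * B]mulrC addrA.
have [f hf] := choice ex; exists f => [v w|x hx].
 apply: (@le_small _ _ _ (B *+ 2)) => [|e e0]; first by rewrite mulrn_wge0.
 have [x hx h] := dj v e e0.
 apply: le_trans (rn_tri _ (T x) _) _; rewrite (rn_distC (f v)).
 apply: le_trans (lerD (hf v x hx) (hf w x hx)) _.
 have h4 : rn (j x - w) <= e + rn (v - w).
  by apply: le_trans (rn_tri _ v _) _; rewrite lerD2r ltW.
 have h5 : B * rn (j x - v) <= B * e by rewrite ler_wpM2l // ltW.
 have h6 : B * rn (j x - w) <= B * (e + rn (v - w)) by rewrite ler_wpM2l.
 by apply: le_trans (lerD h5 h6) _; rewrite mulrDr mulr2n mulrDr [e * B]mulrC addrA addrC.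
apply/eqP; rewrite -subr_eq0; apply/eqP/rn_eq0/eqP; rewrite eq_le rn_ge0 andbT rn_distC.
by have := hf (j x) x hx; rewrite subrr rn0 mulr0.
Qed.

Let estimate3 (d n e p q c r s t u : R) : 0 <= p -> 0 <= q -> 0 <= c -> 0 <= e -> d <= e -> n <= e + r ->
 s <= n * c -> t <= q * d -> u <= p * d -> u + (s + t) <= r * c + e * (p + q + c).
Proof. by move=> p0 q0 c0 e0 de ne sn tq up; nra. Qed.
(** The bounds are stated for differences because the sources carry no addition. It produces all
    actions and pairings on completions, with Lipschitz constants that make them jointly
    continuous. *)
Lemma extend2 (S1 S2 : Type) (X1 : set S1) (X2 : set S2) (V1 V2 W : normedModType R[i])
  (a : S1 -> V1) (b : S2 -> V2) (T : S1 -> S2 -> W) :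
 ncomplete (@rn R W) -> rndense X1 a -> rndense X2 b ->
 (forall x x' y, X1 x -> X1 x' -> X2 y -> rn (T x y - T x' y) <= rn (a x - a x') * rn (b y)) ->
 (forall x y y', X1 x -> X2 y -> X2 y' -> rn (T x y - T x y') <= rn (a x) * rn (b y - b y')) ->
 exists E : V1 -> V2 -> W, [/\ forall x y, X1 x -> X2 y -> E (a x) (b y) = T x y,
  forall w, rnlip (E ^~ w) (rn w) & forall v, rnlip (E v) (rn v)].
Proof.
move=> hW da db h1 h2.
have ex1 y : exists f : V1 -> W, X2 y -> rnlip f (rn (b y)) /\ forall x, X1 x -> f (a x) = T x y.
 have [hy|ny] := pselect (X2 y); last by exists (fun=> 0).
 have [|f lf fT] := extend1 (T := T ^~ y) hW da (rn_ge0 (b y)); last by exists f.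
 by move=> x x' hx hx'; rewrite mulrC; exact: h1.
have [f hf] := choice ex1.
have ef v y y' : X2 y -> X2 y' -> rn (f y v - f y' v) <= rn v * rn (b y - b y').
 move=> hy hy'; have [l1 e1] := hf y hy; have [l2 e2] := hf y' hy'.
 apply: (@le_small _ _ _ (rn (b y) + rn (b y') + rn (b y - b y'))) => [|e e0].
  by rewrite !addr_ge0 ?rn_ge0.
 have [x hx h] := da v e e0.
 have k1 := l1 v (a x); have k2 := l2 (a x) v; have k3 := h2 x y y' hx hy hy'.
 rewrite e1 // in k1; rewrite e2 // in k2; rewrite (rn_distC v) in k1.
 apply: le_trans (rn_tri (f y v) (T x y) (f y' v)) _.
 apply: le_trans (lerD k1 (rn_tri (T x y) (T x y') (f y' v))) _.
 have k6 : rn (a x) <= e + rn v by have := rn_tri (a x) v 0; rewrite !subr0; move: h; lra.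
 by apply: (estimate3 (d := rn (a x - v)) (n := rn (a x))) => //; rewrite ?rn_ge0 // ltW.
have ex2 v : exists g : V2 -> W, rnlip g (rn v) /\ forall y, X2 y -> g (b y) = f y v.
 have [|g lg gf] := extend1 (T := f ^~ v) hW db (rn_ge0 v); last by exists g.
 by move=> y y' hy hy'; exact: ef.
have [g hg] := choice ex2.
exists g; split=> [x y hx hy|w v v'|v].
- by have [_ ->//] := hg (a x); have [_ ->] := hf y hy.
- apply: (@le_small _ _ _ (rn v + rn v' + rn (v - v'))) => [|e e0].
  by rewrite !addr_ge0 ?rn_ge0.
 have [y hy h] := db w e e0; have [l1 e1] := hg v; have [l2 e2] := hg v'; have [l3 _] := hf y hy.
 have k1 := l1 w (b y); have k2 := l2 (b y) w; have k3 := l3 v v'.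
 rewrite e1 // in k1; rewrite e2 // in k2; rewrite (rn_distC w) in k1.
 apply: le_trans (rn_tri (g v w) (f y v) (g v' w)) _.
 apply: le_trans (lerD k1 (rn_tri (f y v) (f y v') (g v' w))) _.
 have k6 : rn (b y) <= e + rn w by have := rn_tri (b y) w 0; rewrite !subr0; move: h; lra.
 by apply: (estimate3 (d := rn (b y - w)) (n := rn (b y))) => //; rewrite ?rn_ge0 // ltW.
- by have [] := hg v.
Qed.

End Extension.
Section DenseIdentities.
Variable R : realType.
Local Notation C := R[i].

(** A purely topological form of density, stable under products, so that identities in several
    variables can be checked on products of dense sets. *)
Definition tdense (S : Type) (T : topologicalType) (X0 : set S) (j : S -> T) :=
 forall (v : T) (A : set T), nbhs v A -> exists2 x, X0 x & A (j x).

Lemma tdense_prod (S S' : Type) (T T' : topologicalType) (X : set S) (X' : set S') (j : S -> T) (j' : S' -> T') :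
 tdense X j -> tdense X' j' -> tdense (X `*` X') (fun p => (j p.1, j' p.2)).
Proof.
move=> d d' [v v'] A [[B B'] /= [nB nB'] BA].
have [x hx Bx] := d v B nB; have [x' hx' Bx'] := d' v' B' nB'.
by exists (x, x') => //; apply: BA.
Qed.

Lemma rndense_tdense (S : Type) (X0 : set S) (V : normedModType C) (j : S -> V) :
 rndense X0 j -> tdense X0 j.
Proof.
move=> d v A /nbhs_rnP[e e0 hA]; have [x hx h] := d v e e0.
by exists x => //; apply: hA; rewrite rn_distC.
Qed.

Lemma dense_rndense (S : Type) (X0 : set S) (V : normedModType C) (j : S -> V) :
 dense (j @` X0) -> rndense X0 j.
Proof.
move=> d v e e0.
have nv : nbhs v [set w | rn (v - w) < e] by apply/nbhs_rnP; exists e.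
have [w [/interior_subset h [x hx jx]]] : ([set w | rn (v - w) < e]^° `&` (j @` X0)) !=set0.
 by apply: d; [exists v|exact: open_interior].
by exists x => //; rewrite jx rn_distC.
Qed.

Lemma rndense_dense (S : Type) (X0 : set S) (V : normedModType C) (j : S -> V) :
 rndense X0 j -> dense (j @` X0).
Proof.
move=> d O [v Ov] oO; have /nbhs_rnP[e e0 h] : nbhs v O by exact: open_nbhs_nbhs.
have [x hx hj] := d v e e0; exists (j x); split; last by exists x.
by apply: h; rewrite rn_distC.
Qed.

Lemma tdense_le (S : Type) (T : topologicalType) (X0 : set S) (j : S -> T) (f g : T -> R) :
 tdense X0 j -> continuous f -> continuous g -> (forall x, X0 x -> f (j x) <= g (j x)) -> forall v, f v <= g v.
Proof.
move=> d cf cg h v; apply/ler_addgt0Pr => e e0.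
have e2 := halfR_gt0 e0.
have /cvgrPdist_lt/(_ _ e2) n1 := cf v; have /cvgrPdist_lt/(_ _ e2) n2 := cg v.
have [x hx [/=]] := d v _ (filterI n1 n2); rewrite !ltr_norml => /andP[_ h1] /andP[h2 _].
by have := h x hx; lra.
Qed.

Lemma tdense_eq (S : Type) (T : topologicalType) (X0 : set S) (j : S -> T) (W : normedModType C) (f g : T -> W) :
 tdense X0 j -> continuous f -> continuous g -> (forall x, X0 x -> f (j x) = g (j x)) -> forall v, f v = g v.
Proof.
move=> d cf cg h v; apply/eqP; rewrite -subr_eq0; apply/eqP/rn_eq0/eqP; rewrite eq_le rn_ge0 andbT.
have := tdense_le (f := fun v => rn (f v - g v)) (g := fun=> 0) d; apply.
- move=> t; apply: (@continuous_comp _ _ _ (fun t => f t - g t) (@rn R W)); last exact: rn_cont.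
 by apply: cvgB; [exact: cf|exact: cg].
- exact: cst_continuous.
- by move=> x /h ->; rewrite subrr rn0.
Qed.

(** Joint continuity in a form that composes, as the tactic [ctn] needs it. *)
Definition bicts (V1 V2 W : topologicalType) (E : V1 -> V2 -> W) :=
 forall (T : topologicalType) (f : T -> V1) (g : T -> V2), continuous f -> continuous g ->
  continuous (fun t => E (f t) (g t)).

Lemma lip2_bicts (V1 V2 W : normedModType C) (E : V1 -> V2 -> W) :
 (forall w, rnlip (E ^~ w) (rn w)) -> (forall v, rnlip (E v) (rn v)) -> bicts E.
Proof.
move=> l1 l2 T f g cf cg t; apply/rn_cvgP => e e0.
have m0 : 0 < rn (f t) + rn (g t) + 1 by rewrite ltr_wpDl ?addr_ge0 ?rn_ge0.
pose d := Num.min 1 (e / (rn (f t) + rn (g t) + 1)).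
have d0 : 0 < d by rewrite lt_min ltr01 divr_gt0.
have n1 : \forall s \near t, rn (f t - f s) < d by move: (cf t) => /(rn_cvgP _); exact.
have n2 : \forall s \near t, rn (g t - g s) < d by move: (cg t) => /(rn_cvgP _); exact.
apply: filterS2 n1 n2 => s h1 h2.
apply: le_lt_trans (rn_tri _ (E (f t) (g s)) _) _.
have k1 := l2 (f t) (g t) (g s); have k2 := l1 (g s) (f t) (f s).
have k3 : rn (g s) <= rn (g t) + 1.
 have := rn_tri (g s) (g t) 0; rewrite !subr0 (rn_distC (g s)) => /le_trans; apply.
 by rewrite addrC lerD2l; apply: ltW; apply: lt_le_trans h2 _; rewrite ge_min lexx.
have k4 : d * (rn (f t) + rn (g t) + 1) <= e.
 by rewrite -ler_pdivlMr // ge_min lexx orbT.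
apply: lt_le_trans k4; apply: le_lt_trans (lerD k1 k2) _.
have k5 : rn (f t) * rn (g t - g s) <= rn (f t) * d by rewrite ler_wpM2l ?rn_ge0 // ltW.
have k6 : rn (g s) * rn (f t - f s) <= (rn (g t) + 1) * rn (f t - f s) by rewrite ler_wpM2r ?rn_ge0.
have k7 : (rn (g t) + 1) * rn (f t - f s) < (rn (g t) + 1) * d.
 by rewrite ltr_pM2l // ltr_wpDl ?rn_ge0.
by apply: le_lt_trans (lerD k5 k6) _; rewrite mulrC; move: k7; lra.
Qed.

Lemma addv_cts (T : topologicalType) (V : normedModType C) (f g : T -> V) :
 continuous f -> continuous g -> continuous (fun t => f t + g t).
Proof. by move=> cf cg t; apply: cvgD; [exact: cf|exact: cg]. Qed.
Lemma oppv_cts (T : topologicalType) (V : normedModType C) (f : T -> V) :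
 continuous f -> continuous (fun t => - f t).
Proof. by move=> cf t; apply: cvgN; exact: cf. Qed.
Lemma scalev_cts (T : topologicalType) (V : normedModType C) (k : C) (f : T -> V) :
 continuous f -> continuous (fun t => k *: f t).
Proof. by move=> cf t; apply: (@cvgZ _ _ _ (nbhs t) _ (fun=> k) f k (f t)); [exact: cvg_cst|exact: cf]. Qed.
Lemma mulC_cts (T : topologicalType) (k : C) (f : T -> C^o) :
 continuous f -> continuous (fun t => k * f t : C^o).
Proof. exact: scalev_cts. Qed.
Lemma conjC_cts (T : topologicalType) (f : T -> C^o) :
 continuous f -> continuous (fun t => conjc (f t) : C^o).
Proof.
move=> cf; apply: (cont_comp cf); apply: (@rnlip_cont _ C^o C^o _ 1) => v w.
by rewrite mul1r -rmorphB; have := rn_conj (v - w); rewrite /rn /= => ->.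
Qed.

End DenseIdentities.

Ltac ctn := cbv beta; repeat first
 [ lazymatch goal with
  | |- continuous (fun _ => (_ + _)) => apply: addv_cts
  | |- continuous (fun _ => - _) => apply: oppv_cts
  | |- continuous (fun _ => _ *: _) => apply: scalev_cts
  | |- continuous (fun _ => (_ * _)) => apply: mulC_cts
  | |- continuous (fun _ => conjc _) => apply: conjC_cts
  | |- continuous (fun _ => fst _) => apply: (cont_comp _ (@cont_fst _ _))
  | |- continuous (fun _ => snd _) => apply: (cont_comp _ (@cont_snd _ _))
  end
 | match goal with
  | h : bicts ?E |- continuous (fun _ => ?E _ _) => apply: h
  | h : continuous ?g |- continuous (fun _ => ?g _) => apply: (cont_comp _ h)
  end
 | exact: cont_fst | exact: cont_snd | (move=> ?; exact: cvg_id) | exact: cst_continuous | assumption ].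

(** * Representations and the universal norm *)

Section Representations.
Variables (R : realType) (GG : groupoid) (E : fell_ops R GG) (lam : measure_system R GG).
Variable CE : fell_cstar E lam.
Local Notation C := R[i].
Local Notation io := (fcs_iota CE).
Local Notation Gc := (Gammac E).
Hypothesis hX : hausdorff_space GG.
Hypothesis hlin : forall k f g, Gc f -> Gc g -> Gc (slin k f g).
Hypothesis hconv : forall f g, Gc f -> Gc g -> Gc (sconv lam f g).
Hypothesis hstar : forall f, Gc f -> Gc (sstar f).

Lemma io_lin k f g : Gc f -> Gc g -> io (slin k f g) = k *: io f + io g.
Proof. by case: (fcsP CE) => h *; exact: h. Qed.
Lemma io_conv f g : Gc f -> Gc g -> io (sconv lam f g) = cmul (io f) (io g).
Proof. by case: (fcsP CE) => _ h *; exact: h. Qed.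
Lemma io_star f : Gc f -> io (sstar f) = cstar (io f).
Proof. by case: (fcsP CE) => _ _ h *; exact: h. Qed.
Lemma io_dense : rndense Gc io.
Proof. by apply: dense_rndense; case: (fcsP CE). Qed.
Lemma io_norm f : Gc f -> universal_norm lam f = (rn (io f))%:E.
Proof. by case: (fcsP CE) => _ _ _ h *; exact: h. Qed.
Lemma le_normC (V W : normedModType C) (v : V) (w : W) (B : R) : `|v| <= B%:C * `|w| = (rn v <= B * rn w).
Proof. by rewrite -!rnE -rmorphM lecR. Qed.

Section OneRep.
Variables (V : completeNormedModType C) (ip : V -> V -> C) (L : (GG -> E) -> V -> V).
Hypothesis hL : is_representation lam ip L.

Lemma rep_lin f : Gc f -> forall k v w, L f (k *: v + w) = k *: L f v + L f w.
Proof. by case: hL => _ [[h _ _ _ _] _]; exact: h. Qed.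
Lemma rep_slin k f g : Gc f -> Gc g -> forall v, L (slin k f g) v = k *: L f v + L g v.
Proof. by case: hL => _ [[_ _ h _ _] _]; exact: h. Qed.
Lemma rep_conv f g : Gc f -> Gc g -> forall v, L (sconv lam f g) v = L f (L g v).
Proof. by case: hL => _ [[_ _ _ h _] _]; exact: h. Qed.
Lemma rep_star f : Gc f -> forall v w, ip (L f v) w = ip v (L (sstar f) w).
Proof. by case: hL => _ [[_ _ _ _ h] _]; exact: h. Qed.
Lemma ip_lin k u v w : ip (k *: u + v) w = k * ip u w + ip v w.
Proof. by case: hL => -[h _ _] _; exact: h. Qed.
Lemma ip_conj u v : ip u v = conjc (ip v u).
Proof. by case: hL => -[_ h _] _; exact: h. Qed.
Lemma ip_sq v : complex.Re (ip v v) = rn v ^+ 2.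
Proof. by case: hL => -[_ _ h] _; rewrite h -rnE -rmorphXn. Qed.
Lemma rep0 f : Gc f -> L f 0 = 0.
Proof. by move=> hf; have := rep_lin hf (-1) 0 0; rewrite scaler0 addr0 scaleN1r addNr. Qed.
Lemma repZ f k v : Gc f -> L f (k *: v) = k *: L f v.
Proof. by move=> hf; have := rep_lin hf k v 0; rewrite rep0 // !addr0. Qed.
Lemma ip_lin_r k u v w : ip w (k *: u + v) = conjc k * ip w u + ip w v.
Proof. by rewrite ip_conj ip_lin rmorphD rmorphM /= -!ip_conj. Qed.
Lemma ip_oppr v w : ip w (- v) = - ip w v.
Proof.
have ip0 : ip w 0 = 0.
 by have := ip_lin_r 1 0 0 w; rewrite scaler0 addr0 rmorph1 mul1r => /eqP; rewrite -subr_eq0 opprD addNKr oppr_eq0 => /eqP.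
by have := ip_lin_r (-1) v 0 w; rewrite addr0 scaleN1r ip0 addr0 rmorphN1 mulN1r.
Qed.

Lemma ip_cs u v : rn (ip u v) <= rn u * rn v.
Proof.
apply: sqr_le; first by rewrite mulr_ge0 ?rn_ge0.
rewrite exprMn; apply: quadratic_bound; rewrite ?sqr_ge0 // => t.
have := sqr_ge0 (rn (((- t)%:C * conjc (ip u v)) *: u + v)); rewrite -ip_sq.
rewrite ip_lin !ip_lin_r (ip_conj v u) -mulrA.
set z := ip u v; have -> : conjc ((- t)%:C * conjc z) = (- t)%:C * z by rewrite conj_scale conjcK.
have -> : (- t)%:C * conjc z * ((- t)%:C * z * ip u u + z) + ((- t)%:C * z * conjc z + ip v v) =
  (t ^+ 2 * rn z ^+ 2)%:C * ip u u + ((- t *+ 2 * rn z ^+ 2)%:C + ip v v).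
 have eM (a b : R) : (a * b)%:C = a%:C * b%:C by exact: rmorphM.
 have eD (a b : R) : (a + b)%:C = a%:C + b%:C by exact: rmorphD.
 have eN (a : R) : (- a)%:C = - a%:C by exact: rmorphN.
 by have := conj_mulC z; move: (rn z ^+ 2) => N hN; rewrite !eM mulr2n eD eN -hN; ring.
by rewrite !ReD Re_scale !ip_sq /= mulrnAl mulNr => h; rewrite mulrA; move: h; rewrite !mulr2n; lra.
Qed.

Lemma rep_bound f v : Gc f -> rn (L f v) <= rn (io f) * rn v.
Proof.
move=> hf; have unit w : rn w <= 1 -> rn (L f w) <= rn (io f).
 move=> w1; rewrite -lee_fin -(io_norm hf); apply: le_trans (_ : opnorm (L f) <= _)%E.
  by apply: ereal_sup_ubound; exists w => //=; rewrite -rnE lecR.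
 by apply: ereal_sup_ubound; exists V, ip, L.
have [v0|v0] := eqVneq (rn v) 0; first by rewrite (rn_eq0 v0) rep0 // !rn0 mulr0.
have v1 : 0 < rn v by rewrite lt_neqAle eq_sym v0 rn_ge0.
have := unit ((rn v)^-1%:C *: v); rewrite repZ // !rnZ !rn_pos ?invr_ge0 ?rn_ge0 // mulVf //.
by move=> /(_ (lexx _)); rewrite mulrC ler_pdivrMr.
Qed.

(** Continuity at the zero section among sections supported in [K], rescaled. The zero section is
    built as a difference of one section supported there with itself; if there is none, nothing has
    to be shown. *)
Lemma rep_cont0 (K : set GG) : compact K -> exists2 c : R, 0 <= c & forall f M, Gc f -> bsupp f `<=` K ->
 (forall x, bnorm (f x) <= M) -> 0 <= M -> forall v, rn (L f v) <= c * M * rn v.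
Proof.
move=> cK; have [[f0 [hf0 sf0]]|none] := pselect (exists f, Gc f /\ bsupp f `<=` K); last first.
 by exists 0 => // f M hf fK; case: none; exists f.
pose z := slin (-1) f0 f0; have hz : Gc z by exact: hlin.
have z0 x : z x = bzero E x by rewrite /z /slin scaleN1r addNr.
have sz (f : GG -> E) : (forall x, f x = bzero E x) -> bsupp f `<=` K.
 by move=> f00 x; rewrite /bsupp (_ : [set _ | _] = set0) ?closure0 // -subset0 => y /=; rewrite f00.
have [_ [_ /(_ K cK z hz (sz z z0) 1 ltr01)[d d0 hd]]] := hL.
have Lz v : L z v = 0 by rewrite rep_slin // scaleN1r addNr.
exists (2 / d); first by rewrite divr_ge0 // ltW.
move=> f M hf fK fM M0 v.
have [sf _ _] := hf.
have M1 : 0 < M + 1 by lra.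
have small (e : R) : 0 < e -> rn (L f v) <= 2 / d * (M + e) * rn v.
 move=> e0; have Me : 0 < M + e by lra.
 pose k := d / 2 / (M + e); have k0 : 0 < k by rewrite !divr_gt0.
 pose g := slin k%:C f z; have hg : Gc g by exact: hlin.
 have gE x : g x = binj (k%:C *: bco x (f x)) by rewrite /g /slin z0 bco_zero addr0.
 have gK : bsupp g `<=` K.
  apply: subset_trans fK; apply: closure_subset => x /= gx fx; apply: gx.
  by rewrite gE fx bco_zero scaler0.
 have := hd g hg gK _ v; rewrite Lz subr0 le_normC mul1r => h.
 have : rn (L g v) <= rn v.
  apply: h => x; rewrite bdistE gE bcoE z0 bco_zero subr0 rnZ rn_pos ?(ltW k0) //.
  rewrite -(@bnormE _ _ _ x) //; apply: le_lt_trans (_ : k * (M + e) < d).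
   by rewrite ler_wpM2l ?(ltW k0) //; have := fM x; lra.
  by rewrite /k divfK ?gt_eqF //; lra.
 rewrite rep_slin // Lz addr0 rnZ rn_pos ?(ltW k0) // => h2.
 rewrite (_ : 2 / d * (M + e) = k^-1); last by rewrite /k !invf_div mulrC.
 by rewrite mulrC ler_pdivlMr // mulrC.
apply: (@le_small _ _ _ (2 / d * rn v)) => [|e /small]; first by rewrite mulr_ge0 ?rn_ge0 // divr_ge0 // ltW.
by rewrite mulrDr mulrDl -mulrA; move/le_trans; apply; rewrite mulrA -mulrA [e * _]mulrC -mulrA mulrCA lerD // mulrC mulrA [_ * e]mulrC mulrA.
Qed.

End OneRep.

Lemma io_le f (M : R) : Gc f -> (forall (V : completeNormedModType C) ip (L : (GG -> E) -> V -> V),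
 is_representation lam ip L -> forall v, rn (L f v) <= M * rn v) -> 0 <= M -> rn (io f) <= M.
Proof.
move=> hf h M0; rewrite -lee_fin -(io_norm hf); apply: ub_ereal_sup => _ [V [ip [L [hL ->]]]].
apply: ub_ereal_sup => _ [v /= v1 <-]; rewrite lee_fin; apply: le_trans (h _ _ _ hL v) _.
by rewrite -[leRHS]mulr1 ler_wpM2l // -lecR rnE.
Qed.

(** If 0 <= L g <= M in every representation, then M - L g has norm at most M, so multiplication of
    sections by M - g is bounded by [M] for the universal norm; density and [cpos_unit_bound]
    conclude. *)
Lemma rep_positive g : Gc g -> sstar g = g ->
 (forall (V : completeNormedModType C) ip (L : (GG -> E) -> V -> V),
  is_representation lam ip L -> forall v, 0 <= complex.Re (ip (L g v) v)) ->
 cpos (@cmul R CE) (@cstar R CE) (io g).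
Proof.
move=> hg sg pos; pose M := rn (io g) + 1.
have M0 : 0 < M by rewrite /M ltr_wpDl ?rn_ge0.
have gM : rn (io g) <= M by rewrite /M lerDl.
apply: (cpos_unit_bound M0) => //; first by rewrite -io_star // sg.
have key h : Gc h -> rn (M%:C *: io h - cmul (io g) (io h)) <= M * rn (io h).
 (* The section M h - g h, with M h written as (M - 1) h + h because [slin] scales only its first
    argument. *)
 move=> hh; pose k := slin (-1) (sconv lam g h) (slin (M - 1)%:C h h).
 have hgh := hconv hg hh; have h2 := hlin (M - 1)%:C hh hh.
 have -> : M%:C *: io h - cmul (io g) (io h) = io k.
  rewrite /k io_lin // io_lin // io_conv // scaleN1r addrC -[X in _ = _ + (_ + X)]scale1r -scalerDl.
  by rewrite -[1 : C](rmorph1 (real_complex R)) -rmorphD subrK.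
 apply: io_le; [exact: hlin| |by rewrite mulr_ge0 ?rn_ge0 ?(ltW M0)].
 move=> V ip L hL v; rewrite (rep_slin hL) // (rep_slin hL) // (rep_conv hL) //.
 set w := L h v; set u := L g w.
 have sq (a b : V) (t : R) : rn (t%:C *: a + b) ^+ 2 = t ^+ 2 * rn a ^+ 2 + t * complex.Re (ip a b) *+ 2 + rn b ^+ 2.
  rewrite -!(ip_sq hL) (ip_lin hL) !(ip_lin_r hL) conjc_real (ip_conj hL b a).
  rewrite !ReD mulrDr !ReD !Re_scale Re_conj; ring.
 have sa (a b : V) : ip (L g a) b = ip a (L g b) by rewrite (rep_star hL) // sg.
 have Lgb (a : V) : rn (L g a) <= M * rn a.
  by apply: le_trans (rep_bound hL _ hg) _; rewrite ler_wpM2r ?rn_ge0.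
 have q1 (a : V) : complex.Re (ip (L g a) a) <= M * rn a ^+ 2.
  have sqa := sq a (L g a) (- M); rewrite -sa in sqa.
  have h0 : 0 <= rn ((- M)%:C *: a + L g a) ^+ 2 by exact: sqr_ge0.
  have h1 : rn (L g a) ^+ 2 <= M ^+ 2 * rn a ^+ 2.
   by rewrite -exprMn ler_pXn2r ?nnegrE ?mulr_ge0 ?rn_ge0 ?(ltW M0).
  rewrite sqa sqrrN mulNr mulNrn in h0.
  by rewrite -(ler_pM2l M0) mulrA -expr2; move: h0 h1; rewrite mulr2n; lra.
 (* Positivity of L g is tested at w - u/M, where u = L g w, and [q1] is used at u. *)
 have q2 : rn u ^+ 2 <= M * complex.Re (ip u w).
  have p := pos _ _ _ hL ((- M^-1)%:C *: u + w).
  have e0 : complex.Re (ip (L g ((- M^-1)%:C *: u + w)) ((- M^-1)%:C *: u + w)) =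
    (M^-1) ^+ 2 * complex.Re (ip (L g u) u) - (M^-1 * rn u ^+ 2) *+ 2 + complex.Re (ip u w).
   rewrite (rep_lin hL hg) -/u (ip_lin hL) !(ip_lin_r hL) conjc_real (sa u w) -/u.
   rewrite mulrDr !ReD !Re_scale (ip_sq hL); ring.
  rewrite e0 in p; have q := q1 u.
  have m2 : 0 <= M^-1 ^+ 2 by exact: sqr_ge0.
  have p2 := ler_wpM2l m2 q.
  have e1 : M^-1 ^+ 2 * (M * rn u ^+ 2) = M^-1 * rn u ^+ 2 by field; rewrite gt_eqF.
  rewrite e1 in p2; rewrite -(ler_pM2l (_ : 0 < M^-1)) ?invr_gt0 // mulKf ?gt_eqF //.
  by move: p p2; rewrite mulr2n; lra.
 have -> : -1 *: u + ((M - 1)%:C *: w + w) = M%:C *: w + - u.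
  rewrite scaleN1r addrC -[X in _ *: _ + X + _]scale1r -scalerDl.
  by rewrite -[1 : C](rmorph1 (real_complex R)) -rmorphD subrK.
 have q3 : rn (M%:C *: w + - u) <= M * rn w.
  apply: sqr_le; first by rewrite mulr_ge0 ?rn_ge0 // ltW.
  rewrite sq (ip_oppr hL) (ip_conj hL w u) rnN exprMn.
  have -> : complex.Re (- conjc (ip u w)) = - complex.Re (ip u w) by case: (ip u w).
  by move: q2; rewrite mulrN mulNrn mulr2n; have := sqr_ge0 (rn u); lra.
 apply: le_trans q3 _; rewrite -mulrA ler_wpM2l ?(ltW M0) //.
 exact: (rep_bound hL v hh).
move=> c; apply: (@le_small _ _ _ (M *+ 3)) => [|e e0]; first by rewrite mulrn_wge0 // ltW.
have [h hh hc] := io_dense c e0; rewrite rn_distC in hc.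
have -> : M%:C *: c - cmul (io g) c = (M%:C *: (c - io h) - cmul (io g) (c - io h)) +
  (M%:C *: io h - cmul (io g) (io h)).
 by rewrite cmulBr scalerBr opprB addrACA subrK (addrC (cmul (io g) (io h))) addrK.
apply: le_trans (rnD _ _) _; apply: le_trans (lerD (rnB _ _) (key h hh)) _.
have h1 := rn_cmul (io g) (c - io h).
have h2 : rn (io g) * rn (c - io h) <= M * rn (c - io h) by rewrite ler_wpM2r ?rn_ge0.
have h3 : rn (io h) <= rn c + rn (c - io h) by have := rnB c (c - io h); rewrite opprB addrCA subrr addr0.
have h4 := ler_wpM2l (ltW M0) (ltW hc); have h5 := ler_wpM2l (ltW M0) h3.
by rewrite rnZ rn_pos ?(ltW M0) // -mulr_natr; move: h1 h2 h4 h5; rewrite mulrDr; lra.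
Qed.

Hypothesis bounded : forall f, Gc f -> exists2 M : R, 0 <= M & forall x, bnorm (f x) <= M.

Variables (S : Type) (X0 : set S) (s : S -> S -> C) (act : (GG -> E) -> S -> S).
Let n x := Num.sqrt (complex.Re (s x x)).
Hypothesis X0n : X0 !=set0.
Hypothesis s_lin : forall k x y, X0 x -> X0 y -> exists2 z, X0 z & forall i, X0 i -> s z i = k * s x i + s y i.
Hypothesis s_conj : forall x y, X0 x -> X0 y -> s x y = conjc (s y x).
Hypothesis s_pos : forall x, X0 x -> 0 <= complex.Re (s x x).
Hypothesis s_cs : forall x y, X0 x -> X0 y -> rn (s x y) <= n x * n y.
Hypothesis act_X : forall f x, Gc f -> X0 x -> X0 (act f x).
Hypothesis act_lin : forall k f g x y, Gc f -> Gc g -> X0 x -> X0 y ->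
 s (act (slin k f g) x) y = k * s (act f x) y + s (act g x) y.
Hypothesis act_conv : forall f g x y, Gc f -> Gc g -> X0 x -> X0 y ->
 s (act (sconv lam f g) x) y = s (act f (act g x)) y.
Hypothesis act_adj : forall f x y, Gc f -> X0 x -> X0 y -> s (act f x) y = s x (act (sstar f) y).
Hypothesis act_bound : forall K : set GG, compact K -> exists2 B : R, 0 <= B &
 forall f M x, Gc f -> bsupp f `<=` K -> 0 <= M -> (forall z, bnorm (f z) <= M) -> X0 x ->
  n (act f x) <= B * M * n x.

(* the *-action of the sections on the Hilbert space obtained from [s] is one
  of the representations that define the universal norm *)
Theorem universal_bound f x : Gc f -> X0 x -> n (act f x) <= rn (io f) * n x.
Proof.
have n0 y : 0 <= n y by exact: sqrtr_ge0.
have sreal y : X0 y -> s y y = (n y ^+ 2)%:C.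
 move=> hy; rewrite sqr_sqrtr ?s_pos //; have := s_conj hy hy.
 case: (s y y) => a b [] /eqP; rewrite -addr_eq0 -mulr2n -mulr_natr mulf_eq0 pnatr_eq0 orbF => /eqP -> //.
have srn y : X0 y -> rn (s y y : C^o) = n y ^+ 2 by move=> /sreal ->; exact: (rn_pos (sqr_ge0 (n y))).
have [V [j [jlin jn jd]]] := @pairing_completion R S X0 (C^o : normedModType C) s n (@complex_ncomplete R) X0n n0 s_cs srn s_lin.
have jE x1 x2 : X0 x1 -> X0 x2 -> (forall i, X0 i -> s x1 i = s x2 i) -> j x1 = j x2.
 move=> h1 h2 e; have [z hz ez] := s_lin (-1) h1 h1.
 have jz : j z = 0 by rewrite (jlin _ _ _ _ h1 h1 hz ez) scaleN1r addNr.
 by rewrite (jlin 1 x2 z x1) // ?jz ?addr0 ?scale1r // => i hi; rewrite ez // e // scale1r mulN1r addNr addr0.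
have sub x1 x2 : X0 x1 -> X0 x2 -> exists z, [/\ X0 z, j z = j x1 - j x2 & forall i, X0 i -> s z i = s x1 i - s x2 i].
 move=> h1 h2; have [z hz ez] := s_lin (-1) h2 h1; exists z; split=> //.
  by rewrite (jlin _ _ _ _ h2 h1 hz ez) scaleN1r addrC.
 by move=> i hi; rewrite ez // mulN1r addrC.
have [ip [ipE ipl ipr]] : exists ip : V -> V -> C^o, [/\ forall x y, X0 x -> X0 y -> ip (j x) (j y) = s x y,
  forall w, rnlip (ip ^~ w) (rn w) & forall v, rnlip (ip v) (rn v)].
 apply: (extend2 (T := fun x y => s x y : C^o) (@complex_ncomplete R) jd jd) => [x1 x2 y h1 h2 hy|y x1 x2 hy h1 h2].
  have [z [hz jz sz]] := sub x1 x2 h1 h2; rewrite -sz // -jz !jn //; exact: s_cs.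
 have [z [hz jz sz]] := sub x1 x2 h1 h2; rewrite -jz !jn // (s_conj hy h1) (s_conj hy h2) -rmorphB -sz //.
 by have := s_cs hy hz; rewrite (s_conj hy hz).
have cip : bicts ip by exact: lip2_bicts.
have td := rndense_tdense jd.
(* This bound depends on the support of [g] and only serves to extend the action to the completion
   and to make it a representation. Once it is one, [rep_bound] supplies the universal norm as
   constant. *)
have crude g : Gc g -> exists2 B : R, 0 <= B & forall x, X0 x -> n (act g x) <= B * n x.
 move=> hg; have [M M0 hM] := bounded hg; have [_ _ cg] := hg; have [B B0 hB] := act_bound cg.
 by exists (B * M); [rewrite mulr_ge0|move=> y hy; apply: hB].
have exL g : exists h : V -> V, Gc g -> (exists2 B, 0 <= B & rnlip h B) /\ forall x, X0 x -> h (j x) = j (act g x).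
 have [hg|ng] := pselect (Gc g); last by exists id.
 have [B B0 hB] := crude g hg.
 have [|h lh hE] := extend1 (T := fun x => j (act g x)) (@rn_complete R V) jd B0; last by exists h => _; split=> //; exists B.
 move=> x1 x2 h1 h2; have [z [hz jz sz]] := sub x1 x2 h1 h2.
 have -> : j (act g x1) - j (act g x2) = j (act g z).
  have [z' [hz' jz' sz']] := sub _ _ (act_X hg h1) (act_X hg h2); rewrite -jz'.
  apply: jE => // [|i hi]; first exact: act_X.
  by rewrite sz' // !act_adj // sz //; apply: act_X => //; exact: hstar.
 by rewrite -jz !jn //; [exact: hB|exact: act_X].
have [L hL] := choice exL.
have cL g : Gc g -> continuous (L g) by move=> /hL[[B _ /rnlip_cont]].
have LE g y : Gc g -> X0 y -> L g (j y) = j (act g y) by move=> /hL[_]; exact.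
have td2 := tdense_prod td td; have td3 := tdense_prod td2 td.
have jsum k y z : X0 y -> X0 z -> exists w, [/\ X0 w, k *: j y + j z = j w & forall i, X0 i -> s w i = k * s y i + s z i].
 by move=> hy hz; have [w hw ew] := s_lin k hy hz; exists w; split=> //; rewrite (jlin _ _ _ _ hy hz hw ew).
have csq : continuous (fun r : R => (r ^+ 2)%:C : C^o).
 move=> r; apply/rn_cvgP => e e0.
 have /cvgrPdist_lt/(_ _ e0) : (fun r : R => r ^+ 2 : R^o) @ r --> (r ^+ 2 : R^o) by exact: exprn_continuous.
 by apply: filterS => z; rewrite -rmorphB -rn_real.
have rep : is_representation lam ip L.
 split; last split.
 - split=> [k u v w|u v|v].
  + apply: (tdense_eq (W := C^o) (f := fun p : V * V * V => ip (k *: p.1.1 + p.1.2) p.2)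
    (g := fun p : V * V * V => k * ip p.1.1 p.2 + ip p.1.2 p.2) td3 _ _ _ (u, v, w)); try by ctn.
   move=> [[x1 x2] y] [[/= h1 h2] hy]; have [z [hz -> ez]] := jsum k x1 x2 h1 h2.
   by rewrite !ipE // ez.
  + apply: (tdense_eq (W := C^o) (f := fun p : V * V => ip p.1 p.2)
    (g := fun p : V * V => conjc (ip p.2 p.1)) td2 _ _ _ (u, v)); try by ctn.
   by move=> [x1 x2] [/= h1 h2]; rewrite !ipE //; exact: s_conj.
  + rewrite -rnE -rmorphXn; apply: (tdense_eq (W := C^o) (f := fun v => ip v v) (g := fun v => (rn v ^+ 2)%:C) td).
   * by ctn.
   * exact: (cont_comp (@rn_cont R V) csq).
   * by move=> y hy; rewrite ipE // sreal // jn.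
 - split.
  + move=> g hg k v w; have c1 := cL g hg.
   apply: (tdense_eq (f := fun p : V * V => L g (k *: p.1 + p.2)) (g := fun p : V * V => k *: L g p.1 + L g p.2) td2 _ _ _ (v, w)); try by ctn.
   move=> [x1 x2] [/= h1 h2]; have [z [hz -> ez]] := jsum k x1 x2 h1 h2; rewrite !LE //.
   have [z' [hz' -> ez']] := jsum k _ _ (act_X hg h1) (act_X hg h2); apply: jE => // [|i hi]; first exact: act_X.
   by rewrite ez' // !act_adj // ez //; apply: act_X => //; exact: hstar.
  + move=> g hg; have [[B B0 lB] hE] := hL g hg; exists B%:C => v; rewrite le_normC.
   have [x0 hx0] := X0n; have [z [hz jz sz]] := sub x0 x0 hx0 hx0; rewrite subrr in jz.
   have L0 : L g 0 = 0.
    rewrite -[X in L g X]jz LE //; apply: rn_eq0; rewrite jn; last exact: act_X.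
    have [B' B'0 hB'] := crude g hg; apply/eqP; rewrite eq_le n0 andbT.
    by apply: le_trans (hB' z hz) _; rewrite -(jn z hz) jz rn0 mulr0.
   by have := lB v 0; rewrite L0 !subr0.
  + move=> k g h hg hh v; have c1 := cL g hg; have c2 := cL h hh; have c3 := cL _ (hlin k hg hh).
   apply: (tdense_eq (f := L (slin k g h)) (g := fun v => k *: L g v + L h v) td); try by ctn.
   move=> y hy; rewrite !LE //; last exact: hlin.
   have [z' [hz' -> ez']] := jsum k _ _ (act_X hg hy) (act_X hh hy).
   apply: jE => // [|i hi]; first by apply: act_X => //; exact: hlin.
   by rewrite ez' // act_lin.
  + move=> g h hg hh v; have c1 := cL g hg; have c2 := cL h hh; have c3 := cL _ (hconv hg hh).
   apply: (tdense_eq (f := L (sconv lam g h)) (g := fun v => L g (L h v)) td); try by ctn.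
   move=> y hy; rewrite !LE //; [|exact: act_X|exact: hconv].
   apply: jE => // [| |i hi]; [by apply: act_X => //; exact: hconv|by apply: act_X => //; exact: act_X|].
   exact: act_conv.
  + move=> g hg v w; have c1 := cL g hg; have c2 := cL _ (hstar hg).
   apply: (tdense_eq (W := C^o) (f := fun p : V * V => ip (L g p.1) p.2)
    (g := fun p : V * V => ip p.1 (L (sstar g) p.2)) td2 _ _ _ (v, w)); try by ctn.
   move=> [x1 x2] [/= h1 h2]; have hs := hstar hg; rewrite !LE // !ipE //; try exact: act_X.
   exact: act_adj.
 - move=> K cK g hg gK e e0; have [B B0 hB] := act_bound cK; have B1 : 0 < B + 1 by lra.
  exists (e / (B + 1)); first by rewrite divr_gt0.
  move=> h hh hK hd v; rewrite le_normC.
  pose k := slin (-1) g h; have hk : Gc k by exact: hlin.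
  have kE z : bco z (k z) = - bco z (g z) + bco z (h z) by rewrite bcoE scaleN1r.
  have kK : bsupp k `<=` K.
   apply: (bsupp_sub hX cK) => z nK; have [pk _ _] := hk.
   apply: (@bco_eq _ _ _ z); rewrite ?bpr_bzero ?pk // kE.
   by rewrite !bsuppP ?bco_zero ?addNr // => [/hK|/gK].
  have kM z : bnorm (k z) <= e / (B + 1).
   have [pk _ _] := hk; rewrite (@bnormE _ _ _ z) ?pk // kE addrC -bdistE; exact/ltW/hd.
  have c1 := cL g hg; have c2 := cL h hh.
  have eB : 0 <= e / (B + 1) by rewrite divr_ge0 ?(ltW e0) // ltW.
  have rc := @rn_cont R V.
  apply: (tdense_le (f := fun v => rn (L h v - L g v)) (g := fun v => e * rn v) td).
  + by apply: (cont_comp (f := fun v => L h v - L g v)) => //; ctn.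
  + by move=> u; apply: (@cvgM R^o); [exact: cvg_cst|exact: rc].
  move=> y hy; have -> : L h (j y) - L g (j y) = j (act k y).
   rewrite !LE //; have [z' [hz' jz' ez']] := sub _ _ (act_X hh hy) (act_X hg hy); rewrite -jz'.
   apply: jE => // [|i hi]; first exact: act_X.
   by rewrite ez' // act_lin // mulN1r addrC.
  rewrite !jn //; last exact: act_X.
  apply: le_trans (hB k _ y hk kK eB kM hy) _; rewrite ler_wpM2r // mulrCA ler_piMr ?(ltW e0) //.
  by rewrite ler_pdivrMr // mul1r; lra.
move=> hf hx; have := rep_bound rep (j x) hf; rewrite LE // !jn //; exact: act_X.
Qed.

End Representations.
Section DenseProducts.
Variable R : realType.

Lemma tdense2_eq (S1 S2 : Type) (V1 V2 : topologicalType) (X1 : set S1) (X2 : set S2) (a : S1 -> V1) (b : S2 -> V2)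
  (W : normedModType R[i]) (f g : V1 -> V2 -> W) : tdense X1 a -> tdense X2 b ->
 continuous (fun p : V1 * V2 => f p.1 p.2) -> continuous (fun p : V1 * V2 => g p.1 p.2) ->
 (forall x y, X1 x -> X2 y -> f (a x) (b y) = g (a x) (b y)) -> forall v w, f v w = g v w.
Proof.
move=> ta tb cf cg h v w.
apply: (tdense_eq (tdense_prod ta tb) (f := fun p => f p.1 p.2) (g := fun p => g p.1 p.2) cf cg _ (v, w)).
by move=> [x y] [hx hy]; exact: h.
Qed.

Lemma tdense3_eq (S1 S2 S3 : Type) (V1 V2 V3 : topologicalType) (X1 : set S1) (X2 : set S2) (X3 : set S3)
  (a : S1 -> V1) (b : S2 -> V2) (c : S3 -> V3) (W : normedModType R[i]) (f g : V1 -> V2 -> V3 -> W) :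
 tdense X1 a -> tdense X2 b -> tdense X3 c ->
 continuous (fun p : V1 * V2 * V3 => f p.1.1 p.1.2 p.2) -> continuous (fun p : V1 * V2 * V3 => g p.1.1 p.1.2 p.2) ->
 (forall x y z, X1 x -> X2 y -> X3 z -> f (a x) (b y) (c z) = g (a x) (b y) (c z)) -> forall u v w, f u v w = g u v w.
Proof.
move=> ta tb tc cf cg h u v w.
apply: (tdense_eq (tdense_prod (tdense_prod ta tb) tc) (f := fun p => f p.1.1 p.1.2 p.2)
 (g := fun p => g p.1.1 p.1.2 p.2) cf cg _ ((u, v), w)).
by move=> [[x y] z] [[hx hy] hz]; exact: h.
Qed.

Lemma tdense_cpos (B : cstar_algebra R) (S : Type) (V : topologicalType) (X0 : set S) (j : S -> V) (f : V -> B) :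
 tdense X0 j -> continuous f -> (forall x, X0 x -> cpos (@cmul R B) (@cstar R B) (f (j x))) ->
 forall v, cpos (@cmul R B) (@cstar R B) (f v).
Proof.
move=> tj cf pos v.
have /choice[x hx] (n : nat) : exists x, X0 x /\ rn (f (j x) - f v) < n.+1%:R^-1.
 have n0 : 0 < n.+1%:R^-1 :> R by rewrite invr_gt0.
 have nf : nbhs (f v) [set b | rn (b - f v) < n.+1%:R^-1].
  by apply/nbhs_rnP; exists n.+1%:R^-1 => // w /=; rewrite rn_distC.
 by have [x hx fx] := tj v _ (cf _ _ nf); exists x.
apply: (@cpos_closed _ _ (fun n => f (j (x n)))) => [n|e e0]; first by apply: pos; case: (hx n).
exists (Num.Def.truncn e^-1) => n hn; have [_ h] := hx n; apply: lt_le_trans h _.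
rewrite -[leRHS]invrK lef_pV2 ?posrE ?invr_gt0 //; apply/ltW/(lt_le_trans (truncnS_gt _)).
by rewrite ler_nat ltnS.
Qed.

Lemma tdense_sq (S : Type) (V W : normedModType R[i]) (X0 : set S) (j : S -> V) (E : V -> V -> W) :
 tdense X0 j -> (forall w, rnlip (E ^~ w) (rn w)) -> (forall v, rnlip (E v) (rn v)) ->
 (forall x, X0 x -> rn (E (j x) (j x)) = rn (j x) ^+ 2) -> forall v, `|E v v| = `|v| ^+ 2.
Proof.
move=> tj e1 e2 h v; rewrite -!rnE -rmorphXn; congr _%:C.
have cE := lip2_bicts e1 e2.
have c1 : continuous (fun v => rn (E v v)).
 by apply: (cont_comp (f := fun v => E v v) _ (@rn_cont _ _)); ctn.
have c2 : continuous (fun v : V => rn v ^+ 2).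
 by apply: (cont_comp (g := fun r : R => r ^+ 2) (@rn_cont _ V)); exact: exprn_continuous.
apply/eqP; rewrite eq_le; apply/andP; split.
 by apply: (tdense_le tj c1 c2) => x hx; rewrite h.
by apply: (tdense_le tj c2 c1) => x hx; rewrite h.
Qed.

Lemma dense_span_sub (V : normedModType R[i]) (P Q : set V) : P `<=` Q -> dense_span P -> dense_span Q.
Proof.
move=> PQ dP O O0 oO; have [v [Ov [n [c [w [hw e]]]]]] := dP O O0 oO.
by exists v; split=> //; exists n, c, w; split=> // i; exact: PQ.
Qed.

Lemma cmul_bicts (B : cstar_algebra R) : bicts (@cmul R B).
Proof.
apply: lip2_bicts => [w v v'|v w w']; rewrite -?cmulBl -?cmulBr; last exact: rn_cmul.
by rewrite mulrC; exact: rn_cmul.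
Qed.

Lemma cstar_cts (B : cstar_algebra R) : continuous (@cstar R B).
Proof. by apply: (@rnlip_cont _ _ _ _ 1) => v w; rewrite -cstarB rn_cstar mul1r. Qed.

End DenseProducts.

Section InnerSquares.
Variables (R : realType) (B : cstar_algebra R).

Lemma quadratic_expand (p c q : B) (t : R) :
 (- t)%:C *: ((- t)%:C *: cmul (cstar c) (cmul p c) + cmul (cstar c) c) + ((- t)%:C *: cmul (cstar c) c + q) =
 (t ^+ 2)%:C *: cmul (cstar c) (cmul p c) - (t *+ 2)%:C *: cmul (cstar c) c + q.
Proof.
rewrite scalerDr scalerA -rmorphM mulrNN -expr2 -addrA addrA -!addrA; congr (_ + _).
by rewrite addrA -scalerDl -rmorphD -opprD -mulr2n rmorphN scaleNr.
Qed.

(** Two uses of the C*-identity give |v|^4 = |v^4| <= |v^3| |v|. *)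
Lemma rn_cube (v : B) : cstar v = v -> rn (cmul (cmul v v) v) = rn v ^+ 3.
Proof.
move=> sv; apply/eqP; rewrite eq_le; apply/andP; split.
 rewrite exprS expr2 mulrA; apply: le_trans (rn_cmul _ _) _; rewrite ler_wpM2r ?rn_ge0 //.
 exact: rn_cmul.
have [v0|v0] := eqVneq (rn v) 0; first by rewrite v0 expr0n rn_ge0.
have v1 : 0 < rn v by rewrite lt_neqAle eq_sym v0 rn_ge0.
have sq (w : B) : cstar w = w -> rn (cmul w w) = rn w ^+ 2 by move=> sw; rewrite -{1}sw rn_cstar_mul.
rewrite -(ler_pM2r v1) -exprSr (_ : 4 = 2 * 2)%N // exprM -(sq v sv) -sq ?cstarM ?sv //.
by rewrite cmulA; exact: rn_cmul.
Qed.

Lemma cube_le (p q : R) : 0 <= p -> 0 <= q -> p ^+ 3 <= q ^+ 2 * p -> p <= q.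
Proof.
move=> p0 q0; have [->|pn] := eqVneq p 0; first by [].
have p1 : 0 < p by rewrite lt_neqAle eq_sym pn.
by rewrite exprSr ler_pM2r // ler_pXn2r.
Qed.

End InnerSquares.

Ltac td2 s t := refine (tdense2_eq s t _ _ _); [ctn|ctn|].
Ltac td3 s t u := refine (tdense3_eq s t u _ _ _); [ctn|ctn|].

(** * Completion of a pre-imprimitivity bimodule *)

Section Completion.
Variables (R : realType) (GA GB : groupoid) (T : ptopologicalType).
Variables (EA : fell_ops R GA) (lamA : measure_system R GA).
Variables (EB : fell_ops R GB) (lamB : measure_system R GB).
Variables (CA : fell_cstar EA lamA) (CB : fell_cstar EB lamB).
Variable EX : bundle R T.
Variables (lact : (GA -> EA) -> (T -> EX) -> (T -> EX))
     (ract : (T -> EX) -> (GB -> EB) -> (T -> EX))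
     (lip : (T -> EX) -> (T -> EX) -> (GA -> EA))
     (rip : (T -> EX) -> (T -> EX) -> (GB -> EB)).
Local Notation A0 := (Gammac EA).
Local Notation B0 := (Gammac EB).
Local Notation X0 := (Gammac EX).
Local Notation iA := (fcs_iota CA).
Local Notation iB := (fcs_iota CB).
Hypothesis pre : is_pre_imprimitivity_bimodule CA CB lact ract lip rip.
Hypothesis linA : forall k F F', A0 F -> A0 F' -> A0 (slin k F F').
Hypothesis linB : forall k g g', B0 g -> B0 g' -> B0 (slin k g g').
Hypothesis linX : forall k x y, X0 x -> X0 y -> X0 (slin k x y).
Hypothesis convA : forall F F', A0 F -> A0 F' -> A0 (sconv lamA F F').
Hypothesis convB : forall g g', B0 g -> B0 g' -> B0 (sconv lamB g g').
Hypothesis starA : forall F, A0 F -> A0 (sstar F).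
Hypothesis starB : forall g, B0 g -> B0 (sstar g).
Hypothesis X0n : X0 !=set0.
Hypothesis adjA : forall F x y, A0 F -> X0 x -> X0 y -> rip (lact F x) y = rip x (lact (sstar F) y).
Hypothesis adjB : forall x g y, X0 x -> B0 g -> X0 y -> lip (ract x g) y = lip x (ract y (sstar g)).

Theorem imprimitivity_completion : exists (X : completeNormedModType R[i]) (j : (T -> EX) -> X),
 is_imprimitivity_completion CA CB lact ract lip rip j.
Proof.
have [[lX rX lipA ripB] [[lact_l lact_r lact_m] [[ract_r ract_l ract_m lact_ract] [[lip_l lip_m lip_s lip_p]
 [[rip_r rip_m rip_s rip_p] [[dA dB] [lact_b [ract_b assoc]]]]]]]] := pre.
pose a x y := iA (lip x y); pose b x y := iB (rip x y).
have aL k x y z : X0 x -> X0 y -> X0 z -> a (slin k x y) z = k *: a x z + a y z.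
 by move=> *; rewrite /a lip_l // io_lin; auto.
have aS x y : X0 x -> X0 y -> a y x = cstar (a x y) by move=> *; rewrite /a -lip_s // io_star; auto.
have aM F x y : A0 F -> X0 x -> X0 y -> a (lact F x) y = cmul (iA F) (a x y).
 by move=> *; rewrite /a lip_m // io_conv; auto.
have aR k x y z : X0 x -> X0 y -> X0 z -> a z (slin k x y) = conjc k *: a z x + a z y.
 by move=> hx hy hz; rewrite (aS (slin k x y)) ?aL // ?cstarD ?cstarZ -?aS; auto.
have aMr F x y : A0 F -> X0 x -> X0 y -> a x (lact F y) = cmul (a x y) (cstar (iA F)).
 by move=> hF hx hy; rewrite (aS (lact F y)) ?aM // ?cstarM -?aS; auto.
have bL k x y z : X0 x -> X0 y -> X0 z -> b z (slin k x y) = k *: b z x + b z y.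
 by move=> *; rewrite /b rip_r // io_lin; auto.
have bS x y : X0 x -> X0 y -> b y x = cstar (b x y) by move=> *; rewrite /b -rip_s // io_star; auto.
have bM x y g : X0 x -> X0 y -> B0 g -> b x (ract y g) = cmul (b x y) (iB g).
 by move=> *; rewrite /b rip_m // io_conv; auto.
have bR k x y z : X0 x -> X0 y -> X0 z -> b (slin k x y) z = conjc k *: b x z + b y z.
 by move=> hx hy hz; rewrite (bS z) ?bL // ?cstarD ?cstarZ -?bS; auto.
have bMl x y g : X0 x -> X0 y -> B0 g -> b (ract x g) y = cmul (cstar (iB g)) (b x y).
 by move=> hx hy hg; rewrite (bS y) ?bM // ?cstarM -?bS; auto.
have cs_b x y : X0 x -> X0 y -> rn (b x y) ^+ 2 <= rn (b x x) * rn (b y y).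
 move=> hx hy; apply: cauchy_schwarz => [|t]; first exact: rip_p.
 (* [hz] concerns y - t x <x, y>, whose inner square is the quadratic expression of
    [cauchy_schwarz]. *)
 have hg := ripB _ _ hx hy; have hr := rX _ _ hx hg; have hz := linX (- t)%:C hr hy.
 have := rip_p _ hz; rewrite -/(b _ _) bL // !bR // !bM // !bMl // -/(b x y) (bS x y) // conjc_real.
 by rewrite -cmulA quadratic_expand.
have cs_a x y : X0 x -> X0 y -> rn (a x y) ^+ 2 <= rn (a x x) * rn (a y y).
 move=> hx hy; apply: cauchy_schwarz => [|t]; first exact: lip_p.
 have hg := lipA _ _ hy hx; have hr := lX _ _ hg hx; have hz := linX (- t)%:C hr hy.
 have := lip_p _ hz; rewrite -/(a _ _) aL // !aR // !aM // !aMr // -/(a y x) (aS x y) // conjc_real cstarK.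
 by rewrite quadratic_expand.
have lact_le F x : A0 F -> X0 x -> rn (b (lact F x) (lact F x)) <= rn (iA F) ^+ 2 * rn (b x x).
 move=> hF hx; have hp := rip_p _ (lX _ _ hF hx).
 have := cpos_mono hp (lact_b _ _ hF hx); rewrite -rnE -rmorphXn rnZ rn_pos ?sqr_ge0 //.
have ract_le x g : X0 x -> B0 g -> rn (a (ract x g) (ract x g)) <= rn (iB g) ^+ 2 * rn (a x x).
 move=> hx hg; have hp := lip_p _ (rX _ _ hx hg).
 have := cpos_mono hp (ract_b _ _ hx hg); rewrite -rnE -rmorphXn rnZ rn_pos ?sqr_ge0 //.
(* applying the two boundedness conditions to [lip x x] and [rip x x] gives
  [|q^3| <= |p|^2 |q|] and [|p^3| <= |q|^2 |p|] for the inner squares p, q *)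
have norm_ab x : X0 x -> rn (a x x) = rn (b x x).
 move=> hx; have ha := lipA _ _ hx hx; have hb := ripB _ _ hx hx.
 apply/eqP; rewrite eq_le; apply/andP; split.
  apply: cube_le; rewrite ?rn_ge0 // -(rn_cube (esym (aS _ _ hx hx))).
  have := ract_le _ _ hx hb; rewrite -assoc // aM ?aMr; auto.
  by rewrite -/(a x x) -(aS x x) // -/(b x x) cmulA.
 apply: cube_le; rewrite ?rn_ge0 // -(rn_cube (esym (bS _ _ hx hx))).
 have := lact_le _ _ ha hx; rewrite assoc // bMl ?bM; auto.
 by rewrite -/(b x x) -(bS x x) // -/(a x x) cmulA.
pose n x := Num.sqrt (rn (b x x)).
have n0 x : 0 <= n x by exact: sqrtr_ge0.
have nsq x : n x ^+ 2 = rn (b x x) by exact: (sqr_sqrtr (rn_ge0 _)).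
have nb x y : X0 x -> X0 y -> rn (b x y) <= n x * n y.
 by move=> hx hy; apply: sqr_le; rewrite ?mulr_ge0 // exprMn !nsq; exact: cs_b.
have na x y : X0 x -> X0 y -> rn (a x y) <= n x * n y.
 by move=> hx hy; apply: sqr_le; rewrite ?mulr_ge0 // exprMn !nsq -!norm_ab //; exact: cs_a.
(* The pairing is taken with its arguments exchanged, since [b] is linear in the second variable. *)
have [|x hx|k x y hx hy|V [j [jlin jn jd]]] := @pairing_completion R _ X0 CB (fun x i => b i x) n
  (@rn_complete R CB) X0n n0.
- by move=> x y hx hy; rewrite mulrC; exact: nb.
- by rewrite nsq.
- by exists (slin k x y) => [|i hi]; auto.
have jL k x y : X0 x -> X0 y -> j (slin k x y) = k *: j x + j y.
 by move=> hx hy; apply: (jlin k x y); auto.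
have jB x y : X0 x -> X0 y -> j x - j y = j (slin (-1) y x).
 by move=> hx hy; rewrite jL // scaleN1r addrC.
have iAB F F' : A0 F -> A0 F' -> iA F - iA F' = iA (slin (-1) F' F).
 by move=> hF hF'; rewrite io_lin // scaleN1r addrC.
have iBB g g' : B0 g -> B0 g' -> iB g - iB g' = iB (slin (-1) g' g).
 by move=> hg hg'; rewrite io_lin // scaleN1r addrC.
have jl F x : A0 F -> X0 x -> rn (j (lact F x)) <= rn (iA F) * rn (j x).
 move=> hF hx; rewrite !jn; auto; apply: sqr_le; first by rewrite mulr_ge0 ?rn_ge0.
 by rewrite exprMn !nsq; exact: lact_le.
have jr x g : X0 x -> B0 g -> rn (j (ract x g)) <= rn (j x) * rn (iB g).
 move=> hx hg; rewrite !jn; auto; apply: sqr_le; first by rewrite mulr_ge0 ?rn_ge0.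
 by rewrite exprMn !nsq -!norm_ab // 1?mulrC; auto.
have cN1 : conjc (-1 : R[i]) = -1 by exact: rmorphN1.
have [] := @extend2 R _ _ A0 X0 CA V V iA j (fun F x => j (lact F x)) (@rn_complete R V) (@io_dense _ _ _ _ CA) jd.
- by move=> F F' x *; rewrite jB -?lact_l ?iAB; auto.
- by move=> F x x' *; rewrite jB -?lact_r ?(jB x); auto.
move=> lactX [lE l1 l2].
have [] := @extend2 R _ _ X0 B0 V CB V j iB (fun x g => j (ract x g)) (@rn_complete R V) jd (@io_dense _ _ _ _ CB).
- by move=> x x' g *; rewrite jB -?ract_l ?(jB x); auto.
- by move=> x g g' *; rewrite jB -?ract_r ?iBB; auto.
move=> ractX [rE r1 r2].
have [] := @extend2 R _ _ X0 X0 V V CA j j a (@rn_complete R CA) jd jd.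
- by move=> x x' y hx hx' hy; have hz := linX (-1) hx' hx; rewrite jB // !jn // -[X in rn X](_ : a (slin (-1) x' x) y = _) ?na // aL // scaleN1r addrC.
- by move=> y x x' hy hx hx'; have hz := linX (-1) hx' hx; rewrite jB // !jn // -[X in rn X](_ : a y (slin (-1) x' x) = _) ?na // aR // cN1 scaleN1r addrC.
move=> lipX [lipE p1 p2].
have [] := @extend2 R _ _ X0 X0 V V CB j j b (@rn_complete R CB) jd jd.
- by move=> x x' y hx hx' hy; have hz := linX (-1) hx' hx; rewrite jB // !jn // -[X in rn X](_ : b (slin (-1) x' x) y = _) ?nb // bR // cN1 scaleN1r addrC.
- by move=> y x x' hy hx hx'; have hz := linX (-1) hx' hx; rewrite jB // !jn // -[X in rn X](_ : b y (slin (-1) x' x) = _) ?nb // bL // scaleN1r addrC.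
move=> ripX [ripE q1 q2].
have cl := lip2_bicts l1 l2; have cr := lip2_bicts r1 r2.
have cp := lip2_bicts p1 p2; have cq := lip2_bicts q1 q2.
have cmA := @cmul_bicts R CA; have cmB := @cmul_bicts R CB.
have csA := @cstar_cts R CA; have csB := @cstar_cts R CB.
have tA := rndense_tdense (@io_dense _ _ _ _ CA); have tB := rndense_tdense (@io_dense _ _ _ _ CB); have tX := rndense_tdense jd.
exists V, j, lactX, ractX, lipX, ripX; split; [|split; [exact: jL|split; [exact: rndense_dense|by split=> *; rewrite ?lE ?rE ?lipE ?ripE]]].
split; [|split; [|split; [|split; [|split]]]].
- split=> [k|k|].
 + by td3 tA tA tX; move=> *; rewrite -io_lin // !lE ?lact_l ?jL; auto.
 + by td3 tA tX tX; move=> *; rewrite -jL // !lE ?lact_r ?jL; auto.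
 + by td3 tA tA tX; move=> *; rewrite -io_conv // !lE ?lact_m; auto.
- split=> [k|k|].
 + by td3 tX tB tB; move=> *; rewrite -io_lin // !rE ?ract_r ?jL; auto.
 + by td3 tX tX tB; move=> *; rewrite -jL // !rE ?ract_l ?jL; auto.
 + by td3 tX tB tB; move=> *; rewrite -io_conv // !rE ?ract_m; auto.
- split=> [k|||v|v].
 + by td3 tX tX tX; move=> *; rewrite -jL // !lipE ?aL; auto.
 + by td3 tA tX tX; move=> *; rewrite lE // !lipE ?aM; auto.
 + by td2 tX tX; move=> *; rewrite !lipE // -aS.
 + apply: (tdense_cpos (f := fun v => lipX v v) tX) => [|x hx]; first by ctn.
  by rewrite lipE //; exact: lip_p.
 + by apply: (tdense_sq tX p1 p2) => x hx; rewrite lipE // jn // nsq norm_ab.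
- split=> [k|||v|v].
 + move=> x y z; move: z x y.
  by td3 tX tX tX; move=> *; rewrite -jL // !ripE ?bL; auto.
 + by td3 tX tX tB; move=> *; rewrite rE // !ripE ?bM; auto.
 + by td2 tX tX; move=> *; rewrite !ripE // -bS.
 + apply: (tdense_cpos (f := fun v => ripX v v) tX) => [|x hx]; first by ctn.
  by rewrite ripE //; exact: rip_p.
 + by apply: (tdense_sq tX q1 q2) => x hx; rewrite ripE // jn // nsq.
- split.
 + apply: dense_span_sub dA => _ [[x y] /= [hx hy] <-]; exists (j x, j y) => //=; exact: lipE.
 + apply: dense_span_sub dB => _ [[x y] /= [hx hy] <-]; exists (j x, j y) => //=; exact: ripE.
- split.
 + by td3 tA tX tB; move=> *; rewrite lE // !rE ?lE ?lact_ract; auto.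
 + by td3 tA tX tX; move=> F x y *; rewrite -io_star // !lE ?ripE; auto; rewrite /b adjA.
 + by td3 tX tB tX; move=> x g y *; rewrite -io_star // !rE ?lipE; auto; rewrite /a adjB.
 + by td3 tX tX tX; move=> *; rewrite lipE // ripE // lE ?rE ?assoc; auto.
Qed.

End Completion.

(** * The equivalence bimodule *)

Section Equivalence.
Variables (R : realType) (G : topGroupType) (H : closed_subgroup G).
Local Notation C := R[i].
Local Notation T := (subg_type H).
Local Notation GH := (coset_space H).
Local Notation inc := (@subg_inc G H).
Local Notation gG := (group_groupoid G).
Variables (mu : borel_measure R G) (nu : borel_measure R T).
Variable A : fell_ops R gG.
Hypotheses (hsG : hausdorff_space G) (lcG : locally_compact [set: G]) (lG : lcpt G).
Hypotheses (hmu : left_haar mu) (hnu : left_haar nu) (hA : is_fell_bundle A).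
Local Notation "x %:g" := (x : gG) (at level 2, format "x %:g").
Local Notation bI m x f := (bint (E := A) m x f).
Local Notation AGH := (trans_fell (coset_gspace H) A).
Local Notation AH := (restr_fell H A).
Local Notation GX := (trans_groupoid (coset_gspace H)).
Local Notation GT := (group_groupoid T).
Let hsH : hausdorff_space T. Proof. exact: subg_hausdorff. Qed.
Let muK : finite_on_compacts G mu. Proof. by case: hmu. Qed.
Let nuK : finite_on_compacts T nu. Proof. by case: hnu. Qed.
Let posG : forall U : set G, open U -> U !=set0 -> (0 < mu U)%E. Proof. by case: hmu. Qed.
Let posH : forall U : set T, open U -> U !=set0 -> (0 < nu U)%E. Proof. by case: hnu. Qed.
Let hE : is_usc_banach_bundle A. Proof. by case: hA. Qed.

(** * The fibres of the Fell bundle *)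

Section FibreAlgebra.
Implicit Types x y z : G.

Lemma bpr_fmul (a b : A) : bpr (fmul a b) = (bpr a * bpr b)%g.
Proof. exact: bpr_mul. Qed.
Lemma bpr_fstar (a : A) : bpr (fstar a) = (bpr a)^-1%g.
Proof. exact: bpr_star. Qed.
Lemma fmulA (a b c : A) : fmul a (fmul b c) = fmul (fmul a b) c.
Proof. by have [_ [_ [[_ _ _ h] _]]] := hA; apply: h. Qed.
Lemma fmul_cont (T : topologicalType) (f g : T -> A) : continuous f -> continuous g ->
 continuous (fun t => fmul (f t) (g t)).
Proof.
move=> cf cg; have [_ [_ [[h _ _ _] _]]] := hA.
by apply: (cont_within_comp (f := fun t => (f t, g t)) h) => //; exact: cont_pair.
Qed.

Lemma fstar_cont (T : topologicalType) (f : T -> A) : continuous f ->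
 continuous (fun t => fstar (f t)).
Proof. by move=> cf; apply: cont_comp cf _; have [_ [_ [_ [[]]]]] := hA. Qed.
Lemma fstarM (a b : A) : fstar (fmul a b) = fmul (fstar b) (fstar a).
Proof. by have [_ [_ [_ [[_ _ h _] _]]]] := hA; apply: h. Qed.
Lemma fstarK (a : A) : fstar (fstar a) = a.
Proof. by have [_ [_ [_ [[_ _ _ h] _]]]] := hA; apply: h. Qed.

Local Notation fm := (@fib_mul R _ A _ _).
Local Notation fs := (@fib_star R _ A _).
Local Notation "'F' x" := (fib A (x : gG)) (at level 10).

(** The target index [z] is a variable tied by an equation in G, so that the fibres over 1 x and
    over x, say, need not be identified by casts. *)
Lemma fm_inj x y z (v : F x) (w : F y) : z = (x * y)%g ->
 binj (fm z v w) = fmul (binj v) (binj w).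
Proof. by move=> ->; rewrite /fib_mul bcoK // bpr_fmul !bpr_binj. Qed.
Lemma fs_inj x y (v : F x) : y = (x^-1)%g -> binj (fs y v) = fstar (binj v).
Proof. by move=> ->; rewrite /fib_star bcoK // bpr_fstar bpr_binj. Qed.
Lemma fm_linl x y z k (v v' : F x) (w : F y) : z = (x * y)%g ->
 fm z (k *: v + v') w = k *: fm z v w + fm z v' w.
Proof. by move=> ->; have [_ [_ [[_ h _ _] _]]] := hA; apply: h. Qed.
Lemma fm_linr x y z k (v : F x) (w w' : F y) : z = (x * y)%g ->
 fm z v (k *: w + w') = k *: fm z v w + fm z v w'.
Proof. by move=> ->; have [_ [_ [[_ _ h _] _]]] := hA; apply: h. Qed.
Lemma fs_lin x y k (v w : F x) : y = (x^-1)%g ->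
 fs y (k *: v + w) = conjc k *: fs y v + fs y w.
Proof. by move=> ->; have [_ [_ [_ [[_ h _ _] _]]]] := hA; apply: h. Qed.

Section Bilinear.
Variables (x y z : G).
Hypothesis hz : z = (x * y)%g.
Lemma fmDl (v v' : F x) (w : F y) : fm z (v + v') w = fm z v w + fm z v' w.
Proof. by have := fm_linl 1 v v' w hz; rewrite !scale1r. Qed.
Lemma fm0l (w : F y) : fm z (0 : F x) w = 0.
Proof. by apply: (@addrI _ (fm z (0 : F x) w)); rewrite -fmDl !addr0. Qed.
Lemma fmZl k (v : F x) (w : F y) : fm z (k *: v) w = k *: fm z v w.
Proof. by have := fm_linl k v 0 w hz; rewrite fm0l !addr0. Qed.
Lemma fmDr (v : F x) (w w' : F y) : fm z v (w + w') = fm z v w + fm z v w'.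
Proof. by have := fm_linr 1 v w w' hz; rewrite !scale1r. Qed.
Lemma fm0r (v : F x) : fm z v (0 : F y) = 0.
Proof. by apply: (@addrI _ (fm z v (0 : F y))); rewrite -fmDr !addr0. Qed.
Lemma fmZr k (v : F x) (w : F y) : fm z v (k *: w) = k *: fm z v w.
Proof. by have := fm_linr k v w 0 hz; rewrite fm0r !addr0. Qed.
Lemma fmNl (v : F x) (w : F y) : fm z (- v) w = - fm z v w.
Proof. by rewrite -scaleN1r fmZl scaleN1r. Qed.
Lemma fmNr (v : F x) (w : F y) : fm z v (- w) = - fm z v w.
Proof. by rewrite -scaleN1r fmZr scaleN1r. Qed.
Lemma fmBl (v v' : F x) (w : F y) : fm z (v - v') w = fm z v w - fm z v' w.
Proof. by rewrite fmDl fmNl. Qed.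
Lemma fmBr (v : F x) (w w' : F y) : fm z v (w - w') = fm z v w - fm z v w'.
Proof. by rewrite fmDr fmNr. Qed.
End Bilinear.

Section StarLinear.
Variables (x y : G).
Hypothesis hy : y = (x^-1)%g.
Lemma fsD (v w : F x) : fs y (v + w) = fs y v + fs y w.
Proof. by have := fs_lin 1 v w hy; rewrite !scale1r conjc1 scale1r. Qed.
Lemma fs0 : fs y (0 : F x) = 0.
Proof. by apply: (@addrI _ (fs y (0 : F x))); rewrite -fsD !addr0. Qed.
Lemma fsZ k (v : F x) : fs y (k *: v) = conjc k *: fs y v.
Proof. by have := fs_lin k v 0 hy; rewrite fs0 !addr0. Qed.
Lemma fsB (v w : F x) : fs y (v - w) = fs y v - fs y w.
Proof. by rewrite fsD -scaleN1r fsZ rmorphN1 scaleN1r. Qed.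
End StarLinear.

Lemma fmA x y w xy yw xyw (u : F x) (v : F y) (t : F w) : xy = (x * y)%g -> yw = (y * w)%g ->
 xyw = (x * yw)%g -> fm xyw u (fm yw v t) = fm xyw (fm xy u v) t.
Proof.
move=> e1 e2 e3; apply: (@binj_inj _ _ A).
by rewrite !fm_inj ?fmulA // e1 -mulgA -e2.
Qed.

Lemma fsM x y z z' (v : F x) (w : F y) : z = (x * y)%g -> z' = (z^-1)%g ->
 fs z' (fm z v w) = fm z' (fs (y^-1)%g w) (fs (x^-1)%g v).
Proof.
move=> e1 e2; apply: (@binj_inj _ _ A).
by rewrite fs_inj // !fm_inj ?fs_inj ?fstarM // e2 e1 invgM.
Qed.

Lemma fell_cstar_axiom : is_cstar_algebra (@fib_mul R _ A 1%g 1%g 1%g) (@fib_star R _ A 1%g 1%g).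
Proof. by have [_ [_ [_ [_ [h _]]]]] := hA; apply: (h 1%g). Qed.

Definition fcst : cstar_algebra R := CstarAlgebra fell_cstar_axiom.

Local Notation cp := (cpos (@cmul R fcst) (@cstar R fcst)).

Lemma fibre_imprimitivity x : is_imprimitivity_bimodule
 (@cmul R fcst) (@cstar R fcst) (@cmul R fcst) (@cstar R fcst)
 (@fib_mul R _ A 1%g x x) (@fib_mul R _ A x 1%g x)
 (fun v w : F x => fm 1%g v (fs (x^-1)%g w)) (fun v w : F x => fm 1%g (fs (x^-1)%g v) w).
Proof. by have [_ [_ [_ [_ [_ h]]]]] := hA; exact: (h x). Qed.
Lemma fpos_r x (v : F x) : cp (fm 1%g (fs (x^-1)%g v) v).
Proof. by have [_ [_ [_ [[]]]]] := fibre_imprimitivity x. Qed.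
Lemma fnorm_r x (v : F x) : rn (fm 1%g (fs (x^-1)%g v) v) = rn v ^+ 2.
Proof.
have [_ [_ [_ [[_ _ _ _ h] _]]]] := fibre_imprimitivity x.
by apply: complexI; rewrite rmorphXn /= !rnE h.
Qed.

Lemma fpos_l x (v : F x) : cp (fm 1%g v (fs (x^-1)%g v)).
Proof. by have [_ [_ [[]]]] := fibre_imprimitivity x. Qed.
Lemma fnorm_l x (v : F x) : rn (fm 1%g v (fs (x^-1)%g v)) = rn v ^+ 2.
Proof.
have [_ [_ [[_ _ _ _ h] _]]] := fibre_imprimitivity x.
by apply: complexI; rewrite rmorphXn /= !rnE h.
Qed.

Lemma fibre_dense x : dense_span [set fm 1%g p.1 (fs (x^-1)%g p.2) | p in [set: F x * F x]].
Proof. by have [_ [_ [_ [_ [[]]]]]] := fibre_imprimitivity x. Qed.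
Lemma rn_fs x y (v : F x) : y = (x^-1)%g -> rn (fs y v) = rn v.
Proof.
move=> e; apply/eqP; rewrite -(@eqrXn2 _ 2) ?rn_ge0 //; apply/eqP.
rewrite -fnorm_r -[RHS]fnorm_l; congr rn; subst y; apply: (@binj_inj _ _ A).
by rewrite !fm_inj ?fs_inj ?mulVg ?mulgV ?fstarK.
Qed.

Local Notation U := (unitization fcst).

Local Notation n_ := (@unm R U).

(** The unitization of the unit fibre acts on every fibre. Square roots such as that of 1 - z, which
    live in the unitization, can then be applied to vectors of any fibre. *)
Definition facl x (u : U) (c : F x) : F x := u.1 *: c + fm x u.2 c.

Lemma mul1gE x : x = (1 * x)%g. Proof. by rewrite mul1g. Qed.
Lemma mulg1E x : x = (x * 1)%g. Proof. by rewrite mulg1. Qed.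
Lemma mulVgE x : 1%g = (x^-1 * x)%g. Proof. by rewrite mulVg. Qed.
Lemma mulgVE x : 1%g = (x * x^-1)%g. Proof. by rewrite mulgV. Qed.

Lemma faclM x (u v : U) (c : F x) : facl (u * v) c = facl u (facl v c).
Proof.
case: u => l a; case: v => m b; rewrite /facl /=.
have h := mul1gE x.
rewrite scalerDr fmDr // fmZr // !fmDl // !fmZl // scalerA -(fmA _ _ _ (mul1gE _) h h) -!addrA.
by congr (_ + _); rewrite addrCA.
Qed.

Lemma faclB x (u v : U) (c : F x) : facl (u - v) c = facl u c - facl v c.
Proof.
case: u => l a; case: v => m b; rewrite /facl /=.
by rewrite scalerBl fmBl ?mul1g // opprD addrACA.
Qed.

Lemma facl1 x (c : F x) : facl (1 : U) c = c.
Proof. by rewrite /facl /= scale1r fm0l ?mul1g // addr0. Qed.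
Lemma facl_inj x (b : fcst) (c : F x) : facl (uinj b : U) c = fm x (b : F 1%g) c.
Proof. by rewrite /facl /= scale0r add0r. Qed.
Lemma faclZ x k (u : U) (c : F x) : facl (k *: u) c = k *: facl u c.
Proof. by case: u => l a; rewrite /facl /= fmZl ?mul1g // scalerDr scalerA. Qed.
Lemma facl_adj x (u : U) (c d : F x) : fm 1%g (fs (x^-1)%g (facl u c)) d =
 fm 1%g (fs (x^-1)%g c) (facl (ust u) d).
Proof.
case: u => l a; rewrite /facl /=.
have h := mul1gE x; have h' := mulVgE x.
rewrite fsD // fsZ // fmDl // fmZl // fmDr // fmZr //; congr (_ + _).
rewrite (fsM _ _ h erefl) (fmA (xy := (x^-1)%g) _ _ _ _ h h') ?invg1 ?mulg1 //.
Qed.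

(** With d^2 = |b|^2 - b^* b in the unitization, |b|^2 <c, c> - <b c, b c> = <d c, d c> is positive.
    Submultiplicativity of the norm across fibres is not among the axioms of a Fell bundle and is
    derived from this. *)
Lemma rn_facl_bound x (b : fcst) (c : F x) : rn (fm x (b : F 1%g) c) <= rn b * rn c.
Proof.
have b0 := rn_ge0 b; set M := rn b ^+ 2.
have ub : upos (uinj (cmul (cstar b) b) : U) by apply/cpos_upos; exact: cpos_mul.
have [|d [sd dd _ _]] := @upos_sqrt R U (M%:C%:A - uinj (cmul (cstar b) b)).
 apply: upos_bound; [exact: sqr_ge0|exact: ub.1|].
 by rewrite /= unorm_inj rn_cstar_mul.
have E : M%:C *: fm 1%g (fs (x^-1)%g c) c -
  fm 1%g (fs (x^-1)%g (fm x (b : F 1%g) c)) (fm x (b : F 1%g) c) =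
  fm 1%g (fs (x^-1)%g (facl d c)) (facl d c).
 rewrite facl_adj sd -faclM dd faclB faclZ facl1 fmBr ?mulVg // fmZr ?mulVg //; congr (_ - _).
 rewrite -!facl_inj facl_adj -faclM; congr (fm _ _ (facl _ _)).
 by rewrite ust_inj -uinjM.
have := @cpos_mono R fcst _ (M%:C *: fm 1%g (fs (x^-1)%g c) c) (fpos_r (fm x (b : F 1%g) c)).
rewrite E => /(_ (fpos_r _)); rewrite !fnorm_r rnZ rn_pos ?sqr_ge0 // fnorm_r -exprMn.
by apply: sqr_le; rewrite ?mulr_ge0 ?rn_ge0.
Qed.

Lemma fibre_cauchy_schwarz x (v w : F x) :
 rn (fm 1%g (fs (x^-1)%g v) w) <= rn v * rn w.
Proof.
suff : rn (fm 1%g (fs (x^-1)%g v) w) ^+ 2 <= (rn v * rn w) ^+ 2.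
 by apply: sqr_le; rewrite ?mulr_ge0 ?rn_ge0.
rewrite exprMn -[rn v ^+ 2]fnorm_r -[rn w ^+ 2]fnorm_r.
apply: (@cauchy_schwarz R fcst); first exact: fpos_r.
move=> t; set b := fm 1%g (fs _ v) w.
have := fpos_r (t%:C *: fm x v (b : F 1%g) - w); congr cp.
have h' := mulVgE x; have h1 := mulg1E x.
have hx := mulg1E (x^-1)%g; have hy := mulgVE x.
have e1 (u : F x) : fm 1%g (fs (x^-1)%g (fm x v (b : F 1%g))) u =
  fm 1%g (fs 1%g (b : F 1%g)) (fm 1%g (fs (x^-1)%g v) u).
 apply: (@binj_inj _ _ A); rewrite !fm_inj ?fs_inj ?fm_inj ?fs_inj ?mulVg ?invg1 ?mulg1 //.
 by rewrite fstarM fmulA.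
have e2 : fm 1%g (fs (x^-1)%g v) (fm x v (b : F 1%g)) = fm 1%g (fm 1%g (fs (x^-1)%g v) v) (b : F 1%g).
 by rewrite (fmA (xy := 1%g)) ?mulVg ?mulg1.
have e3 : fm 1%g (fs (x^-1)%g w) (fm x v (b : F 1%g)) = fm 1%g (fs 1%g (b : F 1%g)) (b : F 1%g).
 apply: (@binj_inj _ _ A); rewrite /b !fm_inj ?fs_inj ?fm_inj ?fs_inj ?mulVg ?invg1 ?mulg1 //.
 by rewrite fstarM fstarK fmulA.
rewrite fsB // fsZ // conjc_real fmBl // fmBr // fmBr // !fmZl // !fmZr // scalerA.
rewrite !e1 e2 e3 -rmorphM -expr2 mulr2n rmorphD /= scalerDl.
move: (fm 1%g (fs 1%g b) b) => u.
by rewrite !opprD opprK !addrA.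
Qed.

(** The inner square of v w is the inner product of w with v^* v w, which Cauchy-Schwarz and the
    bound for the action of the unit fibre control. *)
Lemma rn_fm x y z (v : F x) (w : F y) : z = (x * y)%g -> rn (fm z v w) <= rn v * rn w.
Proof.
move=> hz; apply: sqr_le; first by rewrite mulr_ge0 ?rn_ge0.
have E : fm 1%g (fs (z^-1)%g (fm z v w)) (fm z v w) =
  fm 1%g (fs (y^-1)%g w) (fm y (fm 1%g (fs (x^-1)%g v) v) w).
 apply: (@binj_inj _ _ A); rewrite !fm_inj ?fs_inj ?fm_inj ?fs_inj ?mulVg ?mul1g //.
 by rewrite fstarM !fmulA.
rewrite -fnorm_r E; apply: le_trans (fibre_cauchy_schwarz _ _) _.
have := rn_facl_bound (fm 1%g (fs (x^-1)%g v) v) w; rewrite fnorm_r => h.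
apply: le_trans (ler_wpM2l (rn_ge0 w) h) _.
by rewrite le_eqVlt; apply/orP; left; apply/eqP; ring.
Qed.

Lemma rn_facl x (u : U) (c : F x) : rn (facl u c) <= n_ u * rn c.
Proof.
have u0 := unm_ge0 u; set M := n_ u ^+ 2.
have [|d [sd dd _ _]] := @upos_sqrt R U (M%:C%:A - ust u * u).
 apply: upos_bound; [exact: sqr_ge0|exact: (upos_star_mul u).1|].
 by rewrite unmC.
have E : M%:C *: fm 1%g (fs (x^-1)%g c) c - fm 1%g (fs (x^-1)%g (facl u c)) (facl u c) =
  fm 1%g (fs (x^-1)%g (facl d c)) (facl d c).
 rewrite !facl_adj sd -!faclM dd faclB faclZ facl1 fmBr ?mulVg // fmZr ?mulVg //.
have := @cpos_mono R fcst _ (M%:C *: fm 1%g (fs (x^-1)%g c) c) (fpos_r (facl u c)).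
rewrite E => /(_ (fpos_r _)); rewrite !fnorm_r rnZ rn_pos ?sqr_ge0 // fnorm_r -exprMn.
by apply: sqr_le; rewrite mulr_ge0 // rn_ge0.
Qed.

Lemma bnorm_fmul (a b : A) : bnorm (fmul a b) <= bnorm a * bnorm b.
Proof.
rewrite -(bcoK (erefl (bpr a))) -(bcoK (erefl (bpr b))).
by rewrite -(fm_inj (z := (bpr a * bpr b)%g)) // !bnorm_binj; exact: rn_fm.
Qed.

Lemma bnorm_fstar (a : A) : bnorm (fstar a) = bnorm a.
Proof. by rewrite -(bcoK (erefl (bpr a))) -(fs_inj (y := (bpr a)^-1%g)) // !bnorm_binj rn_fs. Qed.

(** * Approximate units of the unit fibre *)

Section ApproximateUnit.
Variable t : G.
Implicit Types (v w : F t) (vs ws : seq (F t)).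
Local Notation lip v w := (fm 1%g v (fs (t^-1)%g w) : fcst).
Local Notation lsum vs := (\sum_(v <- vs) lip v v).
Local Notation ui b := (@uinj R fcst b : U).

Let ust_cancel (a b : U) : ust a = ust b -> a = b.
Proof. by move=> h; rewrite -[a]ustK h ustK. Qed.
Let facl_fm (u : U) v w : facl u (fm 1%g v (fs (t^-1)%g w)) = lip (facl u v) w.
Proof.
rewrite /facl fmDl ?mulgV // fmZl ?mulgV //; congr (_ + _).
by rewrite (fmA (xy := t)) ?mul1g ?mulgV.
Qed.

Let mul_uinj (u : U) (b : fcst) : u * ui b = ui (@facl 1%g u b).
Proof.
case: u => l a; congr pair => /=; first by rewrite mulr0.
by rewrite scale0r addr0.
Qed.

Let lip_star v w : cstar (lip v w) = lip w v.
Proof.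
apply: (@binj_inj _ _ A); rewrite /cstar /= fs_inj ?invg1 // !fm_inj ?fs_inj ?mulgV //.
by rewrite fstarM fstarK.
Qed.

Let lip_facl (u : U) v : ui (lip (facl u v) (facl u v)) = u * ui (lip v v) * ust u.
Proof.
apply: ust_cancel; rewrite !ustM ustK !ust_inj !lip_star mulrA mul_uinj facl_fm.
apply: ust_cancel; rewrite !ustM !ust_inj !lip_star.
by rewrite ustK mul_uinj facl_fm.
Qed.

Let uinj_sum vs (f : F t -> fcst) : ui (\sum_(v <- vs) f v) = \sum_(v <- vs) ui (f v).
Proof.
apply: (big_morph (@uinj R fcst : fcst -> U)) => //.
by move=> a b; congr pair; rewrite /= addr0.
Qed.

Let lsum_facl (u : U) vs : ui (lsum [seq facl u v | v <- vs]) = u * ui (lsum vs) * ust u.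
Proof.
rewrite big_map !uinj_sum mulr_sumr mulr_suml; apply: eq_bigr => v _.
exact: lip_facl.
Qed.

Let lsum_pos vs : cp (lsum vs).
Proof. by apply: cpos_sum => v; exact: fpos_l. Qed.
Let decay_v (u : U) vs v : v \in vs -> rn (facl u v) ^+ 2 <= n_ (u * ui (lsum vs) * ust u).
Proof.
move=> vx; rewrite -lsum_facl /= unorm_inj -fnorm_l big_map.
apply: (@cpos_mono R fcst); first exact: fpos_l.
rewrite (perm_big _ (perm_to_rem vx)) big_cons /= addrAC subrr add0r.
by apply: (@cpos_sum R fcst) => w; exact: fpos_l.
Qed.

(** Membership in the span of the products v w^* with v in [vs], put as an induction principle
    because it only serves to propagate a property from these generators. *)
Let spanned vs (b : F 1%g) := forall P : F 1%g -> Prop, P 0 ->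
 (forall u u', P u -> P u' -> P (u + u')) ->
 (forall k v w, v \in vs -> P (k *: fm 1%g v (fs (t^-1)%g w))) -> P b.

Let spanned_approx (bs : seq (F 1%g)) (e : R) : 0 < e -> exists vs,
 forall b, b \in bs -> exists2 b', rn (b - b') < e & spanned vs b'.
Proof.
move=> e0; elim: bs => [|b bs [vs IH]]; first by exists [::].
have := fibre_dense t; rewrite /dense_span => dn.
have nb : nbhs b [set c | rn (b - c) < e] by apply/nbhs_rnP; exists e.
have [||b' [/interior_subset/= bb' [n [k [w [hw b'E]]]]]] := dn [set c | rn (b - c) < e]^°.
- by exists b; exact: nb.
- exact: open_interior.
have {}hw i : exists p : F t * F t, w i = fm 1%g p.1 (fs (t^-1)%g p.2).
 by have [p _ <-] := hw i; exists p.
have [p hp] := choice hw.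
exists ([seq (p i).1 | i <- enum 'I_n] ++ vs) => c; rewrite inE => /orP[/eqP ->|/IH[c' cc' Sc']].
 exists b' => // P P0 PD PZ; rewrite b'E; elim/big_ind : _ => // i _.
 by rewrite hp; apply: PZ; rewrite mem_cat; apply/orP; left; apply/mapP; exists i; rewrite ?mem_enum.
exists c' => // P P0 PD PZ; apply: Sc' => // l v v' vv; apply: PZ.
by rewrite mem_cat vv orbT.
Qed.

(** Let z be the sum of the v v^* divided by M, let q = 1 - z and r^2 = q. Then 1 - q^m is the sum
    of the q^k z over k < m, hence again a sum of squares, of the vectors r^k v / sqrt M. It misses
    v w^* by q^m v w^*, and |q^m v|^2 <= M |q^m z| <= M/(m+1) by [power_decay]. By fullness of the
    fibre over [t] such products span densely in the unit fibre, and q^m is a contraction, so the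
    error is small on every b. The index [t] is arbitrary because the vectors will become values of
    sections at [t]. *)
Lemma fibre_approx_unit (bs : seq (F 1%g)) (e : R) : 0 < e -> exists vs,
 let E := lsum vs : F 1%g in
 (forall b, b \in bs -> rn (fm 1%g E b - b) < e) /\
 forall x (c : F x), rn (fm x E c - c) <= rn c.
Proof.
move=> e0; have [vs0 hvs] := spanned_approx bs (halfR_gt0 e0).
set M := rn (lsum vs0) + 1; have M0 : 0 < M by rewrite ltr_wpDl ?rn_ge0.
pose c0 : U := (Num.sqrt M)^-1%:C%:A.
have sc0 : ust c0 = c0 by exact: ust_algR.
pose vs := [seq facl c0 v | v <- vs0]; pose z := ui (lsum vs).
have zE : z = M^-1%:C *: ui (lsum vs0).
 rewrite /z lsum_facl sc0 /c0 mulr_algl mulr_algr scalerA -rmorphM -expr2.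
 by rewrite exprVn sqr_sqrtr // ltW.
have uz : upos z by apply/cpos_upos; exact: lsum_pos.
have z1 : n_ z <= 1.
 rewrite zE unm_real ?invr_ge0 ?(ltW M0) // ler_pdivrMl // mulr1 /= unorm_inj.
 by rewrite lerDl.
pose q := 1 - z; have uq : upos q.
 by have := upos_bound ler01 uz.1 z1; rewrite rmorph1 scale1r.
have q1 : n_ q <= 1 by apply: upos_le1 => //; rewrite /q opprB addrC subrK.
have qn1 m : n_ (q ^+ m) <= 1.
 elim: m => [|m IH]; first by rewrite expr0 unm1.
 rewrite exprS; apply: le_trans (unmM _ _) _.
 by rewrite -[X in _ <= X]mulr1; apply: ler_pM; rewrite ?unm_ge0.
have zq : z * q = q * z by rewrite /q mulrBr mulrBl mul1r mulr1.
have [r [sr rr ur cr]] := upos_sqrt uq.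
have zr : z * r = r * z by exact: cr.
have srk k : ust (r ^+ k) = r ^+ k by case: (upos_powers k ur).
have geo m : \sum_(k <- iota 0 m) q ^+ k * z = 1 - q ^+ m.
 elim: m => [|m IH]; first by rewrite big_nil expr0 subrr.
 have qS : q ^+ m.+1 = q ^+ m - q ^+ m * z by rewrite exprSr {2}/q mulrBr mulr1.
 by rewrite qS -addn1 iotaD big_cat big_seq1 IH add0n opprB addrA addrAC.
pose ws m := flatten [seq [seq facl (r ^+ k) v | v <- vs] | k <- iota 0 m].
have wsE m : ui (lsum (ws m)) = 1 - q ^+ m.
 rewrite -geo /ws; elim: (iota 0 m) => [|k l IH]; first by rewrite !big_nil.
 rewrite /= big_cat /= big_cons -IH.
 have uD (a b : fcst) : ui (a + b) = ui a + ui b by congr pair; rewrite /= addr0.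
 rewrite uD; congr (_ + _); rewrite lsum_facl srk -mulrA -/z.
 have -> : z * r ^+ k = r ^+ k * z by exact: (commrX k (zr : GRing.comm z r)).
 by rewrite mulrA -exprD -rr -expr2 -exprM mul2n addnn.
have act m x (c : F x) : fm x (lsum (ws m) : F 1%g) c - c = - facl (q ^+ m) c.
 rewrite -facl_inj -[X in _ - X]facl1 -faclB wsE addrAC subrr add0r.
 by rewrite -scaleN1r faclZ scaleN1r.
pose Q x (c : F x) := forall d : R, 0 < d -> exists N, forall m, (N <= m)%N -> rn (facl (q ^+ m) c) < d.
have faclD x u (c c' : F x) : facl u (c + c') = facl u c + facl u c'.
 by rewrite /facl scalerDr fmDr ?mul1g // addrACA.
have faclZr x u k (c : F x) : facl u (k *: c) = k *: facl u c.
 by rewrite /facl fmZr ?mul1g // scalerDr !scalerA mulrC.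
have QD x (c c' : F x) : Q x c -> Q x c' -> Q x (c + c').
 move=> h h' d d0; have [N hN] := h _ (halfR_gt0 d0); have [N' hN'] := h' _ (halfR_gt0 d0).
 exists (maxn N N') => m; rewrite geq_max => /andP[/hN a /hN' b].
 by rewrite faclD; apply: le_lt_trans (rnD _ _) _; lra.
have QZ x k (c : F x) : Q x c -> Q x (k *: c).
 move=> h d d0; have k1 : 0 < rn k + 1 by rewrite ltr_wpDl ?rn_ge0.
 have [N hN] := h _ (divr_gt0 d0 k1); exists N => m /hN; rewrite faclZr rnZ ltr_pdivlMr //.
 by have := rn_ge0 k; have := rn_ge0 (facl (q ^+ m) c); nra.
have Qv v w : v \in vs0 -> Q 1%g (fm 1%g v (fs (t^-1)%g w)).
 move=> vv d d0; pose D := M * (rn w + 1) ^+ 2 / d ^+ 2.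
 have D0 : 0 <= D by rewrite divr_ge0 ?sqr_ge0 // mulr_ge0 ?sqr_ge0 ?ltW.
 exists (Num.Def.truncn D) => m Nm; rewrite facl_fm; apply: le_lt_trans (rn_fm _ _ (mulgVE t)) _.
 rewrite rn_fs //.
 have h1 := decay_v (q ^+ m) vv; have [sqm _] := upos_powers m uq.
 have zz : ui (lsum vs0) = M%:C *: z by rewrite zE scalerA -rmorphM divff ?gt_eqF // scale1r.
 have h2 : n_ (q ^+ m * ui (lsum vs0) * ust (q ^+ m)) <= M * n_ (q ^+ m * z).
  rewrite sqm zz -scalerAr -scalerAl unm_real ?(ltW M0) // ler_wpM2l ?(ltW M0) //.
  apply: le_trans (unmM _ _) _; rewrite -[X in _ <= X]mulr1 ler_wpM2l ?unm_ge0 //.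
 have h3 := power_decay m uz z1.
 have h4 : D < m.+1%:R.
  by apply: lt_le_trans (truncnS_gt _) _; rewrite ler_nat ltnS.
 rewrite -/q in h3.
 have [m1 r0 w0] : [/\ 0 < m.+1%:R :> R, 0 <= rn (facl (q ^+ m) v) & 0 <= rn w] by rewrite ltr0n !rn_ge0.
 move: h4; rewrite ltr_pdivrMr ?exprn_gt0 // => h4.
 rewrite -(@ltr_pXn2r _ 2) ?nnegrE ?mulr_ge0 ?(ltW d0) // exprMn.
 rewrite -(ltr_pM2l m1); apply: le_lt_trans h4.
 move: h1 h2 h3; move: (rn (facl _ v)) (n_ _) (n_ _) (rn w) (m.+1%:R) m1 r0 w0 => a b c ww k k0 a0 w0 h1 h2 h3.
 have h5 : k * a ^+ 2 <= M by apply: le_trans (_ : k * (M * b) <= _); [rewrite ler_pM2l //; lra|rewrite mulrCA ler_piMr // (ltW M0)].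
 rewrite mulrA; apply: ler_pM; rewrite ?mulr_ge0 ?sqr_ge0 ?(ltW k0) //.
 by rewrite lerXn2r ?nnegrE //; lra.
have Qb b : b \in bs -> exists N, forall m, (N <= m)%N -> rn (facl (q ^+ m) b) < e.
 move=> /hvs[b' bb' sb']; have [|u u' qu qu'|k v w vv|N hN] := sb' (Q 1%g) _ _ _ _ (halfR_gt0 e0).
 - by move=> d d0; exists 0%N => m _; rewrite /facl fm0r ?mul1g // scaler0 addr0 rn0.
 - exact: QD.
 - by apply: QZ; exact: Qv.
 exists N => m /hN h; rewrite -(subrK b' b) faclD.
 apply: le_lt_trans (rnD _ _) _.
 have := rn_facl (q ^+ m) (b - b'); have := qn1 m; have := rn_ge0 (b - b'); nra.
have [N hN] : exists N, forall b, b \in bs -> forall m, (N <= m)%N -> rn (facl (q ^+ m) b) < e.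
 elim: {hvs} bs Qb => [|b l IH] Ql; first by exists 0%N.
 have [N hN] := Ql b (mem_head _ _).
 have [N' hN'] := IH (fun c cl => Ql c (mem_behead (s := _ :: _) cl)).
 exists (maxn N N') => c; rewrite inE => /orP[/eqP -> m|cl m].
  by rewrite geq_max => /andP[/hN].
 by rewrite geq_max => /andP[_ /hN']; apply.
exists (ws N) => /=; split=> [b bl|x c].
 by rewrite act rnN; exact: hN.
rewrite act rnN; apply: le_trans (rn_facl _ _) _.
by rewrite ler_piMl ?rn_ge0.
Qed.

End ApproximateUnit.

End FibreAlgebra.

(** Supports are tracked through the norm, since a product or an adjoint lies in another fibre than
    its factors and only norms can be compared. *)
Definition nz (a : A) : Prop := bnorm a <> 0.

Lemma nzN (a : A) (x : gG) : bpr a = x -> ~ nz a -> a = bzero A x.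
Proof. by move=> ax /contrapT; exact: bnorm_eq0. Qed.
Lemma nz_fmul (a b : A) : nz (fmul a b) -> nz a /\ nz b.
Proof.
move=> h; have h1 := bnorm_fmul a b; have h0 := bnorm_ge0 (fmul a b).
by split=> z; apply: h; move: h1; rewrite z ?mul0r ?mulr0 => h1; apply/le_anti/andP; split.
Qed.

Lemma nz_fstar (a : A) : nz (fstar a) -> nz a.
Proof. by rewrite /nz bnorm_fstar. Qed.

(** * Bundle-valued integrals and products *)

Section Integral.
Variables (S : ptopologicalType) (m : borel_measure R S).
Hypotheses (hS : hausdorff_space S)
 (mK : finite_on_compacts S m).
Implicit Types x z : gG.

Lemma nz_bint x f : (forall s, bpr (f s) = x) -> nz (bint (E := A) m x f) -> exists s, nz (f s).
Proof.
move=> pf h; apply: contrapT => n; apply: h.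
rewrite /bint (_ : (fun s => _) = fun=> 0) ?vint0 ?bnorm_zero //.
apply/funext => s; rewrite (@nzN (f s) x) ?bco_zero // => hs.
by apply: n; exists s.
Qed.

Lemma csecI x (K : set S) (f : S -> A) : continuous f -> (forall s, bpr (f s) = x) ->
 compact K -> (forall s, nz (f s) -> K s) -> csec x K f.
Proof. by move=> cf pf cK h; split=> // s nK; apply: nzN => // /h. Qed.
Lemma fmul_bint_l x z (K : set S) (a : A) (f : S -> A) : csec x K f -> z = (bpr a * x)%g :> G ->
 fmul a (bint m x f) = bint m z (fun s => fmul a (f s)).
Proof.
move=> sf hz; have aE := bcoK (erefl (bpr a)).
have := @bint_map _ _ A hE _ _ hS mK x z K f (fun v => fib_mul z (bco (bpr a) a) v) (fmul a) (rn (bco (bpr a) a)).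
apply=> //.
- by move=> v; rewrite fm_inj // aE.
- by move=> v w; rewrite fmDr.
- by move=> r v; rewrite fmZr.
- exact: rn_ge0.
- by move=> v; exact: rn_fm.
Qed.

Lemma fmul_bint_r x z (K : set S) (a : A) (f : S -> A) : csec x K f -> z = (x * bpr a)%g :> G ->
 fmul (bint m x f) a = bint m z (fun s => fmul (f s) a).
Proof.
move=> sf hz; have aE := bcoK (erefl (bpr a)).
have := @bint_map _ _ A hE _ _ hS mK x z K f (fun v => fib_mul z v (bco (bpr a) a)) (fun b => fmul b a) (rn (bco (bpr a) a)).
apply=> //.
- by move=> v; rewrite fm_inj // aE.
- by move=> v w; rewrite fmDl.
- by move=> r v; rewrite fmZl.
- exact: rn_ge0.
- by move=> v; rewrite mulrC; exact: rn_fm.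
Qed.

Lemma fstar_bint x z (K : set S) (f : S -> A) : csec x K f -> z = (x^-1)%g :> G ->
 fstar (bint m x f) = bint m z (fun s => fstar (f s)).
Proof.
move=> sf hz.
have := @bint_map _ _ A hE _ _ hS mK x z K f (fun v => fib_star z v) (@fstar _ _ A) 1.
apply=> //.
- by move=> v; rewrite fs_inj.
- by move=> v w; rewrite fsD.
- by move=> r v; rewrite fsZ // conjc_real.
- by move=> v; rewrite rn_fs // mul1r.
Qed.

Lemma eq_bint x (f g : S -> A) : f =1 g -> bint m x f = bint m x g.
Proof. by move=> fg; congr bint; exact/funext. Qed.

End Integral.

Lemma bint_swap (S U : ptopologicalType) (m : borel_measure R S)
  (m' : borel_measure R U) (x : gG) (F : S -> U -> A)
  (K : set S) (L : set U) :
 hausdorff_space S -> hausdorff_space U ->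
 (finite_on_compacts S m) ->
 (forall K : set U, compact K -> (m' K < +oo)%E) ->
 continuous (fun q : S * U => F q.1 q.2) -> (forall s t, bpr (F s t) = x) ->
 compact K -> compact L -> (forall s t, nz (F s t) -> K s /\ L t) ->
 bint m x (fun s => bint m' x (F s)) = bint m' x (fun t => bint m x (F^~ t)).
Proof.
move=> hS hT mK mK' cF pF cK cL F0; rewrite /bint; congr binj.
under eq_fun do rewrite bcoE; under [in RHS]eq_fun do rewrite bcoE.
apply: (vint_swap hS hT mK mK' (F := fun q : S * U => bco x (F q.1 q.2)) _ cK cL).
 by apply: (bco_cont hE cF) => -[s t]; exact: pF.
move=> s t nst /=; rewrite (@nzN (F s t) x) ?bco_zero // => /F0; exact: nst.
Qed.

Ltac fell_cts ::= lazymatch goal with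
 | |- continuous (fun _ => fmul _ _) => apply: fmul_cont
 | |- continuous (fun _ => fstar _) => apply: fstar_cont
 end.

(** A common setting for left convolution with kernels over G x G/H. The space G gives the module
    action and G x G/H the product of the convolution algebra; [lcos] yields the coset at which the
    kernel is evaluated. *)
Record lspace := LSpace {
 lsp :> ptopologicalType;
 lpi : lsp -> G;
 lcos : lsp -> GH;
 lact : G -> lsp -> lsp;
 lpi_cont : continuous lpi;
 lcos_cont : continuous lcos;
 lact_cont : continuous (fun p : G * lsp => lact p.1 p.2);
 lact1 : forall y, lact 1%g y = y;
 lactM : forall r s y, lact (r * s)%g y = lact r (lact s y);
 lpi_act : forall r y, lpi (lact r y) = (r * lpi y)%g;
 lcos_act : forall r y, lcos (lact r y) = coset_act r (lcos y);
 lsp_lcpt : lcpt lsp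
}.

(** The mirror setting for H: the space G gives the right module action of the sections over H, and
    H itself gives their convolution. *)
Record rspace := RSpace {
 rsp :> ptopologicalType;
 rpi : rsp -> G;
 ract : rsp -> T -> rsp;
 rpi_cont : continuous rpi;
 ract_cont : continuous (fun p : rsp * T => ract p.1 p.2);
 ract1 : forall y, ract y 1%g = y;
 ractM : forall y h k, ract y (h * k)%g = ract (ract y h) k;
 rpi_act : forall y h, rpi (ract y h) = (rpi y * inc h)%g;
 rsp_lcpt : lcpt rsp
}.

Definition group_lspace : lspace.
Proof.
refine (@LSpace G id (@coset_of G H) (fun s t => (s * t)%g) _ _ _ _ _ _ _ _) => //.
- by move=> t; exact: cvg_id.
- exact: coset_of_cont.
- exact: mulg_cont.
- exact: mul1g.
- by move=> r s y; rewrite mulgA.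
- by move=> r y; rewrite coset_actE.
Defined.

(** The arrow (s, q) carries the coset s q of its range, which is the source of every left factor
    composable with it. *)
Definition trans_lspace : lspace.
Proof.
refine (@LSpace (G * GH)%type fst (fun z => coset_act z.1 z.2) (fun s z => ((s * z.1)%g, z.2))
 _ _ _ _ _ _ _ _) => //.
- exact: cont_fst.
- exact: coset_act_cont.
- by cts.
- by move=> [s q] /=; rewrite mul1g.
- by move=> r s [u q] /=; rewrite mulgA.
- by move=> r [s q] /=; exact: (gactM (g := coset_gspace H)).
- by apply: prod_lcpt => //; exact: coset_lcpt.
Defined.

Definition group_rspace : rspace.
Proof.
refine (@RSpace G id (fun t h => (t * inc h)%g) _ _ _ _ _ _) => //.
- by move=> t; exact: cvg_id.
- by cts.
- exact: mulg1.
- by move=> y h k; rewrite -mulgA.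
Defined.

Definition subg_rspace : rspace.
Proof.
refine (@RSpace T (inc) (fun t h => (t * h)%g) _ _ _ _ _ _) => //.
- exact: subg_inc_cont.
- exact: mulg_cont.
- exact: mulg1.
- by move=> y h k; rewrite mulgA.
- exact: subg_lcpt.
Defined.

Local Notation gl := group_lspace.
Local Notation gr := group_rspace.
Local Notation tl := trans_lspace.
Local Notation sr := subg_rspace.

Lemma lact_cts (Y : lspace) (S : topologicalType) (f : S -> G) (g : S -> Y) :
 continuous f -> continuous g -> continuous (fun s => lact (f s) (g s)).
Proof. by move=> cf cg; apply: (cont_comp (cont_pair cf cg) (@lact_cont Y)). Qed.
Lemma ract_cts (Y : rspace) (S : topologicalType) (f : S -> Y) (g : S -> T) :
 continuous f -> continuous g -> continuous (fun s => ract (f s) (g s)).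
Proof. by move=> cf cg; apply: (cont_comp (cont_pair cf cg) (@ract_cont Y)). Qed.
Lemma ract_contr (Y : rspace) (y : Y) : continuous (ract y).
Proof. by apply: (@ract_cts Y T (fun=> y) id); cts. Qed.
Lemma lact_contr (Y : lspace) (r : G) : continuous (@lact Y r).
Proof. by apply: (@lact_cts Y Y (fun=> r) id); cts. Qed.
Lemma coset_act_cts (S : topologicalType) (f : S -> G) (g : S -> GH) :
 continuous f -> continuous g -> continuous (fun s => coset_act (f s) (g s)).
Proof. by move=> cf cg; apply: (cont_comp (cont_pair cf cg) (@coset_act_cont G H)). Qed.

Ltac ctx := repeat (cts; first
 [ lazymatch goal with
  | |- continuous (fun _ => lact _ _) => apply: lact_cts
  | |- continuous (fun _ => ract _ _) => apply: ract_cts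
  | |- continuous (fun _ => coset_act _ _) => apply: coset_act_cts
  | |- continuous (fun _ => lcos _) => apply: (cont_comp _ (@lcos_cont _))
  | |- continuous (fun _ => lpi _) => apply: (cont_comp _ (@lpi_cont _))
  | |- continuous (fun _ => rpi _) => apply: (cont_comp _ (@rpi_cont _))
  end | exact: lcos_cont | exact: lpi_cont | exact: rpi_cont
  | exact: ract_contr | exact: lact_contr]); cts.

Lemma fst_compact (S U : topologicalType) (K : set (S * U)) : compact K -> compact (fst @` K).
Proof.
by move=> cK; apply: continuous_compact => //; apply: continuous_subspaceT; exact: cont_fst.
Qed.

Ltac cpt := repeat first [assumption | exact: compact_set1 | apply: mulset_compact
 | apply: invset_compact | apply: subg_compact | apply: compactU | apply: fst_compact].
Ltac bp := intros; do ?[rewrite bpr_fmul | rewrite bpr_fstar | rewrite bpr_bscale];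
 repeat match goal with h : forall y, bpr (?f y) = _ |- context [bpr (?f _)] => rewrite h end;
 rewrite ?lpi_act ?rpi_act /=; gsimp.
Ltac fac a b := apply: (mulset_eq (x := a) (y := b)) => //; solve [exact: invsetI | by gsimp].
Ltac sec := apply: csecI; [by ctx | by bp | by cpt | ].

Definition cs (Y : topologicalType) (pi : Y -> G) (f : Y -> A) : Prop :=
 [/\ continuous f, forall y, bpr (f y) = pi y & exists2 K, compact K & forall y, nz (f y) -> K y].

Local Notation cA := (cs (fst : G * GH -> G)).
Local Notation cB := (cs inc).
Local Notation cX := (cs (id : G -> G)).
Definition lconv (Y : lspace) (F : G * GH -> A) (f : Y -> A) : Y -> A := fun y =>
 bint (E := A) mu (lpi y) (fun r => fmul (F (r, lcos (lact r^-1%g y))) (f (lact r^-1%g y))).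

Definition rconv (Y : rspace) (f : Y -> A) (g : T -> A) : Y -> A := fun y =>
 bint (E := A) nu (rpi y) (fun h => fmul (f (ract y h)) (g h^-1%g)).

(** The inner product before passing to the quotient. It is continuous in both group variables and
    invariant under right translation of [t] by H, so continuity over G x G/H follows from openness
    of the coset map. *)
Definition lip2 (x y : G -> A) (s t : G) : A :=
 bint (E := A) nu s (fun h => fmul (x (s * t * inc h)%g) (fstar (y (t * inc h)%g))).

Definition lipp (x y : G -> A) : G * GH -> A := fun z => lip2 x y z.1 (coset_repr z.2).

Definition ripp (x y : G -> A) : T -> A := fun h =>
 bint (E := A) mu (inc h) (fun s => fmul (fstar (x s^-1%g)) (y (s^-1 * inc h)%g)).

Lemma lactV (Y : lspace) (r : G) (y : Y) : lact r (lact r^-1%g y) = y.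
Proof. by rewrite -lactM mulgV lact1. Qed.
Lemma ractV (Y : rspace) (h : T) (y : Y) : ract (ract y h) h^-1%g = y.
Proof. by rewrite -ractM mulgV ract1. Qed.

Definition fsupp (Y : Type) (f : Y -> A) (K : set Y) := forall y, nz (f y) -> K y.

Section Left.
Variable Y : lspace.
Implicit Types (f : Y -> A) (F : G * GH -> A).

Lemma lconv_int F f y : cA F -> cs (@lpi Y) f -> exists2 K, compact K &
 csec (lpi y) K (fun r => fmul (F (r, lcos (lact r^-1%g y))) (f (lact r^-1%g y))).
Proof.
move=> [cF pF [K cK FK]] [cf pf [L cL fL]].
exists (fst @` K); first by cpt.
sec.
by move=> r /nz_fmul[/FK Kr _]; exists (r, lcos (lact r^-1%g y)).
Qed.

Lemma lconv_supp F f y : cA F -> cs (@lpi Y) f -> nz (lconv F f y) ->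
 exists r, nz (F (r, lcos (lact r^-1%g y))) /\ nz (f (lact r^-1%g y)).
Proof.
move=> [cF pF _] [cf pf _] /(nz_bint hsG muK)[r|r /nz_fmul h]; last by exists r.
by bp.
Qed.

Lemma lconv_cs F f : cA F -> cs (@lpi Y) f -> cs (@lpi Y) (lconv F f).
Proof.
move=> hF hf; have [cF pF [K cK FK]] := hF; have [cf pf [L cL fL]] := hf.
have cK1 : compact (fst @` K).
 by apply: continuous_compact => //; apply: continuous_subspaceT; exact: cont_fst.
split.
- apply: (bint_cont hE hsG muK (pi := @lpi Y)
  (F := fun q : G * Y => fmul (F (q.1, lcos (lact q.1^-1%g q.2))) (f (lact q.1^-1%g q.2)))).
 + exact: lpi_cont.
 + by ctx.
 + by bp.
 + move=> y0; have [M nM cM] := @lsp_lcpt Y y0; exists M, (fst @` K); split=> //.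
  move=> r y _ nK /=; apply: nzN; first by bp.
  by move=> /nz_fmul[/FK h _]; apply: nK; exists (r, lcos (lact r^-1%g y)).
- by move=> y; exact: bpr_bint.
- exists ((fun p : G * Y => lact p.1 p.2) @` ((fst @` K) `*` L)).
  apply: continuous_compact; last exact: compact_setX.
  by apply: continuous_subspaceT; exact: lact_cont.
 move=> y /(lconv_supp hF hf)[r [/FK Fr /fL fr]].
 exists (r, lact r^-1%g y); last by rewrite /= lactV.
 by split=> //=; exists (r, lcos (lact r^-1%g y)).
Qed.

End Left.

Section Right.
Variable Y : rspace.
Implicit Types (f : Y -> A) (g : T -> A).

Lemma rconv_int f g y : cs (@rpi Y) f -> cB g -> exists2 K, compact K &
 csec (rpi y) K (fun h => fmul (f (ract y h)) (g h^-1%g)).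
Proof.
move=> [cf pf [L cL fL]] [cg pg [K cK gK]].
exists (invset K); first exact: invset_compact.
sec.
by move=> h /nz_fmul[_ /gK Kh]; rewrite -[h]invgK; exact: invsetI.
Qed.

Lemma rconv_supp f g y : cs (@rpi Y) f -> cB g -> nz (rconv f g y) ->
 exists h, nz (f (ract y h)) /\ nz (g h^-1%g).
Proof.
move=> [cf pf _] [cg pg _] /(nz_bint hsH nuK)[h|h /nz_fmul hh]; last by exists h.
by rewrite bpr_fmul pf pg rpi_act -mulgA mulgV mulg1.
Qed.

Lemma rconv_cs f g : cs (@rpi Y) f -> cB g -> cs (@rpi Y) (rconv f g).
Proof.
move=> hf hg; have [cf pf [L cL fL]] := hf; have [cg pg [K cK gK]] := hg.
have cK1 : compact (invset K) by exact: invset_compact.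
split.
- apply: (bint_cont hE hsH nuK (pi := @rpi Y)
  (F := fun q : T * Y => fmul (f (ract q.2 q.1)) (g q.1^-1%g))).
 + exact: rpi_cont.
 + by ctx.
 + by move=> h y /=; rewrite bpr_fmul pf pg rpi_act -mulgA mulgV mulg1.
 + move=> y0; have [M nM cM] := @rsp_lcpt Y y0; exists M, (invset K); split=> //.
  move=> h y _ nK /=; apply: nzN; first by rewrite bpr_fmul pf pg rpi_act -mulgA mulgV mulg1.
  by move=> /nz_fmul[_ /gK hK]; apply: nK; rewrite -[h]invgK; exact: invsetI.
- by move=> y; exact: bpr_bint.
- exists ((fun p : Y * T => ract p.1 p.2) @` (L `*` K)).
  apply: continuous_compact; last exact: compact_setX.
  by apply: continuous_subspaceT; exact: ract_cont.
 move=> y /(rconv_supp hf hg)[h [/fL fh /gK gh]].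
 by exists (ract y h, h^-1%g); rewrite //= ractV.
Qed.

End Right.

Lemma lip2_int x y s t : cX x -> cX y -> exists2 K, compact K &
 csec (s : gG) K (fun h : T => fmul (x (s * t * inc h)%g) (fstar (y (t * inc h)%g))).
Proof.
move=> [cx px [K cK xK]] [cy py [L cL yL]].
have cM : compact [set h : T | mulset [set t^-1%g] L (inc h)].
 by cpt.
exists [set h : T | mulset [set t^-1%g] L (inc h)] => //.
apply: csecI => //.
- by cts.
- by bp.
- move=> h /nz_fmul[_ /nz_fstar/yL yh] /=.
 by fac (t^-1)%g (t * inc h)%g.
Qed.

Lemma lip2_supp x y s t : cX x -> cX y -> nz (lip2 x y s t) ->
 exists h : T, nz (x (s * t * inc h)%g) /\ nz (y (t * inc h)%g).
Proof.
move=> [cx px _] [cy py _] /(nz_bint hsH nuK)[h|h /nz_fmul[h1 /nz_fstar h2]]; last by exists h.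
by bp.
Qed.

Lemma lip2_coset x y s t (k : T) : cX x -> cX y ->
 lip2 x y s (t * inc k)%g = lip2 x y s t.
Proof.
move=> [cx px _] [cy py _]; rewrite /lip2.
rewrite -(bint_shift k hE hnu (f := fun h : T => fmul (x (s * t * inc h)%g) (fstar (y (t * inc h)%g)))).
- by apply: eq_bint => h; rewrite !mulgA.
- by cts.
- by bp.
Qed.

Lemma lippE x y s t : cX x -> cX y -> lipp x y (s, coset_of H t) = lip2 x y s t.
Proof.
move=> hx hy; rewrite /lipp /=; have /coset_eqP h := coset_reprK (coset_of H t).
by rewrite -(lip2_coset _ _ (subg_elt h) hx hy) /inc /= mulVKg.
Qed.

Lemma lipp_cs x y : cX x -> cX y -> cA (lipp x y).
Proof.
move=> hx hy; have [cx px [K cK xK]] := hx; have [cy py [L cL yL]] := hy.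
have c2 : continuous (fun q : G * G => lip2 x y q.1 q.2).
 apply: (bint_cont hE hsH nuK (pi := fst : G * G -> gG)
  (F := fun p : T * (G * G) => fmul (x (p.2.1 * p.2.2 * inc p.1)%g)
   (fstar (y (p.2.2 * inc p.1)%g)))).
 - exact: cont_fst.
 - by cts.
 - by bp.
 - move=> [s0 t0]; have [M nM cM] := lG t0; have [M' nM' cM'] := lG s0.
  exists (M' `*` M), [set h : T | mulset (invset M) L (inc h)]; split.
  + by exists (M', M).
  + exact: compact_setX.
  + by cpt.
  + move=> h [s t] [_ /= Mt] nh; apply: nzN.
    by bp.
   move=> /nz_fmul[_ /nz_fstar/yL yh]; apply: nh => /=.
   fac (t^-1)%g (t * inc h)%g.
split.
- move=> [s q]; rewrite -(coset_reprK q); set t := coset_repr q.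
 move=> W /=; rewrite lippE // => nW; have [[B D] /= [nB nD] BD] := c2 (s, t) _ nW.
 exists (B, coset_of H @` D) => /=; first by split=> //; exact: coset_nbhs.
 by move=> [s' _] [/= Bs [t' Dt <-]]; rewrite /= lippE //; exact: (BD (s', t')).
- by move=> [s q]; exact: bpr_bint.
- exists (mulset K (invset L) `*` (coset_of H @` L)).
  apply: compact_setX; last exact: coset_compact.
  by cpt.
 move=> [s q] /(lip2_supp hx hy)[h [/xK /= xh /yL yh]]; split=> /=.
  set t := coset_repr q in xh yh.
  fac (s * t * inc h)%g ((t * inc h)^-1)%g.
 exists (coset_repr q * inc h)%g => //.
 by rewrite coset_inv coset_reprK.
Qed.

Lemma ripp_int x y (h : T) : cX x -> cX y -> exists2 K, compact K &
 csec (inc h : gG) K (fun s : G => fmul (fstar (x s^-1%g)) (y (s^-1 * inc h)%g)).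
Proof.
move=> [cx px [K cK xK]] [cy py [L cL yL]].
exists (invset K); first exact: invset_compact.
sec.
by move=> s /nz_fmul[/nz_fstar/xK xs _]; rewrite -[s]invgK; exact: invsetI.
Qed.

Lemma ripp_supp x y h : cX x -> cX y -> nz (ripp x y h) ->
 exists s, nz (x s^-1%g) /\ nz (y (s^-1 * inc h)%g).
Proof.
move=> [cx px _] [cy py _] /(nz_bint hsG muK)[s|s /nz_fmul[/nz_fstar h1 h2]]; last by exists s.
by bp.
Qed.

Lemma ripp_cs x y : cX x -> cX y -> cB (ripp x y).
Proof.
move=> hx hy; have [cx px [K cK xK]] := hx; have [cy py [L cL yL]] := hy.
split.
- apply: (bint_cont hE hsG muK (pi := inc : T -> gG)
  (F := fun p : G * T => fmul (fstar (x p.1^-1%g)) (y (p.1^-1 * inc p.2)%g))).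
 + exact: subg_inc_cont.
 + by cts.
 + by bp.
 + move=> h0; have [M nM cM] := subg_lcpt lG h0; exists M, (invset K); split=> //.
   exact: invset_compact.
  move=> s h _ nK /=; apply: nzN; first by bp.
  move=> /nz_fmul[/nz_fstar/xK xs _]; apply: nK.
  by rewrite -[s]invgK; exact: invsetI.
- by move=> h; exact: bpr_bint.
- exists [set h : T | mulset (invset K) L (inc h)].
  by cpt.
 move=> h /(ripp_supp hx hy)[s [/xK xs /yL ys]] /=.
 fac ((s^-1)^-1)%g (s^-1 * inc h)%g.
Qed.

Arguments lip2_int : clear implicits.

Lemma coset_actM (s t : G) (q : GH) : coset_act (s * t)%g q = coset_act s (coset_act t q).
Proof. exact: (gactM (g := coset_gspace H)). Qed.
Lemma coset_act1 (q : GH) : coset_act 1%g q = q.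
Proof. exact: (gact1 (g := coset_gspace H)). Qed.

(** * Identities between the actions and the inner products *)

Lemma lconv_shift (Y : lspace) (F : G * GH -> A) (f : Y -> A) (r : G) (y : Y) :
 cA F -> cs (@lpi Y) f ->
 lconv F f (lact r^-1%g y) = bI mu (lpi (lact r^-1%g y)) (fun s =>
  fmul (F ((r^-1 * s)%g, lcos (lact s^-1%g y))) (f (lact s^-1%g y))).
Proof.
move=> hF hf; have [cF pF _] := hF; have [cf pf _] := hf.
rewrite /lconv -(bint_shift r^-1%g hE hmu).
- by apply: eq_bint => s; rewrite -lactM; gsimp.
- ctx.
- by bp.
Qed.

Lemma lconv_assoc (Y : lspace) (F F' : G * GH -> A) (f : Y -> A) :
 cA F -> cA F' -> cs (@lpi Y) f ->
 lconv F (lconv F' f) = lconv (lconv (Y := trans_lspace) F F') f.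
Proof.
move=> hF hF' hf; have [cF pF [K cK FK]] := hF; have [cF' pF' [K' cK' FK']] := hF'.
have [cf pf _] := hf; apply/funext => y.
(* Both sides are iterated integrals of [W], in the two orders, after left invariance has removed
   [r] from the argument of [f]. The identities below follow the same pattern. *)
pose W r s := fmul (F (r, lcos (lact r^-1%g y)))
 (fmul (F' ((r^-1 * s)%g, lcos (lact s^-1%g y))) (f (lact s^-1%g y))).
have W0 r s : nz (W r s) -> (fst @` K) r /\ mulset (fst @` K) (fst @` K') s.
 move=> /nz_fmul[/FK Kr /nz_fmul[/FK' Ks _]].
 split; first by exists (r, lcos (lact r^-1%g y)).
 rewrite -[s](mulVKg r); apply: mulsetI; first by exists (r, lcos (lact r^-1%g y)).
 by exists ((r^-1 * s)%g, lcos (lact s^-1%g y)).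
have cK1 := fst_compact cK; have cK2 := mulset_compact cK1 (fst_compact cK').
have pW r s : bpr (W r s) = lpi y by bp.
have cW : continuous (fun q : G * G => W q.1 q.2) by rewrite /W; ctx.
transitivity (bI mu (lpi y) (fun r => bI mu (lpi y) (W r))).
 apply: eq_bint => r; rewrite lconv_shift //.
 rewrite (@fmul_bint_l _ mu hsG muK (lpi (lact r^-1%g y)) (lpi y) (mulset [set r] (fst @` K'))) //.
  sec; move=> s /nz_fmul[/FK' h _]; rewrite -[s](mulVKg r); apply: mulsetI => //.
   by exists ((r^-1 * s)%g, lcos (lact s^-1%g y)).
 by rewrite pF lpi_act; gsimp.
rewrite (bint_swap hsG hsG muK muK cW pW cK1 cK2 W0).
apply: eq_bint => s; rewrite /lconv.
rewrite (@fmul_bint_r _ mu hsG muK s (lpi y) (fst @` K)).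
- apply: eq_bint => r; rewrite /W -fmulA //; congr (fmul (F (_, _)) _).
 by rewrite /= !lcos_act -coset_actM; gsimp.
- by rewrite /=; sec; move=> r /nz_fmul[/FK h _]; eexists; [exact: h|].
- by rewrite pf lpi_act; gsimp.
Qed.

Lemma rconv_assoc (Y : rspace) (f : Y -> A) (g g' : T -> A) :
 cs (@rpi Y) f -> cB g -> cB g' ->
 rconv (rconv f g) g' = rconv f (rconv (Y := subg_rspace) g g').
Proof.
move=> hf hg hg'; have [cf pf _] := hf; have [cg pg [K cK gK]] := hg.
have [cg' pg' [K' cK' gK']] := hg'; apply/funext => y.
pose W k h := fmul (fmul (f (ract y h)) (g (h^-1 * k)%g)) (g' k^-1%g).
have W0 k h : nz (W k h) -> invset K' k /\ mulset (invset K') (invset K) h.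
 move=> /nz_fmul[/nz_fmul[_ /gK Kr] /gK' Ks]; split.
  by rewrite -[k]invgK; exact: invsetI.
 fac ((k^-1)^-1)%g ((h^-1 * k)^-1)%g.
have cK1 := invset_compact cK'; have cK2 := mulset_compact cK1 (invset_compact cK).
have pW k h : bpr (W k h) = rpi y by bp.
have cW : continuous (fun q : T * T => W q.1 q.2) by rewrite /W; ctx.
transitivity (bI nu (rpi y) (fun k => bI nu (rpi y) (W k))).
 apply: eq_bint => k; rewrite /rconv.
 have -> : bI nu (rpi (ract y k)) (fun h => fmul (f (ract (ract y k) h)) (g h^-1%g)) =
   bI nu (rpi (ract y k)) (fun h => fmul (f (ract y h)) (g (h^-1 * k)%g)).
  rewrite -(bint_shift k hE hnu (f := fun h => fmul (f (ract y h)) (g (h^-1 * k)%g))).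
  - by apply: eq_bint => h; rewrite -ractM; congr (fmul _ (g _)); gsimp.
  - by ctx.
  - by bp.
 rewrite (@fmul_bint_r _ nu hsH nuK _ (rpi y) (mulset [set k] (invset K))) //.
  sec; move=> h /nz_fmul[_ /gK hK]; fac k ((h^-1 * k)^-1)%g.
 by rewrite pg' rpi_act /=; gsimp.
rewrite (bint_swap hsH hsH nuK nuK cW pW cK1 cK2 W0).
apply: eq_bint => h; rewrite /rconv.
rewrite (@fmul_bint_l _ nu hsH nuK _ (rpi y) (invset K')).
- by apply: eq_bint => k; rewrite /W -fmulA.
- by sec; move=> k /nz_fmul[_ /gK' hK]; rewrite -[k]invgK; exact: invsetI.
- by rewrite pf rpi_act /=; gsimp.
Qed.

Lemma lconv_rconv (F : G * GH -> A) (x : G -> A) (g : T -> A) : cA F -> cX x -> cB g ->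
 rconv (Y := group_rspace) (lconv (Y := group_lspace) F x) g =
 lconv (Y := group_lspace) F (rconv (Y := group_rspace) x g).
Proof.
move=> hF hx hg; have [cF pF [K cK FK]] := hF; have [cx px _] := hx.
have [cg pg [L cL gL]] := hg; apply/funext => t.
pose W (h : T) (r : G) := fmul (fmul (F (r, coset_of H (r^-1 * t)%g)) (x (r^-1 * t * inc h)%g)) (g h^-1%g).
have W0 h r : nz (W h r) -> invset L h /\ (fst @` K) r.
 move=> /nz_fmul[/nz_fmul[/FK Kr _] /gL Ks]; split.
  by rewrite -[h]invgK; exact: invsetI.
 by eexists; [exact: Kr|].
have cK1 := fst_compact cK; have cL1 := invset_compact cL.
have pW h r : bpr (W h r) = t by bp.
have cW : continuous (fun q : T * G => W q.1 q.2) by rewrite /W; ctx.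
transitivity (bI nu t (fun h => bI mu t (W h))).
 apply: eq_bint => h; rewrite /lconv /=.
 rewrite (@fmul_bint_r _ mu hsG muK _ t (fst @` K)).
 - apply: eq_bint => r; rewrite /W !mulgA; congr (fmul (fmul (F (_, _)) _) _).
  exact: coset_inv.
 - by sec; move=> r /nz_fmul[/FK Kr _]; eexists; [exact: Kr|].
 - by rewrite pg /=; gsimp.
rewrite (bint_swap hsH hsG nuK muK cW pW cL1 cK1 W0).
apply: eq_bint => r; rewrite /rconv /=.
rewrite (@fmul_bint_l _ nu hsH nuK _ t (invset L)).
- by apply: eq_bint => h; rewrite /W -fmulA.
- by sec; move=> h /nz_fmul[_ /gL hK]; rewrite -[h]invgK; exact: invsetI.
- by rewrite pF /=; gsimp.
Qed.

Lemma lip_lconv (F : G * GH -> A) (x y : G -> A) : cA F -> cX x -> cX y ->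
 lipp (lconv (Y := group_lspace) F x) y =
 lconv (Y := trans_lspace) F (lipp x y).
Proof.
move=> hF hx hy; have [cF pF [K cK FK]] := hF; have [cx px _] := hx.
have [cy py [L cL yL]] := hy; apply/funext => -[s q].
pose t := coset_repr q.
pose W (h : T) (r : G) := fmul (F (r, coset_act (r^-1 * s)%g q))
 (fmul (x (r^-1 * s * t * inc h)%g) (fstar (y (t * inc h)%g))).
have cM : compact [set h : T | mulset [set t^-1%g] L (inc h)].
 by cpt.
have hM h : nz (y (t * inc h)%g) -> mulset [set t^-1%g] L (inc h).
 by move=> /yL yh; fac (t^-1)%g (t * inc h)%g.
have W0 h r : nz (W h r) -> [set h : T | mulset [set t^-1%g] L (inc h)] h /\ (fst @` K) r.
 move=> /nz_fmul[/FK Kr /nz_fmul[_ /nz_fstar /hM]]; split=> //.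
 by eexists; [exact: Kr|].
have cK1 := fst_compact cK.
have pW h r : bpr (W h r) = s by bp.
have cW : continuous (fun q : T * G => W q.1 q.2).
 by rewrite /W; ctx.
transitivity (bI nu s (fun h => bI mu s (W h))).
 apply: eq_bint => h; rewrite /lconv /=.
 rewrite (@fmul_bint_r _ mu hsG muK _ s (fst @` K)).
 - apply: eq_bint => r; rewrite /W -fmulA // !mulgA; congr (fmul (F (_, _)) _).
  by rewrite coset_inv -coset_actE /t coset_reprK.
 - by sec; move=> r /nz_fmul[/FK Kr _]; eexists; [exact: Kr|].
 - by rewrite bpr_fstar py /=; gsimp.
rewrite (bint_swap hsH hsG nuK muK cW pW cM cK1 W0).
apply: eq_bint => r; rewrite /lipp /lip2 /=.
rewrite (@fmul_bint_l _ nu hsH nuK _ s [set h : T | mulset [set t^-1%g] L (inc h)]) //.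
- by sec; move=> h /nz_fmul[_ /nz_fstar/hM].
- by rewrite pF /=; gsimp.
Qed.

Lemma rip_rconv (x y : G -> A) (g : T -> A) : cX x -> cX y -> cB g ->
 ripp x (rconv (Y := group_rspace) y g) =
 rconv (Y := subg_rspace) (ripp x y) g.
Proof.
move=> hx hy hg; have [cx px [K cK xK]] := hx; have [cy py _] := hy.
have [cg pg [L cL gL]] := hg; apply/funext => h.
pose W (s : G) (k : T) := fmul (fmul (fstar (x s^-1%g)) (y (s^-1 * inc h * inc k)%g)) (g k^-1%g).
have W0 s k : nz (W s k) -> invset K s /\ invset L k.
 move=> /nz_fmul[/nz_fmul[/nz_fstar/xK h1 _] /gL h2].
 by rewrite -[s]invgK -[k]invgK; split; exact: invsetI.
have cK1 := invset_compact cK; have cL1 := invset_compact cL.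
have pW s k : bpr (W s k) = inc h by bp.
have cW : continuous (fun q : G * T => W q.1 q.2) by rewrite /W; ctx.
transitivity (bI mu (inc h) (fun s => bI nu (inc h) (W s))).
 apply: eq_bint => s; rewrite /rconv /=.
 rewrite (@fmul_bint_l _ nu hsH nuK _ (inc h) (invset L)).
 - by apply: eq_bint => k; rewrite /W -fmulA.
 - by sec; move=> k /nz_fmul[_ /gL]; rewrite -{2}[k]invgK; exact: invsetI.
 - by rewrite bpr_fstar px /=; gsimp.
rewrite (bint_swap hsG hsH muK nuK cW pW cK1 cL1 W0).
apply: eq_bint => k; rewrite /ripp /=.
rewrite (@fmul_bint_r _ mu hsG muK _ (inc h) (invset K)).
- by apply: eq_bint => s; rewrite /W -mulgA.
- by sec; move=> s /nz_fmul[/nz_fstar/xK h1 _]; rewrite -[s]invgK; exact: invsetI.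
- by rewrite pg /=; gsimp.
Qed.

Lemma lip_star (x y : G -> A) (s : G) (q : GH) : cX x -> cX y ->
 fstar (lipp x y (s^-1%g, coset_act s q)) = lipp y x (s, q).
Proof.
move=> hx hy; have [cx px _] := hx; have [cy py _] := hy.
rewrite -(coset_reprK q) coset_actE !lippE //; set t := coset_repr q; rewrite /lip2.
have [K cK sK] := lip2_int x y s^-1%g (s * t)%g hx hy.
rewrite (fstar_bint hsH nuK sK (z := s)); last by rewrite invgK.
by apply: eq_bint => h; rewrite fstarM // fstarK // !mulgA mulVg mul1g.
Qed.

Lemma rip_star (x y : G -> A) (h : T) : cX x -> cX y ->
 fstar (ripp x y h^-1%g) = ripp y x h.
Proof.
move=> hx hy; have [cx px _] := hx; have [cy py _] := hy.
have [K cK sK] := ripp_int h^-1%g hx hy.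
rewrite {1}/ripp (fstar_bint hsG muK sK (z := inc h)); last by rewrite /= invgK.
rewrite /ripp -(bint_shift (inc h) hE hmu (f := fun s => fmul (fstar (y s^-1%g)) (x (s^-1 * inc h)%g))).
- apply: eq_bint => s; rewrite fstarM // fstarK //; congr (fmul (fstar (y _)) (x _)); last by gsimp.
 by rewrite invgM.
- by cts.
- by bp.
Qed.

Lemma lip_rip (x y z : G -> A) : cX x -> cX y -> cX z ->
 lconv (Y := group_lspace) (lipp x y) z =
 rconv (Y := group_rspace) x (ripp y z).
Proof.
move=> hx hy hz; have [cx px [K cK xK]] := hx; have [cy py [L cL yL]] := hy.
have [cz pz _] := hz; apply/funext => t.
pose W (r : G) (h : T) := fmul (fmul (x (t * inc h)%g) (fstar (y (r^-1 * t * inc h)%g))) (z (r^-1 * t)%g).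
have cM : compact [set h : T | mulset [set t^-1%g] K (inc h)].
 by cpt.
have hM h : nz (x (t * inc h)%g) -> mulset [set t^-1%g] K (inc h).
 by move=> /xK yh; fac (t^-1)%g (t * inc h)%g.
have W0 r h : nz (W r h) -> mulset K (invset L) r /\ [set h : T | mulset [set t^-1%g] K (inc h)] h.
 move=> /nz_fmul[/nz_fmul[hx1 /nz_fstar/yL h1] _]; split; last exact: hM.
 rewrite (_ : r = (t * inc h) * (r^-1 * t * inc h)^-1)%g; last by gsimp.
 by apply: mulsetI; [exact: xK|exact: invsetI].
have cKL : compact (mulset K (invset L)) by cpt.
have pW r h : bpr (W r h) = t by bp.
have cW : continuous (fun q : G * T => W q.1 q.2) by rewrite /W; ctx.
transitivity (bI mu t (fun r => bI nu t (W r))).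
 apply: eq_bint => r; rewrite /= lippE // /lip2.
 have [N cN sN] := lip2_int x y r (r^-1 * t)%g hx hy.
 rewrite (fmul_bint_r hsH nuK sN (z := t)); last by rewrite pz; gsimp.
 by apply: eq_bint => h; rewrite /W mulVKg.
rewrite (bint_swap hsG hsH muK nuK cW pW cKL cM W0).
apply: eq_bint => h; rewrite /ripp /=.
rewrite (@fmul_bint_l _ mu hsG muK _ t (invset L)).
- rewrite -(bint_shift (t * inc h)^-1%g hE hmu).
 + apply: eq_bint => r; rewrite /W -fmulA //; by congr (fmul _ (fmul (fstar (y _)) (z _))); gsimp.
 + by ctx.
 + by bp.
- by sec; move=> s /nz_fmul[/nz_fstar/yL h1 _]; rewrite -[s]invgK; exact: invsetI.
- by rewrite px /=; gsimp.
Qed.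

Definition stA (F : G * GH -> A) : G * GH -> A := fun z =>
 fstar (F (z.1^-1%g, coset_act z.1 z.2)).
Definition stB (g : T -> A) : T -> A := fun h => fstar (g h^-1%g).

Lemma stA_cs F : cA F -> cA (stA F).
Proof.
move=> [cF pF [K cK FK]]; split.
- by rewrite /stA; ctx.
- by move=> z; rewrite bpr_fstar pF invgK.
- exists ((fun z : G * GH => (z.1^-1%g, coset_act z.1 z.2)) @` K).
  by apply: continuous_compact => //; apply: continuous_subspaceT; ctx.
 move=> [s q] /nz_fstar/FK h; eexists; first exact: h.
 by rewrite /= invgK -coset_actM mulVg coset_act1.
Qed.

Lemma stB_cs g : cB g -> cB (stB g).
Proof.
move=> [cg pg [K cK gK]]; split.
- by rewrite /stB; ctx.
- by move=> h; rewrite bpr_fstar pg /= invgK.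
- exists (invset K); first exact: invset_compact.
 by move=> h /nz_fstar/gK hK; rewrite -[h]invgK; exact: invsetI.
Qed.

Lemma stAK F : stA (stA F) = F.
Proof.
by apply/funext => -[s q]; rewrite /stA /= fstarK // invgK -coset_actM mulVg coset_act1.
Qed.

Lemma stBK g : stB (stB g) = g.
Proof. by apply/funext => h; rewrite /stB /= fstarK // invgK. Qed.
Lemma rip_lconv_adj (F : G * GH -> A) (x y : G -> A) : cA F -> cX x -> cX y ->
 ripp (lconv (Y := group_lspace) F x) y =
 ripp x (lconv (Y := group_lspace) (stA F) y).
Proof.
move=> hF hx hy; have [cF pF [K cK FK]] := hF; have [cx px [L cL xL]] := hx.
have [cy py [M cM yM]] := hy; apply/funext => h.
pose W (s r : G) := fmul (fmul (fstar (x r^-1%g)) (fstar (F ((s^-1 * r)%g, coset_of H r^-1%g)))) (y (s^-1 * inc h)%g).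
have W0 s r : nz (W s r) -> mulset [set inc h] (invset M) s /\ invset L r.
 move=> /nz_fmul[/nz_fmul[/nz_fstar/xL h1 _] /yM h2]; split.
  fac (inc h)%g ((s^-1 * inc h)^-1)%g.
 by rewrite -[r]invgK; exact: invsetI.
have cM1 : compact (mulset [set inc h] (invset M)).
 by cpt.
have cL1 := invset_compact cL.
have pW s r : bpr (W s r) = inc h by bp.
have cW : continuous (fun q : G * G => W q.1 q.2) by rewrite /W; ctx.
transitivity (bI mu (inc h) (fun s => bI mu (inc h) (W s))).
 apply: eq_bint => s; have E := lconv_shift (Y := group_lspace) s (1%g : group_lspace) hF hx.
 rewrite /= !mulg1 in E; rewrite E {E}.
 have sN : csec (s^-1%g : gG) (mulset [set s] (fst @` K)) (fun r =>
   fmul (F ((s^-1 * r)%g, coset_of H (r^-1 * 1)%g)) (x (r^-1 * 1)%g)).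
  sec; move=> r /nz_fmul[/FK h1 _]; rewrite -[r](mulVKg s); apply: mulsetI => //.
   by eexists; [exact: h1|].
 rewrite (fstar_bint hsG muK sN (z := s)); last by rewrite invgK.
 rewrite (@fmul_bint_r _ mu hsG muK s (inc h) (mulset [set s] (fst @` K))).
 - by apply: eq_bint => r; rewrite /W fstarM // mulg1.
 - case: sN => cN pN _ zN; split.
  + by apply: fstar_cont.
  + by move=> r; rewrite bpr_fstar pN /= invgK.
  + by cpt.
  + move=> r /zN ->; apply: nzN; first by rewrite bpr_fstar bpr_bzero /= invgK.
   by move=> /nz_fstar; rewrite /nz bnorm_zero.
 - by rewrite py /=; gsimp.
rewrite (bint_swap hsG hsG muK muK cW pW cM1 cL1 W0).
apply: eq_bint => r.
have E := lconv_shift (Y := group_lspace) r (inc h : group_lspace) (stA_cs hF) hy.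
rewrite /= in E; rewrite E {E}.
rewrite (@fmul_bint_l _ mu hsG muK _ (inc h) (mulset [set inc h] (invset M))) //.
- apply: eq_bint => s; rewrite /W -fmulA // /stA /=; congr (fmul _ (fmul (fstar (F (_, _))) _)).
  by gsimp.
 by rewrite coset_actE; gsimp; rewrite coset_inv.
- apply: csecI => //=.
 + by have [cst pst _] := stA_cs hF; ctx.
 + by move=> s; have [cst pst _] := stA_cs hF; rewrite bpr_fmul pst py /=; gsimp.
 + move=> s /nz_fmul[_ /yM h1]; fac (inc h)%g ((s^-1 * inc h)^-1)%g.
- by rewrite bpr_fstar px /=; gsimp.
Qed.

Lemma rconv_shift (Y : rspace) (f : Y -> A) (g : T -> A) (k : T) (y : Y) :
 cs (@rpi Y) f -> cB g ->
 rconv f g (ract y k) = bI nu (rpi (ract y k)) (fun h => fmul (f (ract y h)) (g (h^-1 * k)%g)).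
Proof.
move=> [cf pf _] [cg pg _]; rewrite /rconv.
rewrite -(bint_shift k hE hnu (f := fun h => fmul (f (ract y h)) (g (h^-1 * k)%g))).
- by apply: eq_bint => h; rewrite -ractM; congr (fmul _ (g _)); gsimp.
- by ctx.
- by bp.
Qed.

Lemma lip_rconv_adj (x y : G -> A) (g : T -> A) : cX x -> cX y -> cB g ->
 lipp (rconv (Y := gr) x g) y = lipp x (rconv (Y := gr) y (stB g)).
Proof.
move=> hx hy hg; have [cx px [K cK xK]] := hx; have [cy py [L cL yL]] := hy.
have [cg pg [M cM gM]] := hg; apply/funext => -[s q].
rewrite /lipp /lip2 /=; set t := coset_repr q.
pose W (h k : T) := fmul (fmul (x (s * t * inc k)%g) (g (k^-1 * h)%g)) (fstar (y (t * inc h)%g)).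
pose N1 := [set h : T | mulset [set t^-1%g] L (inc h)].
pose N2 := [set k : T | mulset [set (s * t)^-1%g] K (inc k)].
have cN1 : compact N1 by cpt.
have cN2 : compact N2 by cpt.
have hN1 h : nz (y (t * inc h)%g) -> N1 h.
 by move=> /yL yh; rewrite /N1 /= (_ : inc h = t^-1 * (t * inc h))%g; [exact: mulsetI|gsimp].
have hN2 k : nz (x (s * t * inc k)%g) -> N2 k.
 by move=> /xK xk; rewrite /N2 /= (_ : inc k = (s * t)^-1 * (s * t * inc k))%g;
  [exact: mulsetI|gsimp].
have W0 h k : nz (W h k) -> N1 h /\ N2 k.
 by move=> /nz_fmul[/nz_fmul[/hN2 h1 _] /nz_fstar/hN1].
have pW h k : bpr (W h k) = s by bp.
have cW : continuous (fun q : T * T => W q.1 q.2) by rewrite /W; ctx.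
transitivity (bI nu s (fun h => bI nu s (W h))).
 apply: eq_bint => h; rewrite (@rconv_shift gr _ _ h (s * t)%g) //.
 rewrite (@fmul_bint_r _ nu hsH nuK _ s N2) //.
  apply: csecI => //=; first by ctx.
   by bp.
  by move=> k /nz_fmul[/hN2].
 by rewrite bpr_fstar py /=; gsimp.
rewrite (bint_swap hsH hsH nuK nuK cW pW cN1 cN2 W0).
apply: eq_bint => k; have hg' := stB_cs hg; have [cg' pg' _] := hg'.
rewrite (@rconv_shift gr _ _ k t) //.
have sN : csec (t * inc k : gG)%g N1 (fun h => fmul (y (t * inc h)%g) (stB g (h^-1 * k)%g)).
 apply: csecI => //=; first by ctx.
  by bp.
 by move=> h /nz_fmul[/hN1].
rewrite (fstar_bint hsH nuK sN (z := ((t * inc k)^-1)%g)) //.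
rewrite (@fmul_bint_l _ nu hsH nuK _ s N1).
- apply: eq_bint => h; rewrite /W -fmulA // fstarM // /stB fstarK //.
 by rewrite invgM invgK.
- case: sN => cN pN _ zN; split=> //.
 + by apply: fstar_cont.
 + by move=> h; rewrite bpr_fstar pN.
 + move=> h /zN ->; apply: nzN; first by rewrite bpr_fstar bpr_bzero.
  by move=> /nz_fstar; rewrite /nz bnorm_zero.
- by rewrite px; gsimp.
Qed.

(** * Linear combinations of sections *)

Lemma nz_bzero (x : gG) : ~ nz (bzero A x).
Proof. by apply; exact: bnorm_zero. Qed.

Definition lin (Y : Type) (pi : Y -> G) (k : C) (f f' : Y -> A) : Y -> A := fun y =>
 binj (k *: bco (pi y : gG) (f y) + bco (pi y : gG) (f' y)).

Lemma linE (Y : Type) (pi : Y -> G) k (f f' : Y -> A) y : bpr (f y) = pi y ->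
 lin pi k f f' y = badd (bscale k (f y)) (f' y).
Proof.
by move=> py; rewrite /lin (@baddE _ _ _ (pi y)) ?bpr_bscale // bco_bscale.
Qed.

Lemma bpr_lin (Y : Type) (pi : Y -> G) k (f f' : Y -> A) y : bpr (lin pi k f f' y) = pi y.
Proof. exact: bpr_binj. Qed.
Lemma bco_lin (Y : Type) (pi : Y -> G) k (f f' : Y -> A) y x : pi y = x ->
 bco (x : gG) (lin pi k f f' y) = k *: bco x (f y) + bco x (f' y).
Proof. by move=> <-; exact: bcoE. Qed.
Lemma nz_lin (Y : Type) (pi : Y -> G) k (f f' : Y -> A) y : bpr (f y) = pi y -> bpr (f' y) = pi y ->
 nz (lin pi k f f' y) -> nz (f y) \/ nz (f' y).
Proof.
move=> pf pf' h; apply: contrapT => n; apply: h.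
have [n1 n2] : ~ nz (f y) /\ ~ nz (f' y) by split=> h; apply: n; [left|right].
by rewrite /lin (nzN pf n1) (nzN pf' n2) !bco_zero scaler0 addr0 bnorm_binj rn0.
Qed.

Lemma lin_cs (Y : topologicalType) (pi : Y -> G) k (f f' : Y -> A) :
 cs pi f -> cs pi f' -> cs pi (lin pi k f f').
Proof.
move=> [cf pf [K cK fK]] [cf' pf' [K' cK' fK']]; split.
- rewrite (_ : lin _ _ _ _ = fun y => badd (bscale k (f y)) (f' y)); last first.
  by apply/funext => y; rewrite linE.
 apply: (badd_cont hE) => //; first exact: (cont_comp cf (bscale_contl hE (k := k))).
 by move=> y; rewrite bpr_bscale pf pf'.
- by move=> y; exact: bpr_lin.
- exists (K `|` K'); first exact: compactU.
 by move=> y h; have [/fK|/fK'] := nz_lin (pf y) (pf' y) h; [left|right].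
Qed.

Lemma bint_lin (S : ptopologicalType) (m : borel_measure R S)
  (hS : hausdorff_space S) (mK : finite_on_compacts S m)
  (x : gG) (K K' : set S) k (f g g' : S -> A) :
 csec x K g -> csec x K' g' -> (forall s, bco x (f s) = k *: bco x (g s) + bco x (g' s)) ->
 bI m x f = binj (k *: bco x (bI m x g) + bco x (bI m x g')).
Proof.
move=> sg sg' fE; rewrite !bco_bint /bint; congr binj.
have [cg s1] := csec_bco hE sg; have [cg' s2] := csec_bco hE sg'.
have cU : compact (K `|` K') by apply: compactU; [case: s1|case: s2].
rewrite -(vint_lin hS mK k cg (csupp_sub cU (@subsetUl _ _ _) s1) cg' (csupp_sub cU (@subsetUr _ _ _) s2)).
by congr vint; apply/funext => s; exact: fE.
Qed.

Lemma bco_fmul (x y z : gG) (a b : A) : bpr a = x -> bpr b = y ->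
 bco z (fmul a b) = fib_mul z (bco x a) (bco y b).
Proof. by move=> ax bx; rewrite /fib_mul !bcoK. Qed.

Section LeftLinear.
Variable Y : lspace.
Implicit Types (f : Y -> A) (F : G * GH -> A).
Local Notation pi := (@lpi Y).

Lemma lconv_linl k F F' f : cA F -> cA F' -> cs pi f ->
 lconv (lin fst k F F') f = lin pi k (lconv F f) (lconv F' f).
Proof.
move=> hF hF' hf; have [_ pF _] := hF; have [_ pF' _] := hF'; have [_ pf _] := hf.
apply/funext => y; have [K cK sK] := lconv_int y hF hf; have [K' cK' sK'] := lconv_int y hF' hf.
apply: (bint_lin hsG muK sK sK') => r.
have e : lpi y = (r * lpi (lact r^-1%g y))%g by rewrite lpi_act; gsimp.
rewrite !(@bco_fmul r (lpi (lact r^-1%g y))) ?pF ?pF' ?pf ?bpr_lin //.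
by rewrite bco_lin // fm_linl.
Qed.

Lemma lconv_linr k F f f' : cA F -> cs pi f -> cs pi f' ->
 lconv F (lin pi k f f') = lin pi k (lconv F f) (lconv F f').
Proof.
move=> hF hf hf'; have [_ pF _] := hF; have [_ pf' _] := hf'; have [_ pf _] := hf.
apply/funext => y; have [K cK sK] := lconv_int y hF hf; have [K' cK' sK'] := lconv_int y hF hf'.
apply: (bint_lin hsG muK sK sK') => r.
have e : lpi y = (r * lpi (lact r^-1%g y))%g by rewrite lpi_act; gsimp.
rewrite !(@bco_fmul r (lpi (lact r^-1%g y))) ?pF ?pf' ?pf ?bpr_lin //.
by rewrite bco_lin // fm_linr.
Qed.
End LeftLinear.

Section RightLinear.
Variable Y : rspace.
Implicit Types (f : Y -> A) (g : T -> A).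
Local Notation pi := (@rpi Y).

Lemma rconv_linr k f g g' : cs pi f -> cB g -> cB g' ->
 rconv f (lin (inc) k g g') = lin pi k (rconv f g) (rconv f g').
Proof.
move=> hf hg hg'; have [_ pg _] := hg; have [_ pg' _] := hg'; have [_ pf _] := hf.
apply/funext => y; have [K cK sK] := rconv_int y hf hg; have [K' cK' sK'] := rconv_int y hf hg'.
apply: (bint_lin hsH nuK sK sK') => h.
have e : rpi y = (rpi (ract y h) * inc h^-1)%g by rewrite rpi_act /=; gsimp.
rewrite !(@bco_fmul (rpi (ract y h)) (inc h^-1%g)) ?pg ?pg' ?pf ?bpr_lin //.
by rewrite bco_lin // fm_linr.
Qed.

Lemma rconv_linl k f f' g : cs pi f -> cs pi f' -> cB g ->
 rconv (lin pi k f f') g = lin pi k (rconv f g) (rconv f' g).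
Proof.
move=> hf hf' hg; have [_ pg _] := hg; have [_ pf' _] := hf'; have [_ pf _] := hf.
apply/funext => y; have [K cK sK] := rconv_int y hf hg; have [K' cK' sK'] := rconv_int y hf' hg.
apply: (bint_lin hsH nuK sK sK') => h.
have e : rpi y = (rpi (ract y h) * inc h^-1)%g by rewrite rpi_act /=; gsimp.
rewrite !(@bco_fmul (rpi (ract y h)) (inc h^-1%g)) ?pg ?pf' ?pf ?bpr_lin //.
by rewrite bco_lin // fm_linl.
Qed.
End RightLinear.

Lemma lip_linl k x y z : cX x -> cX y -> cX z ->
 lipp (lin id k x y) z = lin fst k (lipp x z) (lipp y z).
Proof.
move=> hx hy hz; have [_ px _] := hx; have [_ py _] := hy; have [_ pz _] := hz.
apply/funext => -[s q]; rewrite /lipp /lip2 /=; set t := coset_repr q.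
have [K cK sK] := lip2_int x z s t hx hz.
have [K' cK' sK'] := lip2_int y z s t hy hz.
apply: (bint_lin hsH nuK sK sK') => h.
have e : s = (s * t * inc h * (t * inc h)^-1)%g by gsimp.
rewrite !(@bco_fmul (s * t * inc h)%g (t * inc h)^-1%g) ?px ?py ?bpr_fstar ?pz ?bpr_lin //.
by rewrite bco_lin // fm_linl.
Qed.

Lemma rip_linr k x y z : cX x -> cX y -> cX z ->
 ripp z (lin id k x y) = lin (inc) k (ripp z x) (ripp z y).
Proof.
move=> hx hy hz; have [_ px _] := hx; have [_ py _] := hy; have [_ pz _] := hz.
apply/funext => h.
have [K cK sK] := ripp_int h hz hx; have [K' cK' sK'] := ripp_int h hz hy.
apply: (bint_lin hsG muK sK sK') => s.
have e : inc h = (s * (s^-1 * inc h))%g by gsimp.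
rewrite !(@bco_fmul s (s^-1 * inc h)%g) ?px ?py ?bpr_fstar ?pz ?invgK ?bpr_lin //.
by rewrite bco_lin // fm_linr.
Qed.

(** * Sections of the two Fell bundles as functions into the given one *)

Definition fstA (F : GX -> AGH) : G * GH -> A := fun z => (F z).1.
Definition valB (g : GT -> AH) : T -> A := fun h => sval (g h).

Lemma bco_trans (z : GX) (a : AGH) : a.2 = z.2 ->
 bco z a = bco (z.1 : gG) a.1 :> fib A (z.1 : gG).
Proof.
move=> az; rewrite /bco; congr xget; apply/seteqP; split=> v /=.
 by move=> <-.
by case: a az => a x /= -> <-.
Qed.

Lemma bco_restr (h : GT) (a : AH) :
 bco h a = bco (inc h : gG) (sval a) :> fib A (inc h : gG).
Proof.
rewrite /bco; congr xget; apply/seteqP; split=> v /=; first by move=> <-.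
by move=> va; apply: val_inj.
Qed.

Lemma trans_hausdorff : hausdorff_space GX.
Proof. by apply: prod_hausdorff => //; exact: coset_hausdorff. Qed.
Lemma GammacA F : Gammac AGH F <-> cA (fstA F) /\ forall z, (F z).2 = z.2.
Proof.
split=> [/(GammacP trans_hausdorff)[sF cF [K cK F0]]|[[cF pF [K cK FK]] F2]].
 have F2 z : (F z).2 = z.2 by have := congr1 snd (sF z).
 split=> //; split.
 - by apply: (cont_comp cF); exact: cont_fst.
 - by move=> z; have := congr1 fst (sF z).
 - exists K => // z; apply: contraPP => /F0; rewrite /fstA => ->.
  exact: nz_bzero.
apply/(GammacP trans_hausdorff); split.
- by move=> [s q]; rewrite /= /trans_pr; congr pair; [exact: (pF (s, q))|exact: F2].
- rewrite (_ : F = fun z => (fstA F z, z.2)); last first.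
  by apply/funext => z; rewrite -F2 /fstA; case: (F z).
 by apply: cont_pair => //; exact: cont_snd.
- exists K => // z nK; rewrite -[F z](_ : (fstA F z, z.2) = _); last first.
  by rewrite -F2 /fstA; case: (F z).
 rewrite (@nzN (fstA F z) z.1) //.
 by move=> /FK.
Qed.

Lemma GammacB g : Gammac AH g <-> cB (valB g).
Proof.
have hsT : hausdorff_space GT by [].
split=> [/(GammacP hsT)[sg cg [K cK g0]]|[cg pg [K cK gK]]].
 split.
 - by apply: (cont_comp cg); exact: initial_continuous.
 - by move=> h; have := congr1 (inc) (sg h).
 - exists K => // h; apply: contraPP => /g0; rewrite /valB => ->.
  exact: nz_bzero.
apply/(GammacP hsT); split.
- by move=> h; apply: subg_inc_inj; exact: pg.
- apply/continuousP => B [D oD <-].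
 by have /continuousP := cg; exact.
- exists K => // h nK; apply: val_inj; rewrite /= -[RHS](@nzN (valB g h)) //.
 by move=> /gK.
Qed.

Lemma GammacX x : Gammac A x <-> cX x.
Proof.
have hsT : hausdorff_space gG by [].
split=> [/(GammacP hsT)[sg cg [K cK g0]]|[cg pg [K cK gK]]].
 split=> //; exists K => // h; apply: contraPP => /g0 ->.
 exact: nz_bzero.
apply/(GammacP hsT); split=> //; exists K => // h nK; apply: nzN => //.
by move=> /gK.
Qed.

Lemma eqA (F F' : GX -> AGH) : fstA F = fstA F' -> (forall z, (F z).2 = z.2) ->
 (forall z, (F' z).2 = z.2) -> F = F'.
Proof.
move=> e h h'; apply/funext => z; have := congr1 (fun f => f z) e; rewrite /fstA.
by have := h z; have := h' z; case: (F z) => a b; case: (F' z) => c d /= -> -> ->.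
Qed.

Lemma eqB (g g' : GT -> AH) : valB g = valB g' -> g = g'.
Proof.
by move=> e; apply/funext => h; apply: val_inj; have := congr1 (fun f => f h) e.
Qed.

Lemma slinA k (F F' : GX -> AGH) : (forall z, (F z).2 = z.2) -> (forall z, (F' z).2 = z.2) ->
 fstA (slin k F F') = lin fst k (fstA F) (fstA F').
Proof.
by move=> h h'; apply/funext => z; rewrite /fstA /slin /lin /= !bco_trans.
Qed.

Lemma slinB k g g' : valB (slin k g g') = lin (inc) k (valB g) (valB g').
Proof. by apply/funext => h; rewrite /valB /slin /lin /= !bco_restr. Qed.
Lemma sstarA F : fstA (sstar F) = stA (fstA F).
Proof. by []. Qed.
Lemma sstarB g : valB (sstar g) = stB (valB g).
Proof. by []. Qed.
(** The Haar measure at the unit s q is the image of [mu] under r -> (r, r^-1 s q), so the integral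
    over the arrows with range s q pulls back to G. *)
Lemma sconvA F F' : Gammac AGH F -> Gammac AGH F' ->
 fstA (sconv (trans_system (coset_gspace H) mu) F F') =
 lconv (Y := trans_lspace) (fstA F) (fstA F').
Proof.
move=> /GammacA[[cF pF _] F2] /GammacA[[cF' pF' _] F'2]; apply/funext => -[s q].
rewrite /fstA /sconv /lconv /= /bint; congr binj.
pose f (y : GX) := bco (s : gG) (fmul (fstA F y) (fstA F' ((y.1^-1 * s)%g, q))).
rewrite /fib_integral (_ : (fun y => _) = f); last first.
 by apply/funext => y; rewrite bco_trans //= F'2.
have cf : continuous f.
 apply: (bco_cont hE) => [|y]; last by bp.
 by ctx.
have := @vintegral_transfer R _ GX mu (trans_system (coset_gspace H) mu (@trans_rng G (coset_gspace H) (s, q) : GX))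
 (@trans_path G (coset_gspace H) (coset_act s q)) _ _ [set y : GX | grng y = @trans_rng G (coset_gspace H) (s, q)] _ _ _ f cf.
move=> ->.
- congr vintegral; apply/funext => r; rewrite /f /trans_path /=.
 by rewrite coset_actM.
- apply: cont_pair; first by move=> r; exact: cvg_id.
 apply: coset_act_cts; cts.
- by [].
(* The set of arrows with range s q is closed because G/H is Hausdorff. *)
- apply: borel_closed.
 rewrite (_ : [set y | _] = (fun y : GX => coset_act y.1 y.2) @^-1` [set coset_act s q]).
  apply: closed_comp => [y _|]; first exact: coset_act_cont.
  by apply: accessible_closed_set1; apply: hausdorff_accessible; exact: coset_hausdorff.
 apply/seteqP; split=> -[r p] /=; rewrite /trans_rng /=; first by case.
 by move=> ->.
- by move=> r; rewrite /= /trans_rng /trans_path /= -coset_actM mulgV coset_act1.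
Qed.

(** The groupoid formula integrates g(k) g'(k^-1 h), while [rconv] integrates g(h k) g'(k^-1); left
    invariance converts one into the other. *)
Lemma sconvB g g' : Gammac AH g -> Gammac AH g' ->
 valB (sconv (group_system nu) g g') = rconv (Y := subg_rspace) (valB g) (valB g').
Proof.
move=> /GammacB[cg pg _] /GammacB[cg' pg' _]; apply/funext => h.
rewrite /rconv -(bint_shift h^-1%g hE hnu).
- rewrite /valB /sconv /= /bint; congr binj.
 rewrite /fib_integral (_ : [set y | _] = setT); last by apply/seteqP; split.
 congr vintegral; apply/funext => k; rewrite bco_restr /=; congr (bco _ (fmul (sval (g _)) (sval (g' _)))).
  by gsimp.
 by gsimp.
- by ctx.
- by bp.
Qed.

Lemma modlE F xi : mod_lact H mu A F xi = lconv (Y := gl) (fstA F) xi.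
Proof. by []. Qed.
Lemma modrE xi g : mod_ract nu A xi g = rconv (Y := gr) xi (valB g).
Proof. by []. Qed.
Lemma modlipE xi eta : fstA (mod_lip nu A xi eta) = lipp xi eta.
Proof. by apply/funext => -[s q]. Qed.
Lemma modlip2 xi eta z : (mod_lip nu A xi eta z).2 = z.2.
Proof. by case: z. Qed.
Lemma modripE xi eta : valB (mod_rip H mu A xi eta) = ripp xi eta.
Proof. by []. Qed.

Local Notation fm := (@fib_mul R _ A _ _).
Local Notation fs := (@fib_star R _ A _).

(** * Units on the fibres, realized by sections *)

Section FibreUnits.
Local Notation "'F' x" := (fib A (x : gG)) (at level 10).

Lemma fm_suml (I : Type) (s : seq I) (x y z : G) (v : I -> F x) (w : F y) : z = (x * y)%g ->
 fm z (\sum_(i <- s) v i) w = \sum_(i <- s) fm z (v i) w.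
Proof.
move=> hz; elim: s => [|i s IH]; first by rewrite !big_nil fm0l.
by rewrite !big_cons fmDl // IH.
Qed.

(** For d = E c - c the norm of d d^* is |d|^2, and d d^* arises from c c^* by applying E - 1 on
    both sides. As E - 1 acts as a contraction, an [E] that almost fixes c c^* almost fixes c. *)
Lemma fibre_left_unit (x : G) (c : F x) (e : R) : 0 < e ->
 exists b : F 1%g, rn (fm x b c - c) < e.
Proof.
move=> e0; pose cc := fm 1%g c (fs (x^-1)%g c).
have e2 : 0 < e ^+ 2 by rewrite exprn_gt0.
have [vs [/(_ cc (mem_head _ _)) h1 h2]] := fibre_approx_unit 1%g [:: cc] e2.
set E := (\sum_(v <- vs) _ : F 1%g) in h1 h2; exists E.
set d := fm x E c - c.
have d2 : rn d ^+ 2 <= rn (fm 1%g E cc - cc).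
 rewrite -fnorm_l -(rn_fs (y := 1%g) (fm 1%g E cc - cc)); last by rewrite invg1.
 rewrite -(rn_fs (y := 1%g) (fm 1%g d _)); last by rewrite invg1.
 apply: le_trans (h2 1%g _); rewrite le_eqVlt; apply/orP; left; apply/eqP; congr rn.
 have e1 : 1%g = (1^-1)%g :> G by rewrite invg1.
 have e3 : x = (1 * x)%g by rewrite mul1g.
 have e4 : 1%g = (x * x^-1)%g by rewrite mulgV.
 have e5 : 1%g = (1 * 1)%g :> G by rewrite mul1g.
 have E1 (v w : F x) : fs 1%g (fm 1%g v (fs (x^-1)%g w)) = fm 1%g w (fs (x^-1)%g v).
  apply: (@binj_inj _ _ A); rewrite !(fm_inj, fs_inj) //.
  by rewrite fstarM fstarK.
 rewrite E1 fsB // E1 /d (fsB (y := (x^-1)%g)) // fmBr //.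
 rewrite fmBl // fmBl // -!(fmA (xy := x) (yw := 1%g)) //.
 suff -> : fs 1%g (fm 1%g E cc) = fm 1%g c (fs (x^-1)%g (fm x E c)).
  by rewrite fmBr // !opprD !opprK addrACA.
 apply: (@binj_inj _ _ A); rewrite !(fm_inj, fs_inj) //.
 by rewrite !fstarM fstarK fmulA.
rewrite -(@ltr_pXn2r _ 2) ?nnegrE ?rn_ge0 ?(ltW e0) //; exact: le_lt_trans d2 h1.
Qed.

(** [fibre_approx_unit] handles finitely many elements of the unit fibre. By compactness finitely
    many local units of [f] suffice on all of [L], so almost fixing these elements almost fixes [f]
    uniformly. *)
Lemma unit_list (Y : ptopologicalType) (pi : Y -> G) (f : Y -> A) (L : set Y) (e : R) :
 cs pi f -> compact L -> 0 < e -> exists bs : seq (F 1%g), forall y, L y ->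
 exists2 b, b \in bs & rn (fm (pi y) b (bco (pi y : gG) (f y)) - bco (pi y : gG) (f y)) < e.
Proof.
move=> [cf pf _] cL e0; have [b hb] := choice (fun y => fibre_left_unit (bco (pi y : gG) (f y)) e0).
have E y b' : fm (pi y) b' (bco (pi y : gG) (f y)) = bco (pi y : gG) (fmul (binj b') (f y)).
 by rewrite /fib_mul bcoK.
move: (cL); rewrite compact_cover => cc.
pose U y := [set y' | bdist (pi y' : gG) (fmul (binj (b y)) (f y')) (f y') < e].
have nU y : nbhs y (U y).
 have c1 : continuous (fun y' => fmul (binj (b y) : A) (f y')) by cts.
 have pE t : bpr (fmul (binj (b y) : A) (f t)) = pi t by rewrite bpr_fmul bpr_binj mul1g pf.
 have : \forall t \near y, bdist (bpr (fmul (binj (b y) : A) (f t))) (fmul (binj (b y)) (f t)) (f t) < e.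
  apply: (bdist_near hE c1 cf) => [t|]; first by rewrite pE pf.
  by rewrite pE bdistE -E; exact: hb.
 by apply: filterS => t; rewrite pE.
have [||l lL Ll] := cc Y L (fun y => (U y)^°).
- by move=> y _; exact: open_interior.
- by move=> y Ly; exists y => //; exact: nU.
exists [seq b y | y <- finmap.enum_fset l] => y /Ll[y0 /= y0l /interior_subset Uy].
exists (b y0); last by rewrite E.
by apply: (map_f b).
Qed.

Lemma approx_sections (t : G) (vs : seq (F t)) (d : R) : 0 < d -> exists ks : seq (G -> A),
 Alls cX ks /\ rn (\sum_(v <- vs) fm 1%g v (fs (t^-1)%g v) -
  \sum_(k <- ks) fm 1%g (bco (t : gG) (k t)) (fs (t^-1)%g (bco (t : gG) (k t)))) < d.
Proof.
elim: vs d => [|v vs IH] d d0; first by exists [::]; split=> //; rewrite !big_nil subrr rn0.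
have [ks [cks hks]] := IH _ (halfR_gt0 d0).
have v0 := rn_ge0 v; have v1 : 0 < rn v *+ 2 + 1 by rewrite ltr_wpDl // mulrn_wge0.
(* If v and kt differ by less than eta <= 1, then v v^* and kt kt^* differ by at most eta (|v| +
   |kt|) <= eta (2 |v| + 1). *)
pose eta := Num.min 1 (d / 2 / (rn v *+ 2 + 1)).
have eta0 : 0 < eta by rewrite lt_min ltr01 divr_gt0 // halfR_gt0.
have [k kG] := enough_sections hE hsG lcG (bpr_binj v) eta0.
rewrite bdistE bcoE; set kt := bco _ _ => hk.
exists (k :: ks); split; first by split=> //; apply/GammacX.
rewrite !big_cons -/kt opprD addrACA; apply: le_lt_trans (rnD _ _) _.
have e4 : 1%g = (t * t^-1)%g by rewrite mulgV.
have -> : fm 1%g v (fs (t^-1)%g v) - fm 1%g kt (fs (t^-1)%g kt) =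
  fm 1%g (v - kt) (fs (t^-1)%g v) + fm 1%g kt (fs (t^-1)%g (v - kt)).
 by rewrite fmBl // fsB // fmBr // addrA subrK.
have h1 := rn_fm (v - kt) (fs (t^-1)%g v) e4; have h2 := rn_fm kt (fs (t^-1)%g (v - kt)) e4.
rewrite !rn_fs // in h1 h2.
have h3 := rnD (fm 1%g (v - kt) (fs (t^-1)%g v)) (fm 1%g kt (fs (t^-1)%g (v - kt))).
have h4 : rn kt <= rn (kt - v) + rn v by have := rnD (kt - v) v; rewrite subrK.
rewrite (rn_distC kt v) in h4 hk.
have [hk1 hk2] : rn (v - kt) < 1 /\ rn (v - kt) < d / 2 / (rn v *+ 2 + 1).
 by move: hk; rewrite lt_min => /andP[].
move: hk2; rewrite ltr_pdivlMr // mulr2n => hk2.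
have h5 := rn_ge0 (v - kt); have h6 := rn_ge0 kt.
move: h1 h2 h3 h4 hk1 hk2 h5 h6 hks; rewrite -/kt; move: (rn kt) (rn (v - kt)) (rn _) (rn _) (rn _) => *; nra.
Qed.

End FibreUnits.

Definition fsum (Y : Type) (pi : Y -> G) (gs : seq (Y -> A)) : Y -> A :=
 foldr (lin pi 1) (fun y => bzero A (pi y)%:g) gs.

Lemma bpr_fsum (Y : Type) (pi : Y -> G) gs y : bpr (fsum pi gs y) = pi y.
Proof. by case: gs => [|g gs]; exact: bpr_binj. Qed.
Lemma bco_fsum (Y : Type) (pi : Y -> G) gs (y : Y) :
 bco (pi y)%:g (fsum pi gs y) = \sum_(g <- gs) bco (pi y)%:g (g y).
Proof.
elim: gs => [|g gs IH]; first by rewrite big_nil bco_zero.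
by rewrite big_cons -IH /= bco_lin // scale1r.
Qed.

Lemma fsum_cs (Y : topologicalType) (pi : Y -> G) gs : continuous pi ->
 Alls (cs pi) gs -> cs pi (fsum pi gs).
Proof.
move=> cpi; elim: gs => [_|g gs IH [cg /IH h]]; last exact: lin_cs.
split; [|by move=> y; exact: bpr_bzero|].
 by apply: (cont_comp cpi); exact: bzero_cont.
by exists set0 => [|y /nz_bzero //]; exact: compact0.
Qed.

Lemma fsum_cont (Y : topologicalType) (pi : Y -> G) gs : continuous pi ->
 Alls (fun g => continuous g /\ forall y, bpr (g y) = pi y) gs -> continuous (fsum pi gs).
Proof.
move=> cpi; elim: gs => [_|g gs IH [[cg pg] /IH h]].
 by apply: (cont_comp cpi); exact: bzero_cont.
rewrite (_ : fsum pi _ = fun y => badd (g y) (fsum pi gs y)).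
 by apply: (badd_cont hE) => // y; rewrite pg bpr_fsum.
apply/funext => y; rewrite /= linE ?pg //; congr badd; rewrite (@bscaleE _ _ _ (pi y)%:g) // scale1r bcoK //.
Qed.

Lemma nz_fsum (Y : Type) (pi : Y -> G) gs (y : Y) (P : Prop) :
 Alls (fun g => bpr (g y) = pi y /\ (nz (g y) -> P)) gs -> nz (fsum pi gs y) -> P.
Proof.
elim: gs => [_ /nz_bzero //|g gs IH [[pg gP] /IH h]].
by move=> /(nz_lin pg (bpr_fsum _ _ _))[].
Qed.

Lemma bint_fsum (S : ptopologicalType) (m : borel_measure R S)
  (hS : hausdorff_space S) (mK : finite_on_compacts S m)
  (x : gG) (K : set S) gs : compact K -> Alls (csec x K) gs ->
 csec x K (fsum (fun=> x) gs) /\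
 bco x (bint m x (fsum (fun=> x) gs)) = \sum_(g <- gs) bco x (bint m x g).
Proof.
move=> cK; elim: gs => [_|g gs IH [sg /IH[s2 E]]].
 split; first by split=> //; [exact: cst_continuous|move=> s; exact: bpr_bzero].
 rewrite big_nil bco_bint (_ : (fun s => _) = fun=> 0) ?vint0 //.
 by apply/funext => s; rewrite bco_zero.
have cg := sg; case: cg => cg pg _ g0; case: (s2) => c2 p2 _ z2; split.
 split=> //.
 - have := @fsum_cont S (fun=> x) [:: g; fsum (fun=> x) gs] (@cst_continuous _ _ _).
  rewrite (_ : fsum _ [:: _; _] = fsum (fun=> x) (g :: gs)); first by apply; do !split.
  apply/funext => s; apply: (@bco_eq _ _ _ x); rewrite ?bpr_fsum // !(bco_fsum (fun=> x)).
  by rewrite !big_cons big_nil addr0 (bco_fsum (fun=> x)).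
 - by move=> s; exact: bpr_fsum.
 - move=> s nK; apply: nzN; first exact: bpr_fsum.
  move=> /(nz_lin (pi := fun=> x) (pg s) (p2 s))[].
   by rewrite g0 //; exact: nz_bzero.
  by rewrite z2 //; exact: nz_bzero.
rewrite big_cons -E (bint_lin hS mK sg s2 (k := 1)) ?bcoE ?scale1r // => s.
by rewrite bco_lin // .
Qed.

(** * Approximate identities from inner products *)

Section ApproximateIdentities.
Local Notation "'fibA' x" := (fib A (x : gG)) (at level 10).

Lemma scale_cX (u : G -> R) (k : G -> A) : continuous u -> cX k -> cX (fun s => bscale (u s)%:C (k s)).
Proof.
move=> cu [ck pk [K cK kK]]; split.
- move=> s; apply: (bscale_cvg hE); last exact: ck.
 apply/rn_cvgP => d d0; have /cvgrPdist_lt/(_ _ d0) := cu s; apply: filterS => z.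
 by rewrite -rmorphB rn_real.
- by move=> s; rewrite bpr_bscale.
- exists K => // s h; apply: kK => z; apply: h.
 by rewrite bnorm_bscale z mulr0.
Qed.

Lemma approx_unit_sections (Y : ptopologicalType) (pi : Y -> G) (f : Y -> A) (L : set Y) (e : R) (t : G) :
 cs pi f -> compact L -> 0 < e -> exists ks : seq (G -> A), Alls cX ks /\ forall y, L y ->
 rn (fm (pi y) (\sum_(k <- ks) fm 1%g (bco t%:g (k t)) (fs (t^-1)%g (bco t%:g (k t))) : fibA 1%g)
    (bco (pi y)%:g (f y)) - bco (pi y)%:g (f y)) < e.
Proof.
move=> hf cL e0; have [cf pf _] := hf.
have e4 : 0 < e / 4 by rewrite divr_gt0.
have [bs hbs] := unit_list hf cL e4.
have [M M0 hM] := bnorm_compact hE cf cL.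
have d0 : 0 < e / 4 / (M + 1) by rewrite divr_gt0 // ltr_wpDl.
have [vs [h1 h2]] := fibre_approx_unit t bs d0.
set E := (\sum_(v <- vs) _ : fibA 1%g) in h1 h2.
have [ks [cks hks]] := approx_sections vs d0.
exists ks; split=> // y Ly; set c := bco _ (f y).
have hx : pi y = (1 * pi y)%g by rewrite mul1g.
pose lk k := fm 1%g (bco t%:g (k t)) (fs (t^-1)%g (bco t%:g (k t))).
have [b bb hb] := hbs y Ly; set Ek := (\sum_(k <- ks) lk k) in hks *.
have cM : rn c <= M by have := hM y Ly; rewrite (@bnormE _ _ _ (pi y)%:g).
have h3 := h1 b bb; have h4 := h2 _ (c - fm (pi y) b c).
(* Three errors: the replacement of [E] by [Ek], the action of E - 1 on c - b c, where only its
   contractivity is available, and the error of [E] on b. *)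
have h5 : fm (pi y) Ek c - c = - fm (pi y) (E - Ek) c +
  ((fm (pi y) E (c - fm (pi y) b c) - (c - fm (pi y) b c)) + fm (pi y) (fm 1%g E b - b) c).
 rewrite fmBl // fmBl // fmBr // (fmA (xy := 1%g)) ?mul1g //.
 move: (fm _ E c) (fm _ Ek c) (fm _ (fm _ _ _) c) (fm _ b c) => p q r u.
 by rewrite !opprB !addrA subrK [RHS]addrAC (addrAC _ (- c) (- u)) addrK (addrAC _ (- c) r) subrK.
have h6 := rn_fm (E - Ek) c hx; have h7 := rn_fm (fm 1%g E b - b) c hx.
have h8 := rnD (- fm (pi y) (E - Ek) c) ((fm (pi y) E (c - fm (pi y) b c) - (c - fm (pi y) b c)) + fm (pi y) (fm 1%g E b - b) c).
have h9 := rnD (fm (pi y) E (c - fm (pi y) b c) - (c - fm (pi y) b c)) (fm (pi y) (fm 1%g E b - b) c).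
rewrite h5; rewrite rnN in h8; rewrite (rn_distC (fm _ b c)) in hb.
have M1 : 0 < M + 1 by rewrite ltr_wpDl.
move: hks h3; rewrite !ltr_pdivlMr // => hks h3.
have c0 := rn_ge0 c; have r1 := rn_ge0 (E - Ek); have r2 := rn_ge0 (fm 1%g E b - b).
apply: le_lt_trans h8 _.
have k1 : rn (E - Ek) * rn c <= rn (E - Ek) * (M + 1) by rewrite ler_wpM2l //; lra.
have k2 : rn (fm 1%g E b - b) * rn c <= rn (fm 1%g E b - b) * (M + 1) by rewrite ler_wpM2l //; lra.
by move: h9 h6 h7 h4 hb hks h3 k1 k2; lra.
Qed.

(* near a point [t], [\sum_k k k^*] acts as an approximate unit *)
Lemma local_unit (Y : lspace) (f : Y -> A) (L : set Y) (e : R) (t : G) (V : set G) :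
 cs (@lpi Y) f -> compact L -> 0 < e -> nbhs (1%g : G) V ->
 exists (ks : seq (G -> A)) (W : set G), [/\ Alls cX ks, nbhs t W &
  forall a r, W a -> W (r^-1 * a)%g -> V r /\ forall y, L y ->
  rn (\sum_(k <- ks) bco (lpi y)%:g (fmul (fmul (k a) (fstar (k (r^-1 * a)%g))) (f (lact r^-1%g y))) -
    bco (lpi y)%:g (f y)) <= e].
Proof.
move=> hf cL e0 nV; have [cf pf _] := hf.
have [ks [cks hks]] := approx_unit_sections t hf cL e0.
pose Q := fun p : (G * G) * Y => fsum (fun p => lpi p.2)
 [seq (fun p : (G * G) * Y => fmul (fmul (k p.1.1) (fstar (k (p.1.2^-1 * p.1.1)%g))) (f (lact p.1.2^-1%g p.2))) | k <- ks] p.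
have pQ p : bpr (Q p) = lpi p.2 by exact: bpr_fsum.
have QE p : bco (lpi p.2)%:g (Q p) = \sum_(k <- ks) bco (lpi p.2)%:g
  (fmul (fmul (k p.1.1) (fstar (k (p.1.2^-1 * p.1.1)%g))) (f (lact p.1.2^-1%g p.2))).
 by rewrite [LHS](bco_fsum (fun p : (G * G) * Y => lpi p.2)) big_map.
have cQ : continuous Q.
 apply: fsum_cont => //; first by ctx.
 apply: Alls_map cks => k [ck pk _]; split; first by ctx.
 by bp.
have cf2 : continuous (fun p : (G * G) * Y => f p.2) by cts.
have near1 y : L y -> \forall p \near ((t, 1%g), y), bdist (bpr (Q p)) (Q p) (f p.2) < e.
 move=> Ly; apply: (bdist_near hE cQ cf2) => [p|]; first by rewrite pQ pf.
 rewrite pQ bdistE QE /=.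
 set c := bco _ (f y).
 have hx : lpi y = (1 * lpi y)%g by rewrite mul1g.
 have e1 : 1%g = (t * t^-1)%g by rewrite mulgV.
 have -> : \sum_(k <- ks) bco (lpi y)%:g (fmul (fmul (k t) (fstar (k (1^-1 * t)%g))) (f (lact 1^-1%g y))) =
   fm (lpi y) (\sum_(k <- ks) fm 1%g (bco t%:g (k t)) (fs (t^-1)%g (bco t%:g (k t))) : fibA 1%g) c.
  rewrite fm_suml //; apply: (eq_Alls _ cks) => k [_ pk _].
  apply: (@binj_inj _ _ A); rewrite invg1 mul1g lact1 bcoK.
   by rewrite !(fm_inj, fs_inj) // !bcoK.
  by bp.
 exact: hks.
have [N nN hN] : exists2 N, nbhs (t, 1%g : G) N & forall p, N p -> forall y, L y ->
  bdist (bpr (Q (p, y))) (Q (p, y)) (f y) < e.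
 exists [set p | forall y, L y -> bdist (bpr (Q (p, y))) (Q (p, y)) (f y) < e] => //.
 apply: (tube (P := fun p y => bdist (bpr (Q (p, y))) (Q (p, y)) (f y) < e) cL) => y Ly.
 by have := near1 y Ly; apply: filterS => -[].
have [[U V'] /= [nU nV'] UV] := nN.
have nVV : nbhs (1%g : G) (V `&` V') by exact: filterI.
(* If a and r^-1 a are both close to [t], then r = a (r^-1 a)^-1 is close to 1. *)
have : nbhs (t, t) [set p : G * G | (V `&` V') (p.1 * p.2^-1)%g].
 have cdiv : continuous (fun p : G * G => (p.1 * p.2^-1)%g) by cts.
 by apply: cdiv; rewrite /= mulgV.
move=> [[B B'] /= [nB nB'] BB].
exists ks, (U `&` (B `&` B')); split=> //; first by do 2 apply: filterI => //.
move=> a r [Ua [Ba _]] [_ [_ B'a]].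
have [Vr V'r] : (V `&` V') r by have := BB (a, (r^-1 * a)%g) (conj Ba B'a); rewrite /=; gsimp.
split=> // y Ly; have := hN (a, r) (UV (a, r) (conj Ua V'r)) y Ly.
by rewrite pQ bdistE QE => /ltW.
Qed.

Lemma pos_lower_bound (S : topologicalType) (D : S -> R) (K : set S) : compact K ->
 continuous D -> (forall s, K s -> 0 < D s) -> exists2 d : R, 0 < d & forall s, K s -> d <= D s.
Proof.
move=> cK cD pD.
suff [n hn] : exists n : nat, forall s, K s -> n.+1%:R^-1 < D s.
 by exists n.+1%:R^-1 => // s /hn/ltW.
have cov s : K s -> \forall s' \near s & n \near \oo, n.+1%:R^-1 < D s'.
 move=> Ks; have D2 : 0 < D s / 2 by rewrite divr_gt0 // pD.
 pose N := Num.Def.truncn (D s / 2)^-1.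
 exists ([set s' | D s / 2 < D s'], [set n | (N <= n)%N]) => /=.
  split; last by exists N.
  by apply: (cvgr_gt (D s)); [exact: cD|have := pD s Ks; lra].
 move=> [s' n] /= [h Nn]; apply: lt_trans h; rewrite invf_plt ?posrE //.
 by apply: lt_le_trans (truncnS_gt _) _; rewrite ler_nat ltnS.
have /compact_near_coveringP/(_ nat \oo (fun n s => n.+1%:R^-1 < D s) _ cov) := cK.
by move=> /filter_ex[n hn]; exists n.
Qed.

Lemma sum_weighted (V : normedModType C) (I : eqType) (s : seq I) (rho : I -> R) (q : I -> V) (c : V) (e : R) :
 (forall i, i \in s -> 0 <= rho i) -> (forall i, i \in s -> rho i != 0 -> rn (q i - c) <= e) ->
 rn (\sum_(i <- s) (rho i)%:C *: q i - (\sum_(i <- s) rho i)%:C *: c) <= e * \sum_(i <- s) rho i.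
Proof.
elim: s => [|i s IH] r0 h; first by rewrite !big_nil scale0r subrr rn0 mulr0.
rewrite !big_cons rmorphD /= scalerDl opprD addrACA mulrDr; apply: le_trans (rnD _ _) _.
apply: lerD; last first.
 by apply: IH => j js; [apply: r0|apply: h]; rewrite inE js orbT.
rewrite -scalerBr rnZ rn_pos; last by apply: r0; rewrite mem_head.
have [->|ri] := eqVneq (rho i) 0; first by rewrite !(mul0r, mulr0).
by rewrite mulrC ler_wpM2r ?r0 ?mem_head // h ?mem_head.
Qed.

Lemma rsupp_sum (S : ptopologicalType) (m : borel_measure R S)
  (hS : hausdorff_space S) (mK : finite_on_compacts S m)
  (I : eqType) (s : seq I) (K : set S) (rho : I -> S -> R) : compact K ->
 (forall i, i \in s -> rsupp K (rho i)) -> rsupp K (fun t => \sum_(i <- s) rho i t) /\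
 Rintegral m setT (fun t => \sum_(i <- s) rho i t) = \sum_(i <- s) Rintegral m setT (rho i).
Proof.
move=> cK; elim: s => [|i s IH] h.
 rewrite big_nil (_ : (fun t => _) = fun=> 0); last by apply/funext => t; rewrite big_nil.
 by split; [split=> //; exact: cst_continuous|rewrite Rintegral_cst // mul0r].
have hi := h i (mem_head _ _).
have [IH1 IH2] := IH (fun j js => h j (mem_behead (s := _ :: _) js)).
rewrite big_cons (_ : (fun t => _) = fun t => rho i t + \sum_(i <- s) rho i t); last first.
 by apply/funext => t; rewrite big_cons.
by split; [exact: rsuppD|rewrite (RintD hS mK hi IH1) IH2].
Qed.

(** The integral over H is put outside because the weights in [approx_left] have total mass 1 along
    cosets of H; for fixed h, integration over G produces the weight at h. *)
Lemma lconv_lip (Y : lspace) (x y : G -> A) (f : Y -> A) (z : Y) (t : G) (K : set G) :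
 cX x -> cX y -> cs (@lpi Y) f -> lcos z = coset_of H t -> compact K ->
 fsupp x K -> fsupp y K ->
 let W (h : T) (r : G) := fmul (fmul (x (t * inc h)%g) (fstar (y (r^-1 * t * inc h)%g))) (f (lact r^-1%g z)) in
 [/\ lconv (lipp x y) f z = bI nu (lpi z) (fun h => bI mu (lpi z) (W h)),
  forall h, csec (lpi z)%:g (mulset K (invset K)) (W h) &
  csec (lpi z)%:g [set h : T | mulset [set t^-1%g] K (inc h)] (fun h => bI mu (lpi z) (W h))].
Proof.
move=> hx hy hf zt cK xK yK W; have [cx px _] := hx; have [cy py _] := hy; have [cf pf _] := hf.
have cM : compact [set h : T | mulset [set t^-1%g] K (inc h)].
 by cpt.
have cK2 : compact (mulset K (invset K)) by cpt.
have hM h : nz (x (t * inc h)%g) -> mulset [set t^-1%g] K (inc h).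
 by move=> /xK yh; fac (t^-1)%g (t * inc h)%g.
have W0 h r : nz (W h r) -> [set h : T | mulset [set t^-1%g] K (inc h)] h /\ mulset K (invset K) r.
 move=> /nz_fmul[/nz_fmul[hx1 /nz_fstar/yK h1] _]; split; first exact: hM.
 rewrite (_ : r = (t * inc h) * (r^-1 * t * inc h)^-1)%g; last by gsimp.
 by apply: mulsetI; [exact: xK|exact: invsetI].
have pW h r : bpr (W h r) = lpi z by bp.
have cW : continuous (fun q : T * G => W q.1 q.2) by rewrite /W; ctx.
have sW h : csec (lpi z)%:g (mulset K (invset K)) (W h).
 by apply: csecI => // [|r /W0[]//]; rewrite /W; ctx.
split=> //.
- transitivity (bI mu (lpi z) (fun r => bI nu (lpi z) (W^~ r))); last first.
  by rewrite (bint_swap hsH hsG nuK muK cW pW cM cK2 W0).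
 apply: eq_bint => r; rewrite lcos_act zt coset_actE lippE //.
 have [N cN sN] := lip2_int x y r (r^-1 * t)%g hx hy.
 rewrite (fmul_bint_r hsH nuK sN (z := (lpi z)%:g)); last by rewrite pf lpi_act; gsimp.
 by apply: eq_bint => h; rewrite /W mulVKg.
- apply: csecI => [|h|//|h /(nz_bint hsG muK (pW h))[r /W0[]//]]; last exact: bpr_bint.
 apply: (bint_cont hE hsG muK (pi := fun=> (lpi z)%:g) (F := fun q : G * T => W q.2 q.1)).
 + exact: cst_continuous.
 + by rewrite /W; ctx.
 + by move=> r h /=.
 + move=> h0; have [M nM cM'] := subg_lcpt lG h0; exists M, (mulset K (invset K)); split=> //.
  by move=> r h _ nK /=; apply: nzN => // /W0[].
Qed.

Lemma csec_sub (S : ptopologicalType) (x : gG) (K L : set S) (f : S -> A) : compact L ->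
 K `<=` L -> csec x K f -> csec x L f.
Proof. by move=> cL KL [cf pf _ f0]; split=> // s nL; apply: f0 => /KL. Qed.
Lemma bco_fstar (x y : gG) (a : A) : bpr a = x -> bco y (fstar a) = fib_star y (bco x a).
Proof. by move=> ax; rewrite /fib_star bcoK. Qed.

(** Local units near finitely many points t are glued. Bump functions [chi t] cover a compact set of
    representatives of the cosets that occur on [L]. Dividing them by the integral of their sum
    along cosets of H gives weights [v t] of total mass 1 on each such coset, and [u t] is scaled so
    that u t a times u t (r^-1 a), integrated over r, returns v t a. The sections [phis] are the
    products of [u t] with the local unit at t. One compact [L] contains the supports of all
    approximants, as continuity in the inductive limit topology requires. *)
Theorem approx_left (Y : lspace) (f : Y -> A) : cs (@lpi Y) f ->
 exists L : set Y, [/\ compact L, fsupp f L & forall e : R, 0 < e ->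
  exists phis : seq (G -> A), Alls cX phis /\
  let S := fsum (@lpi Y) [seq lconv (lipp phi phi) f | phi <- phis] in
  fsupp S L /\ forall y, rn (bco (lpi y)%:g (S y) - bco (lpi y)%:g (f y)) <= e].
Proof.
move=> hf; have [cf pf [L0 cL0 fL0]] := hf.
have [V0 nV0 cV0] := lG 1%g.
pose L := (fun p : G * Y => lact p.1 p.2) @` (V0 `*` L0).
have cL : compact L.
 apply: continuous_compact; last exact: compact_setX.
 by apply: continuous_subspaceT; exact: lact_cont.
have LI r y : V0 r -> nz (f (lact r^-1%g y)) -> L y.
 by move=> Vr /fL0 h; exists (r, lact r^-1%g y); rewrite //= lactV.
have fL : fsupp f L.
 by move=> y fy; apply: (LI 1%g); [exact: nbhs_singleton|rewrite invg1 lact1].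
exists L; split=> // e e0.
have loc t : exists p : seq (G -> A) * (G -> R) * set G, [/\ Alls cX p.1.1,
  [/\ continuous p.1.2, forall s, 0 <= p.1.2 s & 0 < p.1.2 t], compact p.2, (forall s, ~ p.2 s -> p.1.2 s = 0) &
  forall a r, p.1.2 a != 0 -> p.1.2 (r^-1 * a)%g != 0 -> V0 r /\ forall y, L y ->
  rn (\sum_(k <- p.1.1) bco (lpi y)%:g (fmul (fmul (k a) (fstar (k (r^-1 * a)%g))) (f (lact r^-1%g y))) -
    bco (lpi y)%:g (f y)) <= e].
 have [ks [W [cks nW hW]]] := local_unit t hf cL e0 nV0.
 have [M nM cM] := lG t; have nWM : nbhs t (W `&` M) by exact: filterI.
 have [chi [cchi chi0 chit chiz]] := bump R hsG lcG nWM.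
 have cz s : chi s != 0 -> W s /\ M s.
  by move=> /eqP cs; apply: contrapT => n; apply: cs; exact: nbhs_singleton (chiz s n).
 exists (ks, chi, M); split=> //= [s nMs|a r /cz[Wa _] /cz[Wra _]]; last exact: hW.
 by apply/eqP; apply: contrapT => /negP/cz[].
have [p pP] := choice loc.
pose chi t := (p t).1.2.
have clL : compact (@lcos Y @` L).
 by apply: continuous_compact => //; apply: continuous_subspaceT; exact: lcos_cont.
have [T0 cT0 hT0] := coset_lift lG clL.
move: (cT0); rewrite compact_cover => cc.
have [||l lK Tl] := cc G T0 (fun t => chi t @^-1` [set r | 0 < r]).
- move=> t _; have [_ [c _ _] _ _ _] := pP t.
 by apply: open_comp; [move=> y _; exact: c|exact: open_gt].
- by move=> t T0t; exists t => //; have [_ [] ] := pP t.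
pose l' := finmap.enum_fset l.
have [K cK hK] : exists2 K, compact K & forall t, t \in l' -> (p t).2 `<=` K.
 elim: l' => [|t l1 [K cK hK]]; first by exists set0 => //; exact: compact0.
 exists ((p t).2 `|` K) => [|r].
  by apply: compactU => //; case: (pP t).
 by rewrite inE => /orP[/eqP -> s|/hK h s /h]; [left|right].
have chiK t s : t \in l' -> ~ K s -> chi t s = 0.
 by move=> tl nK; have [_ _ _ h _] := pP t; apply: h => /(hK t tl).
have cchi t : continuous (chi t) by have [_ [c _ _] _ _ _] := pP t.
have chi0 t s : 0 <= chi t s by have [_ [_ c _] _ _ _] := pP t; exact: c.
have schi : rsupp K (fun s => \sum_(t <- l') chi t s).
 by apply: (rsupp_sum hsG muK cK _).1 => t tl; split=> // s; exact: chiK.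
pose X s := \sum_(t <- l') chi t s.
have [cX' _ X0] := schi.
have Xge s : 0 <= X s by apply: sumr_ge0.
have sH t (rho : G -> R) : rsupp K rho -> rsupp [set h : T | mulset [set t^-1%g] K (inc h)] (fun h : T => rho (t * inc h)%g).
 move=> [cr _ rz]; split; first by apply: (cont_comp _ cr); cts.
  by cpt.
 move=> h nh; apply: rz => Kh; apply: nh => /=.
 by fac (t^-1)%g (t * inc h)%g.
pose D t := Rintegral nu setT (fun h : T => X (t * inc h)%g).
have cD : continuous D.
 apply: (Rint_cont hsH nuK (F := fun q : T * G => X (q.2 * inc q.1)%g)).
  by apply: (cont_comp _ cX'); cts.
 move=> t0; have [M nM cM] := lG t0.
 exists M, [set h : T | mulset (invset M) K (inc h)]; split=> //.
  by cpt.
 move=> h t Mt nh /=; apply: X0 => Kh; apply: nh => /=.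
 fac (t^-1)%g (t * inc h)%g.
have DH t (k : T) : D (t * inc k)%g = D t.
 rewrite /D -(Rint_shift k hnu (rho := fun h : T => X (t * inc h)%g)).
  by congr (Rintegral _ _ _); apply/funext => h; rewrite mulgA.
 by apply: (cont_comp _ cX'); cts.
have Dpos t : T0 t -> 0 < D t.
 move=> /Tl[t' /= tl ct]; apply: (Rint_gt0 (s0 := 1%g) hsH nuK (sH t _ schi)) => // [h|]; first exact: Xge.
 rewrite (_ : (t * inc (1 : T))%g = t); last by rewrite mulg1.
 rewrite (perm_big _ (perm_to_rem tl)) /= big_cons ltr_wpDr //.
 by apply: sumr_ge0.
have [d d0 dD] := pos_lower_bound cT0 cD Dpos.
(* [D] is positive only over cosets that meet the supports. Its lower bound [d] on [T0] makes the
   division continuous everywhere and changes nothing over the cosets of [T0]. *)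
pose Dm t := Num.max (D t) d.
have Dm0 t : 0 < Dm t by rewrite lt_max d0 orbT.
have cDm : continuous Dm.
 by move=> t; apply: (@continuous_max _ _ D (fun=> d) t); [exact: cD|exact: cst_continuous].
pose v t s := chi t s / Dm s.
have v0 t s : 0 <= v t s by rewrite divr_ge0 // ltW.
have cv t : continuous (v t).
 move=> s; apply: (@cvgM R^o); first exact: cchi.
 by apply: cvgV; [rewrite gt_eqF|exact: cDm].
have vK t s : t \in l' -> ~ K s -> v t s = 0 by move=> tl nK; rewrite /v chiK // mul0r.
have sv t : t \in l' -> rsupp K (v t) by move=> tl; split=> // s; exact: vK.
have vz t s : v t s != 0 -> chi t s != 0.
 by apply: contraNN => /eqP h; rewrite /v h mul0r.
have sinv a (rho : G -> R) : rsupp K rho -> rsupp (mulset [set a] (invset K)) (fun r => rho (r^-1 * a)%g).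
 move=> [cr _ rz]; split; first by apply: (cont_comp _ cr); cts.
  by cpt.
 move=> r nr; apply: rz => Kr; apply: nr.
 fac a ((r^-1 * a)^-1)%g.
pose dt t := Rintegral mu setT (fun r => v t r^-1%g).
have dt0 t : t \in l' -> 0 < dt t.
 move=> tl; have s1 : rsupp (mulset [set 1%g] (invset K)) (fun r => v t r^-1%g).
  by have := sinv 1%g _ (sv t tl); congr rsupp; apply/funext => r; rewrite mulg1.
 apply: (Rint_gt0 (s0 := t^-1%g) hsG muK s1) => //.
 by rewrite invgK divr_gt0 //; have [_ []] := pP t.
(* The square root appears because the section enters the inner product twice, at a and at r^-1
   a. *)
pose u t s := (Num.sqrt (dt t))^-1 * v t s.
have u0 t s : 0 <= u t s by rewrite mulr_ge0 // invr_ge0 sqrtr_ge0.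
have cu t : continuous (u t).
 by move=> s; apply: (@cvgM R^o); [exact: cvg_cst|exact: cv].
have su t : t \in l' -> rsupp K (u t) by move=> tl; exact: rsuppZ (sv t tl).
have uz t s : u t s != 0 -> chi t s != 0.
 by move=> h; apply: vz; apply: contraNN h => /eqP h; rewrite /u h mulr0.
pose phis := flatten [seq [seq (fun s => bscale (u t s)%:C (k s)) | k <- (p t).1.1] | t <- l'].
pose P (phi : G -> A) := [/\ cX phi, fsupp phi K & forall a r, nz (phi a) -> nz (phi (r^-1 * a)%g) -> V0 r].
have Pphis : Alls P phis.
 apply: Alls_flatmap => t tl.
 have [ck _ _ _ hV] := pP t; apply: Alls_map ck => k ck.
 have nzu a : nz (bscale (u t a)%:C (k a)) -> u t a != 0.
  by move=> h; apply/eqP => z; apply: h; rewrite bnorm_bscale z rn0 mul0r.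
 split; first exact: scale_cX.
  by move=> a /nzu h; apply: contrapT => nK; move: h; rewrite /u vK // mulr0 eqxx.
 by move=> a r /nzu/uz h1 /nzu/uz h2; have [] := hV a r h1 h2.
exists phis; split; first by elim: (phis) Pphis => //= phi l1 IH [[? _ _] /IH].
have supS : fsupp (fsum (@lpi Y) [seq lconv (lipp phi phi) f | phi <- phis]) L.
 move=> y; apply: nz_fsum; apply: Alls_map Pphis => phi [cphi _ phiV].
 split; first exact: bpr_bint.
 move=> /(lconv_supp (lipp_cs cphi cphi) hf)[r [h1 h2]].
 have [h [h3 h4]] := lip2_supp cphi cphi h1.
 apply: (LI r) h2; apply: (phiV _ _ h3); move: h4; congr nz; congr phi.
 by rewrite /=; gsimp.
split=> // y; have [Ly|nLy] := pselect (L y); last first.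
 have -> : f y = bzero A (lpi y)%:g by apply: nzN; [exact: pf|move=> /fL].
 rewrite (@nzN (fsum _ _ y) (lpi y)%:g) ?subrr ?rn0 ?ltW ?bpr_fsum //.
 by move=> /supS.
have [t0 Tt0 yt0] : (coset_of H @` T0) (lcos y) by apply: hT0; exists y.
set x := lpi y; pose W (phi : G -> A) (h : T) (r : G) :=
 fmul (fmul (phi (t0 * inc h)%g) (fstar (phi (r^-1 * t0 * inc h)%g))) (f (lact r^-1%g y)).
pose N := [set h : T | mulset [set t0^-1%g] K (inc h)].
pose K2 := mulset K (invset K).
have WP phi : P phi -> [/\ lconv (lipp phi phi) f y = bI nu x (fun h => bI mu x (W phi h)),
  forall h, csec x%:g K2 (W phi h) & csec x%:g N (fun h => bI mu x (W phi h))].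
 by move=> [cphi sphi _]; exact: (lconv_lip cphi cphi hf (esym yt0) cK sphi sphi).
have cN : compact N by cpt.
have cK2 : compact K2 by cpt.
pose gout := [seq (fun h => bI mu x (W phi h)) | phi <- phis].
pose gin h := [seq W phi h | phi <- phis].
have aout : Alls (csec x%:g N) gout by apply: Alls_map Pphis => phi /WP[].
have ain h : Alls (csec x%:g K2) (gin h) by apply: Alls_map Pphis => phi /WP[_ h1 _]; exact: h1.
have [sout Eout] := bint_fsum hsH nuK cN aout.
have -> : bco x%:g (fsum (@lpi Y) [seq lconv (lipp phi phi) f | phi <- phis] y) =
  bco x%:g (bI nu x (fsum (fun=> x) gout)).
 rewrite Eout bco_fsum !big_map; apply: (eq_Alls _ Pphis) => phi /WP[-> _ _] //.
(* The weights along the coset belonging to [y], parametrized by H from the representative [t0]. *)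
pose w (h : T) := \sum_(t <- l') v t (t0 * inc h)%g.
have [sw _] := rsupp_sum hsH nuK cN (fun t (tl : t \in l') => sH t0 _ (sv t tl)).
have w1 : Rintegral nu setT w = 1.
 rewrite (_ : w = fun h => (D t0)^-1 * X (t0 * inc h)%g).
  by rewrite (RintZ hsH nuK _ (sH t0 _ schi)) mulVf // gt_eqF // Dpos.
 apply/funext => h; rewrite /w /X mulr_sumr; apply: eq_bigr => t _; rewrite /v mulrC.
 by congr (_^-1 * _); rewrite /Dm DH; apply/max_idPl/dD.
have := bint_weighted hsH nuK (a := f y) (rho := w) (e := e) hE sout sw _ (ltW e0) _.
rewrite w1 mulr1 scale1r; apply=> [h|h]; first by apply: sumr_ge0 => t _; exact: v0.
set a := (t0 * inc h)%g.
have [sin Ein] := bint_fsum hsG muK cK2 (ain h).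
have -> : bco x%:g (fsum (fun=> x) gout h) = bco x%:g (bI mu x (fsum (fun=> x) (gin h))).
 by rewrite Ein (bco_fsum (fun=> x)) !big_map.
(* The joint weight at (h, r); integrating r out returns [w h], which is the reason for the scaling
   of [u]. *)
pose rho r := \sum_(t <- l') u t a * u t (r^-1 * a)%g.
pose K3 := mulset [set a] (invset K).
have cK3 : compact K3 by cpt.
have [srho Irho] := rsupp_sum hsG muK cK3 (fun t (tl : t \in l') => rsuppZ (u t a) (sinv a _ (su t tl))).
have Iw : Rintegral mu setT rho = w h.
 rewrite Irho /w; apply: eq_big_seq => t tl.
 rewrite (RintZ hsG muK _ (sinv a _ (su t tl))).
 have [cinv _ _] := sinv a _ (su t tl).
 rewrite -(Rint_shift a hmu cinv) (_ : (fun s => _) = fun r => (Num.sqrt (dt t))^-1 * v t r^-1%g); last first.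
  by apply/funext => r; rewrite /u; congr (_ * v t _); gsimp.
 have s1 : rsupp (mulset [set 1%g] (invset K)) (fun r => v t r^-1%g).
  by have := sinv 1%g _ (sv t tl); congr rsupp; apply/funext => r; rewrite mulg1.
 rewrite (RintZ hsG muK _ s1) -/(dt t) /u -mulrA mulrCA mulrA -mulrA [X in _ * X]mulrA.
 have q0 := dt0 t tl; rewrite -invfM -expr2 sqr_sqrtr ?(ltW q0) // mulVf ?mulr1 // gt_eqF //.
have cU : compact (K2 `|` K3) by exact: compactU.
have := bint_weighted hsG muK (a := f y) (rho := rho) (e := e) hE
 (csec_sub cU (@subsetUl _ _ _) sin) (rsupp_sub cU (@subsetUr _ _ _) srho) _ (ltW e0) _.
rewrite Iw; apply=> [r|r]; first by apply: sumr_ge0 => t _; rewrite mulr_ge0.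
rewrite (bco_fsum (fun=> x)) big_map /phis big_flatten big_map.
pose Q t := \sum_(k <- (p t).1.1) bco x%:g (fmul (fmul (k a) (fstar (k (r^-1 * a)%g))) (f (lact r^-1%g y))).
have -> : \sum_(t <- l') \sum_(phi <- [seq (fun s => bscale (u t s)%:C (k s)) | k <- (p t).1.1]) bco x%:g (W phi h r) =
  \sum_(t <- l') (u t a * u t (r^-1 * a)%g)%:C *: Q t.
 apply: eq_bigr => t _; rewrite big_map /Q scaler_sumr.
 have [ck _ _ _ _] := pP t; apply: (eq_Alls _ ck) => k [_ pk _].
 rewrite /W -/a -mulgA -/a.
 have q1 : bpr (fmul (k a) (fstar (k (r^-1 * a)%g))) = r by bp.
 have q2 : bpr (f (lact r^-1%g y)) = (r^-1 * x)%g by rewrite pf lpi_act.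
 rewrite (bco_fmul x%:g (x := r%:g) (y := (r^-1 * x)%g%:g)) //; last first.
  by bp.
 rewrite (bco_fmul x%:g (x := r%:g) (y := (r^-1 * x)%g%:g) q1 q2) -fmZl; last by gsimp.
 congr (fib_mul _ _ _); rewrite !(bco_fmul r%:g (x := a%:g) (y := (a^-1 * r)%g%:g)) ?bpr_fstar ?bpr_bscale ?pk //; last by gsimp.
 have hb : (a^-1 * r)%g = ((r^-1 * a)^-1)%g by gsimp.
 have hr : r = (a * (a^-1 * r))%g by gsimp.
 rewrite !(@bco_fstar (r^-1 * a)%g%:g) ?bpr_bscale ?pk // !bco_bscale ?pk //.
 by rewrite fsZ // conjc_real fmZl // fmZr // scalerA -rmorphM.
 by gsimp.
apply: sum_weighted => t tl; first by rewrite mulr_ge0.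
move=> h1; have [_ _ _ _ h2] := pP t; apply: (h2 a r _ _).2 => //.
- by apply: uz; apply: contraNN h1 => /eqP ->; rewrite mul0r.
- by apply: uz; apply: contraNN h1 => /eqP ->; rewrite mulr0.
Qed.

Lemma star_cX (k : G -> A) : cX k -> cX (fun s => fstar (k s^-1%g)).
Proof.
move=> [ck pk [K cK kK]]; split; first by cts.
 by move=> s; rewrite bpr_fstar pk invgK.
exists (invset K); first exact: invset_compact.
by move=> s /nz_fstar/kK h; rewrite -[s]invgK; exact: invsetI.
Qed.

(** The left version is applied to the adjoint of [f] and conjugated back; replacing k by the
    adjoint of k(s^-1) puts the two factors at 1 in the order of the right-hand inner product. *)
Lemma approx_unit_sections_right (Y : ptopologicalType) (pi : Y -> G) (f : Y -> A) (L : set Y) (e : R) :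
 cs pi f -> compact L -> 0 < e -> exists ks : seq (G -> A), Alls cX ks /\ forall y, L y ->
 rn (\sum_(k <- ks) bco (pi y)%:g (fmul (f y) (fmul (fstar (k 1%g)) (k 1%g))) - bco (pi y)%:g (f y)) < e.
Proof.
move=> [cf pf [K cK fK]] cL e0.
have hf' : cs (fun y => (pi y)^-1%g) (fun y => fstar (f y)).
 split; [by cts|by move=> y; rewrite bpr_fstar pf|].
 by exists K => // y /nz_fstar/fK.
have [ks [cks hks]] := approx_unit_sections 1%g hf' cL e0.
exists [seq (fun s => fstar (k s^-1%g)) | k <- ks]; split.
 by apply: Alls_map cks => k; exact: star_cX.
move=> y Ly; apply: le_lt_trans (hks y Ly); rewrite le_eqVlt; apply/orP; left; apply/eqP.
have hx : (pi y)^-1%g = ((pi y)^-1)%g by [].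
rewrite -(rn_fs _ hx) fsB // big_map; congr (rn (_ - _)); last first.
 by rewrite (bco_fstar (x := (pi y)%:g)).
have fs_sum (s : seq (G -> A)) (F : (G -> A) -> fibA (pi y)) :
  fs (pi y)^-1%g (\sum_(k <- s) F k) = \sum_(k <- s) fs (pi y)^-1%g (F k).
 by elim: s => [|k s IH]; rewrite ?big_nil ?fs0 // !big_cons fsD // IH.
rewrite fs_sum fm_suml; last by rewrite mul1g.
apply: (eq_Alls _ cks) => k [_ pk _].
have p1 : bpr (fmul (f y) (fmul (fstar (fstar (k 1^-1%g))) (fstar (k 1^-1%g)))) = pi y.
 by bp.
apply: (@binj_inj _ _ A); rewrite fs_inj // !fm_inj //; last 2 first.
- by rewrite mulgV.
- by rewrite mul1g.
rewrite fs_inj // !bcoK ?pf ?pk ?bpr_fstar ?pf //.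
by rewrite invg1 !fstarM !fstarK.
Qed.

Lemma local_unit_right (Y : rspace) (f : Y -> A) (L : set Y) (e : R) (V : set T) :
 cs (@rpi Y) f -> compact L -> 0 < e -> nbhs (1%g : T) V ->
 exists (ks : seq (G -> A)) (W : set G), [/\ Alls cX ks, nbhs 1%g W &
  forall a (h : T), W a -> W (a * (inc h)^-1)%g -> V h /\ forall y, L y ->
  rn (\sum_(k <- ks) bco (rpi y)%:g (fmul (f (ract y h)) (fmul (fstar (k a)) (k (a * (inc h)^-1)%g))) -
    bco (rpi y)%:g (f y)) <= e].
Proof.
move=> hf cL e0 nV; have [cf pf _] := hf.
have [ks [cks hks]] := approx_unit_sections_right hf cL e0.
pose Q := fun p : (G * T) * Y => fsum (fun p => rpi p.2)
 [seq (fun p : (G * T) * Y => fmul (f (ract p.2 p.1.2)) (fmul (fstar (k p.1.1)) (k (p.1.1 * (inc p.1.2)^-1)%g))) | k <- ks] p.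
have pQ p : bpr (Q p) = rpi p.2 by exact: bpr_fsum.
have QE p : bco (rpi p.2)%:g (Q p) = \sum_(k <- ks) bco (rpi p.2)%:g
  (fmul (f (ract p.2 p.1.2)) (fmul (fstar (k p.1.1)) (k (p.1.1 * (inc p.1.2)^-1)%g))).
 by rewrite [LHS](bco_fsum (fun p : (G * T) * Y => rpi p.2)) big_map.
have cQ : continuous Q.
 apply: fsum_cont => //; first by ctx.
 apply: Alls_map cks => k [ck pk _]; split; first by ctx.
 by bp.
have cf2 : continuous (fun p : (G * T) * Y => f p.2) by cts.
have near1 y : L y -> \forall p \near ((1%g, 1%g), y), bdist (bpr (Q p)) (Q p) (f p.2) < e.
 move=> Ly; apply: (bdist_near hE cQ cf2) => [p|]; first by rewrite pQ pf.
 rewrite pQ bdistE QE /= ract1 (_ : (1 * (inc (1 : T))^-1)%g = 1%g :> G); last first.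
  by rewrite mul1g /= invg1.
 exact: hks.
have [N nN hN] : exists2 N, nbhs (1%g : G, 1%g : T) N & forall p, N p -> forall y, L y ->
  bdist (bpr (Q (p, y))) (Q (p, y)) (f y) < e.
 exists [set p | forall y, L y -> bdist (bpr (Q (p, y))) (Q (p, y)) (f y) < e] => //.
 apply: (tube (P := fun p y => bdist (bpr (Q (p, y))) (Q (p, y)) (f y) < e) cL) => y Ly.
 by have := near1 y Ly; apply: filterS => -[].
have [[U V'] /= [nU nV'] UV] := nN.
have /nbhs_subg[VG nVG hVG] : nbhs (1%g : T) (V `&` V') by exact: filterI.
have : nbhs (1%g, 1%g) [set p : G * G | VG (p.2^-1 * p.1)%g].
 have cdiv : continuous (fun p : G * G => (p.2^-1 * p.1)%g) by cts.
 by apply: cdiv; rewrite /= mulVg.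
move=> [[B B'] /= [nB nB'] BB].
exists ks, (U `&` (B `&` B')); split=> //; first by do 2 apply: filterI => //.
move=> a h [Ua [Ba _]] [_ [_ B'a]].
have [Vh V'h] : (V `&` V') h.
 by apply: hVG; have := BB (a, (a * (inc h)^-1)%g) (conj Ba B'a); rewrite /=; gsimp.
split=> // y Ly; have := hN (a, h) (UV (a, h) (conj Ua V'h)) y Ly.
by rewrite pQ bdistE QE => /ltW.
Qed.

(** No covering by several local units is needed: both integrals run over whole groups and the
    weight u(s^-1) u(s^-1 h^-1) does not involve the point y, so one local unit at 1 and one
    normalizing constant [d] suffice. *)
Theorem approx_right (Y : rspace) (f : Y -> A) : cs (@rpi Y) f ->
 exists L : set Y, [/\ compact L, fsupp f L & forall e : R, 0 < e ->
  exists psis : seq (G -> A), Alls cX psis /\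
  let S := fsum (@rpi Y) [seq rconv f (ripp psi psi) | psi <- psis] in
  fsupp S L /\ forall y, rn (bco (rpi y)%:g (S y) - bco (rpi y)%:g (f y)) <= e].
Proof.
move=> hf; have [cf pf [L0 cL0 fL0]] := hf.
have [V0 nV0 cV0] := subg_lcpt (H := H) lG 1%g.
pose L := (fun p : Y * T => ract p.1 p.2^-1%g) @` (L0 `*` V0).
have cL : compact L.
 apply: continuous_compact; last exact: compact_setX.
 by apply: continuous_subspaceT; ctx.
have LI h y : V0 h -> nz (f (ract y h)) -> L y.
 by move=> Vh /fL0 hh; exists (ract y h, h); rewrite //= ractV.
have fL : fsupp f L.
 by move=> y fy; apply: (LI 1%g); [exact: nbhs_singleton|rewrite ract1].
exists L; split=> // e e0.
have [ks [W [cks nW hW]]] := local_unit_right hf cL e0 nV0.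
have [M nM cM] := lG 1%g; have nWM : nbhs (1%g : G) (W `&` M) by exact: filterI.
have [u0 [cu0 u00 u01 u0z]] := bump R hsG lcG nWM.
have u0W a : u0 a != 0 -> W a /\ M a.
 by move=> h; apply: contrapT => /u0z/nbhs_singleton h0; rewrite h0 eqxx in h.
have u0M a : ~ M a -> u0 a = 0.
 by move=> nM'; apply/eqP; apply: contrapT => /negP/u0W[].
pose K2 := [set h : T | mulset (invset M) M (inc h)].
have cK2 : compact K2 by cpt.
pose J (p : G * T) := u0 p.1^-1%g * u0 (p.1^-1 * (inc p.2)^-1)%g.
have cJ : continuous J.
 have c1 : continuous (fun p : G * T => u0 p.1^-1%g) by cts.
 have c2 : continuous (fun p : G * T => u0 (p.1^-1 * (inc p.2)^-1)%g) by cts.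
 by move=> p; apply: (@cvgM R^o); [exact: c1|exact: c2].
have J0 p : 0 <= J p by rewrite mulr_ge0.
have Jz p : J p != 0 -> u0 p.1^-1%g != 0 /\ u0 (p.1^-1 * (inc p.2)^-1)%g != 0.
 by rewrite mulf_eq0 negb_or => /andP.
have cMi : compact (invset M) by exact: invset_compact.
have sJ h : rsupp (invset M) (fun s => J (s, h)).
 split=> //; first exact: cont_slice2.
 move=> s ns; rewrite /J /= u0M ?mul0r // => Ms; apply: ns.
 by rewrite -[s]invgK; exact: invsetI.
pose I h := Rintegral mu setT (fun s => J (s, h)).
have I0 h : 0 <= I h by apply: Rint_ge0 => s.
have cI : continuous I.
 apply: (Rint_cont hsG muK cJ) => h; exists setT, (invset M); split=> //; first exact: filterT.
 by move=> s h' _ ns; have [_ _ h0] := sJ h'; exact: (h0 s).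
have sI : rsupp K2 I.
 split=> // h nh; rewrite /I (_ : (fun s => _) = fun=> 0) ?Rintegral_cst ?mul0r //.
 apply/funext => s; apply/eqP; apply: contrapT => /negP/Jz[/u0W[_ M1] /u0W[_ M2]]; apply: nh.
 rewrite /K2 /= (_ : inc h = (s^-1 * (inc h)^-1)^-1 * s^-1)%g; last by gsimp.
 by apply: mulsetI => //; exact: invsetI.
have I1 : 0 < I 1%g.
 apply: (Rint_gt0 (s0 := 1%g) hsG muK (sJ _)) => //.
 have e1 : ((1%g : G)^-1 * (inc (1%g : T))^-1)%g = 1%g :> G.
  by rewrite (_ : inc (1%g : T) = 1%g) // !invg1 mul1g.
 change (0 < u0 (1%g : G)^-1%g * u0 ((1%g : G)^-1 * (inc (1%g : T))^-1)%g).
 by rewrite e1 invg1 mulr_gt0.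
pose d := Rintegral nu setT I.
have d0 : 0 < d by exact: (Rint_gt0 (s0 := 1%g) hsH nuK sI).
pose u a := (Num.sqrt d)^-1 * u0 a.
have cu : continuous u by move=> a; apply: (@cvgM R^o); [exact: cvg_cst|exact: cu0].
have u_ge0 a : 0 <= u a by rewrite mulr_ge0 // invr_ge0 sqrtr_ge0.
have uz a : u a != 0 -> u0 a != 0 by apply: contraNN => /eqP h; rewrite /u h mulr0.
have uu s h : u s^-1%g * u (s^-1 * (inc h)^-1)%g = d^-1 * J (s, h).
 by rewrite /u mulrACA -invfM -expr2 sqr_sqrtr ?(ltW d0).
pose psis := [seq (fun s => bscale (u s)%:C (k s)) | k <- ks].
pose P (psi : G -> A) := [/\ cX psi & forall a, nz (psi a) -> W a].
have Ppsis : Alls P psis.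
 apply: Alls_map cks => k ck; split; first exact: scale_cX.
 move=> a h; apply: (u0W a _).1; apply: uz; apply/eqP => z; apply: h.
 by rewrite bnorm_bscale z rn0 mul0r.
exists psis; split; first by elim: (psis) Ppsis => //= phi l1 IH [[? _] /IH].
have supS : fsupp (fsum (@rpi Y) [seq rconv f (ripp psi psi) | psi <- psis]) L.
 move=> y; apply: nz_fsum; apply: Alls_map Ppsis => psi [cpsi psiW].
 split; first exact: bpr_bint.
 move=> /(rconv_supp hf (ripp_cs cpsi cpsi))[h [h1 h2]].
 have [s [h3 h4]] := ripp_supp cpsi cpsi h2.
 by apply: (LI h) h1; have [] := hW s^-1%g h (psiW _ h3) (psiW _ h4).
split=> // y; have [Ly|nLy] := pselect (L y); last first.
 have -> : f y = bzero A (rpi y)%:g by apply: nzN; [exact: pf|move=> /fL].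
 rewrite (@nzN (fsum _ _ y) (rpi y)%:g) ?subrr ?rn0 ?ltW ?bpr_fsum //.
 by move=> /supS.
set x := rpi y; pose Wf (psi : G -> A) (h : T) (s : G) :=
 fmul (f (ract y h)) (fmul (fstar (psi s^-1%g)) (psi (s^-1 * (inc h)^-1)%g)).
have WP psi : P psi -> rconv f (ripp psi psi) y = bI nu x (fun h => bI mu x (Wf psi h)) /\
  exists K K' : set _, [/\ forall h, csec x%:g K (Wf psi h) & csec x%:g K' (fun h => bI mu x (Wf psi h))].
 move=> [cpsi _]; have [cp pp [K cK pK]] := cpsi.
 have E h : fmul (f (ract y h)) (ripp psi psi h^-1%g) = bI mu x (Wf psi h).
  have [K1 cK1 s1] := ripp_int h^-1%g cpsi cpsi.
  rewrite /ripp (fmul_bint_l hsG muK s1 (z := x%:g)) ?pf ?rpi_act //.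
  by rewrite /=; gsimp.
 have [K' cK' s'] := rconv_int y hf (ripp_cs cpsi cpsi).
 split; first by apply: eq_bint => h; rewrite E.
 exists (invset K), K'; split; last first.
  by rewrite (_ : (fun h => _) = fun h => fmul (f (ract y h)) (ripp psi psi h^-1%g)) //; apply/funext.
 move=> h; apply: csecI; first by rewrite /Wf; cts.
 - by bp.
 - exact: invset_compact.
 by move=> s /nz_fmul[_ /nz_fmul[/nz_fstar/pK h1 _]]; rewrite -[s]invgK; exact: invsetI.
pose gout := [seq (fun h => bI mu x (Wf psi h)) | psi <- psis].
pose gin h := [seq Wf psi h | psi <- psis].
have [K [K' [cK cK' ain aout]]] : exists K K', [/\ compact K, compact K', forall h, Alls (csec x%:g K) (gin h) & Alls (csec x%:g K') gout].
 rewrite /gin /gout; elim: (psis) Ppsis => [_|psi l IH [/WP[_ [K1 [K1' [h1 h1']]]] /IH[K [K' [cK cK' h2 h2']]]]].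
  by exists set0, set0; split=> //; exact: compact0.
 have cK1 : compact K1 by case: (h1 1%g).
 have cK1' : compact K1' by case: h1'.
 have cU : compact (K1 `|` K) by exact: compactU.
 have cU' : compact (K1' `|` K') by exact: compactU.
 exists (K1 `|` K), (K1' `|` K'); split=> // [h|] /=; split.
 - exact: csec_sub cU (@subsetUl _ _ _) (h1 h).
 - by apply: Alls_impl (h2 h) => g; exact: csec_sub cU (@subsetUr _ _ _).
 - exact: csec_sub cU' (@subsetUl _ _ _) h1'.
 - by apply: Alls_impl h2' => g; exact: csec_sub cU' (@subsetUr _ _ _).
have [sout Eout] := bint_fsum hsH nuK cK' aout.
have -> : bco x%:g (fsum (@rpi Y) [seq rconv f (ripp psi psi) | psi <- psis] y) =
  bco x%:g (bI nu x (fsum (fun=> x) gout)).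
 rewrite Eout bco_fsum /gout [LHS]big_map [RHS]big_map.
 apply: (@eq_Alls _ _ P _ _ _ _ Ppsis) => psi Pp.
 by have [-> _] := WP psi Pp.
pose w (h : T) := d^-1 * I h.
have sw : rsupp K2 w by exact: rsuppZ.
have w1 : Rintegral nu setT w = 1 by rewrite (RintZ hsH nuK _ sI) mulVf // gt_eqF.
have w0 h : 0 <= w h by rewrite mulr_ge0 // invr_ge0 ltW.
have cU2 : compact (K' `|` K2) by exact: compactU.
have := bint_weighted hsH nuK (a := f y) (rho := w) (e := e) hE (csec_sub cU2 (@subsetUl _ _ _) sout)
 (rsupp_sub cU2 (@subsetUr _ _ _) sw) w0 (ltW e0) _.
rewrite w1 mulr1 scale1r; apply=> h.
have [sin Ein] := bint_fsum hsG muK cK (ain h).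
have -> : bco x%:g (fsum (fun=> x) gout h) = bco x%:g (bI mu x (fsum (fun=> x) (gin h))).
 by rewrite Ein (bco_fsum (fun=> x)) !big_map.
have cU3 : compact (K `|` invset M) by exact: compactU.
have := bint_weighted hsG muK (a := f y) (rho := fun s => d^-1 * J (s, h)) (e := e) hE
 (csec_sub cU3 (@subsetUl _ _ _) sin) (rsupp_sub cU3 (@subsetUr _ _ _) (rsuppZ d^-1 (sJ h))) _ (ltW e0) _.
rewrite (RintZ hsG muK _ (sJ h)) -/(w h); apply=> s; first by rewrite mulr_ge0 // invr_ge0 ltW.
rewrite -uu (bco_fsum (fun=> x)) !big_map.
set rho := _ * _.
have -> : \sum_(k <- ks) bco x%:g (Wf (fun s => bscale (u s)%:C (k s)) h s) =
  rho%:C *: \sum_(k <- ks) bco x%:g (fmul (f (ract y h)) (fmul (fstar (k s^-1%g)) (k (s^-1 * (inc h)^-1)%g))).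
 rewrite scaler_sumr; apply: (eq_Alls _ cks) => k [_ pk _].
 have q1 : bpr (f (ract y h)) = (x * inc h)%g by rewrite pf rpi_act.
 have q2 : bpr (fmul (fstar (k s^-1%g)) (k (s^-1 * (inc h)^-1)%g)) = (inc h)^-1%g.
  by bp.
 have q3 : bpr (fstar (k s^-1%g)) = s by rewrite bpr_fstar pk invgK.
 rewrite /Wf (bco_fmul x%:g (x := (x * inc h)%g%:g) (y := (inc h)^-1%g%:g)) //; last first.
  by bp.
 rewrite (bco_fmul x%:g q1 q2) -fmZr; last by gsimp.
 congr (fib_mul _ _ _).
 rewrite !(bco_fmul (inc h)^-1%g%:g (x := s%:g) (y := (s^-1 * (inc h)^-1)%g%:g)) ?bpr_fstar ?bpr_bscale ?pk ?invgK //.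
 rewrite !(bco_fstar (x := s^-1%g%:g)) ?bpr_bscale ?pk // !bco_bscale ?pk //.
 rewrite fsZ ?invgK // conjc_real fmZl ?mulVKg // ?fmZr ?mulVKg // ?scalerA -?rmorphM //.
rewrite -scalerBr rnZ rn_pos ?mulr_ge0 // mulrC.
have [->|r0] := eqVneq rho 0; first by rewrite !mulr0.
rewrite ler_wpM2r ?mulr_ge0 //; move: r0; rewrite mulf_eq0 negb_or => /andP[r1 r2].
have [_ h1] := hW s^-1%g h (u0W _ (uz _ r1)).1 (u0W _ (uz _ r2)).1.
exact: h1.
Qed.

End ApproximateIdentities.

(** * Positive forms on compactly supported sections *)

Local Notation zs := (fun t : G => bzero A t%:g).

Definition ssup (S : Type) (x : S -> A) (M : R) := forall t, bnorm (x t) <= M.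

(* positive semidefinite forms on the compactly supported sections, continuous
  for the inductive limit topology *)
Definition sform (s : (G -> A) -> (G -> A) -> C) : Prop :=
 [/\ forall k x x' y, cX x -> cX x' -> cX y -> s (lin id k x x') y = k * s x y + s x' y,
   forall x y, cX x -> cX y -> s x y = conjc (s y x),
   forall x, cX x -> 0 <= complex.Re (s x x) &
   forall K, compact K -> exists2 D : R, 0 <= D & forall x M, cX x -> fsupp x K -> 0 <= M ->
    ssup x M -> complex.Re (s x x) <= D * M ^+ 2].

Lemma zs_cs : cX zs.
Proof.
split; [exact: bzero_cont|by move=> t; exact: bpr_bzero|].
by exists set0 => [|t /nz_bzero//]; exact: compact0.
Qed.

Lemma zs_lin : zs = lin id (-1) zs zs.
Proof.
apply/funext => t; apply: (@bco_eq _ _ _ t%:g); rewrite ?bpr_bzero ?bpr_lin //.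
by rewrite bco_lin // bco_zero scaler0 addr0.
Qed.

Section OneForm.
Variable s : (G -> A) -> (G -> A) -> C.
Hypothesis hs : sform s.
Definition snorm (x : G -> A) : R := Num.sqrt (complex.Re (s x x)).

Let slinl k x x' y : cX x -> cX x' -> cX y -> s (lin id k x x') y = k * s x y + s x' y.
Proof. by case: hs => h _ _ _; exact: h. Qed.
Let sC x y : cX x -> cX y -> s x y = conjc (s y x). Proof. by case: hs => _ h _ _; exact: h. Qed.
Let s0 x : cX x -> 0 <= complex.Re (s x x). Proof. by case: hs => _ _ h _; exact: h. Qed.

Lemma sform_linr k x y y' : cX x -> cX y -> cX y' -> s x (lin id k y y') = conjc k * s x y + s x y'.
Proof.
move=> hx hy hy'; have hl : cX (lin id k y y') by exact: lin_cs.
by rewrite (sC hx hl) slinl // rmorphD rmorphM /= -(sC hx hy) -(sC hx hy').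
Qed.

Lemma snorm_sq x : cX x -> snorm x ^+ 2 = complex.Re (s x x).
Proof. by move=> /s0; exact: sqr_sqrtr. Qed.
Lemma snorm_ge0 x : 0 <= snorm x.
Proof. exact: sqrtr_ge0. Qed.
Lemma sform_lin2 k x y : cX x -> cX y -> complex.Re (s (lin id k x y) (lin id k x y)) =
 rn k ^+ 2 * complex.Re (s x x) + complex.Re (k * s x y) *+ 2 + complex.Re (s y y).
Proof.
move=> hx hy; have hl : cX (lin id k x y) by exact: lin_cs.
rewrite slinl // !sform_linr // mulrDr !ReD mulrA (mulrC k) conj_mulC Re_scale.
have -> : complex.Re (conjc k * s y x) = complex.Re (k * s x y).
 by rewrite (sC hy hx) -rmorphM /= Re_conj.
by rewrite mulr2n !addrA.
Qed.

Lemma sform_cs x y : cX x -> cX y -> rn (s x y) <= snorm x * snorm y.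
Proof.
move=> hx hy; apply: sqr_le; first by rewrite mulr_ge0 ?snorm_ge0.
rewrite exprMn !snorm_sq //; set N := rn _ ^+ 2.
have key t : 0 <= t ^+ 2 * N * complex.Re (s x x) - (t * N) *+ 2 + complex.Re (s y y).
 have hl : cX (lin id ((- t)%:C * conjc (s x y)) x y) by exact: lin_cs.
 have h := s0 hl.
 move: h; rewrite sform_lin2 // rnM rn_conj rn_real exprMn real_normK ?num_real // sqrrN -/N.
 by rewrite -mulrA conj_mulC -/N -rmorphM /= mulNr mulNrn.
by apply: quadratic_bound key => //; [exact: sqr_ge0|exact: s0].
Qed.

Lemma snorm_lin k x y : cX x -> cX y -> snorm (lin id k x y) <= rn k * snorm x + snorm y.
Proof.
move=> hx hy; apply: sqr_le; first by rewrite addr_ge0 ?mulr_ge0 ?snorm_ge0 ?rn_ge0.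
rewrite snorm_sq ?sform_lin2 //; last exact: lin_cs.
rewrite -!snorm_sq // sqrrD exprMn lerD2r lerD2l lerMn2r /=.
apply: le_trans (le_trans (ler_norm _) (rn_Re _)) _; rewrite rnM -mulrA.
by rewrite ler_wpM2l ?rn_ge0 // sform_cs.
Qed.

Lemma snorm_zs : snorm zs = 0.
Proof.
rewrite /snorm; have -> : s zs zs = 0; last by rewrite /= sqrtr0.
by rewrite {1}zs_lin slinl ?mulN1r ?addNr //; exact: zs_cs.
Qed.

Definition lsum (S : Type) (w : seq (R * S)) (T : S -> G -> A) : G -> A :=
 foldr (fun p acc => lin id p.1%:C (T p.2) acc) zs w.

Lemma bco_lsum (S : Type) (w : seq (R * S)) (T : S -> G -> A) (t : G) :
 bco t%:g (lsum w T t) = \sum_(p <- w) p.1%:C *: bco t%:g (T p.2 t).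
Proof.
elim: w => [|p w IH]; first by rewrite big_nil bco_zero.
by rewrite big_cons -IH /= bco_lin.
Qed.

Lemma lsum_cs (S : Type) (w : seq (R * S)) (T : S -> G -> A) : (forall r, cX (T r)) -> cX (lsum w T).
Proof. by move=> hT; elim: w => [|p w IH]; [exact: zs_cs|apply: lin_cs => //; exact: cvg_id]. Qed.
Lemma snorm_lsum (S : eqType) (w : seq (R * S)) (T : S -> G -> A) (B : R) : (forall r, cX (T r)) ->
 (forall p, p \in w -> 0 <= p.1 /\ snorm (T p.2) <= B) ->
 snorm (lsum w T) <= (\sum_(p <- w) p.1) * B.
Proof.
move=> hT; elim: w => [|p w IH] h; first by rewrite big_nil mul0r snorm_zs.
rewrite big_cons mulrDl; apply: le_trans (snorm_lin _ _ _) _ => //; first exact: lsum_cs.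
have [p0 pB] := h p (mem_head _ _).
apply: lerD; first by rewrite rn_pos // ler_wpM2l.
by apply: IH => q qw; apply: h; rewrite inE qw orbT.
Qed.

(** For Q = T' T the pointwise hypothesis keeps the support of every Q^n x inside that of x and its
    sup norm below c^n M, so one continuity constant [D] of the form serves for all n. Log-convexity
    removes [D], and s (T x) (T x) = d s x (Q x) gives the bound. *)
Lemma power_bound (T T' : (G -> A) -> (G -> A)) (x : G -> A) (d c : R) :
 (forall y, cX y -> cX (T y)) -> (forall y, cX y -> cX (T' y)) -> 0 < d -> 0 <= c ->
 (forall y z, cX y -> cX z -> s (T y) z = d%:C * s y (T' z)) -> cX x ->
 (forall y t, cX y -> bnorm (T' (T y) t) <= c * bnorm (y t)) ->
 snorm (T x) ^+ 2 <= d * c * snorm x ^+ 2.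
Proof.
move=> cT cT' d0 c0 adj hx bT.
pose Q y := T' (T y).
have cQ n : cX (iter n Q x) by elim: n => //= n IH; apply/cT'/cT.
have adjQ y z : cX y -> cX z -> s (Q y) z = s y (Q z).
 move=> hy hz; have dz : d%:C != 0 :> C by apply/eqP => /(congr1 (@complex.Re _)) /= dz; rewrite dz ltxx in d0.
 apply: (mulfI dz); rewrite -(adj y (T z)) ?(sC (cT _ hy)) ?(sC (cT' _ (cT _ hy))) ?adj //; try by apply: cT.
 by rewrite conj_scale.
have [cx px [K cK xK]] := hx.
have [M M0 hM] := bnorm_compact hE cx cK.
have sM : ssup x M.
 move=> t; have [Kt|nK] := pselect (K t); first exact: hM.
 rewrite (_ : x t = bzero A t%:g) ?bnorm_zero //.
 by apply: nzN => // /xK.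
have sQ n t : bnorm (iter n Q x t) <= c ^+ n * bnorm (x t).
 elim: n => [|n IH] /=; first by rewrite expr0 mul1r.
 apply: le_trans (bT _ _ (cQ n)) _; rewrite exprS -mulrA ler_wpM2l //.
have suppQ n : fsupp (iter n Q x) K.
 move=> t h; apply: xK => z; apply: h; apply/eqP; rewrite eq_le bnorm_ge0 andbT.
 by apply: le_trans (sQ n t) _; rewrite z mulr0.
have [_ _ _ /(_ K cK)[D D0 hD]] := hs.
pose a n := complex.Re (s (iter n Q x) (iter n Q x)).
have a1 : a 1%N <= c ^+ 2 * a 0%N.
 apply: (log_convex_growth (D := D * M ^+ 2)) => [n|n||n].
 - exact: s0.
 - rewrite /a [in X in X ^+ 2]/= adjQ //; last exact: (cQ n.+1).
  have h := sform_cs (cQ n) (cQ n.+2).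
  have h2 := le_trans (rn_Re _) h; rewrite -!snorm_sq // -exprMn -[X in X <= _]real_normK ?num_real //.
  by rewrite ler_pXn2r ?nnegrE ?mulr_ge0 ?snorm_ge0.
 - exact: sqr_ge0.
 apply: le_trans (hD _ (c ^+ n * M) (cQ n) (suppQ n) _ _) _.
 - by rewrite mulr_ge0 // exprn_ge0.
 - by move=> t; apply: le_trans (sQ n t) _; rewrite ler_wpM2l // exprn_ge0.
 - by rewrite exprMn -exprM mulnC exprM mulrCA mulrC.
rewrite snorm_sq ?adj //; [|exact: cT|exact: cT].
rewrite Re_scale -mulrA ler_wpM2l ?(ltW d0) //.
have h1 := le_trans (le_trans (ler_norm _) (rn_Re _)) (sform_cs hx (cQ 1%N)).
apply: le_trans h1 _; rewrite expr2 mulrA mulrC ler_wpM2r ?snorm_ge0 //.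
apply: sqr_le; first by rewrite mulr_ge0 ?snorm_ge0.
by rewrite exprMn !snorm_sq //; exact: (cQ 1%N).
Qed.

(** Riemann sums converge to the integral uniformly with supports in [M], hence in the seminorm of
    the form; the seminorm of each sum is bounded term by term. *)
Lemma riemann_bound (S : ptopologicalType) (m : borel_measure R S)
  (hS : hausdorff_space S) (mK : finite_on_compacts S m)
  (W : S * G -> A) (K : set S) (M : set G) (B : R) :
 continuous W -> (forall r t, bpr (W (r, t)) = t) -> compact K -> compact M ->
 (forall r t, nz (W (r, t)) -> K r /\ M t) -> cX (fun t => bint (E := A) m t (fun r => W (r, t))) ->
 (forall r, K r -> snorm (fun t => W (r, t)) <= B) -> 0 <= B ->
 snorm (fun t => bint (E := A) m t (fun r => W (r, t))) <= B * fine (m K).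
Proof.
move=> cW pW cK cM W0 cI hB B0; set I := fun t => _.
have cT r : cX (fun t => W (r, t)).
 by split=> //; [exact: cont_slice|exists M => // t /W0[]].
have [_ _ _ /(_ M cM)[D D0 hD]] := hs.
have m0 : 0 <= fine (m K) by exact: fine_ge0.
apply: (@le_small _ _ _ (Num.sqrt D * fine (m K))); first by rewrite mulr_ge0 ?sqrtr_ge0.
move=> e e0.
pose U := closeto (E := A) id W M e.
have nU r : nbhs r (U r).
 apply: (nbhs_closeto hE (pi := id)) => //.
have [w wP] : exists w, weights m K U w by exact: weights_exist.
have [w1 w2 _] := wP.
pose Sw := lsum w (fun r t => W (r, t)).
have cSw : cX Sw by exact: lsum_cs.
have supSw : fsupp Sw M.
 rewrite /Sw; elim: (w) => [t /nz_bzero//|p w' IH] t /=.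
 by move=> /(nz_lin (pi := id) (pW _ _) _)[|/W0[]//|/IH//]; case: w' {IH} => [|? ?]; exact: bpr_binj.
have supI : fsupp I M.
 by move=> t /(nz_bint hS mK (pW^~ t))[r /W0[]].
pose z := lin id (-1) Sw I.
have cz : cX z by exact: lin_cs.
have supz : fsupp z M.
 move=> t /(nz_lin (pi := id) _ _)[| |/supSw//|/supI//]; last exact: bpr_bint.
 by case: cSw => _ ->.
have zE t : M t -> bnorm (z t) <= e * fine (m K).
 move=> Mt; rewrite (@bnormE _ _ _ t%:g) ?bpr_lin // bco_lin // scaleN1r addrC -bdistE.
 have := bint_closeto hE hS mK (pi := id) cW pW wP cK (M := M) (e := e) (t := t) _ Mt _.
 rewrite /bsum !bdistE bcoE bco_lsum; apply=> //.
  by move=> r t' Mt' nK; apply: nzN => // /W0[].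
 by move=> r.
have sz : ssup z (e * fine (m K)).
 move=> t; have [/zE//|nM] := pselect (M t).
 rewrite (_ : z t = bzero A t%:g) ?bnorm_zero ?mulr_ge0 ?(ltW e0) //.
 by apply: nzN; [exact: bpr_lin|move=> /supz].
have IE : I = lin id 1 Sw z.
 apply/funext => t; apply: (@bco_eq _ _ _ t%:g); rewrite ?bpr_lin ?bpr_bint //.
 by rewrite bco_lin // bco_lin // scale1r scaleN1r addrA subrr add0r.
rewrite IE; apply: le_trans (snorm_lin _ cSw cz) _; rewrite rn_real normr1 mul1r.
apply: lerD.
 rewrite mulrC -w2; apply: snorm_lsum => // p /w1[p0 Kp]; split=> //; exact: hB.
apply: sqr_le; first by rewrite !mulr_ge0 ?sqrtr_ge0 ?(ltW e0).
have em : 0 <= e * fine (m K) by rewrite mulr_ge0 // ltW.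
rewrite snorm_sq //; apply: le_trans (hD _ _ cz supz em sz) _.
have -> : e * (Num.sqrt D * fine (m K)) = Num.sqrt D * (e * fine (m K)) by rewrite mulrCA.
by rewrite [leRHS]exprMn sqr_sqrtr.
Qed.

End OneForm.

Lemma bint_modular (L : topGroupType) (m : borel_measure R L) :
 hausdorff_space L -> lcpt L -> left_haar m ->
 exists Delta : L -> R, [/\ continuous Delta, forall h, 0 < Delta h &
  forall (x : gG) K f h, csec x K f ->
   bI m x (fun k => f (k * h)%g) = bscale (Delta h)%:C (bI m x f)].
Proof.
move=> hL lL hm; have [Delta [cD D0 hD]] := modular_function hL lL hm.
exists Delta; split=> // x K f h sf; have [c1 c2] := csec_bco hE sf.
by rewrite (@bscaleE _ _ _ x) ?bpr_bint // bco_bint /bint (hD _ K (fun k => bco x (f k)) h c1 c2).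
Qed.

Lemma compact_upper_bound (S : topologicalType) (D : S -> R) (K : set S) : compact K ->
 continuous D -> (forall s, 0 < D s) -> exists2 d : R, 0 <= d & forall s, K s -> D s <= d.
Proof.
move=> cK cD D0.
have cV : continuous (fun s => (D s)^-1 : R) by move=> s; apply: cvgV; [rewrite gt_eqF|exact: cD].
have [|d d0 hd] := pos_lower_bound cK cV; first by move=> s _; rewrite invr_gt0.
exists d^-1; first by rewrite invr_ge0 ltW.
by move=> s /hd h; rewrite -[D s]invrK lef_pV2 ?posrE // invr_gt0.
Qed.

Lemma ripp_bound (x z : G -> A) (K K' : set G) (M N : R) : cX x -> cX z -> fsupp x K -> fsupp z K' ->
 compact K -> 0 <= M -> 0 <= N -> ssup x M -> ssup z N ->
 ssup (ripp x z) (M * N * fine (mu (invset K))) /\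
 fsupp (ripp x z) [set h : T | mulset (invset K) K' (inc h)].
Proof.
move=> hx hz xK zK cK M0 N0 xM zN; have [cx px _] := hx; have [cz pz _] := hz; split.
 move=> h; apply: (bint_bound hE hsG muK (K := invset K)) => [|s _]; last first.
  apply: le_trans (bnorm_fmul _ _) _; rewrite bnorm_fstar.
  by apply: ler_pM; rewrite ?bnorm_ge0.
 sec.
 by move=> s /nz_fmul[/nz_fstar/xK h1 _]; rewrite -[s]invgK; exact: invsetI.
move=> h /(ripp_supp hx hz)[s [/xK h1 /zK h2]] /=.
by fac ((s^-1)^-1)%g (s^-1 * inc h)%g.
Qed.

Lemma lipp_bound (x z : G -> A) (K K' : set G) (M N : R) : cX x -> cX z -> fsupp x K -> fsupp z K' ->
 compact K' -> 0 <= M -> 0 <= N -> ssup x M -> ssup z N ->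
 ssup (lipp x z) (M * N * fine (nu [set h : T | mulset (invset K') K' (inc h)])) /\
 fsupp (lipp x z) (mulset K (invset K') `*` (coset_of H @` K')).
Proof.
move=> hx hz xK zK cK M0 N0 xM zN; have [cx px _] := hx; have [cz pz _] := hz.
have sup : fsupp (lipp x z) (mulset K (invset K') `*` (coset_of H @` K')).
 move=> [s q] /(lip2_supp hx hz)[h [/xK h1 /zK h2]] /=; split.
  fac (s * coset_repr q * inc h)%g ((coset_repr q * inc h)^-1)%g.
 by exists (coset_repr q * inc h)%g => //; rewrite coset_inv coset_reprK.
split=> // -[s q]; set B := _ * _.
have B0 : 0 <= B by rewrite !mulr_ge0 // fine_ge0.
have [[_ [t Kt /= tq]]|nS] := pselect ((mulset K (invset K') `*` (coset_of H @` K')) (s, q)); last first.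
 rewrite (_ : lipp _ _ _ = bzero A s%:g) ?bnorm_zero //.
 by apply: nzN => [|/sup//]; exact: bpr_bint.
rewrite -tq lippE //; apply: (bint_bound hE hsH nuK) => [|h _]; last first.
 apply: le_trans (bnorm_fmul _ _) _; rewrite bnorm_fstar.
 by apply: ler_pM; rewrite ?bnorm_ge0.
sec.
move=> h /nz_fmul[_ /nz_fstar/zK h1] /=.
by fac (t^-1)%g (t * inc h)%g.
Qed.

(* functionals having the properties of vector states of representations *)
Definition pfun (Y : topologicalType) (pi : Y -> G) (conv : (Y -> A) -> (Y -> A) -> Y -> A)
  (st : (Y -> A) -> Y -> A) (phi : (Y -> A) -> C) : Prop :=
 [/\ forall k f g, cs pi f -> cs pi g -> phi (lin pi k f g) = k * phi f + phi g,
   forall f, cs pi f -> phi (st f) = conjc (phi f),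
   forall f, cs pi f -> 0 <= complex.Re (phi (conv (st f) f)) &
   forall K, compact K -> exists2 D : R, 0 <= D & forall f M, cs pi f -> fsupp f K -> 0 <= M ->
    ssup f M -> rn (phi f) <= D * M].

Local Notation pfunB := (pfun inc (rconv (Y := sr)) stB).
Local Notation pfunA := (pfun fst (lconv (Y := tl)) stA).

Lemma cs_bound (Y : topologicalType) (pi : Y -> G) (x : Y -> A) : cs pi x -> exists2 M : R, 0 <= M & ssup x M.
Proof.
move=> [cx px [K cK xK]]; have [M M0 hM] := bnorm_compact hE cx cK.
exists M => // t; have [Kt|nK] := pselect (K t); first exact: hM.
rewrite (_ : x t = bzero A (pi t)%:g) ?bnorm_zero //.
by apply: nzN => // /xK.
Qed.

Lemma ssup_lin (Y : Type) (pi : Y -> G) (S f : Y -> A) (e : R) : (forall y, bpr (S y) = pi y) ->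
 (forall y, bpr (f y) = pi y) ->
 (forall y, rn (bco (pi y)%:g (S y) - bco (pi y)%:g (f y)) <= e) -> ssup (lin pi (-1) S f) e.
Proof.
move=> pS pf h y; rewrite (@bnormE _ _ _ (pi y)%:g) ?bpr_lin // bco_lin //.
by rewrite scaleN1r addrC rn_distC.
Qed.

Lemma fsupp_lin (Y : Type) (pi : Y -> G) k (S f : Y -> A) (K : set Y) : (forall y, bpr (S y) = pi y) ->
 (forall y, bpr (f y) = pi y) -> fsupp S K -> fsupp f K -> fsupp (lin pi k S f) K.
Proof. by move=> pS pf SK fK y /(nz_lin (pS y) (pf y))[/SK|/fK]. Qed.
Lemma fsum_form (phi : (G -> A) -> C) (gs : seq (G -> A)) :
 (forall k x x', cX x -> cX x' -> phi (lin id k x x') = k * phi x + phi x') -> Alls cX gs ->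
 phi (fsum id gs) = \sum_(g <- gs) phi g.
Proof.
move=> lphi; have z0 : phi zs = 0.
 by rewrite {1}zs_lin lphi ?mulN1r ?addNr //; exact: zs_cs.
elim: gs => [|g gs IH] /=; first by rewrite big_nil.
move=> [cg cgs]; rewrite big_cons -IH // -[phi g]mul1r -lphi //.
by apply: fsum_cs => // t; exact: cvg_id.
Qed.

Lemma Re_sum_ge0 (I : Type) (P : I -> Prop) (s : seq I) (f : I -> C) : (forall i, P i -> 0 <= complex.Re (f i)) ->
 Alls P s -> 0 <= complex.Re (\sum_(i <- s) f i).
Proof.
move=> f0; elim: s => [|i s IH] /=; first by rewrite big_nil.
by move=> [/f0 h /IH h2]; rewrite big_cons ReD addr_ge0.
Qed.

Lemma approx_ge0 (a : C) (D : R) : 0 <= D ->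
 (forall e, 0 < e -> exists2 b : C, 0 <= complex.Re b & rn (b - a) <= D * e) -> 0 <= complex.Re a.
Proof.
move=> D0 h; apply: (@le_small _ _ _ D) => // e /h[b b0 hb].
have h1 := le_trans (rn_Re _) hb; move: h1; rewrite ler_norml ReD => /andP[_].
by case: (a) b0 => [u v] /=; lra.
Qed.

(** * Forms obtained from functionals, and crude bounds for the two actions *)

Section LeftForm.
Variable phi : (T -> A) -> C.
Hypothesis hphi : pfunB phi.
Local Notation s := (fun x y => phi (ripp y x)).

Let phil k g g' : cB g -> cB g' -> phi (lin (inc) k g g') = k * phi g + phi g'.
Proof. by case: hphi => h _ _ _; exact: h. Qed.
Let cR (x y : G -> A) : cX x -> cX y -> cB (ripp x y). Proof. exact: ripp_cs. Qed.

Let sl x : cX x -> forall k z z', cX z -> cX z' ->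
 phi (ripp x (lin id k z z')) = k * phi (ripp x z) + phi (ripp x z').
Proof. by move=> hx k z z' hz hz'; rewrite rip_linr // phil //; exact: cR. Qed.
Lemma rip_pos x : cX x -> 0 <= complex.Re (phi (ripp x x)).
Proof.
move=> hx; have [cx px [K cK xK]] := hx; have [M M0 xM] := cs_bound hx.
have [L [cL xL hL]] := approx_left (Y := gl) hx.
have cN : compact [set h : T | mulset (invset K) L (inc h)].
 by cpt.
have [_ _ ppos /(_ _ cN)[D D0 hD]] := hphi.
apply: (@approx_ge0 _ (D * (M * fine (mu (invset K))))) => [|e e0].
 by rewrite !mulr_ge0 // fine_ge0.
have [phis [cphis [supS hS]]] := hL e e0.
set gs := [seq _ | _ <- _] in supS hS; pose S := fsum id gs.
have cgs : Alls cX gs.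
 by apply: Alls_map cphis => p hp; apply: (lconv_cs (Y := gl)) => //; exact: lipp_cs.
have cS : cX S by apply: fsum_cs => // t; exact: cvg_id.
have pS y : bpr (S y) = y by case: cS.
exists (phi (ripp x S)).
 rewrite (fsum_form (phi := fun z => phi (ripp x z)) (sl hx) cgs) big_map.
 apply: Re_sum_ge0 cphis => p hp.
 (* The summand is <x, p> <p, x>, a product of the adjoint of <p, x> with <p, x>, on which [phi] is
    nonnegative. *)
 rewrite (lip_rip hp hp hx) (rip_rconv hx hp (cR hp hx)).
 have -> : ripp x p = stB (ripp p x) by apply/funext => h; rewrite /stB rip_star.
 exact/ppos/cR.
have cz : cX (lin id (-1) S x) by exact: lin_cs.
have -> : phi (ripp x S) - phi (ripp x x) = - phi (ripp x (lin id (-1) S x)).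
 by rewrite sl // mulN1r opprD opprK.
have [b1 b2] := ripp_bound hx cz xK (fsupp_lin (k := -1) pS px supS xL) cK M0 (ltW e0) xM (ssup_lin pS px hS).
rewrite rnN; apply: le_trans (hD _ _ (cR hx cz) b2 _ b1) _.
 by rewrite !mulr_ge0 ?fine_ge0 // ltW.
by rewrite -!mulrA [e * _]mulrC.
Qed.

Lemma sform_left : sform s.
Proof.
split=> [k x x' y hx hx' hy|x y hx hy|x|K cK].
- exact: sl.
- have -> : ripp y x = stB (ripp x y) by apply/funext => h; rewrite /stB rip_star.
 by case: hphi => _ h _ _; rewrite h //; exact: cR.
- exact: rip_pos.
have cN : compact [set h : T | mulset (invset K) K (inc h)].
 by cpt.
have [_ _ _ /(_ _ cN)[D D0 hD]] := hphi.
exists (D * fine (mu (invset K))); first by rewrite mulr_ge0 // fine_ge0.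
move=> x M hx xK M0 xM; have [b1 b2] := ripp_bound hx hx xK xK cK M0 M0 xM xM.
apply: le_trans (le_trans (ler_norm _) (rn_Re _)) _.
apply: le_trans (hD _ _ (cR hx hx) b2 _ b1) _; first by rewrite !mulr_ge0 // fine_ge0.
rewrite le_eqVlt; apply/orP; left; apply/eqP; ring.
Qed.

(** [lconv F] is the integral over [r] of these translations. [ltrans'] is the adjoint for the form
    up to the modular function at [r], which comes from a right translation in the integral defining
    the inner product. *)
Definition ltrans (F : G * GH -> A) (r : G) (x : G -> A) : G -> A := fun t =>
 fmul (F (r, coset_of H (r^-1 * t)%g)) (x (r^-1 * t)%g).
Definition ltrans' (F : G * GH -> A) (r : G) (y : G -> A) : G -> A := fun t =>
 fmul (fstar (F (r, coset_of H t))) (y (r * t)%g).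

Lemma ltrans_cs F r x : cA F -> cX x -> cX (ltrans F r x).
Proof.
move=> [cF pF _] [cx px [K cK xK]]; split; first by rewrite /ltrans; ctx.
 by bp.
exists (mulset [set r] K); first by cpt.
move=> t /nz_fmul[_ /xK h].
by fac r (r^-1 * t)%g.
Qed.

Lemma ltrans'_cs F r x : cA F -> cX x -> cX (ltrans' F r x).
Proof.
move=> [cF pF _] [cx px [K cK xK]]; split; first by rewrite /ltrans'; ctx.
 by bp.
exists (mulset [set r^-1%g] K); first by cpt.
move=> t /nz_fmul[_ /xK h].
by fac (r^-1)%g (r * t)%g.
Qed.

Lemma phi_bscale g k : cB g -> phi (fun h => bscale k (g h)) = k * phi g.
Proof.
move=> hg; have [cg pg _] := hg.
have hz : cB (fun h => bzero A (inc h)%:g).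
 split; [apply: (cont_comp (@subg_inc_cont _ _)); exact: bzero_cont|by move=> h; exact: bpr_bzero|].
 by exists set0 => [|h /nz_bzero//]; exact: compact0.
have z0 : phi (fun h => bzero A (inc h)%:g) = 0.
 have {1}-> : (fun h : T => bzero A (inc h)%:g) =
   lin (inc) (-1) (fun h => bzero A (inc h)%:g) (fun h => bzero A (inc h)%:g).
  apply/funext => h; apply: (@bco_eq _ _ _ (inc h)%:g); rewrite ?bpr_bzero ?bpr_lin //.
  by rewrite bco_lin // bco_zero scaler0 addr0.
 by rewrite phil // mulN1r addNr.
rewrite -[RHS]addr0 -z0 -phil //; congr phi; apply/funext => h.
apply: (@bco_eq _ _ _ (inc h)%:g); rewrite ?bpr_bscale ?bpr_lin ?pg //.
by rewrite bco_lin // bco_zero addr0 bco_bscale ?pg.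
Qed.

(** Only the sup norm and the support of F enter, as continuity in the inductive limit topology
    asks. A translation followed by its adjoint multiplies pointwise by a value of F^* F, of norm at
    most M^2, so [power_bound] applies; [d] bounds the modular function on the support. *)
Lemma crude_left (K : set (G * GH)) : compact K -> exists2 B : R, 0 <= B &
 forall F M x, cA F -> fsupp F K -> 0 <= M -> ssup F M -> cX x ->
  snorm s (lconv (Y := gl) F x) <= B * M * snorm s x.
Proof.
move=> cK; have cK1 := fst_compact cK.
have [Delta [cD D0 hD]] := bint_modular hsG lG hmu.
have [d d0 hd] := compact_upper_bound cK1 cD D0.
exists (Num.sqrt d * fine (mu (fst @` K))); first by rewrite mulr_ge0 ?sqrtr_ge0 ?fine_ge0.
move=> F M x hF FK M0 FM hx; have [cF pF _] := hF; have [cx px [Kx cKx xK]] := hx.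
have hs := sform_left.
rewrite (_ : _ * M * snorm s x = Num.sqrt d * M * snorm s x * fine (mu (fst @` K))); last by ring.
have := riemann_bound hs hsG muK (B := Num.sqrt d * M * snorm s x) (W := fun q : G * G => ltrans F q.1 x q.2) (K := fst @` K) (M := mulset (fst @` K) Kx); apply=> //.
- by rewrite /ltrans; ctx.
- by bp.
- exact: mulset_compact.
- move=> r t /= /nz_fmul[/FK h1 /xK h2]; have Kr : (fst @` K) r by exists (r, coset_of H (r^-1 * t)%g).
 by split=> //; fac r (r^-1 * t)%g.
- exact: (lconv_cs (Y := gl)).
- move=> r Kr; apply: sqr_le; first by rewrite !mulr_ge0 ?sqrtr_ge0.
 apply: le_trans (power_bound hs (T := ltrans F r) (T' := ltrans' F r) (d := Delta r) (c := M ^+ 2) _ _ _ _ _ hx _) _ => //.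
 + by move=> y; exact: ltrans_cs.
 + by move=> y; exact: ltrans'_cs.
 + exact: sqr_ge0.
 + move=> y z hy hz; rewrite -phi_bscale; last by apply: cR => //; exact: ltrans'_cs.
  congr phi; apply/funext => h; have [cy py _] := hy; have [cz pz _] := hz.
  have [N cN sN] := ripp_int h (ltrans'_cs r hF hz) hy.
  rewrite /ripp -(hD _ _ _ r sN); apply: eq_bint => u; rewrite /ltrans /ltrans' fstarM fstarK.
  rewrite -fmulA (_ : (r^-1 * (u^-1 * inc h))%g = ((u * r)^-1 * inc h)%g); last by gsimp.
  by rewrite coset_inv (_ : (r * (u * r)^-1)%g = u^-1%g) //; gsimp.
 + move=> y t hy; rewrite /ltrans' /ltrans; apply: le_trans (bnorm_fmul _ _) _; rewrite bnorm_fstar.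
  rewrite expr2 -mulrA; apply: ler_pM; rewrite ?bnorm_ge0 // ?FM //.
  apply: le_trans (bnorm_fmul _ _) _; rewrite mulKg ler_wpM2r ?bnorm_ge0 //.
 by rewrite !exprMn (@sqr_sqrtr _ d) // ler_wpM2r ?sqr_ge0 // ler_wpM2r ?sqr_ge0 // hd.
by rewrite !mulr_ge0 ?sqrtr_ge0.
Qed.

End LeftForm.

Section RightForm.
Variable phi : (G * GH -> A) -> C.
Hypothesis hphi : pfunA phi.
Local Notation s := (fun x y => phi (lipp x y)).

Let phil k F F' : cA F -> cA F' -> phi (lin fst k F F') = k * phi F + phi F'.
Proof. by case: hphi => h _ _ _; exact: h. Qed.
Let cL (x y : G -> A) : cX x -> cX y -> cA (lipp x y). Proof. exact: lipp_cs. Qed.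

Let sl x : cX x -> forall k z z', cX z -> cX z' ->
 phi (lipp (lin id k z z') x) = k * phi (lipp z x) + phi (lipp z' x).
Proof. by move=> hx k z z' hz hz'; rewrite lip_linl // phil //; exact: cL. Qed.
Let lipE (x y : G -> A) : cX x -> cX y -> lipp y x = stA (lipp x y).
Proof. by move=> hx hy; apply/funext => -[u q]; rewrite /stA lip_star. Qed.
Lemma lip_pos x : cX x -> 0 <= complex.Re (phi (lipp x x)).
Proof.
move=> hx; have [cx px [K cK xK]] := hx; have [M M0 xM] := cs_bound hx.
have [L [cL' xL hL]] := approx_right (Y := gr) hx.
have cN : compact (mulset L (invset K) `*` (coset_of H @` K)).
 apply: compact_setX; last exact: coset_compact.
 by cpt.
have [_ _ ppos /(_ _ cN)[D D0 hD]] := hphi.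
set c := fine (nu [set h : T | mulset (invset K) K (inc h)]).
have c0 : 0 <= c by exact: fine_ge0.
apply: (@approx_ge0 _ (D * (M * c))) => [|e e0]; first by rewrite !mulr_ge0.
have [psis [cpsis [supS hS]]] := hL e e0.
set gs := [seq _ | _ <- _] in supS hS; pose S := fsum id gs.
have cgs : Alls cX gs.
 by apply: Alls_map cpsis => p hp; apply: (rconv_cs (Y := gr)) => //; exact: ripp_cs.
have cS : cX S by apply: fsum_cs => // t; exact: cvg_id.
have pS y : bpr (S y) = y by case: cS.
exists (phi (lipp S x)).
 rewrite (fsum_form (phi := fun z => phi (lipp z x)) (sl hx) cgs) big_map.
 apply: Re_sum_ge0 cpsis => p hp.
 (* The mirror identity: x <p, p> = <x, p> p, so the summand is <x, p> <p, x>, whose first factor is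
    the adjoint of the second. *)
 rewrite -(lip_rip hx hp hp) (lip_lconv (cL hx hp) hp hx).
 by rewrite (lipE hp hx); exact/ppos/cL.
have cz : cX (lin id (-1) S x) by exact: lin_cs.
have -> : phi (lipp S x) - phi (lipp x x) = - phi (lipp (lin id (-1) S x) x).
 by rewrite sl // mulN1r opprD opprK.
have [b1 b2] := lipp_bound cz hx (fsupp_lin (k := -1) pS px supS xL) xK cK (ltW e0) M0 (ssup_lin pS px hS) xM.
rewrite rnN; apply: le_trans (hD _ _ (cL cz hx) b2 _ b1) _; first by rewrite !mulr_ge0 // ltW.
rewrite le_eqVlt; apply/orP; left; apply/eqP; rewrite /c; ring.
Qed.

Lemma sform_right : sform s.
Proof.
split=> [k x x' y hx hx' hy|x y hx hy|x|K cK].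
- exact: sl.
- by rewrite (lipE hy hx); case: hphi => _ h _ _; rewrite h //; exact: cL.
- exact: lip_pos.
have cN : compact (mulset K (invset K) `*` (coset_of H @` K)).
 apply: compact_setX; last exact: coset_compact.
 by cpt.
have [_ _ _ /(_ _ cN)[D D0 hD]] := hphi.
exists (D * fine (nu [set h : T | mulset (invset K) K (inc h)])); first by rewrite mulr_ge0 // fine_ge0.
move=> x M hx xK M0 xM; have [b1 b2] := lipp_bound hx hx xK xK cK M0 M0 xM xM.
apply: le_trans (le_trans (ler_norm _) (rn_Re _)) _.
apply: le_trans (hD _ _ (cL hx hx) b2 _ b1) _; first by rewrite !mulr_ge0 // fine_ge0.
rewrite le_eqVlt; apply/orP; left; apply/eqP; ring.
Qed.

Definition rtrans (g : T -> A) (h : T) (x : G -> A) : G -> A := fun t =>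
 fmul (x (t * inc h)%g) (g h^-1%g).
Definition rtrans' (g : T -> A) (h : T) (y : G -> A) : G -> A := fun t =>
 fmul (y (t * (inc h)^-1)%g) (fstar (g h^-1%g)).

Lemma rtrans_cs g h x : cB g -> cX x -> cX (rtrans g h x).
Proof.
move=> [cg pg _] [cx px [K cK xK]]; split; first by rewrite /rtrans; ctx.
 by move=> t; rewrite bpr_fmul pg px -mulgA mulgV mulg1.
exists (mulset K [set (inc h)^-1%g]); first by cpt.
move=> t /nz_fmul[/xK k _].
by fac (t * inc h)%g ((inc h)^-1)%g.
Qed.

Lemma rtrans'_cs g h x : cB g -> cX x -> cX (rtrans' g h x).
Proof.
move=> [cg pg _] [cx px [K cK xK]]; split; first by rewrite /rtrans'; ctx.
 by bp.
exists (mulset K [set (inc h)]); first by cpt.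
move=> t /nz_fmul[/xK k _].
by fac (t * (inc h)^-1)%g (inc h)%g.
Qed.

Lemma phi_bscaleA F k : cA F -> phi (fun z => bscale k (F z)) = k * phi F.
Proof.
move=> hF; have [cF pF _] := hF.
have hz : cA (fun z : G * GH => bzero A z.1%:g).
 split; [apply: (cont_comp (@cont_fst _ _)); exact: bzero_cont|by move=> h; exact: bpr_bzero|].
 by exists set0 => [|h /nz_bzero//]; exact: compact0.
have z0 : phi (fun z : G * GH => bzero A z.1%:g) = 0.
 have {1}-> : (fun z : G * GH => bzero A z.1%:g) =
   lin fst (-1) (fun z : G * GH => bzero A z.1%:g) (fun z : G * GH => bzero A z.1%:g).
  apply/funext => z; apply: (@bco_eq _ _ _ z.1%:g); rewrite ?bpr_bzero ?bpr_lin //.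
  by rewrite bco_lin // bco_zero scaler0 addr0.
 by rewrite phil // mulN1r addNr.
rewrite -[RHS]addr0 -z0 -phil //; congr phi; apply/funext => z.
apply: (@bco_eq _ _ _ z.1%:g); rewrite ?bpr_bscale ?bpr_lin ?pF //.
by rewrite bco_lin // bco_zero addr0 bco_bscale ?pF.
Qed.

Lemma crude_right (K : set T) : compact K -> exists2 B : R, 0 <= B &
 forall g M x, cB g -> fsupp g K -> 0 <= M -> ssup g M -> cX x ->
  snorm s (rconv (Y := gr) x g) <= B * M * snorm s x.
Proof.
move=> cK; have cK1 : compact (invset K) by exact: invset_compact.
have [Delta [cD D0 hD]] := bint_modular hsH (subg_lcpt lG) hnu.
have [d d0 hd] := compact_upper_bound cK1 cD D0.
exists (Num.sqrt d * fine (nu (invset K))); first by rewrite mulr_ge0 ?sqrtr_ge0 ?fine_ge0.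
move=> g M x hg gK M0 gM hx; have [cg pg _] := hg; have [cx px [Kx cKx xK]] := hx.
have hs := sform_right.
rewrite (_ : _ * M * snorm s x = Num.sqrt d * M * snorm s x * fine (nu (invset K))); last by ring.
have := riemann_bound hs hsH nuK (B := Num.sqrt d * M * snorm s x) (W := fun q : T * G => rtrans g q.1 x q.2)
 (K := invset K) (M := mulset Kx (invset (inc @` invset K))); apply=> //.
- by rewrite /rtrans; ctx.
- by move=> h t /=; rewrite bpr_fmul pg px -mulgA mulgV mulg1.
- apply: mulset_compact => //; apply: invset_compact.
 by apply: continuous_compact => //; apply: continuous_subspaceT; exact: subg_inc_cont.
- move=> h t /= /nz_fmul[/xK h2 /gK h1]; have Kh : invset K h by rewrite -[h]invgK; exact: invsetI.
 split=> //; rewrite (_ : t = (t * inc h) * (inc h)^-1)%g; last by gsimp.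
 by apply: mulsetI => //; apply: invsetI; exists h.
- exact: (rconv_cs (Y := gr)).
- move=> h Kh; apply: sqr_le; first by rewrite !mulr_ge0 ?sqrtr_ge0.
 apply: le_trans (power_bound hs (T := rtrans g h) (T' := rtrans' g h) (d := Delta h) (c := M ^+ 2) _ _ _ _ _ hx _) _ => //.
 + by move=> y; exact: rtrans_cs.
 + by move=> y; exact: rtrans'_cs.
 + exact: sqr_ge0.
 + move=> y z hy hz; rewrite -phi_bscaleA; last by apply: cL => //; exact: rtrans'_cs.
  congr phi; apply/funext => q; have [cy py _] := hy; have [cz pz _] := hz.
  have [N cN sN] := lip2_int y (rtrans' g h z) q.1 (coset_repr q.2) hy (rtrans'_cs h hg hz).
  rewrite /lipp /lip2 -(hD _ _ _ h sN); apply: eq_bint => k.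
  rewrite /rtrans /rtrans' fstarM fstarK -fmulA.
  rewrite (_ : inc (k * h)%g = (inc k * inc h)%g) // -!mulgA mulgV mulg1 //.
 + move=> y t hy; rewrite /rtrans' /rtrans mulrC; apply: le_trans (bnorm_fmul _ _) _; rewrite bnorm_fstar.
  rewrite expr2 mulrA; apply: ler_pM; rewrite ?bnorm_ge0 // ?gM //.
  apply: le_trans (bnorm_fmul _ _) _; rewrite -mulgA mulVg mulg1 ler_wpM2l ?bnorm_ge0 //.
 by rewrite !exprMn (@sqr_sqrtr _ d) // ler_wpM2r ?sqr_ge0 // ler_wpM2r ?sqr_ge0 // hd.
by rewrite !mulr_ge0 ?sqrtr_ge0.
Qed.

End RightForm.

(** * Universal norms through models of the section algebras *)

(* The sections of both Fell bundles correspond, through [up], to the functions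
  with values in the given bundle that lie over [pi]. *)
Section SectionModel.

(** A fixed compact support makes the space of sections complete for the sup norm; this completeness
    is what the nested balls in [model_cont] rely on. *)
Lemma cs_limit (Y : topologicalType) (pi : Y -> G) (K : set Y) (u : nat -> Y -> A) :
 compact K -> (forall n, cs pi (u n) /\ fsupp (u n) K) ->
 (forall e : R, 0 < e -> exists N, forall i j, (N <= i)%N -> (N <= j)%N -> forall y,
  rn (bco (pi y)%:g (u i y) - bco (pi y)%:g (u j y)) <= e) ->
 exists f, [/\ cs pi f, fsupp f K & forall e : R, 0 < e -> exists N, forall i, (N <= i)%N -> forall y,
  rn (bco (pi y)%:g (u i y) - bco (pi y)%:g (f y)) <= e].
Proof.
move=> cK hu cau.
have lim y : exists l, nconv (@rn R (fib A (pi y)%:g)) (fun n => bco (pi y)%:g (u n y)) l.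
 apply: rn_complete => e e0; have [N hN] := cau _ (halfR_gt0 e0); exists N => i j hi hj.
 by apply: le_lt_trans (hN i j hi hj y) _; lra.
pose l y := xget 0 [set l | nconv (@rn R (fib A (pi y)%:g)) (fun n => bco (pi y)%:g (u n y)) l].
have lP y : nconv (@rn R _) (fun n => bco (pi y)%:g (u n y)) (l y) by have [v hv] := lim y; exact: (xgetPex 0 (ex_intro _ v hv)).
pose f y : A := binj (l y).
have pf y : bpr (f y) = pi y by exact: bpr_binj.
have unif (e : R) : 0 < e -> exists N, forall i, (N <= i)%N -> forall y,
  rn (bco (pi y)%:g (u i y) - bco (pi y)%:g (f y)) <= e.
 move=> e0; have [N hN] := cau _ (halfR_gt0 e0); exists N => i hi y.
 have [M hM] := lP y _ (halfR_gt0 e0); rewrite /f bcoE.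
 apply: le_trans (rn_tri _ (bco (pi y)%:g (u (maxn N M) y)) _) _.
 have h1 := hN i (maxn N M) hi (leq_maxl _ _) y; have h2 := hM _ (leq_maxr N M); lra.
have sf : fsupp f K.
 move=> y; apply: contraPP => nK; apply; have [hs _] := hu 0%N.
 suff -> : f y = bzero A (pi y)%:g by exact: bnorm_zero.
 congr binj; apply: rn_eq0; apply/eqP; rewrite eq_le rn_ge0 andbT.
 apply/ler_addgt0Pl => e e0; have [N hN] := lP y _ e0; have := hN N (leqnn _).
 have [[_ pu _] uK] := hu N; rewrite (@nzN (u N y) (pi y)) //; last by move=> /uK.
 by rewrite bco_zero sub0r rnN addr0 => /ltW.
exists f; split=> //; split=> //; last by exists K.
move=> y0; apply: (bundle_cvg_unif hE) => e e0; have [N hN] := unif _ (halfR_gt0 e0).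
have [[cu pu _] _] := hu N; exists (u N); split; [exact: cu|by move=> t; rewrite pu pf|].
by near=> t; rewrite pf bdistC; apply: le_lt_trans (hN N (leqnn _) t) _; lra.
Unshelve. all: by end_near. Qed.

Record section_model (GG : groupoid) (E : fell_ops R GG) (lam : measure_system R GG) (pi : GG -> G)
  (conv : (GG -> A) -> (GG -> A) -> GG -> A) (st : (GG -> A) -> GG -> A)
  (up : (GG -> A) -> (GG -> E)) : Prop := SectionModel {
 sm_hX : hausdorff_space GG;
 sm_pi_cont : continuous pi;
 sm_conv_cs : forall f g, cs pi f -> cs pi g -> cs pi (conv f g);
 sm_st_cs : forall f, cs pi f -> cs pi (st f);
 sm_stK : forall f, st (st f) = f;
 sm_st_lin : forall k f g, cs pi f -> cs pi g -> st (lin pi k f g) = lin pi (conjc k) (st f) (st g);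
 sm_Gc : forall f, cs pi f -> Gammac E (up f);
 sm_surj : forall F, Gammac E F -> exists2 f, cs pi f & F = up f;
 sm_inj : forall f g, cs pi f -> cs pi g -> up f = up g -> f = g;
 sm_lin : forall k f g, cs pi f -> cs pi g -> up (lin pi k f g) = slin k (up f) (up g);
 sm_conv : forall f g, cs pi f -> cs pi g -> up (conv f g) = sconv lam (up f) (up g);
 sm_st : forall f, cs pi f -> up (st f) = sstar (up f);
 sm_norm : forall f x, cs pi f -> bnorm (up f x) = bnorm (f x)
}.

Variables (GG : groupoid) (E : fell_ops R GG) (lam : measure_system R GG) (CE : fell_cstar E lam).
Variables (pi : GG -> G) (conv : (GG -> A) -> (GG -> A) -> GG -> A) (st : (GG -> A) -> GG -> A).
Variable up : (GG -> A) -> (GG -> E).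
Hypothesis model : section_model lam pi conv st up.
Local Notation Gc := (Gammac E).
Local Notation cp := (cs pi).
Let hX := sm_hX model.
Let pi_cont := sm_pi_cont model.
Let conv_cs := sm_conv_cs model.
Let st_cs := sm_st_cs model.
Let stK := sm_stK model.
Let st_lin := sm_st_lin model.
Let up_Gc := sm_Gc model.
Let up_surj := sm_surj model.
Let up_inj := sm_inj model.
Let up_lin := sm_lin model.
Let up_conv := sm_conv model.
Let up_st := sm_st model.
Let up_norm := sm_norm model.
Local Notation io f := (fcs_iota CE (up f)).

Let hlin k F F' : Gc F -> Gc F' -> Gc (slin k F F').
Proof. by move=> /up_surj[f hf ->] /up_surj[g hg ->]; rewrite -up_lin //; apply: up_Gc; exact: lin_cs. Qed.
Let hconv F F' : Gc F -> Gc F' -> Gc (sconv lam F F').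
Proof. by move=> /up_surj[f hf ->] /up_surj[g hg ->]; rewrite -up_conv //; apply: up_Gc; exact: conv_cs. Qed.
Let hstar F : Gc F -> Gc (sstar F).
Proof. by move=> /up_surj[f hf ->]; rewrite -up_st //; apply: up_Gc; exact: st_cs. Qed.
Let bounded F : Gc F -> exists2 M : R, 0 <= M & forall x, bnorm (F x) <= M.
Proof. by move=> /up_surj[f hf ->]; have [M M0 hM] := cs_bound hf; exists M => // x; rewrite up_norm. Qed.
Let up_supp f (K : set GG) : cp f -> bsupp (up f) `<=` K -> fsupp f K.
Proof.
move=> hf fK x; apply: contraPP => nK; apply; rewrite -up_norm //.
by rewrite (bsuppP (fun h => nK (fK _ h))) bnorm_zero.
Qed.

Let up_supp' f (K : set GG) : compact K -> cp f -> fsupp f K -> bsupp (up f) `<=` K.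
Proof.
move=> cK hf fK; apply: (bsupp_sub hX cK) => x nK; have [sf _ _] := up_Gc hf.
by apply: bnorm_eq0 => //; rewrite up_norm //; apply: contrapT => /fK.
Qed.

Lemma model_lin k f g : cp f -> cp g -> io (lin pi k f g) = k *: io f + io g.
Proof. by move=> hf hg; rewrite up_lin // io_lin //; exact: up_Gc. Qed.
Lemma model_conv f g : cp f -> cp g -> io (conv f g) = cmul (io f) (io g).
Proof. by move=> hf hg; rewrite up_conv // io_conv //; exact: up_Gc. Qed.
Lemma model_st f : cp f -> io (st f) = cstar (io f).
Proof. by move=> hf; rewrite up_st // io_star //; exact: up_Gc. Qed.
Lemma model_dense : rndense cp (fun f => fcs_iota CE (up f)).
Proof. by move=> v e e0; have [F /up_surj[f hf ->] h] := @io_dense _ _ _ _ CE v e e0; exists f. Qed.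

(** Vector states are all that the universal norm sees; what is shown for arbitrary [pfun] thereby
    becomes a statement in the C*-algebra. *)
Lemma model_functional (V : completeNormedModType C) ip (L : (GG -> E) -> V -> V) v :
 is_representation lam ip L -> pfun pi conv st (fun f => ip (L (up f) v) v).
Proof.
move=> hL; split=> [k f g hf hg|f hf|f hf|K cK].
- by rewrite up_lin // (rep_slin hL) ?(ip_lin hL) //; exact: up_Gc.
- by rewrite up_st // (ip_conj hL) -(rep_star hL) //; exact: up_Gc.
- have hs := st_cs hf; rewrite up_conv // (rep_conv hL); [|exact: up_Gc..].
 by rewrite (rep_star hL (up_Gc hs)) -up_st // stK (ip_sq hL) sqr_ge0.
- have [c c0 hc] := rep_cont0 hlin hL cK; exists (c * rn v * rn v); first by rewrite !mulr_ge0 ?rn_ge0.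
 move=> f M hf fK M0 fM; apply: le_trans (ip_cs hL _ _) _.
 rewrite mulrAC ler_wpM2r ?rn_ge0 // mulrAC.
 apply: hc => //; [exact: up_Gc|exact: up_supp'|by move=> x; rewrite up_norm].
Qed.

Lemma model_pos f : cp f -> st f = f ->
 (forall phi, pfun pi conv st phi -> 0 <= complex.Re (phi f)) ->
 cpos (@cmul R CE) (@cstar R CE) (io f).
Proof.
move=> hf sf pos; apply: rep_positive => //; first exact: up_Gc.
 by rewrite -up_st // sf.
by move=> V ip L hL v; exact: (pos _ (model_functional v hL)).
Qed.

Lemma model_diff_pos (r : R) a b : cp a -> cp b -> st a = a -> st b = b ->
 (forall phi, pfun pi conv st phi -> complex.Re (phi b) <= r * complex.Re (phi a)) ->
 cpos (@cmul R CE) (@cstar R CE) (r%:C *: io a - io b).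
Proof.
move=> ha hb sa sb pos; have hra := lin_cs (r - 1)%:C ha ha.
(* r a - b is written as -b + ((r - 1) a + a), since [lin] scales only its first argument. *)
have -> : r%:C *: io a - io b = io (lin pi (-1) b (lin pi (r - 1)%:C a a)).
 rewrite !model_lin // scaleN1r addrC -[X in _ + (_ + X)]scale1r -scalerDl.
 by rewrite -[1 : C](rmorph1 (real_complex R)) -rmorphD subrK.
apply: model_pos; first exact: lin_cs.
 by rewrite !st_lin // sa sb conjc_real rmorphN1.
move=> phi hphi; have [pl _ _ _] := hphi; rewrite !pl // mulN1r.
have -> : complex.Re (- phi b + ((r - 1)%:C * phi a + phi a)) = r * complex.Re (phi a) - complex.Re (phi b).
 by rewrite !ReD Re_scale; case: (phi b) => ? ? /=; ring.
by rewrite subr_ge0; exact: pos.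
Qed.

(* Baire's argument: if the bound failed, there would be nested balls of sections
  supported in [K] on whose [n]-th member the universal norm exceeds [n]. *)
Lemma model_cont (K : set GG) : compact K -> exists2 c : R, 0 <= c &
 forall f M, cp f -> fsupp f K -> 0 <= M -> ssup f M -> rn (io f) <= c * M.
Proof.
move=> cK; apply: contrapT => no.
pose q f := rn (io f); pose P f := cp f /\ fsupp f K.
pose D (u f : GG -> A) (r : R) := forall y, rn (bco (pi y)%:g (u y) - bco (pi y)%:g (f y)) <= r.
have Plin k u f : P u -> P f -> P (lin pi k u f).
 move=> [hu uK] [hf fK]; split; first exact: lin_cs.
 by apply: fsupp_lin => //; [case: hu|case: hf].
have step (np : nat * ((GG -> A) * R)) : exists p' : (GG -> A) * R, P np.2.1 -> 0 < np.2.2 ->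
  [/\ P p'.1, 0 < p'.2 <= np.2.2 / 2, D np.2.1 p'.1 (np.2.2 / 2) &
   forall f, P f -> D p'.1 f p'.2 -> np.1%:R < q f].
 case: np => n [u r] /=; have [[Pu r0]|h] := pselect (P u /\ 0 < r); last by exists (u, r) => *; case: h.
 have [u' [Pu' uu' nq]] : exists u', [/\ P u', D u u' (r / 2) & n%:R < q u'].
  (* If the norm stayed below [n] on the ball of radius r/2 about [u], homogeneity would bound it on
     all sections supported in [K], with the constant (n + q u) 2/r. *)
  apply: contrapT => hn; apply: no; pose c := (n%:R + q u) * (2 / r).
  have c0 : 0 <= c by rewrite mulr_ge0 ?addr_ge0 ?rn_ge0 // divr_ge0 // ltW.
  exists c => // f M hf fK M0 fM; apply: (le_small c0) => e e0.
  have Me : 0 < M + e by lra.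
  pose k := r / 2 / (M + e); have k0 : 0 < k by rewrite !divr_gt0.
  have h : q (lin pi k%:C f u) <= n%:R.
   rewrite leNgt; apply/negP => h; apply: hn; exists (lin pi k%:C f u); split=> // [|y]; first exact: Plin.
   rewrite rn_distC bco_lin // addrK rnZ rn_pos ?(ltW k0) // -bnormE; last by case: hf.
   have -> : r / 2 = k * (M + e) by rewrite /k divfK ?gt_eqF.
   by rewrite ler_wpM2l ?(ltW k0) //; have := fM y; lra.
  have := rnB (io (lin pi k%:C f u)) (io u); rewrite {1}model_lin ?addrK ?rnZ ?rn_pos ?(ltW k0) //; last by case: Pu.
  have -> : c * M + e * c = (n%:R + q u) / k by rewrite /c /k; field; rewrite !gt_eqF.
  by rewrite ler_pdivlMr // mulrC => /le_trans; apply; rewrite lerD2r.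
 (* A universal norm above [n] is witnessed by one representation and one vector. That
    representation is continuous on sections supported in [K], so the strict inequality persists on
    a small ball about u'. *)
 have [V [ip [L [v [hL Lv]]]]] : exists (V : completeNormedModType C) (ip : V -> V -> C)
   (L : (GG -> E) -> V -> V) v, is_representation lam ip L /\ n%:R * rn v < rn (L (up u') v).
  apply: contrapT => hn; move: nq; apply/negP; rewrite -leNgt.
  apply: io_le => // [|V ip L hL v]; first by case: Pu' => /up_Gc.
  by rewrite leNgt; apply/negP => h; apply: hn; exists V, ip, L, v.
 have [c c0 hc] := rep_cont0 hlin hL cK; have [hu' uK'] := Pu'.
 pose e := rn (L (up u') v) - n%:R * rn v; have e0 : 0 < e by rewrite subr_gt0.
 pose b := c * rn v + 1; have b0 : 0 < b by rewrite ltr_wpDl ?mulr_ge0 ?rn_ge0.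
 exists (u', Num.min (r / 2) (e / b)) => _ _; split=> //=.
  by rewrite lt_min !divr_gt0 //= ge_min lexx.
 move=> f Pf uf; have [hf fK] := Pf; have hd := lin_cs (-1) hf hu'.
 have h1 : rn (L (up (lin pi (-1) f u')) v) <= c * (e / b) * rn v.
  apply: hc; [exact: up_Gc|by apply: up_supp' => //; case: (Plin (-1) _ _ Pf Pu')| |by rewrite divr_ge0 // ltW].
  move=> x; rewrite up_norm // (@bnormE _ _ _ (pi x)%:g) ?bpr_lin // bco_lin // scaleN1r addrC.
  by apply: le_trans (uf x) _; rewrite ge_min lexx orbT.
 rewrite up_lin // (rep_slin hL) ?scaleN1r in h1; [|exact: up_Gc..].
 have h2 := rnD (- L (up f) v + L (up u') v) (L (up f) v); rewrite addrAC addNr add0r in h2.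
 have h3 := rep_bound CE hL v (up_Gc hf).
 have h4 : c * (e / b) * rn v < e.
  rewrite mulrAC mulrA ltr_pdivrMr // mulrC ltr_pM2l // /b; lra.
 rewrite ltNge; apply/negP => qn; have := ler_wpM2r (rn_ge0 v) qn.
 by move: h1 h2 h3 h4; rewrite /e /q; lra.
have [F hF] := choice step.
pose z y := bzero A (pi y)%:g; have Pz : P z by split; [exact: (@fsum_cs _ _ [::] pi_cont)|move=> y /nz_bzero].
pose fix s n := if n is n'.+1 then F (n', s n') else (z, 1 : R).
have sP n : P (s n).1 /\ 0 < (s n).2.
 by elim: n => [|n [h1 h2]]; [split|have [h /andP[]] := hF (n, s n) h1 h2].
have sS n : [/\ (s n.+1).2 <= (s n).2 / 2, D (s n).1 (s n.+1).1 ((s n).2 / 2) &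
  forall f, P f -> D (s n.+1).1 f (s n.+1).2 -> n%:R < q f].
 by have [h1 h2] := sP n; have [_ /andP[]] := hF (n, s n) h1 h2.
have dist n k : D (s n).1 (s (n + k)%N).1 ((s n).2 - (s (n + k)%N).2).
 move=> y; elim: k => [|k IH]; first by rewrite addn0 !subrr rn0.
 rewrite addnS; apply: le_trans (rn_tri _ (bco (pi y)%:g ((s (n + k)%N).1 y)) _) _.
 by have [h1 h2 _] := sS (n + k)%N; have := h2 y; move: IH h1; lra.
have distm n m : (n <= m)%N -> D (s n).1 (s m).1 (s n).2.
 by move=> /subnKC <- y; apply: le_trans (dist _ _ _) _; rewrite gerBl ltW //; case: (sP (n + (m - n))%N).
(* The radii at least halve; the weaker rate 1/(n+1) is all that convergence needs. *)
have rad n : (s n).2 * n.+1%:R <= 1.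
 elim: n => [|n IH]; first by rewrite mulr1.
 have [h _ _] := sS n; apply: le_trans IH; apply: le_trans (ler_wpM2r (ler0n _ _) h) _.
 rewrite -mulrA ler_wpM2l //; first by rewrite ltW //; case: (sP n).
 by rewrite -(natr1 n.+1) -(natr1 n); have := ler0n R n; lra.
have [n|e e0|f [hf fK lim]] := @cs_limit GG pi K (fun n => (s n).1) cK; first by case: (sP n).
 pose N := Num.Def.truncn (2 / e); exists N => i j hi hj y.
 apply: le_trans (rn_tri _ (bco (pi y)%:g ((s N).1 y)) _) _; rewrite rn_distC.
 have h1 := distm _ _ hi y; have h2 := distm _ _ hj y.
 suff : (s N).2 <= e / 2 by move: h1 h2; lra.
 have h := truncnS_gt (2 / e); rewrite -/N ltr_pdivrMr // in h.
 by have := rad N; rewrite leNgt => ?; rewrite leNgt; apply/negP => ?; nra.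
have fn n : D (s n).1 f (s n).2.
 move=> y; apply/ler_addgt0Pr => e e0; have [N hN] := lim e e0.
 apply: le_trans (rn_tri _ (bco (pi y)%:g ((s (maxn n N)).1 y)) _) _.
 by apply: lerD; [apply: distm; exact: leq_maxl|apply: hN; exact: leq_maxr].
have [_ _ /(_ f (conj hf fK) (fn _))] := sS (Num.Def.truncn (q f)).+1.
by rewrite ltNge (ltW (truncnS_gt _)).
Qed.

Lemma model_bound (s : (G -> A) -> (G -> A) -> C) (act : (GG -> A) -> (G -> A) -> (G -> A)) :
 (forall k x y, cX x -> cX y -> exists2 z, cX z & forall i, cX i -> s z i = k * s x i + s y i) ->
 (forall x y, cX x -> cX y -> s x y = conjc (s y x)) -> (forall x, cX x -> 0 <= complex.Re (s x x)) ->
 (forall x y, cX x -> cX y -> rn (s x y) <= snorm s x * snorm s y) ->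
 (forall f x, cp f -> cX x -> cX (act f x)) ->
 (forall k f g x y, cp f -> cp g -> cX x -> cX y -> s (act (lin pi k f g) x) y = k * s (act f x) y + s (act g x) y) ->
 (forall f g x y, cp f -> cp g -> cX x -> cX y -> s (act (conv f g) x) y = s (act f (act g x)) y) ->
 (forall f x y, cp f -> cX x -> cX y -> s (act f x) y = s x (act (st f) y)) ->
 (forall K : set GG, compact K -> exists2 B : R, 0 <= B & forall f M x, cp f -> fsupp f K -> 0 <= M ->
  ssup f M -> cX x -> snorm s (act f x) <= B * M * snorm s x) ->
 forall f x, cp f -> cX x -> snorm s (act f x) <= rn (io f) * snorm s x.
Proof.
move=> sL sC s0 scs aX alin aconv aadj abound f x hf hx.
pose down F := xget f [set g | cp g /\ up g = F].
have downE g : cp g -> down (up g) = g.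
 move=> hg; rewrite /down; case: xgetP => [g' _ [hg' e]|/(_ g)]; last by case.
 exact: up_inj.
rewrite -{1}(downE f hf).
apply: (@universal_bound _ _ _ _ CE hX hlin hconv hstar bounded _ cX s (fun F => act (down F))) => //; last exact: up_Gc.
- by exists x.
- by move=> _ y /up_surj[g hg ->] hy; rewrite downE //; exact: aX.
- move=> k _ _ y z /up_surj[g hg ->] /up_surj[g' hg' ->] hy hz.
 by rewrite -up_lin // !downE // ?alin //; exact: lin_cs.
- move=> _ _ y z /up_surj[g hg ->] /up_surj[g' hg' ->] hy hz.
 by rewrite -up_conv // !downE // ?aconv //; exact: conv_cs.
- move=> _ y z /up_surj[g hg ->] hy hz; rewrite -up_st // !downE // ?aadj //; exact: st_cs.
- move=> K cK; have [B B0 hB] := abound K cK; exists B => // _ M y /up_surj[g hg ->] gK M0 gM hy.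
 rewrite downE //; apply: hB => //; first exact: up_supp.
 by move=> z; rewrite -up_norm.
Qed.

Lemma model_fsum gs : Alls cp gs -> io (fsum pi gs) = \sum_(g <- gs) io g.
Proof.
elim: gs => [_|g gs IH [hg hgs]] /=; last first.
 rewrite big_cons model_lin ?scale1r ?IH //; exact: fsum_cs.
have hz : cp (fun x => bzero A (pi x)%:g) by exact: (@fsum_cs _ _ [::] pi_cont).
rewrite big_nil (_ : (fun x => _) = lin pi (-1) (fun x => bzero A (pi x)%:g) (fun x => bzero A (pi x)%:g)).
 by rewrite model_lin // scaleN1r addNr.
by apply/funext => x; rewrite /lin bco_zero scaleN1r addNr.
Qed.

Lemma model_dense_span (P : set CE) :
 (forall f, cp f -> exists L, [/\ compact L, fsupp f L & forall e : R, 0 < e ->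
  exists gs, [/\ Alls (fun g => cp g /\ P (io g)) gs, fsupp (fsum pi gs) L &
   forall y, rn (bco (pi y)%:g (fsum pi gs y) - bco (pi y)%:g (f y)) <= e]]) ->
 dense_span P.
Proof.
move=> approx; rewrite /dense_span; set D := [set v | _].
suff hD : rndense D id by rewrite -[D]image_id; exact: rndense_dense.
move=> v e e0; have [f hf fv] := model_dense v (halfR_gt0 e0).
have [L [cL fL app]] := approx f hf; have [c c0 hc] := model_cont cL.
have d0 : 0 < e / 2 / (c + 1) by rewrite !divr_gt0 // ltr_wpDl.
have [gs [hgs gL close]] := app _ d0; have hgs' : Alls cp gs by apply: Alls_impl hgs => g [].
have hS := fsum_cs pi_cont hgs'; have [_ pS _] := hS; have [_ pf _] := hf.
exists (io (fsum pi gs)).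
 exists (size gs), (fun=> 1), (fun i => io (nth f gs i)); split; last first.
  rewrite model_fsum // (big_nth f) big_mkord; apply: eq_bigr => i _; exact/esym/scale1r.
 case=> i /=; elim: gs hgs i {gL close hgs' hS pS} => [//|g gs IH [[_ Pg] hgs] [|i] /=] hi //.
 exact: IH.
have h1 : rn (io (fsum pi gs) - io f) <= c * (e / 2 / (c + 1)).
 rewrite addrC -scaleN1r -model_lin //; apply: hc; rewrite ?(ltW d0) //; first exact: lin_cs.
  exact: fsupp_lin.
 by rewrite (_ : lin _ _ _ _ = lin pi (-1) f (fsum pi gs)) //; apply: ssup_lin => // y; rewrite rn_distC; exact: close.
apply: le_lt_trans (rn_tri _ (io f) _) _; apply: le_lt_trans (lerD h1 (lexx _)) _.
have h2 : c * (e / 2 / (c + 1)) <= e / 2.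
 rewrite mulrA ler_pdivrMr ?ltr_wpDl // mulrC ler_wpM2l ?lerDl //; exact/ltW/halfR_gt0.
have : e = e / 2 + e / 2 by lra.
by move: fv h2; lra.
Qed.

End SectionModel.

Definition trans_section (f : G * GH -> A) : GX -> AGH := fun z => ((f z, z.2) : AGH).
(** The value is selected classically, because a proof that [g h] lies over H is available only for
    [g] in [cB]; otherwise the zero vector is the default. *)
Definition restr_section (g : T -> A) : GT -> AH := fun h => xget (bzero AH h) [set a | sval a = g h].
Local Notation mkA := trans_section.
Local Notation mkB := restr_section.

Lemma trans_section_Gc f : cA f -> Gammac AGH (mkA f).
Proof. by move=> hf; apply/GammacA. Qed.
Lemma trans_sectionK F : Gammac AGH F -> cA (fstA F) /\ F = mkA (fstA F).
Proof. by move=> /(GammacA)[hF F2]; split=> //; apply: eqA. Qed.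
Lemma restr_sectionK g : cB g -> valB (mkB g) = g.
Proof.
move=> [_ pg _]; apply/funext => h; rewrite /valB /mkB; case: xgetP => [a _ //|none].
have Hh : subg_set H (bpr (g h)) by rewrite pg; exact: subg_incP.
by case: (none (restr_elt Hh)).
Qed.

Lemma restr_section_Gc g : cB g -> Gammac AH (mkB g).
Proof. by move=> hg; apply/GammacB; rewrite restr_sectionK. Qed.
Lemma valBK g : Gammac AH g -> cB (valB g) /\ g = mkB (valB g).
Proof. by move=> /GammacB hg; split=> //; apply: eqB; rewrite restr_sectionK. Qed.
Lemma star_lin (x y : G) k (a b : A) : y = (x^-1)%g -> bpr a = x -> bpr b = x ->
 fstar (binj (k *: bco x%:g a + bco x%:g b)) =
 binj (conjc k *: bco y%:g (fstar a) + bco y%:g (fstar b)).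
Proof. by move=> yx ax bx; rewrite -(fs_inj _ yx) fs_lin // !(bco_fstar (x := x%:g)). Qed.
Lemma trans_model : section_model (E := AGH) (trans_system (coset_gspace H) mu)
 (fst : GX -> G) (fun F F' => lconv (Y := tl) F F') (@stA) mkA.
Proof.
have gc := trans_section_Gc.
split.
- exact: trans_hausdorff.
- by move=> z; exact: cvg_fst.
- by move=> F F' hF hF'; exact: (lconv_cs (Y := tl)).
- by move=> F hF; exact: stA_cs.
- exact: stAK.
- move=> k f g [_ pf _] [_ pg _]; apply/funext => z; rewrite /stA /lin.
 by apply: star_lin; rewrite ?pf ?pg //= invgK.
- exact: gc.
- by move=> F /trans_sectionK[hF ->]; exists (fstA F).
- by move=> f g _ _ /(congr1 (@fstA)).
- by move=> k f g hf hg; apply: eqA => //; rewrite slinA.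
- move=> f g hf hg; apply: eqA => //.
 by rewrite sconvA //; exact: gc.
- move=> f hf; apply: eqA => // -[s q]; have [_ pf _] := hf; rewrite /sstar /= (pf (s^-1%g, coset_act s q)) /=.
 by rewrite -coset_actM mulVg coset_act1.
- move=> f z hf; have [_ pf _] := hf; have [sf _ _] := gc f hf.
 by rewrite (bnormE (sf z)) (bnormE (pf z : bpr (f z) = z.1%:g)) bco_trans.
Qed.

Lemma restr_model : section_model (E := AH) (group_system nu)
 (inc : GT -> G) (fun g g' => rconv (Y := sr) g g') (@stB) mkB.
Proof.
have gc := restr_section_Gc.
split.
- exact: subg_hausdorff.
- exact: subg_inc_cont.
- by move=> g g' hg hg'; exact: (rconv_cs (Y := sr)).
- by move=> g hg; exact: stB_cs.
- exact: stBK.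
- move=> k f g [_ pf _] [_ pg _]; apply/funext => h; rewrite /stB /lin.
 by apply: star_lin; rewrite ?pf ?pg //= /inc /= invgK.
- exact: gc.
- by move=> g /valBK[hg ->]; exists (valB g).
- by move=> f g hf hg /(congr1 (@valB)); rewrite !restr_sectionK.
- by move=> k f g hf hg; apply: eqB; rewrite slinB !restr_sectionK //; exact: lin_cs.
- move=> f g hf hg; apply: eqB; rewrite sconvB; [|exact: gc..].
 by rewrite !restr_sectionK //; exact: (rconv_cs (Y := sr)).
- by move=> f hf; apply: eqB; rewrite sstarB !restr_sectionK //; exact: stB_cs.
- move=> f h hf; have [_ pf _] := hf; have [sf _ _] := gc f hf.
 rewrite (bnormE (sf h)) (bnormE (pf h : bpr (f h) = (inc h)%:g)) bco_restr.
 by rewrite -/(valB (mkB f) h) restr_sectionK.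
Qed.

(** * The axioms of the pre-imprimitivity bimodule *)

Local Notation tm := trans_model.
Local Notation rm := restr_model.
Variables (CA : fell_cstar AGH (trans_system (coset_gspace H) mu)) (CB : fell_cstar AH (group_system nu)).
Implicit Types (x y z : G -> A) (F : G * GH -> A) (g : T -> A).
Local Notation iA f := (fcs_iota CA (mkA f)).
Local Notation iB g := (fcs_iota CB (mkB g)).
Local Notation posA := (cpos (@cmul R CA) (@cstar R CA)).
Local Notation posB := (cpos (@cmul R CB) (@cstar R CB)).
Local Notation lX F x := (lconv (Y := gl) F x).
Local Notation rX x g := (rconv (Y := gr) x g).
Local Notation lA F F' := (lconv (Y := tl) F F').
Local Notation rB g g' := (rconv (Y := sr) g g').

Let cL x y : cX x -> cX y -> cA (lipp x y). Proof. exact: lipp_cs. Qed.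
Let cR x y : cX x -> cX y -> cB (ripp x y). Proof. exact: ripp_cs. Qed.
Let cl F x : cA F -> cX x -> cX (lX F x). Proof. by move=> hF hx; exact: (lconv_cs (Y := gl)). Qed.
Let cr x g : cX x -> cB g -> cX (rX x g). Proof. by move=> hx hg; exact: (rconv_cs (Y := gr)). Qed.

Lemma stA_lip x y : cX x -> cX y -> stA (lipp x y) = lipp y x.
Proof. by move=> hx hy; apply/funext => -[s q]; rewrite /stA lip_star. Qed.
Lemma stB_rip x y : cX x -> cX y -> stB (ripp x y) = ripp y x.
Proof. by move=> hx hy; apply/funext => h; rewrite /stB rip_star. Qed.
Lemma lip_posA x : cX x -> posA (iA (lipp x x)).
Proof.
move=> hx; apply: (model_pos CA tm (cL hx hx)) => [|phi hphi]; first exact: stA_lip.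
exact: (lip_pos hphi hx).
Qed.

Lemma rip_posB x : cX x -> posB (iB (ripp x x)).
Proof.
move=> hx; apply: (model_pos CB rm (cR hx hx)) => [|phi hphi]; first exact: stB_rip.
exact: (rip_pos hphi hx).
Qed.

(** For every [phi] the form given by phi(<y, x>) carries a representation of the left algebra, so
    [phi] of the difference is nonnegative by the bound with the universal norm of F; positivity in
    the C*-algebra is tested on such functionals. *)
Lemma lact_bound F x : cA F -> cX x ->
 posB ((rn (iA F) ^+ 2)%:C *: iB (ripp x x) - iB (ripp (lX F x) (lX F x))).
Proof.
move=> hF hx; have hFx := cl hF hx.
apply: (model_diff_pos CB rm); [exact: cR|exact: cR|exact: stB_rip|exact: stB_rip|].
move=> phi hphi; have hs := sform_left hphi.
have [pl _ _ _] := hphi.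
rewrite -(snorm_sq hs hFx) -(snorm_sq hs hx) -exprMn ler_pXn2r ?nnegrE ?mulr_ge0 ?rn_ge0 ?snorm_ge0 //.
have [sl sC s0 _] := hs.
apply: (model_bound CA tm (s := fun x y => phi (ripp y x)) (act := fun F x => lX F x)); [| | | | | | | | |exact: hF|exact: hx].
- by move=> k y z hy hz; exists (lin id k y z); [exact: lin_cs|move=> i hi; exact: sl].
- by move=> y z hy hz; exact: (sC y z hy hz).
- exact: s0.
- by move=> y z hy hz; exact: (sform_cs hs hy hz).
- exact: cl.
- move=> k f g y z hf hg hy hz; rewrite (lconv_linl (Y := gl) k hf hg hy).
 exact: (sl _ _ _ _ (cl hf hy) (cl hg hy) hz).
- by move=> f g y z hf hg hy hz; rewrite (lconv_assoc (Y := gl) hf hg hy).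
- by move=> f y z hf hy hz; rewrite (rip_lconv_adj (stA_cs hf) hz hy) stAK.
- exact: (crude_left hphi).
Qed.

(** To use a bound stated for left actions, f acts by right multiplication with [stB f]. This is
    conjugate-linear in f, so the Hilbert space is replaced by its conjugate: hence the exchanged
    arguments of the form and the scalars [conjc k]. *)
Lemma ract_bound x g : cX x -> cB g ->
 posA ((rn (iB g) ^+ 2)%:C *: iA (lipp x x) - iA (lipp (rX x g) (rX x g))).
Proof.
move=> hx hg; have hxg := cr hx hg; have hsg := stB_cs hg.
apply: (model_diff_pos CA tm); [exact: cL|exact: cL|exact: stA_lip|exact: stA_lip|].
move=> phi hphi; have hs := sform_right hphi.
rewrite -(snorm_sq hs hxg) -(snorm_sq hs hx) -exprMn ler_pXn2r ?nnegrE ?mulr_ge0 ?rn_ge0 ?snorm_ge0 //.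
have [sl sC s0 _] := hs.
have conj_linear k y z i : cX y -> cX z -> cX i ->
  phi (lipp i (lin id (conjc k) y z)) = k * phi (lipp i y) + phi (lipp i z).
 move=> hy hz hi; rewrite (sC _ _ hi (lin_cs _ hy hz)) (sl _ _ _ _ hy hz hi) rmorphD rmorphM /= conjcK.
 by rewrite -(sC _ _ hi hy) -(sC _ _ hi hz).
rewrite -(rn_cstar (iB g)) -(model_st CB rm hg) -{1}(stBK g).
apply: (model_bound CB rm (s := fun x y => phi (lipp y x)) (act := fun g x => rX x (stB g))); [| | | | | | | | |exact: hsg|exact: hx].
- move=> k y z hy hz; exists (lin id (conjc k) y z); first exact: lin_cs.
 by move=> i hi; exact: conj_linear.
- by move=> y z hy hz; exact: (sC z y hz hy).
- exact: s0.
- by move=> y z hy hz; rewrite mulrC; exact: (sform_cs hs hz hy).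
- by move=> f y hf hy; apply: cr; last exact: stB_cs.
- move=> k f f' y z hf hf' hy hz; have hs1 := stB_cs hf; have hs2 := stB_cs hf'.
 rewrite (sm_st_lin rm k hf hf') (rconv_linr (Y := gr) _ hy hs1 hs2).
 exact: (conj_linear _ _ _ _ (cr hy hs1) (cr hy hs2) hz).
- move=> f f' y z hf hf' hy hz; have hff' := rconv_cs (Y := sr) hf hf'.
 rewrite -(lip_rconv_adj hz hy hff') -(rconv_assoc (Y := gr) hz hf hf').
 rewrite (lip_rconv_adj (cr hz hf) hy hf') (lip_rconv_adj hz (cr hy (stB_cs hf')) hf).
 exact: erefl.
- by move=> f y z hf hy hz; rewrite -(lip_rconv_adj hz hy hf) stBK.
- move=> K cK; have [B B0 hB] := crude_right hphi (invset_compact cK).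
 exists B => // f M y hf fK M0 fM hy; apply: hB => //; first exact: stB_cs.
  by move=> h /nz_fstar/fK hK; exists h^-1%g; rewrite ?invgK.
 by move=> h; rewrite /stB bnorm_fstar //; exact: fM.
Qed.

(** The terms <phi, phi> f of the sums that approximate f are again inner products, namely <phi, f^*
    phi>. *)
Lemma lip_dense : dense_span [set iA (lipp p.1 p.2) | p in [set p | cX p.1 /\ cX p.2]].
Proof.
apply: (model_dense_span (CE := CA) tm) => f hf.
have [L [cL_ fL app]] := approx_left (Y := tl) hf.
exists L; split=> // e /app[phis [hphis [SL close]]].
exists [seq lA (lipp phi phi) f | phi <- phis]; split=> //.
apply: Alls_map hphis => phi hphi; have h1 := cL hphi hphi.
have hl := lconv_cs (Y := tl) h1 hf; split=> //.
have hsf := stA_cs hf; exists (phi, lX (stA f) phi); first by split=> //; exact: cl.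
have -> : iA (lipp phi (lX (stA f) phi)) = cstar (iA (lA (stA f) (lipp phi phi))).
 have h2 := cl hsf hphi.
 by rewrite -(lip_lconv hsf hphi hphi) -(model_st CA tm (cL h2 hphi)) (stA_lip h2 hphi).
rewrite (model_conv CA tm hsf h1) (model_conv CA tm h1 hf) cstarM (model_st CA tm hf) cstarK.
by rewrite -(model_st CA tm h1) (stA_lip hphi hphi).
Qed.

(** Here the approximating terms g <psi, psi> are the inner products <psi g^*, psi>. *)
Lemma rip_dense : dense_span [set iB (ripp p.1 p.2) | p in [set p | cX p.1 /\ cX p.2]].
Proof.
apply: (model_dense_span (CE := CB) rm) => g hg.
have [L [cL_ gL app]] := approx_right (Y := sr) hg.
exists L; split=> // e /app[psis [hpsis [SL close]]].
exists [seq rB g (ripp psi psi) | psi <- psis]; split=> //.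
apply: Alls_map hpsis => psi hpsi; have h1 := cR hpsi hpsi.
have hl := rconv_cs (Y := sr) hg h1; split=> //.
have hsg := stB_cs hg; exists (rX psi (stB g), psi); first by split=> //; exact: cr.
have -> : iB (ripp (rX psi (stB g)) psi) = cstar (iB (rB (ripp psi psi) (stB g))).
 have h2 := cr hpsi hsg.
 by rewrite -(rip_rconv hpsi hpsi hsg) -(model_st CB rm (cR hpsi h2)) (stB_rip hpsi h2).
rewrite (model_conv CB rm h1 hsg) (model_conv CB rm hg h1) cstarM (model_st CB rm hg) cstarK.
by rewrite -(model_st CB rm h1) (stB_rip hpsi hpsi).
Qed.

Lemma mod_pre_imprimitivity : is_pre_imprimitivity_bimodule CA CB (EX := A)
 (mod_lact H mu A) (mod_ract nu A) (mod_lip nu A) (mod_rip H mu A).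
Proof.
have gX (x : G -> A) : Gammac A x <-> cX x by exact: GammacX.
have gA := @trans_sectionK; have gB := @valBK.
have GA := @trans_section_Gc; have GB := @restr_section_Gc.
have eL (F : GX -> AGH) (x : G -> A) : mod_lact H mu A F x = lX (fstA F) x by exact: modlE.
have eR (x : G -> A) (g : GT -> AH) : mod_ract nu A x g = rX x (valB g) by exact: modrE.
have eLip (x y : G -> A) : mod_lip nu A x y = mkA (lipp x y) by apply: eqA; [exact: modlipE|exact: modlip2|].
have eRip (x y : G -> A) : cX x -> cX y -> mod_rip H mu A x y = mkB (ripp x y).
 by move=> hx hy; apply: eqB; rewrite modripE restr_sectionK //; exact: cR.
have eS k (x y : G -> A) : slin (E := A) k x y = lin id k x y by [].
refine (conj _ (conj _ (conj _ (conj _ (conj _ (conj _ (conj _ (conj _ _)))))))).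
- split=> [F x /gA[hF _] /gX hx|x g /gX hx /gB[hg _]|x y /gX hx /gX hy|x y /gX hx /gX hy].
 + by rewrite eL; apply/gX; exact: cl.
 + by rewrite eR; apply/gX; exact: cr.
 + by rewrite eLip; apply: GA; exact: cL.
 + by rewrite eRip //; apply: GB; exact: cR.
- split=> [k F F' x /gA[hF ->] /gA[hF' ->] /gX hx|k F x y /gA[hF ->] /gX hx /gX hy|F F' x /gA[hF ->] /gA[hF' ->] /gX hx].
 + by rewrite -(sm_lin tm k hF hF') !eL eS; exact: (lconv_linl (Y := gl)).
 + by rewrite !eL !eS; exact: (lconv_linr (Y := gl)).
 + rewrite -(sm_conv tm hF hF') !eL; exact/esym/(lconv_assoc (Y := gl)).
- have vK (g : T -> A) : cB g -> valB (mkB g) = g by exact: restr_sectionK.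
 split=> [k x g g' /gX hx /gB[hg ->] /gB[hg' ->]|k x y g /gX hx /gX hy /gB[hg ->]|
  x g g' /gX hx /gB[hg ->] /gB[hg' ->]|F x g /gA[hF ->] /gX hx /gB[hg ->]].
 + rewrite -(sm_lin rm k hg hg') !eR eS !vK //; last exact: lin_cs.
  exact: (rconv_linr (Y := gr)).
 + by rewrite !eR !eS !vK //; exact: (rconv_linl (Y := gr)).
 + rewrite -(sm_conv rm hg hg') !eR !vK //; first exact/esym/(rconv_assoc (Y := gr)).
  exact: (rconv_cs (Y := sr)).
 + rewrite !eR !eL vK //; exact: lconv_rconv.
- split=> [k x y z /gX hx /gX hy /gX hz|F x y /gA[hF ->] /gX hx /gX hy|x y /gX hx /gX hy|x /gX hx].
 + rewrite !eLip eS -(sm_lin tm k (cL hx hz) (cL hy hz)); congr mkA; exact: lip_linl.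
 + rewrite !eLip eL -(sm_conv tm hF (cL hx hy)); congr mkA; exact: lip_lconv.
 + by rewrite !eLip -(sm_st tm (cL hx hy)) stA_lip.
 + by rewrite eLip; exact: lip_posA.
- have vK (g : T -> A) : cB g -> valB (mkB g) = g by exact: restr_sectionK.
 split=> [k x y z /gX hx /gX hy /gX hz|x y g /gX hx /gX hy /gB[hg ->]|x y /gX hx /gX hy|x /gX hx].
 + rewrite eS !eRip //; last exact: lin_cs.
  rewrite -(sm_lin rm k (cR hz hx) (cR hz hy)); congr mkB; exact: rip_linr.
 + rewrite eR !eRip ?vK //; last exact: cr.
  rewrite -(sm_conv rm (cR hx hy) hg); congr mkB; exact: rip_rconv.
 + by rewrite !eRip // -(sm_st rm (cR hx hy)) stB_rip.
 + by rewrite eRip //; exact: rip_posB.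
- split.
 + rewrite (_ : [set _ | p in _] = [set iA (lipp p.1 p.2) | p in [set p | cX p.1 /\ cX p.2]]).
   exact: lip_dense.
  apply/seteqP; split=> _ [p [h1 h2] <-]; exists p; rewrite ?eLip //=; by split; apply/gX.
 + rewrite (_ : [set _ | p in _] = [set iB (ripp p.1 p.2) | p in [set p | cX p.1 /\ cX p.2]]).
   exact: rip_dense.
  apply/seteqP; split=> _ [p [h1 h2] <-].
   by exists p; [split; apply/gX|rewrite eRip //; apply/gX].
  by exists p; [split; apply/gX|rewrite eRip].
- move=> F x /gA[hF ->] /gX hx; have hFx := cl hF hx.
 rewrite eL (eRip _ _ hx hx) (eRip _ _ hFx hFx) -rnE -rmorphXn; exact: lact_bound.
- move=> x g /gX hx /gB[hg ->]; rewrite eR !eLip restr_sectionK // -rnE -rmorphXn.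
 exact: ract_bound.
- move=> x y z /gX hx /gX hy /gX hz; rewrite eL eLip eR eRip // restr_sectionK; last exact: cR.
 exact: lip_rip.
Qed.

End Equivalence.

Theorem corollary5p2 (R : realType) (G : topGroupType)
  (hG : lch_second_countable G)
  (mu : {measure set (borel G) -> \bar R}) (hmu : left_haar mu)
  (H : closed_subgroup G)
  (nu : {measure set (borel (subg_type H)) -> \bar R}) (hnu : left_haar nu)
  (A : fell_ops R (group_groupoid G)) (hA : is_fell_bundle A)
  (CA : fell_cstar (trans_fell (coset_gspace H) A)
          (trans_system (coset_gspace H) mu))
  (CB : fell_cstar (restr_fell H A) (group_system nu)) :
  completes_to_imprimitivity_bimodule CA CB (EX := A)
    (mod_lact H mu A) (mod_ract nu A) (mod_lip nu A) (mod_rip H mu A).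
Proof.
have [hsG lcG _] := hG; have lG : lcpt G by exact: lc_lcpt.
have pre := mod_pre_imprimitivity hsG lcG lG hmu hnu hA CA CB.
have tm := trans_model H hsG lG hmu hA; have rm := restr_model hsG lG hnu hA.
have gX (x : G -> A) := GammacX hsG x.
have sl F F' k : Gammac (trans_fell (coset_gspace H) A) F -> Gammac _ F' -> Gammac _ (slin k F F').
 by move=> /(sm_surj tm)[f hf ->] /(sm_surj tm)[f' hf' ->]; rewrite -(sm_lin tm) //; apply: (sm_Gc tm); exact: lin_cs.
split; first exact: pre.
apply: (imprimitivity_completion pre).
- by move=> k F F'; exact: sl.
- move=> k g g' /(sm_surj rm)[f hf ->] /(sm_surj rm)[f' hf' ->]; rewrite -(sm_lin rm) //; apply: (sm_Gc rm); exact: lin_cs.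
- by move=> k x y /gX hx /gX hy; apply/gX; exact: (lin_cs hA).
- move=> F F' /(sm_surj tm)[f hf ->] /(sm_surj tm)[f' hf' ->]; rewrite -(sm_conv tm) //; apply: (sm_Gc tm); exact: (sm_conv_cs tm).
- move=> g g' /(sm_surj rm)[f hf ->] /(sm_surj rm)[f' hf' ->]; rewrite -(sm_conv rm) //; apply: (sm_Gc rm); exact: (sm_conv_cs rm).
- move=> F /(sm_surj tm)[f hf ->]; rewrite -(sm_st tm) //; apply: (sm_Gc tm); exact: (sm_st_cs tm).
- move=> g /(sm_surj rm)[f hf ->]; rewrite -(sm_st rm) //; apply: (sm_Gc rm); exact: (sm_st_cs rm).
- exists (fun t => bzero A (t : group_groupoid G)); apply/gX.
 by apply: (@fsum_cs _ _ _ hA _ id [::]) => // t; exact: cvg_id.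
- move=> F x y /(GammacA hsG)[hF _] /gX hx /gX hy; apply: eqB.
 by rewrite !modripE !(modlE mu lG) sstarA (rip_lconv_adj hsG lG hmu hA hF hx hy).
- move=> x g y /gX hx /(GammacB hsG) hg /gX hy; apply: eqA; [|exact: modlip2|exact: modlip2].
 by rewrite !modlipE !(modrE nu lG) sstarB (lip_rconv_adj hsG lG hnu hA hx hy hg).
Qed.
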